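(* Let $q\ge1$ and $p$ be integers with $\gcd(p,q)=1$. Then for every positive integer $k\notin\{1,2,3,5,7,11\}$, $k\Delta'(p,q)$ has a unimodular triangulation with standard boundary (with respect to $\Lambda_{p,q}$).
   Context: Let $p'=(-p)\bmod q$, $\Lambda_{p,q}=q\mathbb{Z}\times q\mathbb{Z}\times\mathbb{Z}+\mathbb{Z}(p',1,0)$, and $\Delta'(p,q)=\operatorname{conv}\{(0,0,0),(q,0,0),(0,0,1),(0,q,1)\}$, an empty lattice tetrahedron with respect to $\Lambda_{p,q}$ (every empty lattice tetrahedron in $\mathbb{Z}^3$ is lattice-equivalent to one of these). Triangulations have vertices in the lattice; a tetrahedron is unimodular if its vertices form an affine basis of the lattice. A triangulation of $k\Delta$ ($\Delta$ an empty lattice tetrahedron) has standard boundary if every edge contained in the boundary of $k\Delta$ is parallel to an edge of $\Delta$. *)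

(* Defs.v *)
From HB Require Import structures.
From mathcomp Require Import all_boot all_order all_algebra.
From mathcomp Require Import reals.
Unset Printing Implicit Defensive.
Import Order.TTheory GRing.Theory Num.Theory.
Local Open Scope ring_scope.

Notation ipt := 'rV[int]_3.

Definition mkpt (a b c : int) : ipt := \row_(i < 3) [:: a; b; c]`_i.

Definition pprime (p q : int) : int := ((- p) %% q)%Z.

(* Lambda_{p,q} = qZ x qZ x Z + Z (p',1,0) *)
Definition in_Lambda (p q : int) (v : ipt) : Prop :=
  exists x y z t : int,
    v = mkpt (q * x + t * pprime p q) (q * y + t) z.

Definition Delta' (p q : int) : 'I_4 -> ipt :=
  fun i => [:: mkpt 0 0 0; mkpt q 0 0; mkpt 0 0 1; mkpt 0 q 1]`_i.

Definition kDelta' (p q : int) (k : nat) : 'I_4 -> ipt :=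
  fun i => (k%:Z) *: Delta' p q i.

Definition tetra := {ffun 'I_4 -> ipt}.

Definition toR (R : realType) (v : ipt) : 'rV[R]_3 := map_mx intr v.

Definition conv (R : realType) (s : seq 'rV[R]_3) (x : 'rV[R]_3) : Prop :=
  exists l : 'I_(size s) -> R,
    (forall i, 0 <= l i) /\ \sum_i l i = 1 /\ x = \sum_i l i *: s`_i.

Definition face (R : realType) (v : 'I_4 -> ipt) (S : {set 'I_4}) :=
  conv R [seq toR R (v i) | i in S].

Definition polytope (R : realType) (v : 'I_4 -> ipt) := face R v setT.

Definition aff_indep (v : 'I_4 -> ipt) : Prop :=
  forall c : 'I_4 -> int, \sum_i c i = 0 -> \sum_i c i *: v i = 0 ->
    forall i, c i = 0.

Definition unimodular (L : ipt -> Prop) (T : tetra) : Prop :=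
  (forall i, L (T i)) /\ aff_indep T /\
  (forall w, L w -> exists c : 'I_4 -> int,
       \sum_i c i = 1 /\ w = \sum_i c i *: T i).

Definition triangulation (R : realType) (L : ipt -> Prop)
    (P : 'I_4 -> ipt) (ts : seq tetra) : Prop :=
  (forall T, T \in ts -> (forall i, L (T i)) /\ aff_indep T) /\
  (forall x, polytope R P x <-> exists2 T, T \in ts & polytope R T x) /\
  (forall T1 T2, T1 \in ts -> T2 \in ts ->
     exists S1 S2 : {set 'I_4},
       (forall x, (polytope R T1 x /\ polytope R T2 x) <-> face R T1 S1 x) /\
       (forall x, (polytope R T1 x /\ polytope R T2 x) <-> face R T2 S2 x)).

Definition interior3 (R : realType) (A : 'rV[R]_3 -> Prop) (x : 'rV[R]_3) :=
  exists2 e : R, 0 < e &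
    forall y : 'rV[R]_3, (forall i, `|y 0 i - x 0 i| < e) -> A y.

Definition boundary3 (R : realType) (A : 'rV[R]_3 -> Prop) (x : 'rV[R]_3) :=
  A x /\ ~ interior3 R A x.

Definition standard_boundary (R : realType) (D P : 'I_4 -> ipt)
    (ts : seq tetra) : Prop :=
  forall T, T \in ts -> forall i j : 'I_4, i != j ->
    (forall x, conv R [:: toR R (T i); toR R (T j)] x ->
               boundary3 R (polytope R P) x) ->
    exists a b : 'I_4, a != b /\
      exists lam : R, toR R (T j) - toR R (T i) = lam *: (toR R (D b) - toR R (D a)).

(* Main.v *)
Require Import Defs.
From HB Require Import structures.
From mathcomp Require Import all_boot all_order all_algebra.
From mathcomp Require Import boolp reals ring lra zify.
Set Implicit Arguments. Unset Strict Implicit. Unset Printing Implicit Defensive.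
Import Order.TTheory GRing.Theory Num.Theory.
Local Open Scope ring_scope.

(** Dividing the first two coordinates by q turns k Delta' into the tetrahedron 0 <= x, 0 <= y <= z,
    x + z <= k.  Its layer at height j is a (k - j) x j rectangle, tiled by unit squares, in which the
    lattice points are the points of Z (p, 1)/q + Z^2.  A triangulation of the unit square, obtained
    by minimising convex costs lexicographically, is repeated periodically over the layers.  Edge paths
    crossing the square in both directions become monotone staircases, and a point of the layer j is
    joined to a point of the layer j + 1 when the pair lies on these staircases.  The four-point
    cells of such a slab with three points in one layer are unimodular, and those joining two edges
    are lattice images of some Delta'(1, m).

    For p = 1 a zigzag triangulation of the square gives m = 1, so that k Delta'(1, q) is unimodularly
    triangulated for all k >= 2.  For other p one reduces to 2 <= p <= q/2 by a reflection, and a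
    pinwheel triangulation of the square gives a triangulation of k1 Delta' whose cells are images of
    Delta'(1, m) for various m.  Dilating it by k2 and refining each cell yields a unimodular
    triangulation of k1 k2 Delta' for k1, k2 >= 2.  Dilation factors can also be added: in a slab
    triangulation of (k1 + k2) Delta' the part between the planes x = k1 and x + z = k1 is
    unimodular for every p, and the rest consists of copies of k1 Delta' and k2 Delta'.
    Finally every k to be treated is 2 j, 9 or 9 + 2 j with j >= 2. *)

(** * Lexicographic linear programming *)

(** Cells are handled through barycentric weights: any two cells that represent the same point must
    do so with the same weight function. This single condition stands for affine independence and
    for intersection in common faces, and uniqueness of an optimum yields it. The triangulations of
    the square are never described in full: the costs only have to force the edges that make up the
    paths.

    The obstacle is the slab at the edge z = 0. In all other slabs one family of paths, in the x
    direction with steps 1/q, gives unimodular cells for every p. In the lowest slab the bottom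
    layer is a segment, and joining its unit segments to vertical unit edges of the layer z = 1
    reproduces copies of Delta' itself. Avoiding them takes paths in the y direction within the same
    triangulation of the square, hence the longer steps of the pinwheel and the second dilation that
    repairs them. The layer z = 1 has width k - 1, whence k >= 2.

    Pieces refined independently still fit together: a standard unimodular triangulation of a
    dilated triangle is unique. In a sum of factors the middle part meets the edge z = 0 in one
    point and so contains no copy of Delta'. *)

Section Weights.
Variables (R : realType) (T : eqType).
Implicit Types (s V : seq T) (w d : T -> R) (f g h : T -> R) (cs hs : seq (T -> R)).

Definition E s w f : R := \sum_(p <- s) w p * f p.

(* [rep cs s w b]: the weights [w], supported on [s], write as a convex combination of [s] the point
   whose coordinates, measured by the functions [cs], are [b]. *)
Definition rep cs s w (b : seq R) : Prop :=
  [/\ forall p, 0 <= w p, forall p, p \notin s -> w p = 0,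
      E s w (fun _ => 1) = 1 & [seq E s w c | c <- cs] = b].

Lemma eq_E s w f g : {in s, f =1 g} -> E s w f = E s w g.
Proof. by move=> h; apply: eq_big_seq => p /h ->. Qed.

Lemma eq_Ew s w d f : {in s, w =1 d} -> E s w f = E s d f.
Proof. by move=> h; apply: eq_big_seq => p /h ->. Qed.

Lemma ED s w f g : E s w (fun p => f p + g p) = E s w f + E s w g.
Proof. by rewrite /E -big_split; apply: eq_bigr => p _; rewrite mulrDr. Qed.

Lemma EZ s w k f : E s w (fun p => k * f p) = k * E s w f.
Proof. by rewrite /E big_distrr; apply: eq_bigr => p _ /=; ring. Qed.

Lemma EwD s w d f : E s (fun p => w p + d p) f = E s w f + E s d f.
Proof. by rewrite /E -big_split; apply: eq_bigr => p _; rewrite mulrDl. Qed.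

Lemma EwZ s w k f : E s (fun p => k * w p) f = k * E s w f.
Proof. by rewrite /E big_distrr; apply: eq_bigr => p _ /=; ring. Qed.

Lemma E_cat s1 s2 w f : E (s1 ++ s2) w f = E s1 w f + E s2 w f.
Proof. exact: big_cat. Qed.

Lemma E_le s w f g : (forall p, 0 <= w p) -> {in s, forall p, w p != 0 -> f p <= g p} ->
  E s w f <= E s w g.
Proof.
move=> w0 h; rewrite /E big_seq [leRHS]big_seq; apply: ler_sum => p ps.
have [->|wp] := eqVneq (w p) 0; first by rewrite !mul0r.
exact: ler_wpM2l (w0 p) _ _ (h p ps wp).
Qed.

Lemma E_ge0 s w f : (forall p, 0 <= w p) -> {in s, forall p, w p != 0 -> 0 <= f p} ->
  0 <= E s w f.
Proof.
move=> w0 f0.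
have <- : E s w (fun _ => 0) = 0 by rewrite /E big1 // => x _; rewrite mulr0.
exact: E_le.
Qed.

(** Used throughout as complementary slackness: an upper bound on the mean of a nonnegative function
    forces the support into its zero set. *)
Lemma E_ge0_eq0 s w f : (forall p, 0 <= w p) -> {in s, forall p, w p != 0 -> 0 <= f p} ->
  E s w f <= 0 -> {in s, forall p, w p != 0 -> f p = 0}.
Proof.
move=> w0 f0 le0 p ps wp; apply/eqP; have /negbTE wF := wp.
have E0 : E s w f == 0 by rewrite eq_le le0 E_ge0.
move: E0; rewrite /E big_seq psumr_eq0; last first.
  by move=> x xs; have [->|wx] := eqVneq (w x) 0; [rewrite mul0r | rewrite mulr_ge0 // f0].
by move=> /allP /(_ _ ps); rewrite ps /= mulf_eq0 wF.
Qed.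

Lemma E_widen s V w f : uniq s -> uniq V -> {subset s <= V} ->
  (forall p, p \notin s -> w p = 0) -> E V w f = E s w f.
Proof.
move=> us uV sV w0; rewrite /E (bigID (mem s)) /= [X in _ + X]big1 ?addr0; last first.
  by move=> p /w0 ->; rewrite mul0r.
rewrite -big_filter; apply: perm_big; apply: uniq_perm; rewrite ?filter_uniq //.
by move=> p; rewrite mem_filter; case: (boolP (p \in s)) => // /sV ->.
Qed.

Lemma rep_widen cs s V w b : uniq s -> uniq V -> {subset s <= V} ->
  rep cs s w b -> rep cs V w b.
Proof.
move=> us uV sV [w0 ws w1 wb]; split=> //.
- by move=> p pV; apply: ws; apply: contra pV; apply: sV.
- by rewrite (E_widen _ us).
- by rewrite -wb; apply: eq_map => c; rewrite (E_widen _ us).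
Qed.

Lemma rep_shrink cs s V w b : uniq s -> uniq V -> {subset s <= V} ->
  (forall p, p \notin s -> w p = 0) -> rep cs V w b -> rep cs s w b.
Proof.
move=> us uV sV ws [w0 _ w1 wb]; split=> //.
- by rewrite -(E_widen _ us uV sV ws).
- by rewrite -wb; apply: eq_map => c; rewrite (E_widen _ us).
Qed.

Lemma rep_supp cs s w b : uniq s -> rep cs s w b ->
  rep cs [seq p <- s | w p != 0] w b.
Proof.
move=> us r; apply: (rep_shrink _ us _ _ r).
- exact: filter_uniq.
- by move=> p; rewrite mem_filter => /andP[].
- move=> p; rewrite mem_filter negb_and negbK => /orP[/eqP //|]; by case: r => _ h _ _ /h.
Qed.

Lemma E_ind s p f : uniq s -> p \in s -> E s (fun x => (x == p)%:R) f = f p.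
Proof.
move=> us ps; rewrite /E (bigD1_seq p) //= eqxx mul1r big1 ?addr0 // => x /negbTE ->.
by rewrite mul0r.
Qed.

Lemma E_two s p p' a b f : uniq s -> p \in s -> p' \in s ->
  E s (fun x => a * (x == p)%:R + b * (x == p')%:R) f = a * f p + b * f p'.
Proof.
by move=> us ps ps'; rewrite (EwD s (fun x => a * (x == p)%:R)) !EwZ !E_ind.
Qed.

Lemma map_eq_In (A B : Type) (f g : A -> B) (l : seq A) :
  (forall x, List.In x l -> f x = g x) -> map f l = map g l.
Proof.
elim: l => //= x l IH h; rewrite h; last by left.
by rewrite IH // => y yl; apply: h; right.
Qed.

(** Uniqueness of convex weights gives affine independence: a dependence [d], suitably scaled, would
    perturb the uniform weights on [s] into other weights of the same point. *)
Lemma cell_indep cs s : uniq s ->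
  (forall w1 w2 b, rep cs s w1 b -> rep cs s w2 b -> w1 =1 w2) ->
  forall d, E s d (fun _ => 1) = 0 -> (forall c, List.In c cs -> E s d c = 0) ->
  {in s, forall p, d p = 0}.
Proof.
move=> us un d d1 dc p ps.
(* [M] bounds every [|d x|], so the uniform weights stay nonnegative after adding [d / (n * M)]. *)
pose M : R := 1 + \sum_(x <- s) `|d x|.
pose n : R := (size s)%:R.
have n0 : 0 < n by rewrite ltr0n; case: (s) ps.
have sum0 : 0 <= \sum_(x <- s) `|d x| by apply: sumr_ge0.
have M0 : 0 < M by rewrite /M; lra.
have dM x : x \in s -> `|d x| <= M.
  move=> xs; rewrite /M (bigD1_seq x) //=.
  have : 0 <= \sum_(i <- s | i != x) `|d i| by apply: sumr_ge0.
  lra.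
pose w0 x : R := (x \in s)%:R / n.
pose w1 x := w0 x + (n * M)^-1 * (if x \in s then d x else 0).
have Ew1 c : E s w1 c = E s w0 c + (n * M)^-1 * E s d c.
  rewrite EwD EwZ; congr (_ + _ * _); apply: eq_Ew => x ->; exact: erefl.
have r0 : rep cs s w0 [seq E s w0 c | c <- cs].
  split=> //.
  - by move=> x; rewrite divr_ge0 // ltW.
  - by move=> x /negbTE xs; rewrite /w0 xs mul0r.
  - rewrite /E big_seq (eq_bigr (fun=> n^-1)); last by move=> x xs; rewrite /w0 xs mulr1 mul1r.
    by rewrite -big_seq big_const_seq count_predT iter_addr_0 -mulr_natl mulfV // gt_eqF.
have r1 : rep cs s w1 [seq E s w0 c | c <- cs].
  split.
  - move=> x; rewrite /w1 /w0; case: (boolP (x \in s)) => xs; last by rewrite !(mul0r, mulr0) addr0.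
    have := dM x xs; rewrite ler_norml => /andP[h _].
    have -> : 1%:R / n + (n * M)^-1 * d x = (n * M)^-1 * (M + d x).
      by field; rewrite !gt_eqF.
    apply: mulr_ge0; last lra.
    by rewrite invr_ge0 mulr_ge0 // ltW.
  - by move=> x /negbTE xs; rewrite /w1 /w0 xs mul0r mulr0 addr0.
  - by rewrite Ew1 d1 mulr0 addr0; case: r0.
  - by apply: map_eq_In => c hc; rewrite Ew1 dc // mulr0 addr0.
have := un _ _ _ r1 r0 p; rewrite /w1 ps => /eqP.
by rewrite -subr_eq0 addrC addKr mulf_eq0 invr_eq0 (gt_eqF (mulr_gt0 n0 M0)) => /eqP.
Qed.

(** With more points than this, the matrix of the constant 1 and the coordinates has a nonzero left
    kernel vector, which is an affine dependence. *)
Lemma cell_size cs s : uniq s ->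
  (forall w1 w2 b, rep cs s w1 b -> rep cs s w2 b -> w1 =1 w2) -> (size s <= (size cs).+1)%N.
Proof.
move=> us un; rewrite leqNgt; apply/negP => lt.
case: (s) lt us un => // x0 s' => lt us un; set l := x0 :: s' in lt us un.
pose A := \matrix_(i < size l, j < (size cs).+1)
  (nth (fun _ => 1) ((fun _ => 1) :: cs) j (nth x0 l i) : R).
have : kermx A != 0.
  rewrite -mxrank_eq0 mxrank_ker subn_eq0 -ltnNge; exact: leq_ltn_trans (rank_leq_col A) lt.
move=> /rowV0Pn [u /sub_kermxP uA /eqP u0]; apply: u0; apply/rowP => i; rewrite mxE.
pose d p := if insub (index p l) is Some i then u 0 i else 0.
have di j : d (nth x0 l (nat_of_ord j)) = u 0 j by rewrite /d index_uniq // valK.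
have Ed c : E l d c = \sum_i u 0 i * c (nth x0 l i).
  rewrite /E (big_nth x0) big_mkord (eq_bigr (fun j : 'I_(size l) => u 0 j * c (nth x0 l j))) // => j _; by rewrite di.
have kj (j : 'I_(size cs).+1) : E l d (nth (fun _ => 1) ((fun _ => 1) :: cs) j) = 0.
  have := congr1 (fun M : 'rV_(size cs).+1 => M 0 j) uA; rewrite !mxE => uA0.
  rewrite Ed -[RHS]uA0; by apply: eq_bigr => k _; rewrite mxE.
rewrite -di; apply: (cell_indep us un) => [||].
- exact: (kj ord0).
- move=> c hc.
  have [k [lk ek]] : exists k, (k < size cs)%N /\ nth (fun _ => 1) cs k = c.
    elim: (cs) hc => //= y m IH [<-|/IH [k [h1 h2]]]; first by exists 0%N.
    by exists k.+1.
  by have := kj (Ordinal (lk : (k.+1 < (size cs).+1)%N)); rewrite /= ek.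
- by rewrite mem_nth.
Qed.

Fixpoint lexle (s t : seq R) {struct s} : bool :=
  match s, t with
  | x :: s', y :: t' => (x < y) || ((x == y) && lexle s' t')
  | [::], _ => true
  | _, [::] => false
  end.

Lemma lexle_refl (s : seq R) : lexle s s.
Proof. by elim: s => //= x s ->; rewrite eqxx orbT. Qed.

Lemma lexle_total (s t : seq R) : lexle s t || lexle t s.
Proof.
by elim: s t => [|x s IH] [|y t] //=; rewrite (eq_sym y); case: ltgtP => //= _; exact: IH.
Qed.

Lemma lexle_trans (s t u : seq R) : lexle s t -> lexle t u -> lexle s u.
Proof.
elim: s t u => [|x s IH] [|y t] [|z u] //=.
move=> /orP[xy|/andP[/eqP <- st]] /orP[yz|/andP[/eqP <- tu]].
- by rewrite (lt_trans xy yz).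
- by rewrite xy.
- by rewrite yz.
- by rewrite eqxx (IH _ _ st tu) orbT.
Qed.

Lemma lexle_anti (s t : seq R) : lexle s t -> lexle t s -> s = t.
Proof.
elim: s t => [|x s IH] [|y t] //=.
rewrite (eq_sym y); case: ltgtP => //= <- st ts; by rewrite (IH _ st ts).
Qed.

Lemma lexle_cons x (s : seq R) y t : lexle (x :: s) (y :: t) -> x <= y /\ (y <= x -> lexle s t).
Proof. by move=> /=; case: ltgtP. Qed.

Lemma lexle_min (I : Type) (c : I -> seq R) (l : seq I) (i0 : I) :
  exists i, (i = i0 \/ List.In i l) /\ lexle (c i) (c i0) /\
     forall j, List.In j l -> lexle (c i) (c j).
Proof.
elim: l i0 => [|j l IH] i0; first by exists i0; split; [left|split=> //; exact: lexle_refl].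
have [i [hi [h0 hl]]] := IH i0.
case/orP: (lexle_total (c i) (c j)) => h.
  exists i; split; first by case: hi => ?; [left|right; right].
  by split=> // j' [<-|] //; apply: hl.
exists j; split; first by right; left.
split; first exact: lexle_trans h0.
by move=> j' [<-|/hl h']; [exact: lexle_refl | exact: lexle_trans h'].
Qed.

Variables (V : seq T) (cs : seq (T -> R)).
Hypothesis uV : uniq V.

Definition costs hs w := [seq E V w h | h <- hs].

(** Costs are linear: if moving from [w] along [nu' - nu] does not lower them, then [nu] costs at
    most as much as [nu']. *)
Lemma costs_exchange hs w nu nu' k : 0 < k ->
  lexle (costs hs w) (costs hs (fun p => w p + k * (nu' p - nu p))) ->
  lexle (costs hs nu) (costs hs nu').
Proof.
move=> k0; elim: hs => //= h hs IH.
rewrite EwD EwZ (EwD V nu' (fun p => - nu p)).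
have -> : E V (fun p => - nu p) h = - E V nu h.
  by rewrite /E -sumrN; apply: eq_bigr => p _; rewrite mulNr.
rewrite ltrDl pmulr_rgt0 // subr_gt0 => /orP[->//|/andP[/eqP e /IH ->]].
have /eqP : k * (E V nu' h - E V nu h) = 0 by lra.
rewrite mulf_eq0 gt_eqF //= subr_eq0 => /eqP ->; by rewrite eqxx orbT.
Qed.

Definition dep d := [/\ E V d (fun _ => 1) = 0, forall c, List.In c cs -> E V d c = 0
  & exists2 p, p \in V & d p != 0].

Definition indep s := ~ exists d, dep d /\ forall p, p \notin s -> d p = 0.

Lemma costs_dir hs w d k : 0 <= k ->
  lexle (costs hs d) (costs hs (fun=> 0)) ->
  lexle (costs hs (fun p => w p + k * d p)) (costs hs w).
Proof.
rewrite le_eqVlt => /orP[/eqP<- _|k0].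
  have -> : costs hs (fun p => w p + 0 * d p) = costs hs w; last exact: lexle_refl.
  by apply: eq_map => h; apply: eq_Ew => p _; rewrite mul0r addr0.
elim: hs => //= h hs IH.
have -> : E V (fun=> 0) h = 0 by rewrite /E big1 // => p _; rewrite mul0r.
rewrite EwD EwZ gtrDl pmulr_rlt0 // => /orP[->//|/andP[/eqP -> /IH ->]].
by rewrite mulr0 addr0 eqxx orbT.
Qed.

Lemma E_opp s d f : E s (fun p => - d p) f = - E s d f.
Proof. by rewrite /E -sumrN; apply: eq_bigr => p _; rewrite mulNr. Qed.

(** The simplex method: while the support is dependent, move along a dependence in a direction that
    does not raise the costs until one weight vanishes. The induction is on the size of the
    support. *)
Lemma reduce hs w b : rep cs V w b ->
  exists w', [/\ rep cs V w' b, indep [seq p <- V | w' p != 0]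
    & lexle (costs hs w') (costs hs w)].
Proof.
have [n] := ubnP (size [seq p <- V | w p != 0]).
elim: n w => // n IH w ltn r.
have [i|/contrapT [d0 [dep0 sd0]]] := pselect (indep [seq p <- V | w p != 0]).
  by exists w; split=> //; exact: lexle_refl.
(* Of [d0] and its opposite, one does not raise the costs. *)
have [d [[d1 dc dnz] sd dle]] : exists d, [/\ dep d,
    forall p, p \notin [seq p <- V | w p != 0] -> d p = 0
    & lexle (costs hs d) (costs hs (fun=> 0))].
  case/orP: (lexle_total (costs hs d0) (costs hs (fun=> 0))) => h; first by exists d0.
  exists (fun p => - d0 p); split.
  - case: dep0 => h1 h2 [p pV hp]; split; first by rewrite E_opp h1 oppr0.
      by move=> c /h2 e; rewrite E_opp e oppr0.
    by exists p => //; rewrite oppr_eq0.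
  - by move=> p /sd0 ->; rewrite oppr0.
  - elim: hs h {IH} => //= h hs IH.
    have -> : E V (fun=> 0) h = 0 by rewrite /E big1 // => p _; rewrite mul0r.
    rewrite E_opp oppr_lt0 oppr_eq0 (eq_sym 0) => /orP[->//|/andP[-> /IH ->]].
    by rewrite orbT.
(* [d] is nonzero with total mass 0, hence negative somewhere. *)
have [p0 p0V dp0] : exists2 p, p \in V & d p < 0.
  apply: contrapT => hn; case: dnz => p pV; apply/negP; rewrite negbK.
  have d0' : forall p, p \in V -> 0 <= d p.
    by move=> x xV; rewrite leNgt; apply/negP => hx; apply: hn; exists x.
  move: d1; rewrite /E big_seq => /eqP; rewrite psumr_eq0; last by move=> x /d0'; rewrite mulr1.
  by move=> /allP /(_ _ pV); rewrite pV mulr1.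
(* Ratio test: [p1] is the first point whose weight vanishes along [d]. *)
have [p1 [p1V dp1 p1min]] : exists p1, [/\ p1 \in V, d p1 < 0 &
    forall p, p \in V -> d p < 0 -> w p1 / - d p1 <= w p / - d p].
  have := @lexle_min _ (fun p => [:: w p / - d p]) [seq p <- V | d p < 0] p0.
  have inP : forall p l, List.In p l <-> p \in l :> Prop.
    by move=> ? p; elim=> //= y l IHl; rewrite inE; split=> [[->|/IHl ->]|/orP[/eqP ->|/IHl]];
      rewrite ?eqxx ?orbT; auto.
  move=> [p1 [hp1 [_ hm]]]; exists p1.
  have [e1 e2] : p1 \in V /\ d p1 < 0.
    by case: hp1 => [->//|/inP]; rewrite mem_filter => /andP[].
  split=> // p pV dp; have := hm p; rewrite /= andbT => h.
  rewrite le_eqVlt orbC; apply: h; apply/inP; by rewrite mem_filter dp.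
case: (r) => w0 ws w1 wb.
pose k := w p1 / - d p1.
have k0 : 0 <= k by rewrite divr_ge0 // oppr_ge0 ltW.
pose w' p := w p + k * d p.
have r' : rep cs V w' b.
  split.
  - move=> p; rewrite /w'; have [dp|dp] := leP 0 (d p).
      by apply: addr_ge0 => //; apply: mulr_ge0.
    have [pV|pV] := boolP (p \in V); last first.
      by rewrite sd ?mulr0 ?addr0 // mem_filter (negbTE pV) andbF.
    have := p1min p pV dp; rewrite -/k ler_pdivlMr ?oppr_gt0 //; lra.
  - move=> p pV; rewrite /w' ws // sd ?mulr0 ?addr0 // mem_filter (negbTE pV) andbF //.
  - by rewrite EwD EwZ d1 w1 mulr0 addr0.
  - rewrite -wb; apply: map_eq_In => c hc; by rewrite EwD EwZ dc // mulr0 addr0.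
have [w'' [h1 h2 h3]] : exists w'', [/\ rep cs V w'' b, indep [seq p <- V | w'' p != 0]
    & lexle (costs hs w'') (costs hs w')].
  apply: IH => //; move: ltn; rewrite ltnS; apply: leq_trans.
  have sub : {subset [seq p <- V | w' p != 0] <= [seq p <- V | w p != 0]}.
    move=> p; rewrite !mem_filter => /andP[h ->]; rewrite andbT.
    apply: contraNneq h => wp; rewrite /w' wp sd ?mulr0 ?addr0 // mem_filter wp eqxx //.
  have p1in : p1 \in [seq p <- V | w p != 0].
    rewrite mem_filter p1V andbT; apply/negP => /eqP e.
    by move: dp1; rewrite sd ?ltxx // mem_filter e eqxx.
  have p1out : p1 \notin [seq p <- V | w' p != 0].
    rewrite mem_filter negb_and negbK /w' /k; apply/orP; left.
    have : d p1 != 0 by rewrite lt_eqF.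
    by move=> h; apply/eqP; field.
  have := @uniq_leq_size _ (p1 :: [seq p <- V | w' p != 0]) [seq p <- V | w p != 0].
  rewrite /= p1out filter_uniq //= => h; apply: h => // x; rewrite inE => /orP[/eqP ->//|].
  exact: sub.
exists w''; split=> //; apply: lexle_trans h3 _; exact: costs_dir.
Qed.

Fixpoint subs (l : seq T) : seq (seq T) :=
  if l is x :: l' then subs l' ++ map (cons x) (subs l') else [:: [::]].

Lemma filter_subs a l : List.In (filter a l) (subs l).
Proof.
elim: l => [|x l IH] /=; first by left.
apply/List.in_app_iff; case: (a x); last by left.
by right; apply: List.in_map.
Qed.

Lemma indep_uniq s w1 w2 b : indep s -> rep cs V w1 b -> rep cs V w2 b ->
  (forall p, p \notin s -> w1 p = 0) -> (forall p, p \notin s -> w2 p = 0) -> w1 =1 w2.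
Proof.
move=> i [_ n1 e1 b1] [_ n2 e2 b2] s1 s2 p; apply: contrapT => hp.
have nz : w1 p - w2 p != 0 by rewrite subr_eq0; apply/eqP.
apply: i; exists (fun p => w1 p - w2 p); split; last by move=> x xs; rewrite s1 ?s2 ?subrr.
have ew c : E V (fun p => w1 p - w2 p) c = E V w1 c - E V w2 c.
  by rewrite (EwD V w1 (fun p => - w2 p)) E_opp.
split; first by rewrite ew e1 e2 subrr.
  have : [seq E V w1 c | c <- cs] = [seq E V w2 c | c <- cs] by rewrite b1 b2.
  move=> + c; elim: (cs) => //= x l IH [h1 h2] [<-|/IH]; first by rewrite ew h1 subrr.
  exact.
exists p => //; apply: contraNT nz => pV; by rewrite n1 ?n2 ?subrr.
Qed.

(** By [reduce] it suffices to compare weights with independent support. Such weights are determined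
    by their support, so the minimum is taken over finitely many candidates, at most one for each
    sublist of [V]. *)
Lemma lp_exists hs w b : rep cs V w b ->
  exists w0, rep cs V w0 b /\ forall w', rep cs V w' b -> lexle (costs hs w0) (costs hs w').
Proof.
move=> /(reduce hs)[wb [rb ib _]].
pose P s w := [/\ rep cs V w b, indep s & forall p, p \notin s -> w p = 0].
pose cand s := if pselect (exists w, P s w) is left h then [:: projT1 (cid h)] else [::].
have [w0 [h0 [_ hm]]] := lexle_min (costs hs) (flatten (map cand (subs V))) wb.
have flatP : forall x l, List.In x (flatten (map cand l)) ->
    exists s, List.In s l /\ List.In x (cand s).
  move=> x; elim=> //= s l IH /List.in_app_iff [h|/IH[s' [h1 h2]]]; first by exists s; split; [left|].
  by exists s'; split; [right|].
have flatP' : forall x s l, List.In s l -> List.In x (cand s) -> List.In x (flatten (map cand l)).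
  move=> x s; elim=> //= s' l IH [->|/IH h] hx; apply/List.in_app_iff; [by left|right; exact: h].
exists w0; split.
  case: h0 => [->//|/flatP [s [_]]]; rewrite /cand; case: pselect => //= h [<-|//].
  by case: (projT2 (cid h)).
move=> w' /(reduce hs) [w1 [r1 i1 le1]]; apply: lexle_trans le1.
pose s := [seq p <- V | w1 p != 0].
have Pw1 : P s w1.
  split=> // p; rewrite mem_filter negb_and negbK => /orP[/eqP //|pV].
  by case: r1 => _ h _ _; apply: h.
have [w2 [h2 e2]] : exists w2, List.In w2 (cand s) /\ w2 =1 w1.
  rewrite /cand; case: pselect => [h|[]]; last by exists w1.
  exists (projT1 (cid h)); split; first by left.
  case: (projT2 (cid h)) => r2 _ s2; case: Pw1 => _ _ s1; exact: (indep_uniq i1 r2 r1 s2 s1).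
have -> : costs hs w1 = costs hs w2 by apply: eq_map => h; apply: eq_Ew => p _; rewrite e2.
by apply: hm; apply: flatP' h2; apply: filter_subs.
Qed.

Lemma E_pick w p : p \in V -> E V w (fun x => (x == p)%:R) = w p.
Proof.
move=> pV; rewrite /E (bigD1_seq p) //= eqxx mulr1 big1 ?addr0 // => x /negbTE ->.
by rewrite mulr0.
Qed.

Lemma lexle_cat (a a' b b' : seq R) : size a = size b -> lexle (a ++ a') (b ++ b') -> lexle a b.
Proof.
elim: a b => [|x a IH] [|y b] //= [e] /orP[->//|/andP[-> /IH ->]] //; by rewrite orbT.
Qed.

(* The cells are the supports of the weights that are optimal for the lexicographic order,
   ties being broken by the weights themselves. *)
Theorem lp hs : exists K : seq T -> Prop,
  [/\ forall s, K s -> uniq s /\ {subset s <= V},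
      forall b w, rep cs V w b -> exists s w', [/\ K s, rep cs s w' b & {in s, forall p, 0 < w' p}],
      forall s1 s2 w1 w2 b, K s1 -> K s2 -> rep cs s1 w1 b -> rep cs s2 w2 b -> w1 =1 w2 &
      forall s w b w', K s -> rep cs s w b -> rep cs V w' b -> lexle (costs hs w) (costs hs w')].
Proof.
pose hs' := hs ++ [seq (fun x => (x == p)%:R) | p <- V].
pose opt w b := rep cs V w b /\ forall w', rep cs V w' b -> lexle (costs hs' w) (costs hs' w').
have opt_uniq w1 w2 b : opt w1 b -> opt w2 b -> w1 =1 w2.
  move=> [r1 o1] [r2 o2] p; have /eqP := lexle_anti (o1 _ r2) (o2 _ r1).
  rewrite /costs !map_cat eqseq_cat ?size_map // -!map_comp => /andP[_ /eqP e].
  have [pV|pV] := boolP (p \in V); last first.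
    by case: r1 r2 => [_ h1 _ _] [_ h2 _ _]; rewrite h1 ?h2.
  have := congr1 (fun l => nth 0 l (index p V)) e.
  by rewrite !(nth_map p) ?index_mem // !nth_index //= !E_pick.
pose K s := exists w b, opt w b /\ s = [seq p <- V | w p != 0].
have Kuniq s : K s -> uniq s /\ {subset s <= V}.
  move=> [w [b [_ ->]]]; split; first exact: filter_uniq.
  by move=> p; rewrite mem_filter => /andP[].
(* Every weight on an optimal support is itself optimal: for a small [k > 0] the optimum [w0]
   dominates [k * w], so trading that part for [k * w'] stays feasible, and [costs_exchange]
   applies. *)
have Kopt s w b : K s -> rep cs s w b -> opt w b.
  move=> Ks r; have [us sV] := Kuniq s Ks.
  have rV := rep_widen us uV sV r.
  split=> // w' r'; case: Ks => w0 [b0 [[r0 o0] es]].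
  have [k k0 hk] : exists2 k, 0 < k & forall p, p \in V -> k * w p <= w0 p.
    case: (r) (r0) => [wnn ws _ _] [w0nn w0s _ _].
    have hx p : p \in V -> exists2 k, 0 < k & forall k', 0 < k' -> k' <= k -> k' * w p <= w0 p.
      move=> pV; have [ps|ps] := boolP (p \in s); last first.
        by exists 1 => // k' _ _; rewrite (ws _ ps) mulr0.
      have w0p : 0 < w0 p by move: ps; rewrite es mem_filter => /andP[h _]; rewrite lt_neqAle eq_sym h /=.
      exists (w0 p / (w p + 1)); first by rewrite divr_gt0 // ltr_wpDl.
      have wp1 : 0 < w p + 1 by have := wnn p; lra.
      move=> k' k'0; rewrite ler_pdivlMr // => h; have := wnn p; nra.
    elim: (V) hx => [|x l IH] hx; first by exists 1.
    have [|k1 k10 h1] := IH; first by move=> p pl; apply: hx; rewrite inE pl orbT.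
    have [k2 k20 h2] := hx x (mem_head _ _).
    have [h|h] := leP k1 k2.
      exists k1 => // p; rewrite inE => /orP[/eqP ->|/h1 //]; exact: h2.
    exists k2 => // p; rewrite inE => /orP[/eqP ->|/h1 hp]; first exact: h2.
    apply: le_trans hp; apply: ler_wpM2r (ltW h); by case: r.
  apply: (costs_exchange k0 (nu := w) (nu' := w')).
  case: (r0) (r) (r') => [a1 a2 a3 a4] [c1 c2 c3 c4] [d1 d2 d3 d4].
  suff r2 : rep cs V (fun p => w0 p + k * (w' p - w p)) b0.
    by apply: lexle_trans (o0 _ r2); exact: lexle_refl.
  have ew c : E V (fun p => w0 p + k * (w' p - w p)) c = E V w0 c + k * (E V w' c - E V w c).
    by rewrite EwD EwZ (EwD V w' (fun p => - w p)) E_opp.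
  split.
  - move=> p; have := d1 p; have [pV|pV] := boolP (p \in V); first by have := hk p pV; nra.
    by rewrite a2 // d2 // c2 ?subrr ?mulr0 ?addr0 //; apply: contra pV; apply: sV.
  - by move=> p pV; rewrite a2 // d2 // c2 ?subrr ?mulr0 ?addr0 //; apply: contra pV; apply: sV.
  - by rewrite ew a3 d3 (E_widen _ us) // c3 subrr mulr0 addr0.
  - rewrite -a4; apply: map_eq_In => c hc; rewrite ew.
    have : [seq E V w' c | c <- cs] = [seq E V w c | c <- cs].
      by rewrite d4 -c4; apply: eq_map => x; rewrite (E_widen _ us).
    move=> h; have -> : E V w' c = E V w c.
      elim: (cs) h hc => //= y l IH [h1 h2] [<-//|hc]; exact: IH.
    by rewrite subrr mulr0 addr0.
exists K; split=> //.
- move=> b w /(lp_exists hs')[w0 [r0 o0]].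
  exists [seq p <- V | w0 p != 0], w0; split; first by exists w0, b.
    exact: rep_supp.
  move=> p; rewrite mem_filter => /andP[h _]; rewrite lt_neqAle eq_sym h /=; by case: r0.
- move=> s1 s2 w1 w2 b K1 K2 r1 r2.
  exact: (opt_uniq _ _ b (Kopt _ _ _ K1 r1) (Kopt _ _ _ K2 r2)).
- move=> s w b w' Ks r r'; have [_ /(_ _ r')] := Kopt _ _ _ Ks r.
  rewrite /costs /hs' !map_cat; apply: lexle_cat; by rewrite !size_map.
Qed.

End Weights.

(** * Edge paths *)

Section Plane.
Variable R : realType.
Notation P2 := (R * R)%type.

Definition cs2 : seq (P2 -> R) := [:: fst; snd].
Definition rep2 (s : seq P2) (w : P2 -> R) (B : P2) := rep cs2 s w [:: B.1; B.2].

Lemma rep2_aff s w B al be ga : rep2 s w B ->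
  E s w (fun p => al + be * p.1 + ga * p.2) = al + be * B.1 + ga * B.2.
Proof.
move=> [_ _ e1 [e2 e3]].
rewrite (ED s w (fun p : P2 => al + be * p.1) (fun p => ga * p.2)).
rewrite (ED s w (fun p : P2 => al) (fun p => be * p.1)) !EZ e2 e3.
by rewrite (eq_E w (g := fun p => al * 1)) ?EZ ?e1 ?mulr1 // => p _; rewrite mulr1.
Qed.

Lemma rep2_face s w B (l : P2 -> R) al be ga : rep2 s w B ->
  (forall p, l p = al + be * p.1 + ga * p.2) ->
  (forall p, w p != 0 -> 0 <= l p) -> l B <= 0 -> forall p, w p != 0 -> l p = 0.
Proof.
move=> r hl l0 lB p wp; have [w0 ws _ _] := r.
have ps : p \in s by apply: contraNT wp => /ws ->.
apply: (E_ge0_eq0 w0 _ _ ps wp) => [x _|]; first exact: l0.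
by rewrite (eq_E w (g := fun p => al + be * p.1 + ga * p.2)) // (rep2_aff _ _ _ r) -hl.
Qed.

Lemma rep2_le s w B (l : P2 -> R) al be ga : rep2 s w B ->
  (forall p, l p = al + be * p.1 + ga * p.2) ->
  (forall p, w p != 0 -> 0 <= l p) -> 0 <= l B.
Proof.
move=> r hl l0; have [w0 ws _ _] := r.
rewrite hl -(rep2_aff _ _ _ r); apply: E_ge0 => // p _ wp; rewrite -hl; exact: l0.
Qed.

Section Paths.
Variables (K : seq P2 -> Prop) (s t : P2 -> R) (good : P2 -> P2 -> Prop).

(* Every simplex representing a point of the segment CD does so through C and D alone. *)
Definition edge (C D : P2) := forall l w (B : P2) th, K l -> rep2 l w B -> 0 <= th <= 1 ->
  B.1 = C.1 + th * (D.1 - C.1) -> B.2 = C.2 + th * (D.2 - C.2) ->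
  forall p, w p != 0 -> p = C \/ p = D.

(* The graph of [f], in the coordinates (s, t), is an edge path; [path_cross] replaces continuity. *)
Record pathI (a b : R) (f : R -> R) : Prop := PathI {
  pathI_le : a <= b;
  path_edge : forall x, a <= x <= b -> exists C D th, [/\ edge C D, C != D -> good C D,
     0 <= th <= 1, x = s C + th * (s D - s C) & forall th', 0 <= th' <= 1 ->
       a <= s C + th' * (s D - s C) <= b /\
       f (s C + th' * (s D - s C)) = t C + th' * (t D - t C)];
  path_cross : forall x1 y1 x2 y2, a <= x1 <= b -> a <= x2 <= b -> y1 < f x1 -> f x2 < y2 ->
     exists th, [/\ 0 < th < 1 & y1 + th * (y2 - y1) = f (x1 + th * (x2 - x1))] }.

Lemma path_cross' a b f x1 y1 x2 y2 : pathI a b f -> a <= x1 <= b -> a <= x2 <= b ->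
  f x1 < y1 -> y2 < f x2 ->
  exists th, [/\ 0 < th < 1 & y1 + th * (y2 - y1) = f (x1 + th * (x2 - x1))].
Proof.
move=> h h1 h2 l1 l2; have [th [ht e]] := path_cross h h2 h1 l2 l1.
exists (1 - th); split; first lra.
have -> : x1 + (1 - th) * (x2 - x1) = x2 + th * (x1 - x2) by ring.
rewrite -e; ring.
Qed.

Lemma path_pt C : edge C C -> pathI (s C) (s C) (fun _ => t C).
Proof.
move=> eC; split=> //.
- move=> x hx; exists C, C, 0; split=> //; first (by rewrite eqxx).
  + lra.
  + lra.
  + by move=> th _; split; lra.
- move=> x1 y1 x2 y2 h1 h2 l1 l2.
  exists ((t C - y1) / (y2 - y1)).
  have d : 0 < y2 - y1 by lra.
  split; last by rewrite divfK ?gt_eqF //; ring.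
  by rewrite divr_gt0 ?ltr_pdivrMr //; lra.
Qed.

Lemma path_seg C D : edge C D -> good C D -> s C < s D ->
  exists f, [/\ pathI (s C) (s D) f, f (s C) = t C, f (s D) = t D &
    forall x, f x = t C + (x - s C) / (s D - s C) * (t D - t C)].
Proof.
move=> eC g lt; pose k := (t D - t C) / (s D - s C).
have d : 0 < s D - s C by lra.
have d' : s D - s C != 0 by rewrite gt_eqF.
exists (fun x => t C + (x - s C) / (s D - s C) * (t D - t C)); split=> //; last first.
- by rewrite divff // mul1r; ring.
- by rewrite subrr mul0r mul0r addr0.
split; first exact: ltW.
- move=> x hx; exists C, D, ((x - s C) / (s D - s C)); split=> //.
  + by rewrite divr_ge0 ?ler_pdivrMr //; lra.
  + by rewrite divfK //; ring.
  + move=> th hth; split; first by nra.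
    by rewrite [_ + _ - s C]addrC addKr mulfK.
- move=> x1 y1 x2 y2 h1 h2.
  have e x : (x - s C) / (s D - s C) * (t D - t C) = k * (x - s C) by rewrite /k; field.
  rewrite !e => l1 l2.
  (* [u1] and [u2] are the vertical gaps at the two ends. The graph is a line, so the crossing
     divides the segment in their ratio. *)
  pose u1 := t C + k * (x1 - s C) - y1; pose u2 := y2 - (t C + k * (x2 - s C)).
  have u10 : 0 < u1 by rewrite /u1; lra.
  have u20 : 0 < u2 by rewrite /u2; lra.
  exists (u1 / (u1 + u2)); split; first by rewrite divr_gt0 ?ltr_pdivrMr //; lra.
  rewrite e; set th := u1 / _.
  have hth : th * (u1 + u2) = u1 by rewrite /th divfK // gt_eqF //; lra.
  rewrite /u1 /u2 in hth; lra.
Qed.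

(** For the crossing property, the segment between the two given points is cut where it meets the
    line over [b]. The side of the common value [f b] on which the cut point lies tells which half
    crosses. *)
Lemma path_glue a b c f g : pathI a b f -> pathI b c g -> f b = g b ->
  pathI a c (fun x => if x <= b then f x else g x).
Proof.
move=> pf pg e; have ab := pathI_le pf; have bc := pathI_le pg.
have gx x : b <= x -> (if x <= b then f x else g x) = g x.
  by move=> bx; case: leP => // xb; have -> : x = b by [lra]; rewrite e.
have fx x : x <= b -> (if x <= b then f x else g x) = f x by move=> ->.
split; first exact: le_trans bc.
- move=> x hx; case: (leP x b) => xb.
    have [|C [D [th [h3 h4 h5 h6 h7]]]] := path_edge pf (x := x); first lra.
    exists C, D, th; split=> // th' /h7 [h8 h9]; rewrite fx; last lra.
    by split=> //; lra.
  have [|C [D [th [h3 h4 h5 h6 h7]]]] := path_edge pg (x := x); first lra.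
  exists C, D, th; split=> // th' /h7 [h8 h9]; rewrite gx; last lra.
  by split=> //; lra.
move=> x1 y1 x2 y2 h1 h2.
have [x1b|x1b] := leP x1 b; have [x2b|x2b] := leP x2 b => l1 l2.
- have [||th [ht e']] := path_cross pf _ _ l1 l2; [lra|lra|].
  by exists th; split=> //; rewrite fx //; nra.
- pose v := (b - x1) / (x2 - x1).
  have d : 0 < x2 - x1 by lra.
  have v0 : 0 <= v by rewrite divr_ge0; lra.
  have v1 : v < 1 by rewrite ltr_pdivrMr //; lra.
  have ev : b = x1 + v * (x2 - x1) by rewrite divfK ?gt_eqF //; ring.
  have [lt|gt|eq] := ltgtP (y1 + v * (y2 - y1)) (f b).
  + rewrite e in lt.
    have [||th [ht e']] := path_cross pg _ _ lt l2; [lra|lra|].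
    exists (v + th * (1 - v)); split; first by nra.
    have ee : x1 + (v + th * (1 - v)) * (x2 - x1) = b + th * (x2 - b) by rewrite ev; ring.
    rewrite ee gx; last by nra.
    rewrite -e'; ring.
  + have [||th [ht e']] := path_cross pf _ _ l1 gt; [lra|lra|].
    have hv : 0 < v by rewrite lt_neqAle v0 andbT; apply: contraTneq gt => v0';
      have xb : x1 = b by [rewrite ev -v0'; ring]; rewrite -v0' mul0r addr0 -xb -leNgt ltW.
    exists (th * v); split; first by nra.
    rewrite fx; last by nra.
    have -> : x1 + th * v * (x2 - x1) = x1 + th * (b - x1) by rewrite [in RHS]ev; ring.
    rewrite -e'; ring.
  + have hv : 0 < v by rewrite lt_neqAle v0 andbT; apply: contraTneq l1 => v0';
      have xb : x1 = b by [rewrite ev -v0'; ring]; rewrite xb -eq -v0' mul0r addr0 ltxx.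
    exists v; split; first by rewrite hv.
    by rewrite -ev eq fx.
- pose v := (b - x2) / (x1 - x2).
  have d : 0 < x1 - x2 by lra.
  have v0 : 0 <= v by rewrite divr_ge0; lra.
  have v1 : v < 1 by rewrite ltr_pdivrMr //; lra.
  have ev : b = x2 + v * (x1 - x2) by rewrite divfK ?gt_eqF //; ring.
  have [lt|gt|eq] := ltgtP (y2 + v * (y1 - y2)) (f b).
  + have [||th [ht e']] := path_cross pf _ _ lt l2; [lra|lra|].
    have hv : 0 < v by rewrite lt_neqAle v0 andbT; apply: contraTneq lt => v0';
      have xb : x2 = b by [rewrite ev -v0'; ring]; rewrite -v0' mul0r addr0 -xb -leNgt ltW.
    exists (1 - v + th * v); split; first by nra.
    have ee : x1 + (1 - v + th * v) * (x2 - x1) = b + th * (x2 - b) by rewrite ev; ring.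
    rewrite ee fx; last by nra.
    rewrite -e'; ring.
  + rewrite e in gt; have [||th [ht e']] := path_cross pg _ _ l1 gt; [lra|lra|].
    exists (th * (1 - v)); split; first by nra.
    have ee : x1 + th * (1 - v) * (x2 - x1) = x1 + th * (b - x1) by rewrite ev; ring.
    rewrite ee gx; last by nra.
    rewrite -e'; ring.
  + have hv : 0 < v by rewrite lt_neqAle v0 andbT; apply: contraTneq l2 => v0';
      have xb : x2 = b by [rewrite ev -v0'; ring]; rewrite xb -eq -v0' mul0r addr0 ltxx.
    exists (1 - v); split; first by lra.
    have -> : x1 + (1 - v) * (x2 - x1) = b by rewrite ev; ring.
    rewrite fx // -eq; ring.
- have [||th [ht e']] := path_cross pg _ _ l1 l2; [lra|lra|].
  by exists th; split=> //; rewrite gx //; nra.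
Qed.

End Paths.
End Plane.
Arguments cs2 {R}.

Section Sides.
Variable R : realType.
Notation P2 := (R * R)%type.
Variables (K : seq P2 -> Prop) (s t : P2 -> R) (good : P2 -> P2 -> Prop).
Hypothesis axes : s = fst /\ t = snd \/ s = snd /\ t = fst.

Lemma rep2_pair (l : seq P2) w (B C D : P2) : rep2 l w B -> (forall p, w p != 0 -> p = C \/ p = D) ->
  exists th, [/\ 0 <= th <= 1, B.1 = C.1 + th * (D.1 - C.1) & B.2 = C.2 + th * (D.2 - C.2)].
Proof.
move=> [w0 ws w1 [e1 e2]] h; exists (E l w (fun p => (p == D)%:R)).
have pos p : p \in l -> w p != 0 -> 0 <= ((p == D)%:R : R) by move=> _ _; exact: ler0n.
have le1 p : p \in l -> w p != 0 -> ((p == D)%:R : R) <= 1 by move=> _ _; case: eqP.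
have lin (c : P2 -> R) : E l w c = c C + E l w (fun p => (p == D)%:R) * (c D - c C).
  have ec : E l w (fun _ => c C * 1) = c C by rewrite EZ w1 mulr1.
  rewrite -[X in X + _]ec [X in _ + X]mulrC -EZ -ED; apply: eq_big_seq => p pl; have [->|/h[->|->]] := eqVneq (w p) 0.
  - by rewrite !mul0r.
  - case: eqP => [<-|_]; last by rewrite mulr0 addr0 mulr1.
    by rewrite mulr1 subrr mul0r addr0.
  - by rewrite eqxx !mulr1; congr (_ * _); ring.
have t1 : 0 <= E l w (fun p => (p == D)%:R) <= 1.
  rewrite (E_ge0 w0 pos) /= -[leRHS]w1; exact: (E_le w0 le1).
split=> //.
- by rewrite -[LHS]e1 (lin fst).
- by rewrite -[LHS]e2 (lin snd).
Qed.

Lemma rep2_mix (l : seq P2) w w' (B B' : P2) th : 0 <= th <= 1 -> rep2 l w B -> rep2 l w' B' ->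
  rep2 l (fun p => (1 - th) * w p + th * w' p)
    (B.1 + th * (B'.1 - B.1), B.2 + th * (B'.2 - B.2)).
Proof.
move=> hth [a0 a1 a2 [a3 a4]] [b0 b1 b2 [b3 b4]].
have e c : E l (fun p => (1 - th) * w p + th * w' p) c = (1 - th) * E l w c + th * E l w' c.
  by rewrite (EwD l (fun p => (1 - th) * w p)) !EwZ.
split.
- by move=> p; have := a0 p; have := b0 p; nra.
- by move=> p pl; rewrite a1 // b1 // !mulr0 addr0.
- by rewrite e a2 b2; ring.
- rewrite /= !e a3 a4 b3 b4; congr [:: _; _]; ring.
Qed.

(* If a path separated two points of a simplex, one of them with full support, it would cross the
   simplex at a point of full support, so that the simplex would be one of its edges. *)
Lemma path_side a b f (l : seq P2) w (B : P2) w' (B' : P2) : pathI K s t good a b f -> K l ->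
  (forall p, p \in l -> a <= s p <= b) -> rep2 l w B -> {in l, forall p, 0 < w p} ->
  rep2 l w' B' ->
  (t B <= f (s B) -> t B' <= f (s B')) /\ (f (s B) <= t B -> f (s B') <= t B').
Proof.
move=> pf Kl lab r wpos r'.
have sab v A : rep2 l v A -> a <= s A <= b.
  move=> rA; have pl p : v p != 0 -> p \in l by case: rA => _ h _ _; apply: contraNT => /h ->.
  have H (sg c : R) : (forall p, p \in l -> 0 <= c + sg * s p) -> 0 <= c + sg * s A.
    move=> hl; case: axes => [[e _]|[e _]].
    - apply: (rep2_le (l := fun p => c + sg * s p) (al := c) (be := sg) (ga := 0) rA).
        by move=> p; rewrite e; ring.
      by move=> p /pl; apply: hl.
    - apply: (rep2_le (l := fun p => c + sg * s p) (al := c) (be := 0) (ga := sg) rA).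
        by move=> p; rewrite e; ring.
      by move=> p /pl; apply: hl.
  have h1 := H 1 (- a); have h2 := H (-1) b.
  have g1 : 0 <= - a + 1 * s A by apply: h1 => p /lab; lra.
  have g2 : 0 <= b + -1 * s A by apply: h2 => p /lab; lra.
  lra.
(* A point before the end of the segment from [B] to [B'] has positive weight on all of [l]. If it
   lies on the path, then all of [l] lies on one edge of the path, and so does [B']. *)
have onpath th : 0 <= th < 1 ->
    t B + th * (t B' - t B) = f (s B + th * (s B' - s B)) -> t B' = f (s B').
  move=> hth ez.
  have hth' : 0 <= th <= 1 by lra.
  have rZ := rep2_mix hth' r r'.
  have sZ : a <= s B + th * (s B' - s B) <= b.
    by have := sab _ _ r; have := sab _ _ r'; nra.
  have [C [D [v [eCD _ hv ex ey]]]] := path_edge pf sZ.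
  have [_ eZ] := ey v hv.
  have sub p : p \in l -> p = C \/ p = D.
    move=> pl; apply: (eCD _ _ _ v Kl rZ hv).
    - rewrite -ex -ez in eZ; case: axes ex eZ => [[-> ->]|[-> ->]] //=.
    - rewrite -ex -ez in eZ; case: axes ex eZ => [[-> ->]|[-> ->]] //=.
    - have := wpos p pl; case: r' => [w'0 _ _ _]; have := w'0 p => h1 h2.
      rewrite gt_eqF //; nra.
  have [|u [hu e1 e2]] := rep2_pair (C := C) (D := D) r'.
    by move=> p wp; apply: sub; apply: contraNT wp; case: r' => _ h _ _ /h ->.
  have [_] := ey u hu; by case: axes => [[-> ->]|[-> ->]]; rewrite e1 e2.
have [h1 h2] := (sab _ _ r, sab _ _ r').
split=> hB; rewrite leNgt; apply/negP => hB'.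
- have hlt : t B < f (s B).
    rewrite lt_neqAle hB andbT; apply/eqP => e.
    have : t B' = f (s B') by apply: (onpath 0); [lra | rewrite !mul0r !addr0].
    by move=> e'; rewrite e' ltxx in hB'.
  have [th [hth e]] := path_cross pf h1 h2 hlt hB'.
  by have := onpath th _ e; rewrite ltW ?(andP hth).1 ?(andP hth).2 // => /(_ isT) e'; rewrite e' ltxx in hB'.
- have hlt : f (s B) < t B.
    rewrite lt_neqAle hB andbT; apply/eqP => e.
    have : t B' = f (s B') by apply: (onpath 0); [lra | rewrite !mul0r !addr0].
    by move=> e'; rewrite e' ltxx in hB'.
  have [th [hth e]] := path_cross' pf h1 h2 hlt hB'.
  by have := onpath th _ e; rewrite ltW ?(andP hth).1 ?(andP hth).2 // => /(_ isT) e'; rewrite e' ltxx in hB'.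
Qed.

(* Hence a simplex with an edge inside the path has that edge among the edges of the path. *)
Lemma path_good a b f (l : seq P2) (p p' : P2) : pathI K s t good a b f -> K l ->
  uniq l -> p \in l -> p' \in l -> p != p' ->
  (forall B, B.1 = (p.1 + p'.1) / 2 -> B.2 = (p.2 + p'.2) / 2 ->
     a <= s B <= b /\ t B = f (s B)) ->
  good p p' \/ good p' p.
Proof.
move=> pf Kl ul pl p'l pp' /(_ ((p.1 + p'.1) / 2, (p.2 + p'.2) / 2) erefl erefl).
set B := (_, _) => -[hB ez].
have r : rep2 l (fun x => 2^-1 * (x == p)%:R + 2^-1 * (x == p')%:R) B.
  split=> [x|x xl||].
  - by rewrite addr_ge0 // mulr_ge0 ?ler0n // invr_ge0 ler0n.
  - have -> : x == p = false by apply: contraNF xl => /eqP ->.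
    have -> : x == p' = false by apply: contraNF xl => /eqP ->.
    by rewrite !mulr0 addr0.
  - by rewrite E_two //; field.
  - by rewrite /= !E_two //; congr [:: _; _]; field.
have [C [D [th [eCD gCD hth ex ey]]]] := path_edge pf hB.
have [_ eZ] := ey th hth; rewrite -ex -ez in eZ.
have sub x : x = p \/ x = p' -> x = C \/ x = D.
  move=> hx; apply: (eCD _ _ _ th Kl r hth).
  - by case: axes ex eZ => [[-> ->]|[-> ->]].
  - by case: axes ex eZ => [[-> ->]|[-> ->]].
  - rewrite gt_eqF //; case: hx => ->; rewrite eqxx mulr1.
      by apply: ltr_wpDr; rewrite ?mulr_ge0 ?invr_ge0 ?invr_gt0 ?ler0n ?ltr0n.
    by apply: ltr_wpDl; rewrite ?mulr_ge0 ?invr_ge0 ?invr_gt0 ?ler0n ?ltr0n.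
have := sub p (or_introl erefl); have := sub p' (or_intror erefl).
move=> [e1|e1] [e2|e2]; subst p p'; rewrite ?eqxx // in pp'.
- by right; apply: gCD; rewrite eq_sym.
- by left; apply: gCD.
Qed.

End Sides.

(** * Triangulations of the unit square *)

Section Lattice.
Variable R : realType.
Notation P2 := (R * R)%type.

Lemma int_small (x : R) : x \is a Num.int -> -1 < x < 1 -> x = 0.
Proof.
move=> xi h; apply/eqP; apply: contraT => /(norm_intr_ge1 xi); rewrite ler_normr; lra.
Qed.

Lemma int_gap (x y : R) : x \is a Num.int -> y \is a Num.int -> x < y -> x + 1 <= y.
Proof.
move=> xi yi xy; rewrite leNgt; apply/negP => h.
have : y - x = 0 by apply: int_small; [rewrite rpredB | lra].
lra.
Qed.

(* The planar lattice Z u + Z v + Z (p u + v)/q, in the basis (u, v). *)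
Definition lat (q : nat) (p : int) (P : P2) : bool :=
  (q%:R * P.2 \is a Num.int) && (P.1 - p%:~R * P.2 \is a Num.int).

Definition insq (P : P2) : bool := (0 <= P.1 <= 1) && (0 <= P.2 <= 1).

Definition uni2 q p (l : seq P2) := exists P Q S, perm_eq l [:: P; Q; S] /\
  forall L, lat q p L -> exists a b : int,
    L.1 = P.1 + a%:~R * (Q.1 - P.1) + b%:~R * (S.1 - P.1) /\
    L.2 = P.2 + a%:~R * (Q.2 - P.2) + b%:~R * (S.2 - P.2).

(* A triangulation of the unit square by lattice simplices; [sq_same], the uniqueness of weights,
   says both that the cells are simplices and that they meet along common faces. *)
Record square q p (K : seq P2 -> Prop) : Prop := Square {
  sq_uniq : forall l, K l -> uniq l;
  sq_lat : forall l P, K l -> P \in l -> lat q p P;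
  sq_in : forall l P, K l -> P \in l -> insq P;
  sq_cover : forall B, insq B -> exists l w, [/\ K l, rep2 l w B & {in l, forall P, 0 < w P}];
  sq_same : forall l1 l2 w1 w2 B, K l1 -> K l2 -> rep2 l1 w1 B -> rep2 l2 w2 B -> w1 =1 w2;
  sq_uni : forall l, K l -> size l = 3 -> uni2 q p l }.

Variables (q : nat) (p : int).
Hypothesis q0 : (0 < q)%N.
Hypothesis cop : exists u v : int, u * p + v * q%:Z = 1.

Let q0R : 0 < (q%:R : R). Proof. by rewrite ltr0n. Qed.

Lemma lat_sub P Q : lat q p P -> lat q p Q -> lat q p (P.1 - Q.1, P.2 - Q.2).
Proof.
move=> /andP[a b] /andP[c d]; rewrite /lat /= mulrBr rpredB //=.
have -> : P.1 - Q.1 - p%:~R * (P.2 - Q.2) = (P.1 - p%:~R * P.2) - (Q.1 - p%:~R * Q.2) by ring.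
exact: rpredB.
Qed.

Lemma lat_add P Q : lat q p P -> lat q p Q -> lat q p (P.1 + Q.1, P.2 + Q.2).
Proof.
move=> /andP[a b] /andP[c d]; rewrite /lat /= mulrDr rpredD //=.
have -> : P.1 + Q.1 - p%:~R * (P.2 + Q.2) = (P.1 - p%:~R * P.2) + (Q.1 - p%:~R * Q.2) by ring.
exact: rpredD.
Qed.

Lemma lat_mulz P (k : int) : lat q p P -> lat q p (k%:~R * P.1, k%:~R * P.2).
Proof.
move=> /andP[a b]; rewrite /lat /=.
have -> : q%:R * (k%:~R * P.2) = k%:~R * (q%:R * P.2) by ring.
have -> : k%:~R * P.1 - p%:~R * (k%:~R * P.2) = k%:~R * (P.1 - p%:~R * P.2) by ring.
by apply/andP; split; apply: rpredM => //; exact: intr_int.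
Qed.

Lemma lat_int x y : x \is a Num.int -> y \is a Num.int -> lat q p (x, y).
Proof. by move=> hx hy; rewrite /lat /= rpredM ?rpredB ?rpredM ?intr_int ?natr_int. Qed.

Lemma lat_qx P : lat q p P -> q%:R * P.1 \is a Num.int.
Proof.
move=> /andP[a b].
have -> : q%:R * P.1 = q%:R * (P.1 - p%:~R * P.2) + p%:~R * (q%:R * P.2) by ring.
by apply: rpredD; apply: rpredM => //; rewrite ?intr_int ?natr_int.
Qed.

(** [p] is invertible modulo [q], so each coordinate of a lattice point determines the other modulo
    1. In particular the sides of the square contain no lattice points but the corners. *)
Lemma lat_x P : lat q p P -> (P.1 \is a Num.int) = (P.2 \is a Num.int).
Proof.
move=> /andP[a b]; apply/idP/idP => h; last first.
  have -> : P.1 = (P.1 - p%:~R * P.2) + p%:~R * P.2 by ring.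
  by rewrite rpredD // rpredM ?intr_int.
case: cop => u [v e]; have e' : u%:~R * p%:~R + v%:~R * q%:R = 1 :> R.
  by have := congr1 (intmul (1 : R)) e; rewrite rmorphD !rmorphM.
have -> : P.2 = u%:~R * (P.1 - (P.1 - p%:~R * P.2)) + v%:~R * (q%:R * P.2).
  rewrite -[LHS]mul1r -[X in X * _]e'; ring.
by apply: rpredD; apply: rpredM => //; rewrite ?intr_int //; apply: rpredB.
Qed.

Definition onb (x : R) := (x == 0) || (x == 1).

Lemma onb_int x : 0 <= x <= 1 -> onb x = (x \is a Num.int).
Proof.
move=> hx; apply/idP/idP; first by case/orP => /eqP ->; rewrite ?rpred0 ?rpred1.
move=> xi; rewrite /onb; case: (ltP x 1) => h1.
  by rewrite (int_small xi) ?eqxx; lra.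
by have -> : x = 1 by [lra]; rewrite eqxx orbT.
Qed.

Lemma lat_onb P : lat q p P -> insq P -> onb P.1 = onb P.2.
Proof. by move=> lP /andP[h1 h2]; rewrite !onb_int // lat_x. Qed.

Lemma square_points : exists V : seq P2, uniq V /\ forall P, (P \in V) = lat q p P && insq P.
Proof.
pose l := [seq (i%:R / q%:R : R, j%:R / q%:R : R) | i <- iota 0 q.+1, j <- iota 0 q.+1].
exists (undup [seq P <- l | lat q p P && insq P]); split; first exact: undup_uniq.
move=> P; rewrite mem_undup mem_filter; case E1: (lat q p P && insq P) => //=; have [lP hsq] := andP E1; have [h1 h2] := andP hsq.
have ex (x : R) : q%:R * x \is a Num.int -> 0 <= x <= 1 -> exists2 i, i \in iota 0 q.+1 & x = i%:R / q%:R.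
  move=> xi hx; have : q%:R * x \is a Num.nat by rewrite natrEint xi mulr_ge0 //; lra.
  move=> /natrP [i e]; exists i; last by rewrite -e mulrC mulKf // gt_eqF.
  rewrite mem_iota /= add0n ltnS -(ler_nat R) -e; have [_ hx1] := andP hx. have := ler_wpM2l (ler0n R q) hx1. by rewrite mulr1.
have [i hi ei] := ex _ (lat_qx lP) h1.
have [lP1 _] := andP lP; have [j hj ej] := ex _ lP1 h2.
apply/allpairsP; exists (i, j); split=> //=; by rewrite -ei -ej -surjective_pairing.
Qed.

End Lattice.

Section Triangulate.
Variable R : realType.
Notation P2 := (R * R)%type.
Variables (q : nat) (p : int).
Hypothesis q0 : (0 < q)%N.
Hypothesis cop : exists u v : int, u * p + v * q%:Z = 1.
Variables (V : seq P2).
Hypothesis uV : uniq V.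
Hypothesis mV : forall P, (P \in V) = lat q p P && insq P.

Lemma corner_V (x y : R) : onb x -> onb y -> (x, y) \in V.
Proof.
have H (z : R) : onb z -> (z \is a Num.int) && (0 <= z <= 1).
  by case/orP => /eqP ->; rewrite ?rpred0 ?rpred1 ?lexx ler01.
move=> /H/andP[h1 h2] /H/andP[h3 h4]; by rewrite mV lat_int // /insq h2 h4.
Qed.

Lemma rep2_insq l w (B : P2) : {subset l <= V} -> rep2 l w B -> insq B.
Proof.
move=> lV r.
have pV P : w P != 0 -> insq P.
  case: r => _ ws _ _ h; have : P \in l by apply: contraNT h => /ws ->.
  by move/lV; rewrite mV => /andP[].
have h1 := rep2_le (l := fun P => P.1) (al := 0) (be := 1) (ga := 0) r.
have h2 := rep2_le (l := fun P => 1 - P.1) (al := 1) (be := -1) (ga := 0) r.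
have h3 := rep2_le (l := fun P => P.2) (al := 0) (be := 0) (ga := 1) r.
have h4 := rep2_le (l := fun P => 1 - P.2) (al := 1) (be := 0) (ga := -1) r.
rewrite /insq; apply/andP; split; apply/andP; split; rewrite -?(subr_ge0 _ 1).
- apply: h1 => [P|P /pV /andP[/andP[]]//]; ring.
- by apply: h2 => [P|P /pV /andP[/andP[h5 h6]]]; [ring|rewrite subr_ge0].
- apply: h3 => [P|P /pV /andP[_ /andP[]]//]; ring.
- by apply: h4 => [P|P /pV /andP[_ /andP[h5 h6]]]; [ring|rewrite subr_ge0].
Qed.

Lemma insq_rep (B : P2) : insq B -> exists w, rep2 V w B.
Proof.
move=> /andP[hx hy].
pose l : seq P2 := [:: (0, 0); (1, 0); (0, 1); (1, 1)].
have ul : uniq l.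
  have e01 : (0 == 1 :> R) = false by rewrite eq_sym oner_eq0.
  by rewrite /l /= !inE !xpair_eqE ?eqxx ?e01 ?oner_eq0 ?andbF.

have lV : {subset l <= V}.
  move=> P; rewrite !inE => /or4P[] /eqP ->; apply: corner_V; by rewrite /onb eqxx ?orbT.
(* Bilinear interpolation from the corners: for [P.1] equal to 0 or 1 the first factor is [1 - B.1]
   or [B.1]. *)
pose w (P : P2) := if P \in l then (1 - P.1 - B.1 + 2 * P.1 * B.1) * (1 - P.2 - B.2 + 2 * P.2 * B.2) else 0.
exists w; apply: (rep_widen ul uV lV); split.
- move=> P; rewrite /w; case: ifP => //; rewrite !inE => /or4P[] /eqP -> /=; apply: mulr_ge0; lra.
- by move=> P /negbTE h; rewrite /w h.
- rewrite /E !big_cons big_nil /w !inE !eqxx ?orbT /=; ring.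
- rewrite /= /E !big_cons !big_nil /w !inE !eqxx ?orbT /=; congr [:: _; _]; ring.
Qed.

Variables (hs : seq (P2 -> R)) (K : seq P2 -> Prop).
Hypothesis K1 : forall l, K l -> uniq l /\ {subset l <= V}.
Hypothesis K2 : forall b w, rep cs2 V w b ->
  exists l w', [/\ K l, rep cs2 l w' b & {in l, forall P, 0 < w' P}].
Hypothesis K3 : forall l1 l2 w1 w2 b, K l1 -> K l2 -> rep cs2 l1 w1 b -> rep cs2 l2 w2 b -> w1 =1 w2.
Hypothesis K4 : forall l w b w', K l -> rep cs2 l w b -> rep cs2 V w' b ->
  lexle (costs V hs w) (costs V hs w').

(** An optimal cell through a point of the segment CD competes with the weights [1 - th] and [th] on
    its ends. Edges are recognised by this comparison of costs. *)
Lemma K_seg l w (B C D : P2) th : K l -> rep2 l w B -> C \in V -> D \in V -> 0 <= th <= 1 ->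
  B.1 = C.1 + th * (D.1 - C.1) -> B.2 = C.2 + th * (D.2 - C.2) ->
  rep2 V w B /\ lexle (costs V hs w) [seq (1 - th) * h C + th * h D | h <- hs].
Proof.
move=> Kl r CV DV hth e1 e2; have [ul lV] := K1 Kl; split; first exact: (rep_widen ul uV lV r).
have r2 : rep2 V (fun P => (1 - th) * (P == C)%:R + th * (P == D)%:R) B.
  split=> [P|P PV||].
  - by rewrite addr_ge0 // mulr_ge0 ?ler0n //; lra.
  - have -> : P == C = false by apply: contraNF PV => /eqP ->.
    have -> : P == D = false by apply: contraNF PV => /eqP ->.
    by rewrite !mulr0 addr0.
  - by rewrite E_two //; ring.
  - by rewrite /= !E_two // e1 e2; congr [:: _; _]; ring.
have := K4 Kl r r2; rewrite {2}/costs.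
by congr lexle; apply: eq_map => h; rewrite E_two.
Qed.

(** This makes every lattice point of the square a vertex of the triangulation, from which
    unimodularity of the triangles follows. *)
Hypothesis vert : forall C w, C \in V -> rep2 V w C ->
  lexle (costs V hs w) [seq h C | h <- hs] -> forall P, w P != 0 -> P = C.

Lemma K_vert l w C : K l -> C \in V -> rep2 l w C -> forall P, w P != 0 -> P = C.
Proof.
move=> Kl CV r; have [|||r' le] := K_seg (th := 0) Kl r CV CV; try lra.
apply: (vert CV r'); move: le; congr lexle; apply: eq_map => h; ring.
Qed.

Lemma edge_vert C : C \in V -> edge K C C.
Proof.
move=> CV l w B th Kl r _; rewrite !subrr !mulr0 !addr0 => e1 e2 P wP; left.
apply: (K_vert Kl CV _ wP); by rewrite /rep2 -e1 -e2.
Qed.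

(** A triangle whose only lattice points are its vertices spans the lattice: taking floors moves a
    lattice point into the half-open parallelogram, and a point beyond the diagonal is reflected in
    the centre. *)
Lemma uni2_of l : K l -> size l = 3 -> uni2 q p l.
Proof.
move=> Kl; have [ul lV] := K1 Kl.
case: l Kl ul lV => [|P [|Q [|S [|]]]] // Kl ul lV _; exists P, Q, S; split=> //.
have un w1 w2 b : rep cs2 [:: P; Q; S] w1 b -> rep cs2 [:: P; Q; S] w2 b -> w1 =1 w2.
  exact: K3.
have /and3P[] : [&& P \in V, Q \in V & S \in V] by rewrite !lV ?inE ?eqxx ?orbT.
rewrite !mV => /andP[lP iP] /andP[lQ iQ] /andP[lS iS].
move: (ul); rewrite /= !inE negb_or andbT => /andP[/andP[PQ PS] QS].
pose W (x y z : R) (X : P2) := if X == P then x else if X == Q then y else if X == S then z else 0.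
have EW x y z f : E [:: P; Q; S] (W x y z) f = x * f P + y * f Q + z * f S.
  rewrite /E !big_cons big_nil /W !eqxx (eq_sym Q) (negbTE PQ) (eq_sym S) (negbTE PS).
  by rewrite (eq_sym S) (negbTE QS); ring.
have det : (Q.1 - P.1) * (S.2 - P.2) - (Q.2 - P.2) * (S.1 - P.1) != 0.
  apply/negP => /eqP det0.
  have H x y : x + y != 0 -> (x * (Q.1 - P.1) + y * (S.1 - P.1) = 0) ->
      (x * (Q.2 - P.2) + y * (S.2 - P.2) = 0) -> False.
    move=> nz e1 e2.
    have : W (- x - y) x y P = 0.
      apply: (cell_indep ul un); last exact: mem_head.
      - by rewrite EW; ring.
      - by move=> c [<-|[<-|//]]; rewrite EW; lra.
    rewrite /W eqxx => h; move/negP: nz; apply; apply/eqP; lra.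
  have G x y : (x != 0) || (y != 0) -> (x * (Q.1 - P.1) + y * (S.1 - P.1) = 0) ->
      (x * (Q.2 - P.2) + y * (S.2 - P.2) = 0) -> False.
    move=> nz e1 e2; have [e|] := eqVneq (x + y) 0; last by move/H; apply.
    have ey : y = - x by lra.
    have xn : x != 0 by move: nz; rewrite ey oppr_eq0 orbb.
    have c1 : x * (Q.1 - S.1) = 0 by rewrite ey in e1; lra.
    have c2 : x * (Q.2 - S.2) = 0 by rewrite ey in e2; lra.
    move/eqP: c1; rewrite mulf_eq0 (negbTE xn) subr_eq0 /= => /eqP c1.
    move/eqP: c2; rewrite mulf_eq0 (negbTE xn) subr_eq0 /= => /eqP c2.
    by move/negP: QS; apply; rewrite (surjective_pairing Q) (surjective_pairing S) c1 c2.
  have [a0|a0] := eqVneq (Q.1 - P.1) 0; last first.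
    by apply: (G (S.1 - P.1) (- (Q.1 - P.1))); [rewrite oppr_eq0 a0 orbT | ring | lra].
  have [b0|b0] := eqVneq (Q.2 - P.2) 0; last first.
    by apply: (G (S.2 - P.2) (- (Q.2 - P.2))); [rewrite oppr_eq0 b0 orbT | lra | ring].
  move/negP: PQ; apply; rewrite (surjective_pairing Q) (surjective_pairing P) xpair_eqE.
  by apply/andP; split; apply/eqP; lra.
move=> L lL; pose D := (Q.1 - P.1) * (S.2 - P.2) - (Q.2 - P.2) * (S.1 - P.1).
pose x := ((L.1 - P.1) * (S.2 - P.2) - (L.2 - P.2) * (S.1 - P.1)) / D.
pose y := ((Q.1 - P.1) * (L.2 - P.2) - (Q.2 - P.2) * (L.1 - P.1)) / D.
have ex : L.1 = P.1 + x * (Q.1 - P.1) + y * (S.1 - P.1) by rewrite /x /y /D; field.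
have ey : L.2 = P.2 + x * (Q.2 - P.2) + y * (S.2 - P.2) by rewrite /x /y /D; field.
exists (Num.floor x), (Num.floor y).
have /andP[hx1 hx2] := floor_itv x; have /andP[hy1 hy2] := floor_itv y.
rewrite !intrD !rmorph1 in hx2 hy2.
set m : R := (Num.floor x)%:~R in hx1 hx2 *; set n : R := (Num.floor y)%:~R in hy1 hy2 *.
suff [e1 e2] : x - m = 0 /\ y - n = 0.
  have -> : m = x by lra.
  by have -> : n = y by lra.
have lL' : lat q p (P.1 + (x - m) * (Q.1 - P.1) + (y - n) * (S.1 - P.1),
                    P.2 + (x - m) * (Q.2 - P.2) + (y - n) * (S.2 - P.2)).
  have := lat_sub lL (lat_add (lat_mulz (Num.floor x) (lat_sub lQ lP)) (lat_mulz (Num.floor y) (lat_sub lS lP))).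
  rewrite /= -/m -/n ex ey; congr (lat _ _ (_, _)); ring.
(* A lattice point of the triangle is represented by itself alone, so exactly one of the three
   weights is nonzero; as [x'] and [y'] are below 1, it is the weight of [P]. *)
have key x' y' : 0 <= x' < 1 -> 0 <= y' < 1 -> x' + y' <= 1 ->
    lat q p (P.1 + x' * (Q.1 - P.1) + y' * (S.1 - P.1), P.2 + x' * (Q.2 - P.2) + y' * (S.2 - P.2)) ->
    x' = 0 /\ y' = 0.
  move=> hx hy hxy lA; set A := (_, _) in lA.
  have rA : rep2 [:: P; Q; S] (W (1 - x' - y') x' y') A.
    split=> [X|X||].
    - rewrite /W; do !case: ifP => // _; lra.
    - by rewrite !inE !negb_or /W => /and3P[/negbTE -> /negbTE -> /negbTE ->].
    - by rewrite EW; ring.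
    - by rewrite /= !EW; congr [:: _; _]; rewrite /A /=; ring.
  have AV : A \in V by rewrite mV lA (rep2_insq lV rA).
  have h := K_vert Kl AV rA.
  have hP := h P; have hQ := h Q; have hS := h S.
  rewrite /W eqxx in hP; rewrite /W eqxx (eq_sym Q) (negbTE PQ) in hQ.
  rewrite /W eqxx (eq_sym S) (negbTE PS) (eq_sym S) (negbTE QS) in hS.
  have [x0|/hQ eQ] := eqVneq x' 0; have [y0|/hS eS] := eqVneq y' 0 => //.
  - have [|/hP eP] := eqVneq (1 - x' - y') 0; first lra.
    by rewrite eP eS eqxx in PS.
  - have [|/hP eP] := eqVneq (1 - x' - y') 0; first lra.
    by rewrite eP eQ eqxx in PQ.
  - by rewrite eS eQ eqxx in QS.
have [le1|gt1] := leP ((x - m) + (y - n)) 1; first by apply: key => //; lra.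
have [||||z1 z2] := key (1 - (x - m)) (1 - (y - n)); try lra.
have := lat_sub (lat_add lQ lS) lL'; congr (lat _ _ (_, _)); rewrite /=; ring.
Qed.

Lemma LP_square : square q p K.
Proof.
split.
- by move=> l /K1[].
- by move=> l P /K1[_ lV] /lV; rewrite mV => /andP[].
- by move=> l P /K1[_ lV] /lV; rewrite mV => /andP[].
- by move=> B /insq_rep[w /K2].
- by move=> l1 l2 w1 w2 B; apply: K3.
- exact: uni2_of.
Qed.

End Triangulate.

(** * Concatenation of edges into paths across the square *)

Section Conn.
Variable R : realType.
Notation P2 := (R * R)%type.
Variables (K : seq P2 -> Prop) (s t : P2 -> R) (good : P2 -> P2 -> Prop).

Lemma edge_sym C D : edge K C D -> edge K D C.
Proof.
move=> e l w B th Kl r hth e1 e2 p wp.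
by have [|||->|->] := e l w B (1 - th) Kl r _ _ _ p wp; [lra | rewrite e1; ring | rewrite e2; ring | right | left].
Qed.

Definition conn C D := exists f, [/\ pathI K s t good (s C) (s D) f, f (s C) = t C,
  f (s D) = t D & forall x, s C <= x <= s D -> 0 <= f x <= 1].

Lemma conn_refl C : edge K C C -> 0 <= t C <= 1 -> conn C C.
Proof. by move=> e h; exists (fun _ => t C); split=> //; apply: path_pt. Qed.

Lemma conn_edge C D : edge K C D -> good C D -> s C < s D -> 0 <= t C <= 1 -> 0 <= t D <= 1 ->
  conn C D.
Proof.
move=> e g lt hC hD; have [f [h1 h2 h3 h4]] := @path_seg _ K s t good _ _ e g lt; exists f; split=> // x hx.
rewrite h4; have d : 0 < s D - s C by lra.
pose k := (x - s C) / (s D - s C).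
have hk : 0 <= k <= 1 by rewrite divr_ge0 ?ler_pdivrMr //; lra.
rewrite -/k; nra.
Qed.

Lemma conn_trans C D F : conn C D -> conn D F -> conn C F.
Proof.
move=> [f [f1 f2 f3 f4]] [g [g1 g2 g3 g4]].
have h1 := pathI_le f1; have h2 := pathI_le g1.
exists (fun x => if x <= s D then f x else g x); split.
- by apply: path_glue => //; rewrite f3 g2.
- by rewrite h1 f2.
- case: (leP (s F) (s D)) => // h; have e : s F = s D by lra.
  by rewrite e f3 -g2 -e g3.
- move=> x hx; case: (leP x (s D)) => xD; [apply: f4 | apply: g4]; lra.
Qed.

Record paths (lo up : R -> R) : Prop := Paths {
  pth_lo : pathI K s t good 0 1 lo;
  pth_up : pathI K s t good 0 1 up;
  pth_ends : [/\ lo 0 = 0, lo 1 = 0, up 0 = 1 & up 1 = 1];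
  pth_bnd : forall x, 0 <= x <= 1 -> 0 <= lo x /\ lo x <= up x /\ up x <= 1 }.

Definition fork1 c C := [/\ edge K c C & good c C].

(** Both paths follow the same connection from [C] to [D]. They differ only at the ends, where one
    branches off to the lower corners and the other to the upper ones. *)
Lemma fork_paths C D c00 c01 c10 c11 : conn C D -> 0 < s C -> s D < 1 ->
  (s c00 = 0 /\ t c00 = 0) -> (s c01 = 0 /\ t c01 = 1) ->
  (s c10 = 1 /\ t c10 = 0) -> (s c11 = 1 /\ t c11 = 1) ->
  0 <= t C <= 1 -> 0 <= t D <= 1 ->
  fork1 c00 C -> fork1 c01 C -> fork1 D c10 -> fork1 D c11 ->
  exists lo up, paths lo up.
Proof.
move=> [f [f1 f2 f3 f4]] sC sD [s00 t00] [s01 t01] [s10 t10] [s11 t11] hC hD.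
move=> [e00 g00] [e01 g01] [e10 g10] [e11 g11].
have hCD := pathI_le f1.
have [|l0 [pl0 l0a l0b l0e]] := @path_seg _ K s t good _ _ e00 g00 _; first lra.
have [|u0 [pu0 u0a u0b u0e]] := @path_seg _ K s t good _ _ e01 g01 _; first lra.
have [|l1 [pl1 l1a l1b l1e]] := @path_seg _ K s t good _ _ e10 g10 _; first lra.
have [|u1 [pu1 u1a u1b u1e]] := @path_seg _ K s t good _ _ e11 g11 _; first lra.
rewrite s00 t00 in pl0 l0a l0e; rewrite s01 t01 in pu0 u0a u0e.
rewrite s10 t10 in pl1 l1b l1e; rewrite s11 t11 in pu1 u1b u1e.
pose lo x := if x <= s D then (if x <= s C then l0 x else f x) else l1 x.
pose up x := if x <= s D then (if x <= s C then u0 x else f x) else u1 x.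
exists lo, up; split.
- apply: path_glue => //; first by apply: path_glue => //; rewrite l0b f2.
  by rewrite l1a; case: leP => // h; have e : s D = s C by [lra]; rewrite e l0b -f2 -e f3.
- apply: path_glue => //; first by apply: path_glue => //; rewrite u0b f2.
  by rewrite u1a; case: leP => // h; have e : s D = s C by [lra]; rewrite e u0b -f2 -e f3.
- rewrite /lo /up; have -> : 0 <= s D by lra. have -> : 0 <= s C by lra.
  have -> : (1 <= s D) = false by apply/negbTE; rewrite -ltNge.
  by [].
- have frac (u v w : R) : u <= w <= v -> u < v -> 0 <= (w - u) / (v - u) <= 1.
    by move=> h1 h2; rewrite divr_ge0 ?ler_pdivrMr ?mul1r; lra.
  move=> x hx; rewrite /lo /up; case: (leP x (s D)) => xD; last first.
    have := frac (s D) 1 x; rewrite l1e u1e; set k := _ / _ => hk.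
    have {}hk : 0 <= k <= 1 by apply: hk; lra.
    nra.
  case: (leP x (s C)) => xC; last by have /andP[-> ->] : 0 <= f x <= 1 by [apply: f4; lra]; rewrite lexx.
  have := frac 0 (s C) x; rewrite l0e u0e; set k := _ / _ => hk.
  have {}hk : 0 <= k <= 1 by apply: hk; lra.
  nra.
Qed.

End Conn.

(** * Inner lattice points of the square and the edges at its corners *)

Section Forks.
Variable R : realType.
Notation P2 := (R * R)%type.
Variables (q : nat) (p : int).
Hypothesis q0 : (0 < q)%N.
Hypothesis cop : exists u v : int, u * p + v * q%:Z = 1.
Variables (V : seq P2).
Hypothesis uV : uniq V.
Hypothesis mV : forall P, (P \in V) = lat q p P && insq P.

Let q0R : 0 < (q%:R : R). Proof. by rewrite ltr0n. Qed.

(** [ax] selects a coordinate and [~~ ax] the other one, so that each statement is proved once for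
    both directions. *)
Definition co (ax : bool) (P : P2) := if ax then P.1 else P.2.
(** Distance to one of the opposite sides 0 and 1, so that the four corners are treated alike. *)
Definition flip (b : bool) (z : R) := if b then 1 - z else z.

Lemma V_onb P ax : P \in V -> onb (co ax P) = onb P.1.
Proof. by rewrite mV /co => /andP[l i]; case: ax => //; rewrite (lat_onb cop l i). Qed.

Lemma V_in P ax : P \in V -> 0 <= co ax P <= 1.
Proof. by rewrite mV /co => /andP[_ /andP[]]; case: ax. Qed.

Lemma V_inner P ax : P \in V -> ~~ onb P.1 -> q%:R^-1 <= co ax P <= 1 - q%:R^-1.
Proof.
move=> PV; rewrite -(V_onb ax PV) => nb; have h := V_in ax PV.
have /andP[lP _] : lat q p P && insq P by rewrite -mV.
have ci : q%:R * co ax P \is a Num.int by rewrite /co; case: ax {nb h}; [exact: (lat_qx lP) | by case/andP: lP].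
have [z0 z1] : 0 < co ax P /\ co ax P < 1.
  by move: nb; rewrite /onb negb_or => /andP[h1 h2]; rewrite lt_neqAle eq_sym h1 lt_neqAle h2; lra.
have qi : q%:R \is a Num.int := natr_int R q.
have h1 : 0 + 1 <= q%:R * co ax P by apply: int_gap => //; rewrite ?rpred0 // mulr_gt0.
have h2 : q%:R * co ax P + 1 <= q%:R.
  by apply: int_gap => //; rewrite -[ltRHS]mulr1 ltr_pM2l.
apply/andP; split; first by rewrite -[leLHS]mul1r ler_pdivrMr // mulrC; lra.
by rewrite lerBrDr -(ler_pM2l q0R) mulrDr mulfV ?gt_eqF // mulr1.
Qed.

(** Lattice points on a line parallel to an axis differ by integers, while two inner points differ
    by less than 1. *)
Lemma V_eq P Q ax : P \in V -> Q \in V -> ~~ onb P.1 -> co ax P = co ax Q -> P = Q.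
Proof.
move=> PV QV nb e.
have nbQ : ~~ onb Q.1 by rewrite -(V_onb ax QV) -e (V_onb ax PV).
have /andP[lP _] : lat q p P && insq P by rewrite -mV.
have /andP[lQ _] : lat q p Q && insq Q by rewrite -mV.
have lx := lat_x cop (lat_sub lP lQ); rewrite /= in lx.
have q1 : 0 < (q%:R : R)^-1 by rewrite invr_gt0.
have h1 := V_inner (~~ ax) PV nb; have h2 := V_inner (~~ ax) QV nbQ.
case: ax e lx h1 h2; rewrite /co /= => e lx h1 h2.
- have : P.2 - Q.2 = 0.
    apply: int_small; last lra.
    by rewrite -lx e subrr rpred0.
  by move=> e2; rewrite (surjective_pairing P) (surjective_pairing Q) e; congr (_, _); lra.
- have : P.1 - Q.1 = 0.
    apply: int_small; last lra.
    by rewrite lx e subrr rpred0.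
  by move=> e2; rewrite (surjective_pairing P) (surjective_pairing Q) e; congr (_, _); lra.
Qed.

(** The missing coordinate is [z] multiplied by [p], or by its inverse [u] modulo [q], and reduced
    modulo 1. *)
Lemma V_row ax (z : R) : q%:R * z \is a Num.int -> 0 < z < 1 ->
  exists P, [/\ P \in V, ~~ onb P.1 & co ax P = z].
Proof.
move=> zi hz; suff [P [lP iP eP]] : exists P, [/\ lat q p P, insq P & co ax P = z].
  have PV : P \in V by rewrite mV lP iP.
  exists P; split=> //; rewrite -(V_onb ax PV) eP /onb negb_or; apply/andP; split; apply/eqP; lra.
have fl (x : R) : 0 <= x - (Num.floor x)%:~R <= 1.
  have := floor_itv x; rewrite intrD rmorph1; lra.
case: ax; last first.
  exists (p%:~R * z - (Num.floor (p%:~R * z))%:~R, z); split=> //; last first.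
    by rewrite /insq /= fl; lra.
  rewrite /lat /= zi /=.
  have -> : p%:~R * z - (Num.floor (p%:~R * z))%:~R - p%:~R * z = - (Num.floor (p%:~R * z))%:~R by ring.
  by rewrite rpredN intr_int.
case: cop => u [v e]; have e' : u%:~R * p%:~R + v%:~R * q%:R = 1 :> R.
  by have := congr1 (intmul (1 : R)) e; rewrite rmorphD !rmorphM.
exists (z, u%:~R * z - (Num.floor (u%:~R * z))%:~R); split=> //; last first.
  by rewrite /insq /= fl andbT; lra.
rewrite /lat /=; set n := Num.floor _.
have -> : q%:R * (u%:~R * z - n%:~R) = u%:~R * (q%:R * z) - q%:R * n%:~R by ring.
have -> : z - p%:~R * (u%:~R * z - n%:~R) = v%:~R * (q%:R * z) + p%:~R * n%:~R.
  by rewrite -[X in X - _]mul1r -[X in X * z - _]e'; ring.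
apply/andP; split; [apply: rpredB | apply: rpredD]; apply: rpredM => //; rewrite ?intr_int ?natr_int //.
Qed.

(* The cost of putting mass on the corners comes first: the corners are then used only where forced. *)
Definition corner_cost (P : P2) : R := (onb P.1)%:R.

Variables (hs : seq (P2 -> R)) (K : seq P2 -> Prop).
Hypothesis K1 : forall l, K l -> uniq l /\ {subset l <= V}.
Hypothesis K4 : forall l w b w', K l -> rep cs2 l w b -> rep cs2 V w' b ->
  lexle (costs V (corner_cost :: hs) w) (costs V (corner_cost :: hs) w').

Lemma rep2_V w B P : rep2 V w B -> w P != 0 -> P \in V.
Proof. by move=> [_ h _ _]; apply: contraNT => /h ->. Qed.

(** [D] is the inner point next to a side through [C]. The affine function [g] is at most the corner
    cost at all lattice points, with equality only at the corners of that side and at [D]; the cost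
    of the segment makes the two means equal. *)
Lemma fork_edge ax sl sm C D : C \in V -> D \in V ->
  flip sl (co ax C) = 0 -> flip sm (co (~~ ax) C) = 0 ->
  ~~ onb D.1 -> flip sl (co ax D) = q%:R^-1 -> edge K C D.
Proof.
move=> CV DV lC mC nD lD l w B th Kl r hth eB1 eB2.
have [rV le] := K_seg uV K1 K4 Kl r CV DV hth eB1 eB2.
have cC : onb C.1 by rewrite -(V_onb ax CV) /onb; case: sl lC {lD} => /= h; apply/orP; [right|left]; apply/eqP; lra.
have [le0 _] := lexle_cons le; rewrite /corner_cost cC (negbTE nD) mulr0 addr0 mulr1 in le0.
have q1 : 0 < (q%:R : R)^-1 by rewrite invr_gt0.
have qq : q%:R * (q%:R : R)^-1 = 1 by rewrite mulfV // gt_eqF.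
pose g P := 1 - q%:R * flip sl (co ax P).
have hg : exists al be ga, forall P, g P = al + be * P.1 + ga * P.2.
  rewrite /g /flip /co; case: (ax) (sl) => [] [].
  - by exists (1 - q%:R), q%:R, 0 => P; ring.
  - by exists 1, (- q%:R), 0 => P; ring.
  - by exists (1 - q%:R), 0, q%:R => P; ring.
  - by exists 1, 0, (- q%:R) => P; ring.
case: hg => al [be [ga hg]].
have gB : g B = 1 - th.
  have -> : g B = g C + th * (g D - g C) by rewrite !hg eB1 eB2; ring.
  by rewrite /g lC lD qq; ring.
have key P : w P != 0 -> corner_cost P - g P = 0.
  have [w0 _ _ _] := rV.
  move=> wP; apply: (@E_ge0_eq0 _ _ V w (fun P => corner_cost P - g P) w0 _ _ P (rep2_V rV wP) wP).
    move=> X XV _; rewrite /corner_cost /g; have hX := V_in ax XV.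
    case: (boolP (onb X.1)) => nX.
      have : 0 <= flip sl (co ax X) by rewrite /flip; case: (sl); lra.
      by move=> h; rewrite opprB addrCA subrr addr0 mulr_ge0 // ltW.
    have hX' := V_inner ax XV nX.
    have : q%:R^-1 <= flip sl (co ax X) by rewrite /flip; case: (sl); lra.
    by rewrite -(ler_pM2l q0R) qq => h; rewrite sub0r opprB subr_ge0.
  have eg : E V w (fun X => - g X) = - g B.
    have -> : E V w (fun X => - g X) = E V w (fun X => (-1) * g X) by apply: eq_E => X _; rewrite mulN1r.
    by rewrite EZ mulN1r (eq_E w (g := fun P => al + be * P.1 + ga * P.2)) // (rep2_aff _ _ _ rV) -hg.
  by rewrite (ED V w corner_cost (fun X => - g X)) eg gB; lra.
have sup P : w P != 0 -> flip sl (co ax P) = 0 \/ P = D.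
  move=> wP; have := key P wP; rewrite /corner_cost /g; have PV := rep2_V rV wP.
  case: (boolP (onb P.1)) => nP.
    move=> /= h; left; have /eqP : q%:R * flip sl (co ax P) = 0 by lra.
    by rewrite mulf_eq0 gt_eqF //= => /eqP.
  move=> /= h; right; apply: (V_eq (ax := ax)) => //.
  have : q%:R * flip sl (co ax P) = q%:R * flip sl (co ax D) by rewrite lD qq; lra.
  have qn : (q%:R : R) != 0 by rewrite gt_eqF.
  by move/(mulfI qn); rewrite /flip; case: (sl); lra.
(* [m] is affine, vanishes at [C] and [D], and is positive at the other corner of the side, which it
   thus excludes. *)
pose m P := flip sm (co (~~ ax) P) - q%:R * flip sm (co (~~ ax) D) * flip sl (co ax P).
have hm : exists al be ga, forall P, m P = al + be * P.1 + ga * P.2.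
  rewrite /m; set z := q%:R * _; rewrite /flip /co; case: (ax) (sl) (sm) => [] [] [] /=.
  - by exists (1 - z), z, (-1) => P; ring.
  - by exists (- z), z, 1 => P; ring.
  - by exists 1, (- z), (-1) => P; ring.
  - by exists 0, (- z), 1 => P; ring.
  - by exists (1 - z), (-1), z => P; ring.
  - by exists (- z), 1, z => P; ring.
  - by exists 1, (-1), (- z) => P; ring.
  - by exists 0, 1, (- z) => P; ring.
case: hm => al' [be' [ga' hm]].
have mD : m D = 0 by rewrite /m lD mulrAC qq mul1r subrr.
have mC0 : m C = 0 by rewrite /m lC mC mulr0 subrr.
have mB : m B = 0.
  have -> : m B = m C + th * (m D - m C) by rewrite !hm eB1 eB2; ring.
  by rewrite mD mC0; ring.
move=> P wP; have [lP|->] := sup P wP; last by right.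
left; have mP : m P = 0.
  apply: (rep2_face rV hm _ _ wP); last by rewrite mB.
  move=> X wX; have [lX|->] := sup X wX; last by rewrite mD.
  rewrite /m lX mulr0 subr0; have := V_in (~~ ax) (rep2_V rV wX).
  rewrite /flip; case: (sm); lra.
have mP' : flip sm (co (~~ ax) P) = 0 by move: mP; rewrite /m lP mulr0 subr0.
have e1 : co ax P = co ax C by move: lP lC; rewrite /flip; case: (sl); lra.
have e2 : co (~~ ax) P = co (~~ ax) C by move: mP' mC; rewrite /flip; case: (sm); lra.
by rewrite (surjective_pairing P) (surjective_pairing C); move: e1 e2; rewrite /co; case: (ax) => /= -> ->.
Qed.

End Forks.

(** * The zigzag triangulation of the square *)

Section Finish.
Variable R : realType.
Notation P2 := (R * R)%type.
Variables (q : nat) (p : int).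
Hypothesis q0 : (0 < q)%N.
Hypothesis cop : exists u v : int, u * p + v * q%:Z = 1.
Variables (V : seq P2).
Hypothesis uV : uniq V.
Hypothesis mV : forall P, (P \in V) = lat q p P && insq P.

Definition mkp (ax : bool) (a b : R) : P2 := if ax then (a, b) else (b, a).

Lemma mkpE ax a b : co ax (mkp ax a b) = a /\ co (~~ ax) (mkp ax a b) = b.
Proof. by case: ax. Qed.

Lemma flip_aff sl ax : exists al be ga, forall P : P2, flip sl (co ax P) = al + be * P.1 + ga * P.2.
Proof.
rewrite /flip /co; case: sl ax => [] [].
- by exists 1, (-1), 0 => P; ring.
- by exists 1, 0, (-1) => P; ring.
- by exists 0, 1, 0 => P; ring.
- by exists 0, 0, 1 => P; ring.
Qed.

Lemma corner_vert C w : C \in V -> onb C.1 -> rep2 V w C -> forall P, w P != 0 -> P = C.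
Proof.
move=> CV c1 r P wP; have c2 : onb C.2 by rewrite (V_onb cop mV false CV).
have H ax : onb (co ax C) -> co ax P = co ax C.
  move=> h.
  suff : flip (co ax C == 1) (co ax P) = 0.
    by rewrite /flip; case: eqP h => [->|h1] /orP[/eqP->|/eqP] //; lra.
  have [al [be [ga hf]]] := flip_aff (co ax C == 1) ax.
  apply: (rep2_face r hf _ _ wP).
  - move=> X wX; have := V_in mV ax (rep2_V r wX); rewrite /flip; case: eqP; lra.
  - by rewrite /flip; case: eqP h => [->|h1] /orP[/eqP->|/eqP] //; lra.
have e1 := H true c1; have e2 := H false c2; rewrite /co in e1 e2.
by rewrite (surjective_pairing P) e1 e2 -surjective_pairing.
Qed.

Variables (hs : seq (P2 -> R)) (K : seq P2 -> Prop).
Hypothesis K1 : forall l, K l -> uniq l /\ {subset l <= V}.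
Hypothesis K4 : forall l w b w', K l -> rep cs2 l w b -> rep cs2 V w' b ->
  lexle (costs V (@corner_cost R :: hs) w) (costs V (@corner_cost R :: hs) w').

Lemma corner_mkp ax (a b : R) : onb a -> onb b -> mkp ax a b \in V.
Proof. by move=> ha hb; rewrite /mkp; case: ax; apply: (corner_V mV). Qed.

(** A lattice point on a side of the square is a corner, so a side cannot be subdivided. *)
Lemma side_edge ax b : onb b -> edge K (mkp ax 0 b) (mkp ax 1 b).
Proof.
move=> hb l w B th Kl r hth e1 e2 P wP; have [ul lV] := K1 Kl.
have rV : rep2 V w B := rep_widen ul uV lV r; have PV := rep2_V rV wP.
have eB : co (~~ ax) B = b by rewrite /co /mkp in e1 e2 *; case: ax e1 e2 => /= e1 e2; rewrite ?e1 ?e2; ring.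
have eP : co (~~ ax) P = b.
  suff : flip (b == 1) (co (~~ ax) P) = 0.
    by rewrite /flip; case: eqP hb => [->|h1] /orP[/eqP->|/eqP] //; lra.
  have [al [be [ga hf]]] := flip_aff (b == 1) (~~ ax).
  apply: (rep2_face r hf _ _ wP).
  - move=> X wX; have := V_in mV (~~ ax) (rep2_V rV wX); rewrite /flip; case: eqP; lra.
  - by rewrite /flip eB; case: eqP hb => [->|h1] /orP[/eqP->|/eqP] //; lra.
have : onb (co ax P) by rewrite (V_onb cop mV ax PV) -(V_onb cop mV (~~ ax) PV) eP.
case/orP => /eqP ea; [left|right]; rewrite (surjective_pairing P) /mkp;
  by case: ax ea eP {e1 e2 eB}; rewrite /co /= => -> ->.
Qed.

Variable good : P2 -> P2 -> Prop.

Lemma finish_paths ax C D : C \in V -> D \in V -> ~~ onb C.1 -> ~~ onb D.1 ->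
  co ax C = q%:R^-1 -> co ax D = 1 - q%:R^-1 ->
  conn K (co ax) (co (~~ ax)) good C D ->
  (forall b, onb b -> good (mkp ax 0 b) C /\ good D (mkp ax 1 b)) ->
  exists lo up, paths K (co ax) (co (~~ ax)) good lo up.
Proof.
move=> CV DV nC nD eC eD cCD hg.
have i1 : 0 < (q%:R : R)^-1 by rewrite invr_gt0 ltr0n.
have b0 : onb (0 : R) by rewrite /onb eqxx.
have b1 : onb (1 : R) by rewrite /onb eqxx orbT.
have [x0 y0] := mkpE ax 0 0; have [x1 y1] := mkpE ax 0 1.
have [x2 y2] := mkpE ax 1 0; have [x3 y3] := mkpE ax 1 1.
apply: (fork_paths (c00 := mkp ax 0 0) (c01 := mkp ax 0 1) (c10 := mkp ax 1 0) (c11 := mkp ax 1 1) cCD) => //.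
- by rewrite eC.
- by rewrite eD; lra.
- exact: (V_in mV).
- exact: (V_in mV).
- split; last by case: (hg 0 b0).
  apply: (fork_edge q0 cop uV mV K1 K4 (ax := ax) (sl := false) (sm := false)); rewrite ?corner_mkp //=.
- split; last by case: (hg 1 b1).
  apply: (fork_edge q0 cop uV mV K1 K4 (ax := ax) (sl := false) (sm := true)); rewrite ?corner_mkp //= y1 subrr //.
- split; last by case: (hg 0 b0).
  apply: edge_sym.
  apply: (fork_edge q0 cop uV mV K1 K4 (ax := ax) (sl := true) (sm := false)); rewrite ?corner_mkp //= ?x2 ?eD; try ring; done.
- split; last by case: (hg 1 b1).
  apply: edge_sym.
  apply: (fork_edge q0 cop uV mV K1 K4 (ax := ax) (sl := true) (sm := true)); rewrite ?corner_mkp //= ?x3 ?y3 ?eD; try ring; done.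
Qed.

(** Applied for [q = 1], when there are no inner lattice points: two opposite sides serve as the
    paths. *)
Lemma side_paths ax : (forall b, onb b -> good (mkp ax 0 b) (mkp ax 1 b)) ->
  exists lo up, paths K (co ax) (co (~~ ax)) good lo up.
Proof.
move=> hg.
have b0 : onb (0 : R) by rewrite /onb eqxx.
have b1 : onb (1 : R) by rewrite /onb eqxx orbT.
have [x0 y0] := mkpE ax 0 0; have [x1 y1] := mkpE ax 0 1.
have [x2 y2] := mkpE ax 1 0; have [x3 y3] := mkpE ax 1 1.
have [|lo [l1 l2 l3 l4]] := @path_seg _ K (co ax) (co (~~ ax)) good _ _ (side_edge (ax := ax) b0) (hg 0 b0) _.
  by rewrite x0 x2 ltr01.
have [|up [u1 u2 u3 u4]] := @path_seg _ K (co ax) (co (~~ ax)) good _ _ (side_edge (ax := ax) b1) (hg 1 b1) _.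
  by rewrite x1 x3 ltr01.
rewrite x0 x2 y0 y2 in l1 l2 l3 l4; rewrite x1 x3 y1 y3 in u1 u2 u3 u4.
exists lo, up; split=> // x hx; rewrite l4 u4; lra.
Qed.

End Finish.

Section Zigzag.
Variable R : realType.
Notation P2 := (R * R)%type.
Variables (q : nat) (p : int).
Hypothesis q0 : (0 < q)%N.
Hypothesis cop : exists u v : int, u * p + v * q%:Z = 1.

(** The shortest positive advance of a lattice vector along an axis; such edges are good with
    [m = 1]. *)
Definition step (ax : bool) (C D : P2) := co ax D - co ax C = q%:R^-1.

(** The cost after the corner cost is [x ^ 2]. Inner points have distinct abscissas, all multiples
    of 1/q, so strict convexity makes consecutive ones adjacent. For [p = 1] the inner points lie on
    the diagonal, and the same edges are steps in the other direction as well. *)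
Theorem zigzag_square : exists K lo up,
  [/\ square q p K, paths K fst snd (step true) lo up &
      p = 1 -> exists L U, paths K snd fst (step false) L U].
Proof.
have [V [uV mV]] := @square_points R q p q0.
have q0R : 0 < (q%:R : R) by rewrite ltr0n.
have q1 : 0 < (q%:R : R)^-1 by rewrite invr_gt0.
have qq : q%:R * (q%:R : R)^-1 = 1 by rewrite mulfV // gt_eqF.
pose hs : seq (P2 -> R) := [:: fun P => P.1 ^+ 2].
have [K [K1 K2 K3 K4]] := lp cs2 uV (@corner_cost R :: hs).
have vert C w : C \in V -> rep2 V w C ->
    lexle (costs V (@corner_cost R :: hs) w) [seq h C | h <- @corner_cost R :: hs] ->
    forall P, w P != 0 -> P = C.
  move=> CV r; have [nC|nC] := boolP (onb C.1); first by move=> _; exact: (corner_vert cop mV CV nC r).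
  have [w0 _ w1 [e1 e2]] := r.
  have cC : corner_cost C = 0 :> R by rewrite /corner_cost (negbTE nC).
  have ge0 : 0 <= E V w (@corner_cost R) by apply: E_ge0 => // X _ _; exact: ler0n.
  move=> /lexle_cons[]; rewrite cC => le0 le1 P wP.
  have PV := rep2_V r wP.
  have nP : ~~ onb P.1.
    have := @E_ge0_eq0 _ _ V w (@corner_cost R) w0 _ le0 P PV wP; rewrite /corner_cost.
    by case: (onb P.1) => // h; have /eqP := h (fun X _ _ => ler0n _ _); rewrite oner_eq0.
  have /lexle_cons[le2 _] := le1 ge0.
  apply: (V_eq q0 cop mV (ax := true)) => //; rewrite /co; apply/eqP; rewrite -subr_eq0 -sqrf_eq0; apply/eqP.
  apply: (@E_ge0_eq0 _ _ V w (fun X => (X.1 - C.1) ^+ 2) w0 _ _ P PV wP) => [X _ _|]; first exact: sqr_ge0.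
  have -> : E V w (fun X : P2 => (X.1 - C.1) ^+ 2) =
      E V w (fun X : P2 => X.1 ^+ 2) + E V w (fun X => C.1 ^+ 2 + (- 2 * C.1) * X.1 + 0 * X.2).
    by rewrite -ED; apply: eq_E => X _; ring.
  by rewrite (rep2_aff _ _ _ r); move: le2; lra.
have Ksq := LP_square uV mV K1 K2 K3 K4 vert.
have [q2|q2] := leqP q 1.
  have eq1 : q = 1%N by lia.
  have st ax b : onb b -> step ax (mkp ax 0 b) (mkp ax 1 b).
    by rewrite /step !(mkpE ax _ b).1 eq1 invr1 subr0.
  have [lo [up hp]] := side_paths cop uV mV K1 (st true).
  have [L [U hp']] := side_paths cop uV mV K1 (st false).
  by exists K, lo, up; split=> // _; exists L, U.
have row ax i : (0 < i < q)%N -> exists P : P2, [/\ P \in V, ~~ onb P.1 & co ax P = i%:R / q%:R].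
  move=> hi; apply: (V_row cop mV ax); first by rewrite mulrC divfK ?gt_eqF // natr_int.
  by rewrite divr_gt0 ?ltr_pdivrMr // ?mul1r ?ltr_nat ?ltr0n; lia.
have ed C D : C \in V -> D \in V -> ~~ onb C.1 -> ~~ onb D.1 -> step true C D -> edge K C D.
  move=> CV DV nC nD st l w B th Kl r hth e1 e2 P wP.
  have [rV /lexle_cons[le0 le1]] := K_seg uV K1 K4 Kl r CV DV hth e1 e2.
  have cC : corner_cost C = 0 :> R by rewrite /corner_cost (negbTE nC).
  have cD : corner_cost D = 0 :> R by rewrite /corner_cost (negbTE nD).
  rewrite cC cD !mulr0 addr0 in le0 le1.
  have [w0 _ _ _] := rV.
  have ge0 : 0 <= E V w (@corner_cost R) by apply: E_ge0 => // X _ _; exact: ler0n.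
  have /lexle_cons[le2 _] := le1 ge0.
  have PV := rep2_V rV wP.
  have nc X : w X != 0 -> ~~ onb X.1.
    move=> wX; have := @E_ge0_eq0 _ _ V w (@corner_cost R) w0 _ le0 X (rep2_V rV wX) wX; rewrite /corner_cost.
    by case: (onb X.1) => // h; have /eqP := h (fun X _ _ => ler0n _ _); rewrite oner_eq0.
  rewrite /step /co in st.
  have qi X : X \in V -> q%:R * X.1 \is a Num.int by rewrite mV => /andP[lX _]; exact: lat_qx lX.
  (* No lattice abscissa lies strictly between those of [C] and [D], so the product is nonnegative
     on the support; the bound on the cost makes its mean at most 0. *)
  have : (P.1 - C.1) * (P.1 - D.1) = 0.
    apply: (@E_ge0_eq0 _ _ V w (fun X => (X.1 - C.1) * (X.1 - D.1)) w0 _ _ P PV wP) => [X XV wX|].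
      have [h|h] := leP X.1 C.1; first by nra.
      have : q%:R * C.1 + 1 <= q%:R * X.1 by apply: int_gap; rewrite ?qi // ltr_pM2l.
      have : q%:R * D.1 = q%:R * C.1 + 1 by rewrite -{1}[D.1](subrK C.1) st mulrDr qq addrC.
      move=> e h1; have hD : D.1 <= X.1 by rewrite -(ler_pM2l q0R) e.
      by apply: mulr_ge0; lra.
    have -> : E V w (fun X : P2 => (X.1 - C.1) * (X.1 - D.1)) =
      E V w (fun X : P2 => X.1 ^+ 2) + E V w (fun X => C.1 * D.1 + (- C.1 - D.1) * X.1 + 0 * X.2).
      by rewrite -ED; apply: eq_E => X _; ring.
    rewrite (rep2_aff _ _ _ rV) e1; move: le2; lra.
  move/eqP; rewrite mulf_eq0 !subr_eq0 => /orP[/eqP e|/eqP e]; [left|right];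
    by apply: (V_eq q0 cop mV (ax := true)) => //; apply: nc.
have ev C : C \in V -> edge K C C by apply: (edge_vert uV K1 K4 vert).
have iq (i : nat) : i.+1%:R / q%:R - i%:R / q%:R = (q%:R : R)^-1.
  by rewrite -mulrBl -addn1 natrD addrAC subrr add0r mul1r.
have q1m : ((q.-1)%:R : R) / q%:R = 1 - q%:R^-1.
  have -> : ((q.-1)%:R : R) = q%:R - 1 by rewrite -{2}(prednK q0) -addn1 natrD addrK.
  by rewrite mulrBl mulfV ?gt_eqF // mul1r.
have build ax : (forall C D, C \in V -> D \in V -> ~~ onb C.1 -> ~~ onb D.1 -> step ax C D -> step true C D) ->
    exists lo up, paths K (co ax) (co (~~ ax)) (step ax) lo up.
  move=> ht; have [C [CV nC eC]] := row ax 1%N (ltac:(lia) : (0 < 1 < q)%N).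
  have cn n : (0 < n < q)%N -> forall D, D \in V -> ~~ onb D.1 -> co ax D = n%:R / q%:R ->
      conn K (co ax) (co (~~ ax)) (step ax) C D.
    elim: n => // n IH hn D DV nD eD.
    have [n0|n0] := posnP n.
      have -> : D = C by apply: (V_eq q0 cop mV (ax := ax)) => //; rewrite eD eC n0.
      by apply: conn_refl; [apply: ev | apply: (V_in mV)].
    have hn' : (0 < n < q)%N by lia.
    have [F [FV nF eF]] := row ax n hn'.
    have st : step ax F D by rewrite /step eD eF iq.
    apply: conn_trans (IH hn' F FV nF eF) _; apply: conn_edge => //; try exact: (V_in mV).
    - by apply: ed => //; apply: ht.
    - by rewrite -subr_gt0 st.
  have [D [DV nD eD]] := row ax q.-1 (ltac:(lia) : (0 < q.-1 < q)%N).
  apply: (finish_paths q0 cop uV mV K1 K4 CV DV nC nD) => //.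
  - by rewrite eC mul1r.
  - by rewrite eD.
  - by apply: cn eD => //; lia.
  - move=> b hb; rewrite /step !(mkpE ax _ b).1 eC eD mul1r; split; last rewrite q1m; ring.
have [lo [up h1]] := build true (fun _ _ _ _ _ _ h => h).
exists K, lo, up; split=> // p1.
apply: (build false) => C D CV DV nC nD.
have diag X : X \in V -> ~~ onb X.1 -> X.1 = X.2.
  move=> XV nX; have k1 := V_inner q0 cop mV true XV nX; have k2 := V_inner q0 cop mV false XV nX.
  move: XV; rewrite mV p1 => /andP[/andP[_ h] _]; rewrite mul1r in h.
  have : X.1 - X.2 = 0.
    apply: (int_small h); clear - k1 k2 q1; rewrite /co in k1 k2.
    by case/andP: k1 => *; case/andP: k2 => *; apply/andP; split; lra.
  by move/eqP; rewrite subr_eq0 => /eqP.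
rewrite /step /co /= => st.
have eC := diag C CV nC; have eD := diag D DV nD.
by rewrite eC eD.
Qed.

End Zigzag.

(** * The pinwheel triangulation of the square *)

Section LPEdges.
Variable R : realType.
Notation P2 := (R * R)%type.
Variables (q : nat) (p : int).
Hypothesis q0 : (0 < q)%N.
Hypothesis cop : exists u v : int, u * p + v * q%:Z = 1.
Variables (V : seq P2).
Hypothesis uV : uniq V.
Hypothesis mV : forall P, (P \in V) = lat q p P && insq P.

Definition affine (F : P2 -> R) := exists al be ga, forall P, F P = al + be * P.1 + ga * P.2.

Lemma E_affine w (B : P2) (F : P2 -> R) : affine F -> rep2 V w B -> E V w F = F B.
Proof.
move=> [al [be [ga h]]] r; rewrite h -(rep2_aff _ _ _ r); exact: eq_E.
Qed.

Lemma affine_mix (F : P2 -> R) (B C D : P2) th : affine F -> B.1 = C.1 + th * (D.1 - C.1) ->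
  B.2 = C.2 + th * (D.2 - C.2) -> F B = F C + th * (F D - F C).
Proof. by move=> [al [be [ga h]]] e1 e2; rewrite !h e1 e2; ring. Qed.

Lemma E_sub w (F G : P2 -> R) : E V w (fun P => F P - G P) = E V w F - E V w G.
Proof. by rewrite /E -sumrB; apply: eq_bigr => P _; rewrite mulrBr. Qed.

(* Convexity of the square, in the form E F^2 - 2 c E F + c^2 >= 0. *)
Lemma E_sqr w (B : P2) (F : P2 -> R) c : affine F -> rep2 V w B -> F B = c ->
  E V w (fun P => (F P - c) ^+ 2) = E V w (fun P => F P ^+ 2) - c ^+ 2.
Proof.
move=> aF r e; have [_ _ w1 _] := r.
have -> : E V w (fun P => (F P - c) ^+ 2) =
    E V w (fun P => F P ^+ 2) + E V w (fun P => (- 2 * c) * F P + c ^+ 2 * 1).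
  by rewrite -ED; apply: eq_E => P _; ring.
rewrite (ED V w (fun P => - 2 * c * F P) (fun _ => c ^+ 2 * 1)) !EZ w1 (E_affine aF r) e; ring.
Qed.

Variables (h1 h2 : P2 -> R).
Let h3 (P : P2) : R := P.1 ^+ 2 + P.2 ^+ 2.
Let hs := [:: @corner_cost R; h1; h2; h3].

(* The chart used on a quadrant: there h1 is linear and h2 dominates F^2. *)
Record quad (F G : P2 -> R) : Prop := Quad {
  quF : affine F; quG : affine G;
  qu1 : forall P, h1 P = `|F P| + `|G P|;
  qu2 : forall P, 0 <= F P -> 0 <= G P -> h2 P = if F P == 0 then G P ^+ 2 else F P ^+ 2;
  quZ : forall P, P \in V -> F P \is a Num.int }.

Lemma quad_h2 F G (P : P2) : quad F G -> 0 <= F P -> 0 <= G P -> F P ^+ 2 <= h2 P.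
Proof. by move=> qu f0 g0; rewrite (qu2 qu) //; case: eqP => [->|] //; rewrite expr0n sqr_ge0. Qed.

(** Peels off the corner cost: inner end points have none, so the support consists of inner points
    and the comparison passes to the remaining costs. *)
Lemma lev0 w C D th : 0 <= th <= 1 -> rep2 V w (C : P2) \/ True ->
  ~~ onb C.1 -> ~~ onb D.1 -> (forall P, 0 <= w P) ->
  lexle (costs V hs w) [seq (1 - th) * h C + th * h D | h <- hs] ->
  (forall P, P \in V -> w P != 0 -> ~~ onb P.1) /\
  lexle (costs V [:: h1; h2; h3] w) [seq (1 - th) * h C + th * h D | h <- [:: h1; h2; h3]].
Proof.
move=> hth _ nC nD w0 /lexle_cons[].
have cC : corner_cost C = 0 :> R by rewrite /corner_cost (negbTE nC).
have cD : corner_cost D = 0 :> R by rewrite /corner_cost (negbTE nD).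
rewrite cC cD !mulr0 addr0 => le0 le1.
have ge0 : 0 <= E V w (@corner_cost R) by apply: E_ge0 => // X _ _; exact: ler0n.
split; last exact: le1 ge0.
move=> P PV wP; have := @E_ge0_eq0 _ _ V w (@corner_cost R) w0 _ le0 P PV wP; rewrite /corner_cost.
by case: (onb P.1) => // h; have /eqP := h (fun X _ _ => ler0n _ _); rewrite oner_eq0.
Qed.

(** Peels off [h1]: it equals [F + G] on the closed quadrant and exceeds it elsewhere, so the
    support stays in the quadrant of the segment. *)
Lemma lev1 w (B C D : P2) th F G : quad F G -> 0 <= th <= 1 -> rep2 V w B ->
  B.1 = C.1 + th * (D.1 - C.1) -> B.2 = C.2 + th * (D.2 - C.2) ->
  0 <= F C -> 0 <= G C -> 0 <= F D -> 0 <= G D ->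
  lexle (costs V [:: h1; h2; h3] w) [seq (1 - th) * h C + th * h D | h <- [:: h1; h2; h3]] ->
  (forall P, P \in V -> w P != 0 -> 0 <= F P /\ 0 <= G P /\ (F B = 0 -> F P = 0)) /\
  lexle (costs V [:: h2; h3] w) [seq (1 - th) * h C + th * h D | h <- [:: h2; h3]].
Proof.
move=> qu hth r e1 e2 FC GC FD GD /lexle_cons[]; have [w0 _ _ _] := r.
have FB := affine_mix (quF qu) e1 e2; have GB := affine_mix (quG qu) e1 e2.
rewrite !(qu1 qu) !ger0_norm // => le0 le1.
have eFG : E V w (fun P => F P + G P) = F B + G B.
  by rewrite ED (E_affine (quF qu) r) (E_affine (quG qu) r).
have ge : F B + G B <= E V w h1.
  rewrite -eFG; apply: E_le => // P _ _; rewrite (qu1 qu); have := ler_norm (F P); have := ler_norm (G P); lra.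
split; last by apply: le1; rewrite FB GB in ge; lra.
have key P : P \in V -> w P != 0 -> h1 P - (F P + G P) = 0.
  move=> PV wP; apply: (@E_ge0_eq0 _ _ V w (fun P => h1 P - (F P + G P)) w0 _ _ P PV wP) => [X _ _|].
    rewrite (qu1 qu); have := ler_norm (F X); have := ler_norm (G X); lra.
  by rewrite E_sub eFG FB GB; lra.
have pos P : P \in V -> w P != 0 -> 0 <= F P /\ 0 <= G P.
  move=> PV wP; have := key P PV wP; rewrite (qu1 qu) => h.
  have := ler_norm (F P); have := ler_norm (G P); have := normr_ge0 (F P); have := normr_ge0 (G P); lra.
move=> P PV wP; have [f0 g0] := pos P PV wP; split=> //; split=> // FB0.
apply: (@E_ge0_eq0 _ _ V w F w0 _ _ P PV wP) => [X XV wX|]; first by case: (pos X XV wX).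
by rewrite (E_affine (quF qu) r) FB0.
Qed.

Variable K : seq P2 -> Prop.
Hypothesis K1 : forall l, K l -> uniq l /\ {subset l <= V}.
Hypothesis K4 : forall l w b w', K l -> rep cs2 l w b -> rep cs2 V w' b ->
  lexle (costs V hs w) (costs V hs w').

(** Once the first costs confine the support, convexity shows that [h2] is no lower in the mean than
    at [C]. The decision falls to the strictly convex [h3]. *)
Lemma quad_vert : (forall C, C \in V -> exists F G, [/\ quad F G, 0 <= F C & 0 <= G C]) ->
  forall C w, C \in V -> rep2 V w C ->
  lexle (costs V hs w) [seq h C | h <- hs] -> forall P, w P != 0 -> P = C.
Proof.
move=> hq C w CV r; have [nC|nC] := boolP (onb C.1); first by move=> _; exact: (corner_vert cop mV CV nC r).
have [F [G [qu FC GC]]] := hq C CV.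
have -> : [seq h C | h <- hs] = [seq (1 - 0) * h C + 0 * h C | h <- hs].
  by apply: eq_map => h; ring.
have h01 : 0 <= (0 : R) <= 1 by lra.
have [w0 _ _ _] := r.
have c1 : C.1 = C.1 + 0 * (C.1 - C.1) by ring.
have c2 : C.2 = C.2 + 0 * (C.2 - C.2) by ring.
move=> /(lev0 h01 (or_intror I) nC nC w0)[nc /(lev1 qu h01 r c1 c2 FC GC FC GC)[sup]].
move=> /lexle_cons[le2 le3] P wP; have PV := rep2_V r wP.
have h3C : E V w h3 <= h3 C -> P = C.
  move=> le.
  have a1 : affine (fun P : P2 => P.1) by exists 0, 1, 0 => X; ring.
  have a2 : affine (fun P : P2 => P.2) by exists 0, 0, 1 => X; ring.
  have : (P.1 - C.1) ^+ 2 + (P.2 - C.2) ^+ 2 = 0.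
    apply: (@E_ge0_eq0 _ _ V w (fun P => (P.1 - C.1) ^+ 2 + (P.2 - C.2) ^+ 2) w0 _ _ P PV wP).
      by move=> X _ _; rewrite addr_ge0 // sqr_ge0.
    rewrite ED (E_sqr (F := fun P => P.1) a1 r erefl) (E_sqr (F := fun P => P.2) a2 r erefl).
    by move: le; rewrite /h3 ED; lra.
  move/eqP; rewrite paddr_eq0 ?sqr_ge0 // !sqrf_eq0 !subr_eq0 => /andP[/eqP e1 /eqP e2].
  by rewrite (surjective_pairing P) e1 e2 -surjective_pairing.
apply: h3C; suff h : h2 C <= E V w h2.
  have /lexle_cons[le _] : lexle (costs V [:: h3] w) [seq (1 - 0) * h C + 0 * h C | h <- [:: h3]].
    by apply: le3; move: h; lra.
  by move: le; lra.
have [FC0|FC0] := eqVneq (F C) 0.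
- have e : E V w h2 = E V w (fun P => G P ^+ 2).
    rewrite /E; apply: eq_big_seq => X XV; have [->|wX] := eqVneq (w X) 0; first by rewrite !mul0r.
    have [f0 [g0 f1]] := sup X XV wX; by rewrite (qu2 qu) // f1 // eqxx.
  rewrite e (qu2 qu) // FC0 eqxx -subr_ge0 -(E_sqr (quG qu) r erefl).
  by apply: E_ge0 => // X _ _; exact: sqr_ge0.
- rewrite (qu2 qu) // (negbTE FC0).
  apply: (@le_trans _ _ (E V w (fun P => F P ^+ 2))).
    by rewrite -subr_ge0 -(E_sqr (quF qu) r erefl); apply: E_ge0 => // X _ _; exact: sqr_ge0.
  apply: E_le => // X XV wX; have [f0 [g0 f1]] := sup X XV wX; exact: (quad_h2 qu).
Qed.

(** [C] and [D] are lowest for [G] on two consecutive levels of [F]. Minimising [h2], which is at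
    least [F ^ 2], confines the support to these levels; then [L], the excess of [G] over the line
    CD, is nonnegative on it with mean 0. *)
Lemma strip_edge F G C D : quad F G -> C \in V -> D \in V -> ~~ onb C.1 -> ~~ onb D.1 ->
  F D = F C + 1 -> 0 <= F C -> 0 <= G C -> 0 <= G D -> (F C = 0 -> G C = 0) ->
  (forall X, X \in V -> ~~ onb X.1 -> 0 <= G X -> F X = F C -> G C <= G X) ->
  (forall X, X \in V -> ~~ onb X.1 -> 0 <= G X -> F X = F D -> G D <= G X) ->
  (forall X, X \in V -> F X = F C -> G X = G C -> X = C) ->
  (forall X, X \in V -> F X = F D -> G X = G D -> X = D) -> edge K C D.
Proof.
move=> qu CV DV nC nD FD FC GC GD FC0 minC minD injC injD l w B th Kl r hth e1 e2 P wP.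
have [rV le] := K_seg uV K1 K4 Kl r CV DV hth e1 e2.
have [w0 _ _ _] := rV; have PV := rep2_V rV wP.
have FDp : 0 <= F D by lra.
have [nc /(lev1 qu hth rV e1 e2 FC GC FDp GD)[sup]] := lev0 hth (or_intror I) nC nD w0 le.
move=> /lexle_cons[]; have FDn : F D == 0 = false by apply/negbTE; rewrite gt_eqF //; lra.
have hC : h2 C = F C ^+ 2.
  by rewrite (qu2 qu) //; case: eqP => // e; rewrite e FC0.
rewrite hC (qu2 qu FDp GD) FDn => le2 _.
have FB := affine_mix (quF qu) e1 e2; have GB := affine_mix (quG qu) e1 e2.
have [_ _ w1 _] := rV.
have gap X : X \in V -> 0 <= (F X - F C) * (F X - F D).
  move=> XV; have hX := quZ qu XV; have hCi := quZ qu CV; rewrite FD.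
  have [h|h] := leP (F X) (F C); first by nra.
  by have := int_gap hCi hX h; nra.
have : h2 P - F P ^+ 2 + (F P - F C) * (F P - F D) = 0.
  apply: (@E_ge0_eq0 _ _ V w (fun P => h2 P - F P ^+ 2 + (F P - F C) * (F P - F D)) w0 _ _ P PV wP) => [X XV wX|].
    have [f0 [g0 _]] := sup X XV wX; have := quad_h2 qu f0 g0; have := gap X XV; lra.
  have -> : E V w (fun P => h2 P - F P ^+ 2 + (F P - F C) * (F P - F D)) =
      E V w h2 + E V w (fun P => (- F C - F D) * F P + (F C * F D) * 1).
    by rewrite -ED; apply: eq_E => X _; ring.
  rewrite (ED V w (fun P => (- F C - F D) * F P) (fun _ => F C * F D * 1)) !EZ w1 (E_affine (quF qu) rV) FB FD.
  move: le2; rewrite FD; lra.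
have [fP [gP _]] := sup P PV wP.
have lev X : X \in V -> w X != 0 -> F X = F C \/ F X = F D.
  move=> XV wX; have [f0 [g0 _]] := sup X XV wX.
  have : h2 X - F X ^+ 2 + (F X - F C) * (F X - F D) = 0.
    apply: (@E_ge0_eq0 _ _ V w (fun P => h2 P - F P ^+ 2 + (F P - F C) * (F P - F D)) w0 _ _ X XV wX) => [Y YV wY|].
      have [f0' [g0' _]] := sup Y YV wY; have := quad_h2 qu f0' g0'; have := gap Y YV; lra.
    have -> : E V w (fun P => h2 P - F P ^+ 2 + (F P - F C) * (F P - F D)) =
        E V w h2 + E V w (fun P => (- F C - F D) * F P + (F C * F D) * 1).
      by rewrite -ED; apply: eq_E => Z _; ring.
    rewrite (ED V w (fun P => (- F C - F D) * F P) (fun _ => F C * F D * 1)) !EZ w1 (E_affine (quF qu) rV) FB FD.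
    move: le2; rewrite FD; lra.
  move=> h; have := quad_h2 qu f0 g0; have := gap X XV => h' h''.
  have /eqP : (F X - F C) * (F X - F D) = 0 by lra.
  by rewrite mulf_eq0 !subr_eq0 => /orP[/eqP|/eqP]; auto.
move=> _.
pose L P := G P - (G C + (F P - F C) * (G D - G C)).
have aL : affine L.
  case: (quF qu) (quG qu) => [a [b [c hF]]] [a' [b' [c' hG]]].
  exists (a' - (G C + (a - F C) * (G D - G C))), (b' - b * (G D - G C)), (c' - c * (G D - G C)) => X.
  by rewrite /L hF hG; ring.
have LC : L C = 0 by rewrite /L; ring.
have LD : L D = 0 by rewrite /L FD; ring.
have LB : L B = 0 by rewrite (affine_mix aL e1 e2) LC LD; ring.
have : L P = 0.
  apply: (@E_ge0_eq0 _ _ V w L w0 _ _ P PV wP) => [X XV wX|]; last by rewrite (E_affine aL rV) LB.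
  have [_ [gX _]] := sup X XV wX; rewrite /L; case: (lev X XV wX) => e.
    by have := minC X XV (nc X XV wX) gX e; rewrite e; lra.
  by have := minD X XV (nc X XV wX) gX e; rewrite e FD; lra.
case: (lev P PV wP) => e; rewrite /L e => h; [left; apply: injC | right; apply: injD] => //;
  by move: h; rewrite ?FD; lra.
Qed.

Hypothesis vert : forall C w, C \in V -> rep2 V w C ->
  lexle (costs V hs w) [seq h C | h <- hs] -> forall P, w P != 0 -> P = C.

(** The line [F = 0] bounds the inner points, so the support stays on it. If the support reached
    beyond [C] or [D], that lattice point would be a proper convex combination inside a cell,
    against [K_vert]. *)
Lemma line_edge (F G : P2 -> R) C D : affine F -> affine G ->
  (forall X Y, F X = F Y -> G X = G Y -> X = Y) ->
  (forall X, X \in V -> ~~ onb X.1 -> 0 <= F X) -> F C = 0 -> F D = 0 ->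
  C \in V -> D \in V -> ~~ onb C.1 -> ~~ onb D.1 -> G C < G D ->
  (forall X, X \in V -> F X = 0 -> G C <= G X <= G D -> X = C \/ X = D) -> edge K C D.
Proof.
move=> aF aG inj F0 FC FD CV DV nC nD lt gap l w B th Kl r hth e1 e2 P wP.
have [rV le] := K_seg uV K1 K4 Kl r CV DV hth e1 e2.
have [w0 _ _ _] := rV; have PV := rep2_V rV wP.
have [nc _] := lev0 hth (or_intror I) nC nD w0 le.
have FB := affine_mix aF e1 e2; have GB := affine_mix aG e1 e2.
have onF X : w X != 0 -> F X = 0.
  move=> wX; have XV := rep2_V rV wX.
  apply: (@E_ge0_eq0 _ _ V w F w0 _ _ X XV wX) => [Y YV wY|].
    by apply: F0 => //; apply: nc.
  by rewrite (E_affine aF rV) FB FC FD; lra.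
have [ul lV] := K1 Kl.
have inl X : w X != 0 -> X \in l by case: r => _ h _ _; apply: contraNT => /h ->.
have mid (X Y Z : P2) : w X != 0 -> w Y != 0 -> Z \in V -> F Z = 0 -> G X < G Z -> G Z < G Y -> False.
  move=> wX wY ZV FZ lXZ lZY.
  pose s := (G Z - G X) / (G Y - G X).
  have hs' : 0 < s < 1 by rewrite divr_gt0 ?ltr_pdivrMr ?mul1r; lra.
  pose M : P2 := (X.1 + s * (Y.1 - X.1), X.2 + s * (Y.2 - X.2)).
  have eM : M = Z.
    apply: inj; first by rewrite (@affine_mix F M X Y s) // FZ !onF //; ring.
    rewrite (@affine_mix G M X Y s) // /s divfK ?gt_eqF; lra.
  have rZ : rep2 l (fun A => (1 - s) * (A == X)%:R + s * (A == Y)%:R) Z.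
    rewrite -eM; split=> [A|A Al||].
    - by rewrite addr_ge0 // mulr_ge0 ?ler0n //; lra.
    - have -> : A == X = false by apply: contraNF Al => /eqP ->; apply: inl.
      have -> : A == Y = false by apply: contraNF Al => /eqP ->; apply: inl.
      by rewrite !mulr0 addr0.
    - by rewrite E_two ?inl //; ring.
    - by rewrite /= !E_two ?inl //; congr [:: _; _]; ring.
  have := K_vert uV K1 K4 vert Kl ZV rZ (P := X); rewrite eqxx => h.
  have e : X = Z.
    apply: h; rewrite gt_eqF //= mulr1; have : 0 <= s * ((X == Y)%:R : R) by rewrite mulr_ge0 ?ler0n //; lra.
    lra.
  by move: lXZ; rewrite e ltxx.
have far (sg : R) Z : Z \in V -> F Z = 0 -> sg = 1 \/ sg = -1 -> sg * G B <= sg * G Z -> sg * G P <= sg * G Z.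
  move=> ZV FZ hsg hB; rewrite leNgt; apply/negP => hP.
  have [Y wY hY] : exists2 Y, w Y != 0 & sg * G Y < sg * G Z.
    apply: contrapT => hn.
    have ge Y : Y \in V -> w Y != 0 -> 0 <= sg * G Y - sg * G Z.
      by move=> _ wY; rewrite subr_ge0 leNgt; apply/negP => hY; apply: hn; exists Y.
    have [_ _ w1 _] := rV.
    have : sg * G P - sg * G Z = 0.
      apply: (@E_ge0_eq0 _ _ V w (fun X => sg * G X - sg * G Z) w0 ge _ P PV wP).
      have -> : E V w (fun X => sg * G X - sg * G Z) = E V w (fun X => sg * G X + (- (sg * G Z)) * 1).
        by apply: eq_E => X _; rewrite mulr1.
      rewrite (ED V w (fun X => sg * G X) (fun _ => - (sg * G Z) * 1)) !EZ w1 (E_affine aG rV); lra.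
    lra.
  by case: hsg => e; rewrite e in hY hP; [apply: (mid Y P Z) | apply: (mid P Y Z)] => //; lra.
apply: gap => //; first exact: onF.
have h1' : 1 * G P <= 1 * G D by apply: far => //; [left | rewrite GB; nra].
have h2' : -1 * G P <= -1 * G C by apply: far => //; [right | rewrite GB; nra].
lra.
Qed.

End LPEdges.

(** Corners of the square have integral images too; this finds those that fall into the rectangle of
    the inner points. *)
Lemma corner_level (p p2 dl r0 a b x y : int) : 1 <= p -> 1 <= p2 ->
  dl = 1 /\ r0 = 0 \/ dl = -1 /\ r0 = 1 -> 0 <= a <= p - 1 -> r0 <= b <= r0 + p2 - 1 ->
  x = 0 \/ x = 1 -> y = 0 \/ y = 1 -> p * y - x = a -> p2 * x - dl * y = b ->
  dl = 1 /\ (a = 0 /\ b = 0 \/ a = p - 1 /\ b = p2 - 1).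
Proof. by move=> h1 h2 [[-> ->]|[-> ->]] h3 h4 [->|->] [->|->] e1 e2; lia. Qed.

Section Pinwheel.
Variable R : realType.
Notation P2 := (R * R)%type.
Variables (q : nat) (p p2 c dl a0 b0 r0 : int).
Hypothesis q0 : (0 < q)%N.
Hypothesis c0 : 1 <= c.
(** [p2] is the inverse of [p] modulo [q] up to the sign [dl]. Below, [(a0, b0)] is the centre of
    the pinwheel, and [r0] is the lower end of the range of the second coordinate. *)
Hypothesis inv : p * p2 = dl + c * q%:Z.
Hypothesis pq : p < q%:Z.
Hypothesis p2q : p2 < q%:Z.
Hypothesis cas :
  [/\ dl = 1, a0 = c, b0 = c, r0 = 0 & 2 * c + 1 <= p /\ 2 * c + 1 <= p2] \/
  [/\ dl = -1, a0 = p - c, b0 = c + 1, r0 = 1 & 2 * c <= p /\ 2 * c <= p2].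

Let cop : exists u v : int, u * p + v * q%:Z = 1.
Proof.
exists (dl * p2), (- dl * c).
have -> : dl * p2 * p + - dl * c * q%:Z = dl * (p * p2 - c * q%:Z) by ring.
by rewrite inv; case: cas => -[-> _ _ _ _]; ring.
Qed.

Let p1 : 1 <= p. Proof. by case: cas => -[_ _ _ _ [h _]]; lia. Qed.
Let p21 : 1 <= p2. Proof. by case: cas => -[_ _ _ _ [_ h]]; lia. Qed.

(** The edge is a multiple of a lattice vector [W], advancing by 1/q, up to a unit vector of the
    other axis. Joined to a unit edge of the next layer parallel to that axis, it gives a lattice
    image of Delta'(1, m). *)
Definition goodp ax (C D : P2) := exists (m : int) (W : P2) (e : int),
  [/\ 1 <= m, lat q p W, co ax W = q%:R^-1, e = 1 \/ e = -1 &
      co ax D - co ax C = m%:~R * co ax W /\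
      co (~~ ax) D - co (~~ ax) C = m%:~R * co (~~ ax) W + e%:~R].

(* In the coordinates (Af, Bf) the lattice points inside the square are the integral points of a
   rectangle, minus two opposite corners if dl = 1. *)
Let Af (P : P2) : R := p%:~R * P.2 - P.1.
Let Bf (P : P2) : R := p2%:~R * P.1 - dl%:~R * P.2.
Let cR : R := c%:~R.
Let qR : R := q%:R.

Let q0R : 0 < qR. Proof. by rewrite ltr0n. Qed.
Let c0R : 1 <= cR. Proof. by have : (1%:~R : R) <= c%:~R by rewrite ler_int. Qed.
Let cq0 : cR * qR != 0. Proof. by have h := c0R; have h2 := q0R; rewrite mulf_neq0 ?gt_eqF //; lra. Qed.
Let invR : p%:~R * p2%:~R = dl%:~R + cR * qR.
Proof. by have := congr1 (intmul (1 : R)) inv; rewrite rmorphD !rmorphM. Qed.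
Let dlR : dl%:~R * dl%:~R = 1 :> R.
Proof. by case: cas => -[-> _ _ _ _]; rewrite -rmorphM. Qed.

Let solx P : cR * qR * P.1 = p%:~R * Bf P + dl%:~R * Af P.
Proof.
rewrite /Af /Bf; have -> : cR * qR = p%:~R * p2%:~R - dl%:~R by rewrite invR; ring.
ring.
Qed.

Let soly P : cR * qR * P.2 = p2%:~R * Af P + Bf P.
Proof.
rewrite /Af /Bf; have -> : cR * qR = p%:~R * p2%:~R - dl%:~R by rewrite invR; ring.
ring.
Qed.

Variables (V : seq P2).
Hypothesis uV : uniq V.
Hypothesis mV : forall P, (P \in V) = lat q p P && insq P.

Let AB (X : P2) (a b : int) := [/\ X \in V, ~~ onb X.1, Af X = a%:~R & Bf X = b%:~R].

Let AB_inj X Y : Af X = Af Y -> Bf X = Bf Y -> X = Y.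
Proof.
move=> e1 e2; rewrite (surjective_pairing X) (surjective_pairing Y).
have h1 : cR * qR * X.1 = cR * qR * Y.1 by rewrite !solx e1 e2.
have h2 : cR * qR * X.2 = cR * qR * Y.2 by rewrite !soly e1 e2.
by rewrite (mulfI cq0 h1) (mulfI cq0 h2).
Qed.

(** In these coordinates the lattice is the sublattice of Z^2 of index [c] given by [p2 * a + b = 0]
    modulo [c]. A line on which one coordinate is fixed thus meets it in a progression of difference
    [c]. *)
Let AB_int X : lat q p X -> exists a b k : int,
  [/\ Af X = a%:~R, Bf X = b%:~R & p2 * a + b = c * k].
Proof.
move=> /andP[/intrP[k ek] /intrP[n en]].
exists (- n), (p2 * n + c * k), k; split; last ring.
- by rewrite /Af rmorphN /= -en; ring.
- rewrite /Bf rmorphD !rmorphM /= -en -ek -/cR -/qR.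
  have -> : cR * (qR * X.2) = cR * qR * X.2 by ring.
  have -> : cR * qR = p%:~R * p2%:~R - dl%:~R by rewrite invR; ring.
  ring.
Qed.

(** For [dl = 1] these two points of the rectangle are the corners (0, 0) and (1, 1) of the
    square. *)
Let ncond a b := dl = 1 -> ~ (a = 0 /\ b = 0) /\ ~ (a = p - 1 /\ b = p2 - 1).

Let AB_ex X : X \in V -> ~~ onb X.1 -> exists a b, AB X a b.
Proof.
move=> XV nX; have /andP[lX _] : lat q p X && insq X by rewrite -mV.
by have [a [b [k [h1 h2 h3]]]] := AB_int lX; exists a, b; split.
Qed.

Let AB_range X a b : AB X a b ->
  [/\ 0 <= a <= p - 1, r0 <= b <= r0 + p2 - 1, exists k, p2 * a + b = c * k & ncond a b].
Proof.
move=> [XV nX eA eB]; have /andP[lX iX] : lat q p X && insq X by rewrite -mV.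
have [a' [b' [k [h1 h2 h3]]]] := AB_int lX.
have ea : a' = a by apply: (@intr_inj R); rewrite -h1 eA.
have eb : b' = b by apply: (@intr_inj R); rewrite -h2 eB.
subst a' b'.
have x1 := V_inner q0 cop mV true XV nX; have y1 := V_inner q0 cop mV false XV nX.
rewrite /co in x1 y1.
have i0 : 0 < (q%:R : R)^-1 by rewrite invr_gt0 ltr0n.
have pR : 1 <= (p%:~R : R) by have : (1%:~R : R) <= p%:~R by rewrite ler_int.
have p2R : 1 <= (p2%:~R : R) by have : (1%:~R : R) <= p2%:~R by rewrite ler_int.
have prod (m z : R) : 1 <= m -> q%:R^-1 <= z <= 1 - q%:R^-1 -> 0 < m * z <= m.
  move=> hm hz; rewrite mulr_gt0 /=; try lra.
  by rewrite ler_piMr; lra.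
have h1' := prod _ _ pR y1; have h2' := prod _ _ p2R x1.
have ltA : (-1)%:~R < Af X < p%:~R by rewrite rmorphN1 /Af; lra.
rewrite eA !ltr_int in ltA.
have rB : (r0 - 1)%:~R < Bf X < (r0 + p2)%:~R.
  by rewrite /Bf; case: cas => -[-> _ _ -> _]; rewrite !(rmorphD, rmorphB) /=; lra.
rewrite eB !ltr_int in rB.
split; [by move: ltA; clear; lia | by move: rB; clear; lia | by exists k |].
move=> d1; split=> -[ea eb].
- have : X = (0, 0) by apply: AB_inj; rewrite ?eA ?eB ?ea ?eb /Af /Bf /=; ring.
  by move=> e; move: nX; rewrite e /onb eqxx.
- have : X = (1, 1).
    by apply: AB_inj; rewrite ?eA ?eB ?ea ?eb /Af /Bf ?d1 /= ?rmorphB /=; ring.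
  by move=> e; move: nX; rewrite e /onb eqxx orbT.
Qed.

Let AB_pt a b k : 0 <= a <= p - 1 -> r0 <= b <= r0 + p2 - 1 -> p2 * a + b = c * k -> ncond a b ->
  exists X, AB X a b.
Proof.
move=> ha hb hk nc.
pose X : P2 := ((p%:~R * b%:~R + dl%:~R * a%:~R) / (cR * qR), (p2%:~R * a%:~R + b%:~R) / (cR * qR)).
have hR : p2%:~R * a%:~R + b%:~R = cR * k%:~R.
  by have := congr1 (intmul (1 : R)) hk; rewrite rmorphD !rmorphM.
have iV : (cR * qR)^-1 * (cR * qR) = 1 by rewrite mulVf.
have cqE : cR * qR = p%:~R * p2%:~R - dl%:~R by rewrite invR; ring.
have eA : Af X = a%:~R.
  have -> : Af X = (cR * qR)^-1 * ((p%:~R * p2%:~R - dl%:~R) * a%:~R) by rewrite /Af /X /=; ring.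
  by rewrite -cqE mulrA iV mul1r.
have eB : Bf X = b%:~R.
  have -> : Bf X = (cR * qR)^-1 * ((p%:~R * p2%:~R - dl%:~R) * b%:~R) by rewrite /Bf /X /=; ring.
  by rewrite -cqE mulrA iV mul1r.
have lX : lat q p X.
  rewrite /lat; apply/andP; split; last first.
    by have -> : X.1 - p%:~R * X.2 = - Af X by [rewrite /Af; ring]; rewrite eA rpredN intr_int.
  have -> : q%:R * X.2 = k%:~R.
    rewrite /X /= hR mulrA [q%:R * _]mulrC -/qR; have qn : qR != 0 by [rewrite gt_eqF]; have cn : cR != 0 by [have h := c0R; rewrite gt_eqF //; lra]; by field; rewrite ?qn ?cn.
  exact: intr_int.
have cqp : 0 < cR * qR by have h1 := c0R; apply: mulr_gt0 => //; lra.
have bnd (n : int) : 0 <= n <= c * q%:Z -> 0 <= (n%:~R : R) / (cR * qR) <= 1.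
  move=> hn; have h1 : (0 : R) <= n%:~R by rewrite ler0z; lia.
  have h2 : (n%:~R : R) <= cR * qR.
    have -> : cR * qR = (c * q%:Z)%:~R by rewrite rmorphM.
    by rewrite ler_int; lia.
  by rewrite divr_ge0 ?ler_pdivrMr ?mul1r // ltW.
have iX : insq X.
  rewrite /insq /X /=; apply/andP; split.
  - have := bnd (p * b + dl * a); rewrite rmorphD !rmorphM; apply.
    by case: cas ha hb inv => -[-> _ _ -> _] *; nia.
  - have := bnd (p2 * a + b); rewrite rmorphD !rmorphM; apply.
    by case: cas ha hb inv => -[-> _ _ -> _] *; nia.
have XV : X \in V by rewrite mV lX iX.
exists X; split=> //; apply/negP => cx.
have cy : onb X.2 by rewrite (V_onb cop mV false XV).
have pt x y : X = (x, y) -> p%:~R * y - x = a%:~R /\ p2%:~R * x - dl%:~R * y = b%:~R.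
  by move=> e; rewrite -eA -eB e.
have [x [y [hx hy]]] : exists x y : int, [/\ (x = 0 \/ x = 1), (y = 0 \/ y = 1) & X = (x%:~R, y%:~R)].
  rewrite (surjective_pairing X).
  case/orP: cx => /eqP ->; case/orP: cy => /eqP ->;
    [exists 0, 0 | exists 0, 1 | exists 1, 0 | exists 1, 1]; split; auto.
move=> /pt [f1 f2].
have g1 : p * y - x = a by apply: (@intr_inj R); rewrite -f1 rmorphB rmorphM.
have g2 : p2 * x - dl * y = b by apply: (@intr_inj R); rewrite -f2 rmorphB !rmorphM.
have hdr : dl = 1 /\ r0 = 0 \/ dl = -1 /\ r0 = 1 by case: cas => -[? _ _ ? _]; [left|right].
have [d1 h] := corner_level p1 p21 hdr ha hb hx hy g1 g2.
by have [n1 n2] := nc d1; case: h.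
Qed.

(** Axis-neutral notation: [i] is the level, which is [Bf] for paths in the x direction and [Af] for
    the others, and [o] is the position on the level. *)
Let ABx (ax : bool) X (i o : int) := if ax then AB X o i else AB X i o.
Let lmin (ax : bool) : int := if ax then r0 else 0.
Let lmax (ax : bool) : int := if ax then r0 + p2 - 1 else p - 1.
Let l0 (ax : bool) : int := if ax then b0 else a0.
Let e (ax : bool) : int := if ax then -1 else 1.
Let lev (ax : bool) (P : P2) : R := if ax then Bf P else Af P.

Let ABx_lev ax X i o : ABx ax X i o ->
  [/\ X \in V, ~~ onb X.1, lev ax X = i%:~R & lev (~~ ax) X = o%:~R].
Proof. by case: ax => -[]. Qed.

Let ABx_range ax X i o : ABx ax X i o ->
  lmin ax <= i <= lmax ax /\ lmin (~~ ax) <= o <= lmax (~~ ax).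
Proof. by rewrite /ABx /lmin /lmax; case: ax => /= /AB_range[-> -> _ _]. Qed.

Let ABx_uniq ax X Y i o : ABx ax X i o -> ABx ax Y i o -> X = Y.
Proof. by rewrite /ABx; case: ax => -[_ _ e1 e2] [_ _ e3 e4]; apply: AB_inj; rewrite ?e1 ?e2 ?e3 ?e4. Qed.

Let ABx_mod ax X Y i o o' : ABx ax X i o -> ABx ax Y i o' -> exists k, o - o' = c * k.
Proof.
rewrite /ABx; case: ax => /AB_range[_ _ [k hk] _] /AB_range[_ _ [k' hk'] _]; last first.
  by exists (k - k'); rewrite mulrBr -hk -hk'; ring.
exists (dl * (p * (k - k') - q%:Z * (o - o'))).
have dd : dl * dl = 1 by case: cas => -[-> _ _ _ _].
have -> : c * (dl * (p * (k - k') - q%:Z * (o - o'))) =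
    dl * (p * (c * k - c * k') - c * q%:Z * (o - o')) by ring.
rewrite -hk -hk'.
have -> : p * (p2 * o + i - (p2 * o' + i)) = p * p2 * (o - o') by ring.
by rewrite inv -mulrBl addrK mulrA dd mul1r.
Qed.

Let ABx_ex ax X : X \in V -> ~~ onb X.1 -> exists i o, ABx ax X i o.
Proof. by move=> XV nX; have [a [b h]] := AB_ex XV nX; case: ax; [exists b, a | exists a, b]. Qed.

Let ABx_pt ax i lo : lmin ax <= i <= lmax ax -> lmin (~~ ax) <= lo -> lo + c - 1 <= lmax (~~ ax) ->
  (forall o, lo <= o <= lo + c - 1 -> if ax then ncond o i else ncond i o) ->
  exists X o, ABx ax X i o /\ lo <= o <= lo + c - 1.
Proof.
move=> hi h1 h2 nc; pose t := if ax then - dl * p * i else - p2 * i.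
have hc : c != 0 by rewrite gt_eqF //; move: c0; clear; lia.
pose o := lo + ((t - lo) %% c)%Z.
have ho : lo <= o <= lo + c - 1.
  have g1 := modz_ge0 (t - lo) hc; have g2 := ltz_mod (t - lo) hc.
  rewrite /o; move: g1 g2 c0; clear; set z := (_ %% _)%Z; lia.
have [k ek] : exists k, o = t + c * k.
  exists (- ((t - lo) %/ c)%Z); rewrite /o; have := divz_eq (t - lo) c; clear.
  set z := (_ %% _)%Z; set y := (_ %/ _)%Z; lia.
have [X hX] : exists X, ABx ax X i o.
  have et : t = if ax then - dl * p * i else - p2 * i by [].
  clearbody o; clearbody t.
  rewrite /ABx; case: ax hi h1 h2 nc et => /= hi h1 h2 nc et.
  - apply: (@AB_pt o i (p2 * k - dl * q%:Z * i)); try exact: nc; rewrite ?hi //.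
      by move: ho h1 h2; rewrite /lmin /lmax /=; clear; lia.
    rewrite ek et mulrBr.
    have -> : p2 * (- dl * p * i + c * k) + i = i - dl * (p * p2) * i + c * (p2 * k) by ring.
    rewrite inv; have -> : dl * (dl + c * q%:Z) = 1 + dl * c * q%:Z.
      by rewrite mulrDr mulrA; case: cas => -[-> _ _ _ _].
    ring.
  - apply: (@AB_pt i o k); try exact: nc; rewrite ?hi //.
      by move: ho h1 h2; rewrite /lmin /lmax /=; clear; lia.
    by rewrite ek et; ring.
by exists X, o.
Qed.

(** The spine of the pinwheel: on each level the lattice point nearest to the centre line, on one
    side of it. The sign [h] selects a half of the spine, and [e ax] puts the four halves into the
    four different quadrants. *)
Let SP ax (h i : int) X := exists o, ABx ax X i o /\ 0 <= h * e ax * (o - l0 (~~ ax)) <= c - 1.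

Let SP_ex ax h i : h = 1 \/ h = -1 -> lmin ax <= i <= lmax ax -> 0 <= h * (l0 ax - i) ->
  exists X, SP ax h i X.
Proof.
move=> hh hi hl.
(* The window of [c] consecutive positions starts or ends at the centre line, according to the
   side. *)
pose lo := if h * e ax == 1 then l0 (~~ ax) else l0 (~~ ax) - c + 1.
have he : h * e ax = 1 \/ h * e ax = -1 by case: hh => ->; rewrite /e; case: (ax); auto.
have [X [o [hX ho]]] : exists X o, ABx ax X i o /\ lo <= o <= lo + c - 1.
  apply: ABx_pt => //.
  - by move: he cas c0; rewrite /lo /lmin /l0 /=; clear => -[->|->]; case: ax => /= -[[]|[]]; lia.
  - by move: he cas c0; rewrite /lo /lmax /l0 /=; clear => -[->|->]; case: ax => /= -[[]|[]]; lia.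
  - move: hh cas c0 hl hi; rewrite /lo /lmin /lmax /l0 /ncond /e; clear.
    by case=> ->; case: ax => /= cas c0 hl hi o ho d1; case: cas => -[]; lia.
exists X, o; split=> //; move: he ho c0; rewrite /lo; clear.
by case=> ->; rewrite /=; lia.
Qed.

Let Opt ax : exists X, ABx ax X (l0 ax) (l0 (~~ ax)).
Proof.
have [X hX] : exists X, AB X a0 b0.
  have [k hk] : exists k, p2 * a0 + b0 = c * k.
    case: cas => -[ed -> -> _ _]; [exists (p2 + 1) | exists (q%:Z - p2 + 1)]; first ring.
    have -> : p2 * (p - c) + (c + 1) = p * p2 - p2 * c + c + 1 by ring.
    by rewrite inv ed; ring.
  apply: AB_pt hk _; move: cas c0; rewrite /ncond; clear; case=> -[]; lia.
by exists X; case: ax.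
Qed.

(* A pinwheel around (a0, b0): on opposite quadrants the same one of the two coordinates comes first. *)
Let h1 (P : P2) : R := `|Af P - a0%:~R| + `|Bf P - b0%:~R|.
Let h2 (P : P2) : R :=
  if Af P == a0%:~R then (Bf P - b0%:~R) ^+ 2 else
  if Bf P == b0%:~R then (Af P - a0%:~R) ^+ 2 else
  if (Af P - a0%:~R) * (Bf P - b0%:~R) < 0 then (Af P - a0%:~R) ^+ 2 else (Bf P - b0%:~R) ^+ 2.

(** The charts of the four quadrants: [FF] counts levels away from the centre and [GG] measures the
    distance from the centre line. *)
Let FF ax (h : int) P : R := h%:~R * ((l0 ax)%:~R - lev ax P).
Let GG ax (h : int) P : R := (h * e ax)%:~R * (lev (~~ ax) P - (l0 (~~ ax))%:~R).

Let lev_aff ax : affine (lev ax).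
Proof.
rewrite /lev; case: ax.
- by exists 0, p2%:~R, (- dl%:~R) => P; rewrite /Bf; ring.
- by exists 0, (-1), p%:~R => P; rewrite /Af; ring.
Qed.

Let quads ax h : h = 1 \/ h = -1 -> quad V h1 h2 (FF ax h) (GG ax h).
Proof.
move=> hh; have hR : (h%:~R : R) = 1 \/ (h%:~R : R) = -1 by case: hh => ->; rewrite ?rmorphN1; auto.
split.
- have [al [be [ga hl]]] := lev_aff ax.
  by exists (h%:~R * ((l0 ax)%:~R - al)), (- h%:~R * be), (- h%:~R * ga) => P; rewrite /FF hl; ring.
- have [al [be [ga hl]]] := lev_aff (~~ ax).
  exists ((h * e ax)%:~R * (al - (l0 (~~ ax))%:~R)), ((h * e ax)%:~R * be), ((h * e ax)%:~R * ga) => P.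
  by rewrite /GG hl; ring.
- move=> P; rewrite /h1 /FF /GG /lev /l0 /e rmorphM /= !normrM.
  have -> : `|h%:~R| = 1 :> R by case: hR => ->; rewrite ?normrN normr1.
  have -> : `|(if ax then -1 else 1 : int)%:~R| = 1 :> R by case: (ax); rewrite ?rmorphN1 ?normrN normr1.
  by rewrite !mul1r; case: (ax) => /=; [rewrite addrC (distrC (Bf P)) | rewrite (distrC (Af P))].
- move=> P; rewrite /h2 /FF /GG /lev /l0 /e rmorphM /=.
  have sq (x y : R) : x = y \/ x = - y -> x ^+ 2 = y ^+ 2 by case=> ->; rewrite ?sqrrN.
  case: hR => ->; case: (ax) => /=; rewrite ?rmorphN1 !(mul1r, mulN1r, opprK);
    move: (Af P) (Bf P) (a0%:~R : R) (b0%:~R : R) => a b u v f0 g0.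
  - have -> : (v - b == 0) = (b == v) by rewrite subr_eq0 eq_sym.
    have [ea|na] := eqVneq a u; first by try case: eqP => [eb|_]; apply: sq; rewrite ?ea ?eb; first [by left; ring | by right; ring].
    have [eb|nb] := eqVneq b v; first by apply: sq; rewrite ?eb; first [by left; ring | by right; ring].
    have -> : (a - u) * (b - v) < 0 = false by apply/negbTE; rewrite -leNgt; nra.
    by apply: sq; first [by left; ring | by right; ring].
  - have -> : (u - a == 0) = (a == u) by rewrite subr_eq0 eq_sym.
    have [ea|na] := eqVneq a u; first by try case: eqP => [eb|_]; apply: sq; rewrite ?ea ?eb; first [by left; ring | by right; ring].
    have [eb|nb] := eqVneq b v; first by apply: sq; rewrite ?eb; first [by left; ring | by right; ring].
    have -> : (a - u) * (b - v) < 0.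
      have : a < u by rewrite lt_neqAle na; lra.
      have : v < b by rewrite lt_neqAle eq_sym nb; lra.
      by move=> *; nra.
    by apply: sq; first [by left; ring | by right; ring].
  - have -> : (- (v - b) == 0) = (b == v) by rewrite oppr_eq0 subr_eq0 eq_sym.
    have [ea|na] := eqVneq a u; first by try case: eqP => [eb|_]; apply: sq; rewrite ?ea ?eb; first [by left; ring | by right; ring].
    have [eb|nb] := eqVneq b v; first by apply: sq; rewrite ?eb; first [by left; ring | by right; ring].
    have -> : (a - u) * (b - v) < 0 = false by apply/negbTE; rewrite -leNgt; nra.
    by apply: sq; first [by left; ring | by right; ring].
  - have -> : (- (u - a) == 0) = (a == u) by rewrite oppr_eq0 subr_eq0 eq_sym.
    have [ea|na] := eqVneq a u; first by try case: eqP => [eb|_]; apply: sq; rewrite ?ea ?eb; first [by left; ring | by right; ring].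
    have [eb|nb] := eqVneq b v; first by apply: sq; rewrite ?eb; first [by left; ring | by right; ring].
    have -> : (a - u) * (b - v) < 0.
      have : u < a by rewrite lt_neqAle eq_sym na; lra.
      have : b < v by rewrite lt_neqAle nb; lra.
      by move=> *; nra.
    by apply: sq; first [by left; ring | by right; ring].
- move=> P PV; have /andP[lP _] : lat q p P && insq P by rewrite -mV.
  have [a [b [k [e1 e2 _]]]] := AB_int lP.
  rewrite /FF /lev; case: (ax); rewrite ?e1 ?e2; apply: rpredM; rewrite ?intr_int //;
    apply: rpredB; exact: intr_int.
Qed.

Let quad_cover C : C \in V -> exists F G, [/\ quad V h1 h2 F G, 0 <= F C & 0 <= G C].
Proof.
move=> _.
have o1 : (1 : int) = 1 \/ (1 : int) = -1 by left.
have o2 : (-1 : int) = 1 \/ (-1 : int) = -1 by right.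
have [hA|hA] := leP (Af C) a0%:~R; have [hB|hB] := leP (Bf C) b0%:~R.
- exists (FF true 1), (GG true 1); split; [exact: quads | |]; rewrite /FF /GG /lev /l0 /= ?mul1r ?rmorphN1; lra.
- exists (FF false 1), (GG false 1); split; [exact: quads | |]; rewrite /FF /GG /lev /l0 /= ?mul1r; lra.
- exists (FF false (-1)), (GG false (-1)); split; [exact: quads | |];
    rewrite /FF /GG /lev /l0 /= ?mulr1 ?rmorphN1; lra.
- exists (FF true (-1)), (GG true (-1)); split; [exact: quads | |];
    rewrite /FF /GG /lev /l0 /= ?mulrN1 ?opprK ?rmorphN1; lra.
Qed.

Definition pin_costs := [:: @corner_cost R; h1; h2; fun P : P2 => P.1 ^+ 2 + P.2 ^+ 2].
Let hs := pin_costs.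
Variable K : seq P2 -> Prop.
Hypothesis K1 : forall l, K l -> uniq l /\ {subset l <= V}.
Hypothesis K4 : forall l w b w', K l -> rep cs2 l w b -> rep cs2 V w' b ->
  lexle (costs V hs w) (costs V hs w').

Lemma pin_vert C w : C \in V -> rep2 V w C ->
  lexle (costs V hs w) [seq h C | h <- hs] -> forall P, w P != 0 -> P = C.
Proof. exact: (quad_vert cop mV quad_cover). Qed.
Let vert := pin_vert.

Let F_int ax h X i o : ABx ax X i o -> FF ax h X = (h * (l0 ax - i))%:~R.
Proof. by move=> /ABx_lev[_ _ e1 _]; rewrite /FF e1 rmorphM rmorphB. Qed.

Let G_int ax h X i o : ABx ax X i o -> GG ax h X = (h * e ax * (o - l0 (~~ ax)))%:~R.
Proof. by move=> /ABx_lev[_ _ _ e1]; rewrite /GG e1 !rmorphM rmorphB. Qed.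

Let unit_sq (h : int) : h = 1 \/ h = -1 -> h * h = 1.
Proof. by case=> ->. Qed.

Let SP_edge ax h i j X Y : h = 1 \/ h = -1 -> SP ax h i X -> SP ax h j Y ->
  0 <= h * (l0 ax - i) -> h * (l0 ax - j) = h * (l0 ax - i) + 1 -> edge K X Y.
Proof.
move=> hh [o [hX wX]] [o' [hY wY]] hi hj.
have [XV nX lX oX] := ABx_lev hX; have [YV nY lY oY] := ABx_lev hY.
have he : (h * e ax) * (h * e ax) = 1.
  by rewrite mulrACA (unit_sq hh) mul1r /e; case: (ax).
have hcancel a b : h * (l0 ax - a) = h * (l0 ax - b) -> a = b.
  by case: hh => ->; clear; lia.
(* Positions on a level differ by multiples of [c], so the point in the window is the lowest one of
   its level within the quadrant. *)
have low A B n m m' : ABx ax A n m -> ABx ax B n m' -> 0 <= h * e ax * (m - l0 (~~ ax)) <= c - 1 ->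
    0 <= h * e ax * (m' - l0 (~~ ax)) -> h * e ax * (m - l0 (~~ ax)) <= h * e ax * (m' - l0 (~~ ax)).
  move=> hA hB g1 g2; have [k hk] := ABx_mod hA hB.
  have hk' : h * e ax * (m - l0 (~~ ax)) - h * e ax * (m' - l0 (~~ ax)) = c * (h * e ax * k).
    by rewrite -mulrBr opprB addrA subrK hk; ring.
  move: g1 g2 hk' c0; clear; move: (h * e ax * (m - _)) (h * e ax * (m' - _)) (h * e ax * k) => x y z.
  move=> g1 g2 g3 g4; rewrite leNgt; apply/negP => g5.
  have : z <= 0 \/ 1 <= z by lia.
  by case=> hz; nia.
have inj A B n m : ABx ax A n m -> B \in V -> FF ax h B = FF ax h A -> GG ax h B = GG ax h A -> B = A.
  move=> hA BV; rewrite /FF /GG => f g; have hn : (h%:~R : R) != 0 by rewrite intr_eq0; case: hh => ->.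
  have hn' : ((h * e ax)%:~R : R) != 0.
    by rewrite intr_eq0; apply/eqP => z; move: he; rewrite z mul0r.
  have {}f := mulfI hn f; have {}g := mulfI hn' g.
  have f' : lev ax B = lev ax A by lra.
  have g' : lev (~~ ax) B = lev (~~ ax) A by lra.
  by move: f' g'; rewrite /lev; case: (ax) => /= f' g'; apply: AB_inj.
apply: (strip_edge uV K1 K4 (quads ax hh) XV YV nX nY).
- by rewrite !(F_int _ hX) (F_int _ hY) hj rmorphD.
- by rewrite (F_int _ hX) ler0z.
- by rewrite (G_int _ hX) ler0z; case/andP: wX.
- by rewrite (G_int _ hY) ler0z; case/andP: wY.
- rewrite (F_int _ hX) (G_int _ hX) => /eqP; rewrite intr_eq0 => /eqP z.
  have [Z hZ] := Opt ax.
  have ei : i = l0 ax by apply: hcancel; rewrite z subrr mulr0.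
  subst i; have := low _ _ _ _ _ hX hZ wX; rewrite subrr mulr0 lexx => /(_ isT) le.
  have -> : h * e ax * (o - l0 (~~ ax)) = 0 by apply/eqP; rewrite eq_le le; case/andP: wX.
  by [].
- move=> A AV nA gA fA; have [n [m hA]] := ABx_ex ax AV nA.
  have en : n = i.
    by apply: hcancel; apply: (@intr_inj R); rewrite -(F_int _ hA) -(F_int _ hX).
  subst n; rewrite (G_int _ hX) (G_int _ hA) ler_int; apply: (low _ _ _ _ _ hX hA) => //.
  by rewrite (G_int _ hA) ler0z in gA.
- move=> A AV nA gA fA; have [n [m hA]] := ABx_ex ax AV nA.
  have en : n = j.
    by apply: hcancel; apply: (@intr_inj R); rewrite -(F_int _ hA) -(F_int _ hY).
  subst n; rewrite (G_int _ hY) (G_int _ hA) ler_int; apply: (low _ _ _ _ _ hY hA) => //.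
  by rewrite (G_int _ hA) ler0z in gA.
- by move=> A AV; apply: (inj _ _ _ _ hX).
- by move=> A AV; apply: (inj _ _ _ _ hY).
Qed.

(** Subtracting a unit vector from a step of length 1/q leaves the required [W], with [m = 1]. *)
Let good_unit ax C D : lat q p C -> lat q p D -> co ax D - co ax C = q%:R^-1 -> goodp ax C D.
Proof.
move=> lC lD st.
have lDC := lat_sub lD lC.
pose W : P2 := if ax then (D.1 - C.1, D.2 - C.2 - 1) else (D.1 - C.1 - 1, D.2 - C.2).
exists 1, W, 1; split=> //; last first.
- by rewrite !mul1r /W; move: st; rewrite /co; case: (ax) => /=; split; lra.
- by left.
- by rewrite -st /W /co; case: (ax).
have l10 : lat q p (if ax then (0, 1) else (1, 0) : P2).
  by case: (ax); apply: lat_int; rewrite ?rpred0 ?rpred1.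
have := lat_sub lDC l10; rewrite /W; case: (ax) => /=; congr (lat _ _ (_, _)); ring.
Qed.

Let ABx_co ax X i o : ABx ax X i o ->
  cR * qR * co ax X = (if ax then p * i + dl * o else p2 * i + o)%:~R.
Proof.
rewrite /ABx /co; case: ax => -[_ _ eA eB]; rewrite ?solx ?soly eA eB rmorphD ?rmorphM //.
Qed.

Let cqp : 0 < cR * qR.
Proof. by have j1 := c0R; have j2 := q0R; apply: mulr_gt0 => //; lra. Qed.

(** Passing to the next level changes the form [Bf] or [Af] by exactly 1, which ties the second
    coordinate of the step to the first. The step advances because [p] and [p2] exceed [c]. *)
Let good_step ax X Y i o o' : ABx ax X i o -> ABx ax Y (i + 1) o' -> - c < o' - o < c ->
  co ax X < co ax Y /\ goodp ax X Y.
Proof.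
move=> hX hY ho; have [XV nX lX oX] := ABx_lev hX; have [YV nY lY oY] := ABx_lev hY.
have /andP[latX _] : lat q p X && insq X by rewrite -mV.
have /andP[latY _] : lat q p Y && insq Y by rewrite -mV.
have dd : dl = 1 \/ dl = -1 by case: cas => -[-> _ _ _ _]; auto.
have lt : co ax X < co ax Y.
  rewrite -(ltr_pM2l cqp) (ABx_co hX) (ABx_co hY) ltr_int.
  move: ho cas c0; clear -dd; case: (ax) => ho [] [e1 _ _ _ [j1' j2']] c0; rewrite ?e1; lia.
split=> //.
have qi ax' Z : lat q p Z -> q%:R * co ax' Z \is a Num.int.
  by move=> l; rewrite /co; case: ax'; [exact: (lat_qx l) | by case/andP: l].
have /intrP[m hm] : q%:R * (co ax Y - co ax X) \is a Num.int.
  by rewrite mulrBr rpredB ?qi.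
have m1 : 1 <= m.
  have : 0 < (m%:~R : R) by rewrite -hm mulr_gt0 // subr_gt0.
  by rewrite ltr0z; clear; lia.
have qn : qR != 0 by rewrite gt_eqF.
have em : co ax Y - co ax X = m%:~R * q%:R^-1 by rewrite -hm mulrAC mulfV // mul1r.
have qV : q%:R * q%:R^-1 = 1 :> R by rewrite mulfV.
case: ax hX hY lX oX lY oY lt hm em ho => hX hY lX oX lY oY lt hm em ho; rewrite /co /= in em *.
(* [W] is the lattice vector with first coordinate 1/q on which [Bf] vanishes. The growth of [Bf] by
   1 along the step is due to the unit vector with sign [- dl]. *)
- exists m, (q%:R^-1, dl%:~R * p2%:~R / q%:R), (- dl); split=> //=.
  + apply/andP; split=> /=.
      have -> : q%:R * (dl%:~R * p2%:~R / q%:R) = (dl * p2)%:~R :> R.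
        by rewrite rmorphM mulrCA qV mulr1.
      exact: intr_int.
    have -> : q%:R^-1 - p%:~R * (dl%:~R * p2%:~R / q%:R) = - (dl * c)%:~R :> R.
      have -> : p%:~R * (dl%:~R * p2%:~R / q%:R) = dl%:~R * (p%:~R * p2%:~R) / q%:R :> R by ring.
      rewrite invR mulrDr dlR mulrDl mul1r rmorphM /= -/cR -/qR.
      have -> : dl%:~R * (cR * qR) / qR = dl%:~R * cR by rewrite mulrA mulfK.
      by ring.
    by rewrite rpredN intr_int.
  + by case: dd => ->; auto.
  + split=> //.
    have yE Z : Z.2 = dl%:~R * (p2%:~R * Z.1 - Bf Z).
      have -> : Bf Z = p2%:~R * Z.1 - dl%:~R * Z.2 by [].
      by rewrite opprB addrCA subrr addr0 mulrA dlR mul1r.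
    rewrite (yE Y) (yE X); rewrite /lev in lX lY; rewrite lX lY rmorphD /=.
    have -> : dl%:~R * (p2%:~R * Y.1 - (i%:~R + 1%:~R)) - dl%:~R * (p2%:~R * X.1 - i%:~R) =
       dl%:~R * (p2%:~R * (Y.1 - X.1)) - dl%:~R :> R by ring.
    by rewrite em rmorphN /=; ring.
- exists m, (p%:~R / q%:R, q%:R^-1), (-1); split=> //=.
  + apply/andP; split=> /=; first by rewrite qV rpred1.
    by rewrite subrr rpred0.
  + by right.
  + split=> //.
    have xE Z : Z.1 = p%:~R * Z.2 - Af Z by rewrite /Af; ring.
    rewrite (xE Y) (xE X); rewrite /lev in lX lY; rewrite lX lY rmorphD /=.
    have -> : p%:~R * Y.2 - (i%:~R + 1%:~R) - (p%:~R * X.2 - i%:~R) = p%:~R * (Y.2 - X.2) - 1 :> R by ring.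
    by rewrite em rmorphN1; ring.
Qed.

Let cn ax := conn K (co ax) (co (~~ ax)) (goodp ax).

Let ev C : C \in V -> edge K C C.
Proof. exact: (edge_vert uV K1 K4 vert). Qed.

Let SP_step ax h i X Y : h = 1 \/ h = -1 -> SP ax h i X -> SP ax h (i + 1) Y ->
  0 <= h * (l0 ax - i) -> 0 <= h * (l0 ax - (i + 1)) -> cn ax X Y.
Proof.
move=> hh hX hY hi hj; have [o [aX wX]] := hX; have [o' [aY wY]] := hY.
have ho : - c < o' - o < c.
  have : h * e ax = 1 \/ h * e ax = -1 by case: hh => ->; rewrite /e; case: (ax); auto.
  by move: wX wY c0; clear; set u := h * e ax; move=> j1 j2 h3 [] ee; rewrite ee in j1 j2; lia.
have [lt g] := good_step aX aY ho; have [XV _ _ _] := ABx_lev aX; have [YV _ _ _] := ABx_lev aY.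
apply: conn_edge => //; try exact: (V_in mV).
case: hh => eh; subst h.
- by apply: edge_sym; apply: (SP_edge (or_introl erefl) hY hX) => //; ring.
- by apply: (SP_edge (or_intror erefl) hX hY) => //; ring.
Qed.

Let Opt_SP ax h X : ABx ax X (l0 ax) (l0 (~~ ax)) -> SP ax h (l0 ax) X.
Proof. by move=> hX; exists (l0 (~~ ax)); split=> //; rewrite subrr mulr0 lexx /=; move: c0; clear; lia. Qed.

Let l0_range ax : lmin ax <= l0 ax <= lmax ax.
Proof. by have [X /ABx_range[]] := Opt ax. Qed.

Let down ax X0 (n : nat) : ABx ax X0 (l0 ax) (l0 (~~ ax)) -> lmin ax <= l0 ax - n%:Z ->
  exists X, SP ax 1 (l0 ax - n%:Z) X /\ cn ax X X0.
Proof.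
move=> hX0; elim: n => [|n IH] hn.
  exists X0; rewrite subr0; split; first exact: Opt_SP.
  have [XV _ _ _] := ABx_lev hX0.
  by apply: conn_refl; [apply: ev | apply: (V_in mV)].
have [|X [hX cX]] := IH; first by move: hn; clear; lia.
have lr := l0_range ax.
have [||Y hY] := @SP_ex ax 1 (l0 ax - n.+1%:Z) (or_introl erefl).
- by move: lr hn; clear; lia.
- by clear; lia.
exists Y; split=> //; apply: conn_trans cX.
have e1 : l0 ax - n.+1%:Z + 1 = l0 ax - n%:Z by clear; lia.
apply: (SP_step (h := 1) (or_introl erefl) hY); rewrite ?e1 //; clear; lia.
Qed.

Let upw ax X0 (n : nat) : ABx ax X0 (l0 ax) (l0 (~~ ax)) -> l0 ax + n%:Z <= lmax ax ->
  exists X, SP ax (-1) (l0 ax + n%:Z) X /\ cn ax X0 X.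
Proof.
move=> hX0; elim: n => [|n IH] hn.
  exists X0; rewrite addr0; split; first exact: Opt_SP.
  have [XV _ _ _] := ABx_lev hX0.
  by apply: conn_refl; [apply: ev | apply: (V_in mV)].
have [|X [hX cX]] := IH; first by move: hn; clear; lia.
have lr := l0_range ax.
have [||Y hY] := @SP_ex ax (-1) (l0 ax + n.+1%:Z) (or_intror erefl).
- by move: lr hn; clear; lia.
- by clear; lia.
exists Y; split=> //; apply: conn_trans cX _.
have e1 : l0 ax + n.+1%:Z = l0 ax + n%:Z + 1 by clear; lia.
rewrite e1 in hY; apply: (SP_step (h := -1) (or_intror erefl) hX hY); clear; lia.
Qed.

Let eps (ax : bool) : int := if ax then dl else 1.

(** The first and last levels bound the rectangle of inner points, so [line_edge] applies.
    Neighbours on a level are [c] apart, which is a step of length 1/q; [eps] is the sign for which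
    it goes forward. *)
Let climb_edge ax i o X Y : i = lmin ax \/ i = lmax ax -> ABx ax X i o -> ABx ax Y i (o + eps ax * c) ->
  cn ax X Y.
Proof.
move=> hi hX hY; have [XV nX lX oX] := ABx_lev hX; have [YV nY lY oY] := ABx_lev hY.
have /andP[latX _] : lat q p X && insq X by rewrite -mV.
have /andP[latY _] : lat q p Y && insq Y by rewrite -mV.
have cn0 : cR != 0 by have h := c0R; rewrite gt_eqF //; lra.
have qn : qR != 0 by rewrite gt_eqF.
have st : co ax Y - co ax X = q%:R^-1.
  apply: (mulfI cq0); rewrite mulrBr (ABx_co hX) (ABx_co hY) -rmorphB.
  have -> : (if ax then p * i + dl * (o + eps ax * c) else p2 * i + (o + eps ax * c)) -
      (if ax then p * i + dl * o else p2 * i + o) = c.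
    have dd : dl * dl = 1 by case: cas => -[-> _ _ _ _].
    rewrite /eps; case: (ax); last ring.
    have -> : p * i + dl * (o + dl * c) - (p * i + dl * o) = dl * dl * c by ring.
    by rewrite dd mul1r.
  by rewrite -/cR -/qR mulfK.
have i0 : 0 < (q%:R : R)^-1 by rewrite invr_gt0.
apply: conn_edge; [|exact: good_unit| by rewrite -subr_gt0 st | exact: (V_in mV) | exact: (V_in mV)].
have [sg [hsg sg0]] : exists sg : R, (sg = 1 \/ sg = -1) /\   forall Z, Z \in V -> ~~ onb Z.1 -> 0 <= sg * (lev ax Z - i%:~R).
  case: hi => ei; [exists 1 | exists (-1)]; (split; first by auto); move=> Z ZV nZ;
    have [a [b hZ]] := ABx_ex ax ZV nZ; have [_ _ -> _] := ABx_lev hZ;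
    have [/andP[r1 r2] _] := ABx_range hZ; rewrite -rmorphB /= ?mul1r ?mulN1r -?rmorphN ler0z ei;
    move: r1 r2; clear; lia.
have sgn : sg != 0 by case: hsg => ->; rewrite ?oppr_eq0 oner_eq0.
have inj0 Z1 Z2 : lev ax Z1 = lev ax Z2 -> co ax Z1 = co ax Z2 -> Z1 = Z2.
  rewrite /lev /co /Af /Bf; case: (ax) => f g; rewrite (surjective_pairing Z1) (surjective_pairing Z2).
  - rewrite g in f *; congr (_, _).
    have f' : dl%:~R * Z1.2 = dl%:~R * Z2.2 by lra.
    by rewrite -[LHS]mul1r -[RHS]mul1r -dlR -!mulrA f'.
  - by rewrite g in f *; congr (_, _); lra.
apply: (line_edge uV K1 K4 vert (F := fun Z => sg * (lev ax Z - i%:~R)) (G := co ax)) => //.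
- have [al [be [ga hl]]] := lev_aff ax.
  by exists (sg * (al - i%:~R)), (sg * be), (sg * ga) => Z; rewrite hl; ring.
- by rewrite /co; case: (ax); [exists 0, 1, 0 | exists 0, 0, 1] => Z; ring.
- move=> Z1 Z2 /(mulfI sgn) f; apply: inj0; lra.
- by rewrite lX subrr mulr0.
- by rewrite lY subrr mulr0.
- by rewrite -subr_gt0 st.
- move=> Z ZV /eqP; rewrite mulf_eq0 (negbTE sgn) /= subr_eq0 => /eqP lZ /andP[g1 g2].
  have qi ax' Z' : Z' \in V -> q%:R * co ax' Z' \is a Num.int.
    by rewrite mV => /andP[l _]; rewrite /co; case: ax'; [exact: (lat_qx l) | by case/andP: l].
  have inj Z' : lev ax Z' = i%:~R -> co ax Z = co ax Z' -> Z = Z' by move=> f; apply: inj0; lra.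
  have [g3|g3] := leP (co ax Z) (co ax X).
    by left; apply: inj => //; lra.
  right; apply: inj => //.
  have := int_gap (qi ax X XV) (qi ax Z ZV); rewrite ltr_pM2l // => /(_ g3) g4.
  have qV : q%:R * q%:R^-1 = 1 :> R by rewrite mulfV.
  have g5 : qR * co ax Y = qR * co ax X + 1 by rewrite -qV -st; ring.
  have g6 : qR * co ax Y <= qR * co ax Z by rewrite g5.
  by move: g6; rewrite ler_pM2l // => g6; apply/eqP; rewrite eq_le g2.
Qed.

Let climb ax i o X Y (n : nat) : i = lmin ax \/ i = lmax ax -> ABx ax X i o ->
  ABx ax Y i (o + eps ax * c * n%:Z) -> cn ax X Y.
Proof.
move=> hi hX; elim: n Y => [|n IH] Y hY.
  rewrite mulr0 addr0 in hY; rewrite (ABx_uniq hY hX).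
  have [XV _ _ _] := ABx_lev hX.
  by apply: conn_refl; [apply: ev | apply: (V_in mV)].
suff [Z hZ] : exists Z, ABx ax Z i (o + eps ax * c * n%:Z).
  apply: conn_trans (IH Z hZ) _; apply: (climb_edge hi hZ).
  by have -> : o + eps ax * c * n%:Z + eps ax * c = o + eps ax * c * n.+1%:Z by [rewrite -addn1 PoszD; ring].
have he : eps ax = 1 \/ eps ax = -1 by rewrite /eps; case: (ax); [case: cas => -[-> _ _ _ _]; auto | left].
set o1 := o + eps ax * c * n%:Z; set o2 := o + eps ax * c * n.+1%:Z in hY.
have bt : o <= o1 <= o2 \/ o2 <= o1 <= o.
  rewrite /o1 /o2 -addn1 PoszD; move: c0 (n%:Z) (le0z_nat n); clear -he.
  case: he => -> c0 m hm; [left | right]; nia.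
have hk : exists k, o1 - o = c * k by exists (eps ax * n%:Z); rewrite /o1; ring.
clearbody o1 o2.
have dd : dl = 1 \/ dl = -1 by case: cas => -[-> _ _ _ _]; auto.
rewrite /ABx in hX hY *; case: (ax) hi hX hY => /= hi /AB_range[r1 r2 [k1 e1] n1] /AB_range[r3 r4 [k2 e2] n2].
- case: hk => k hk; apply: (@AB_pt o1 i (k1 + p2 * k)).
  + by move: bt r1 r3; clear; lia.
  + by [].
  + by rewrite mulrDr -e1 mulrCA -hk; ring.
  + move=> d1; have {}n1 := n1 d1; have {}n2 := n2 d1.
    have r0E : r0 = 0 by case: cas => -[ed _ _ -> _] //; move: d1; rewrite ed.
    by move: hi bt n1 n2 r1 r3; rewrite /lmin /lmax r0E; clear; lia.
- case: hk => k hk; apply: (@AB_pt i o1 (k1 + k)).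
  + by [].
  + by move: bt r2 r4; clear; lia.
  + by rewrite mulrDr -e1 -hk; ring.
  + move=> d1; have {}n1 := n1 d1; have {}n2 := n2 d1.
    have r0E : r0 = 0 by case: cas => -[ed _ _ -> _] //; move: d1; rewrite ed.
    by move: hi bt n1 n2 r2 r4; rewrite /lmin /lmax r0E; clear; lia.
Qed.

(** Positions on a level differ by multiples of [c], so the weak bound already means a nonnegative
    number of climbing steps. *)
Let climb_to ax i o o' X Y : i = lmin ax \/ i = lmax ax -> ABx ax X i o -> ABx ax Y i o' ->
  - c < eps ax * (o' - o) -> cn ax X Y.
Proof.
move=> hi hX hY ho; have [k hk] := ABx_mod hY hX.
have he : eps ax = 1 \/ eps ax = -1 by rewrite /eps; case: (ax); [case: cas => -[-> _ _ _ _]; auto | left].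
have k0 : 0 <= eps ax * k.
  rewrite hk in ho; move: ho c0; clear -he.
  have -> : eps ax * (c * k) = c * (eps ax * k) by ring.
  move: (eps ax * k) => z j1 j2; rewrite leNgt; apply/negP => h3; nia.
have eo : o' = o + eps ax * c * (absz (eps ax * k))%:Z.
  rewrite gez0_abs //.
  have -> : eps ax * c * (eps ax * k) = (eps ax * eps ax) * (c * k) by ring.
  have -> : eps ax * eps ax = 1 by case: he => ->.
  by rewrite mul1r -hk addrCA subrr addr0.
by rewrite eo in hY; exact: climb hi hX hY.
Qed.

(** The inner point at distance 1/q from the side lies on the first level. The last clause ensures
    that the spine meets this level not before that point. *)
Let fork_lo ax : exists C o, [/\ ABx ax C (lmin ax) o, co ax C = q%:R^-1 &
  forall o', 0 <= e ax * (o' - l0 (~~ ax)) <= c - 1 -> - c < eps ax * (o' - o)].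
Proof.
have cn0 : cR != 0 by have h := c0R; rewrite gt_eqF //; lra.
have fin C o : ABx ax C (lmin ax) o -> (if ax then p * lmin ax + dl * o else p2 * lmin ax + o) = c ->
    co ax C = q%:R^-1.
  by move=> hC ec; apply: (mulfI cq0); rewrite (ABx_co hC) ec mulfK // gt_eqF.
case: cas => -[ed ea eb er [hc1 hc2]]; case: ax fin => fin.
- have [||||C hC] := @AB_pt c 0 p2; rewrite /ncond ?ed ?er; try (move: hc1 hc2 c0; clear; lia); try ring.
  exists C, c; rewrite /lmin er; split=> //.
  + by apply: (fin C c); rewrite /lmin ?er // ?ed; ring.
  + by rewrite /e /eps /l0 ed ea /=; move: c0; clear; lia.
- have [||||C hC] := @AB_pt 0 c 1; rewrite /ncond ?ed ?er; try (move: hc1 hc2 c0; clear; lia); try ring.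
  exists C, c; rewrite /lmin; split=> //.
  + by apply: (fin C c); rewrite /lmin // ?ed; ring.
  + by rewrite /e /eps /l0 eb /=; move: c0; clear; lia.
- have [||||C hC] := @AB_pt (p - c) 1 (q%:Z - p2); rewrite /ncond ?ed ?er; try (move: hc1 hc2 c0; clear; lia).
    by rewrite mulrBr mulrC inv ed; ring.
  exists C, (p - c); rewrite /lmin er; split=> //.
  + by apply: (fin C (p - c)); rewrite /lmin ?er // ?ed; ring.
  + by rewrite /e /eps /l0 ed ea /=; move: c0; clear; lia.
- have [||||C hC] := @AB_pt 0 c 1; rewrite /ncond ?ed ?er; try (move: hc1 hc2 c0; clear; lia); try ring.
  exists C, c; rewrite /lmin; split=> //.
  + by apply: (fin C c); rewrite /lmin // ?ed; ring.
  + by rewrite /e /eps /l0 eb /=; move: c0; clear; lia.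
Qed.

Let fork_hi ax : exists C o, [/\ ABx ax C (lmax ax) o, co ax C = 1 - q%:R^-1 &
  forall o', 0 <= - e ax * (o' - l0 (~~ ax)) <= c - 1 -> - c < eps ax * (o - o')].
Proof.
have cn0 : cR != 0 by have h := c0R; rewrite gt_eqF //; lra.
have fin C o : ABx ax C (lmax ax) o ->
    (if ax then p * lmax ax + dl * o else p2 * lmax ax + o) = c * q%:Z - c ->
    co ax C = 1 - q%:R^-1.
  move=> hC ec; apply: (mulfI cq0); rewrite (ABx_co hC) ec rmorphB rmorphM /= -/cR -/qR mulrBr mulr1 mulfK //.
  by rewrite gt_eqF.
case: cas => -[ed ea eb er [hc1 hc2]]; case: ax fin => fin.
- have [||||C hC] := @AB_pt (p - 1 - c) (p2 - 1) (q%:Z - p2); rewrite /ncond ?ed ?er;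
    try (move: hc1 hc2 c0; clear; lia).
    have -> : p2 * (p - 1 - c) + (p2 - 1) = p * p2 - 1 - p2 * c by ring.
    by rewrite inv ed; ring.
  have le : 0 + p2 - 1 = p2 - 1 by rewrite add0r.
  exists C, (p - 1 - c); rewrite /lmax er le; split=> //.
  + apply: (fin C (p - 1 - c)); rewrite /lmax ?er ?le // ?ed mulrBr inv ed; ring.
  + by rewrite /e /eps /l0 ed ea /=; move: hc1 hc2 c0; clear; lia.
- have [||||C hC] := @AB_pt (p - 1) (p2 - 1 - c) (q%:Z - 1); rewrite /ncond ?ed ?er;
    try (move: hc1 hc2 c0; clear; lia).
    have -> : p2 * (p - 1) + (p2 - 1 - c) = p * p2 - 1 - c by ring.
    by rewrite inv ed; ring.
  exists C, (p2 - 1 - c); rewrite /lmax; split=> //.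
  + apply: (fin C (p2 - 1 - c)); rewrite /lmax // mulrBr [p2 * p]mulrC inv ed; ring.
  + by rewrite /e /eps /l0 eb /=; move: hc1 hc2 c0; clear; lia.
- have [||||C hC] := @AB_pt (c - 1) p2 p2; rewrite /ncond ?ed ?er; try (move: hc1 hc2 c0; clear; lia); try ring.
  have le : 1 + p2 - 1 = p2 by rewrite [1 + p2]addrC addrK.
  exists C, (c - 1); rewrite /lmax er le; split=> //.
  + apply: (fin C (c - 1)); rewrite /lmax ?er ?le // ?ed inv ed; ring.
  + by rewrite /e /eps /l0 ed ea /=; move: hc1 hc2 c0; clear; lia.
- have [||||C hC] := @AB_pt (p - 1) (p2 + 1 - c) (q%:Z - 1); rewrite /ncond ?ed ?er;
    try (move: hc1 hc2 c0; clear; lia).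
    have -> : p2 * (p - 1) + (p2 + 1 - c) = p * p2 + 1 - c by ring.
    by rewrite inv ed; ring.
  exists C, (p2 + 1 - c); rewrite /lmax; split=> //.
  + apply: (fin C (p2 + 1 - c)); rewrite /lmax // mulrBr [p2 * p]mulrC inv ed; ring.
  + by rewrite /e /eps /l0 eb /=; move: hc1 hc2 c0; clear; lia.
Qed.

(** Coming from the corners, the path reaches [C], climbs along the first level to the spine,
    follows the spine through the centre to the last level, and climbs along that level to [D]. *)
Lemma pin_paths ax : exists lo up, paths K (co ax) (co (~~ ax)) (goodp ax) lo up.
Proof.
have [X0 hX0] := Opt ax; have lr := l0_range ax.
have [C [oC [hC sC fC]]] := fork_lo ax; have [D [oD [hD sD fD]]] := fork_hi ax.
have [CV nC _ _] := ABx_lev hC; have [DV nD _ _] := ABx_lev hD.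
have e1 : l0 ax - (absz (l0 ax - lmin ax))%:Z = lmin ax.
  by rewrite gez0_abs; [ring | move: lr; clear; lia].
have e2 : l0 ax + (absz (lmax ax - l0 ax))%:Z = lmax ax.
  by rewrite gez0_abs; [ring | move: lr; clear; lia].
have := down (n := absz (l0 ax - lmin ax)) hX0; rewrite e1 lexx => /(_ isT)[X [[oX [hX wX]] cX]].
have := upw (n := absz (lmax ax - l0 ax)) hX0; rewrite e2 lexx => /(_ isT)[Y [[oY [hY wY]] cY]].
have cC : cn ax C X by apply: (climb_to (or_introl erefl) hC hX); apply: fC; rewrite -[e ax]mul1r.
have cD : cn ax Y D by apply: (climb_to (or_intror erefl) hY hD); apply: fD; rewrite -[e ax]mul1r -mulNr.
apply: (finish_paths q0 cop uV mV K1 K4 CV DV nC nD sC sD).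
  exact: conn_trans cC (conn_trans cX (conn_trans cY cD)).
have /andP[latC _] : lat q p C && insq C by rewrite -mV.
have /andP[latD _] : lat q p D && insq D by rewrite -mV.
have lc (a b : R) : onb a -> onb b -> lat q p (mkp ax a b).
  move=> ha hb; have : mkp ax a b \in V by apply: (corner_mkp mV).
  by rewrite mV => /andP[].
have o0 : onb (0 : R) by rewrite /onb eqxx.
have o1 : onb (1 : R) by rewrite /onb eqxx orbT.
move=> b hb; split; apply: good_unit; rewrite ?lc //.
- by rewrite (mkpE ax 0 b).1 sC subr0.
- by rewrite (mkpE ax 1 b).1 sD; ring.
Qed.

End Pinwheel.

Theorem pinwheel_square (R : realType) (q : nat) (p p2 c dl : int) : (0 < q)%N -> 1 <= c ->
  p * p2 = dl + c * q%:Z -> p < q%:Z -> p2 < q%:Z ->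
  [/\ dl = 1, 2 * c + 1 <= p & 2 * c + 1 <= p2] \/ [/\ dl = -1, 2 * c <= p & 2 * c <= p2] ->
  exists (K : seq (R * R) -> Prop) lo up L U, [/\ square q p K, paths K fst snd (goodp q p true) lo up &
    paths K snd fst (goodp q p false) L U].
Proof.
move=> q0 c0 inv pq p2q cas.
have [a0 [b0 [r0 cas']]] : exists a0 b0 r0 : int,
  [/\ dl = 1, a0 = c, b0 = c, r0 = 0 & 2 * c + 1 <= p /\ 2 * c + 1 <= p2] \/
  [/\ dl = -1, a0 = p - c, b0 = c + 1, r0 = 1 & 2 * c <= p /\ 2 * c <= p2].
  case: cas => -[e h h']; [exists c, c, 0; left | exists (p - c), (c + 1), 1; right]; split; auto.
have cop : exists u v : int, u * p + v * q%:Z = 1.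
  exists (dl * p2), (- dl * c).
  have -> : dl * p2 * p + - dl * c * q%:Z = dl * (p * p2 - c * q%:Z) by ring.
  by rewrite inv; case: cas => -[-> _ _]; ring.
have [V [uV mV]] := @square_points R q p q0.
have [K [K1 K2 K3 K4]] := lp cs2 uV (pin_costs R p p2 dl a0 b0).
exists K.
have [lo [up h1]] := pin_paths q0 c0 inv pq p2q cas' uV mV K1 K4 true.
have [L [U h2]] := pin_paths q0 c0 inv pq p2q cas' uV mV K1 K4 false.
exists lo, up, L, U; split=> //.
have vt := pin_vert inv cas' mV.
exact: (LP_square uV mV K1 K2 K3 K4 vt).
Qed.

(** * Periodic triangulations of the plane *)

Section Hat.
Variables (R : realType) (T : eqType).
Implicit Types (s l : seq T) (w : T -> R).

Lemma E_perm s s' w (f : T -> R) : perm_eq s s' -> E s w f = E s' w f.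
Proof. exact: perm_big. Qed.

Lemma rep_perm (cs : seq (T -> R)) s s' w b : perm_eq s s' -> rep cs s w b -> rep cs s' w b.
Proof.
move=> e [h1 h2 h3 h4]; split=> //.
- by move=> p; rewrite -(perm_mem e); exact: h2.
- by rewrite -(E_perm _ _ e).
- by rewrite -h4; apply: eq_map => c; rewrite (E_perm _ _ e).
Qed.

Definition hat (x : R) := Num.max 0 (1 - `|x|).

(** Only two consecutive integral values occur on the support, so the mean determines how the mass
    is divided between them. *)
Lemma hat_mass s w (f : T -> R) : (forall p, 0 <= w p) -> E s w (fun _ => 1) = 1 ->
  {in s, forall p, w p != 0 -> f p \is a Num.int} ->
  {in s &, forall p p', w p != 0 -> w p' != 0 -> `|f p - f p'| <= 1} ->
  forall r, r \is a Num.int -> E s w (fun p => (f p == r)%:R) = hat (E s w f - r).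
Proof.
move=> w0 w1 fi fd r ri.
have [p0 [p0s wp0]] : exists p0, p0 \in s /\ w p0 != 0.
  apply: contrapT => hn; have : E s w (fun _ => 1) = 0.
    rewrite /E big_seq big1 // => p ps; have [->|wp] := eqVneq (w p) 0; first by rewrite mul0r.
    by case: hn; exists p.
  by rewrite w1 => /eqP; rewrite oner_eq0.
have [v [vi hv]] : exists v, v \is a Num.int /\ {in s, forall p, w p != 0 -> f p = v \/ f p = v + 1}.
  have i0 := fi _ p0s wp0.
  have [[p1 [p1s wp1 lt]]|hn] := pselect (exists p1, [/\ p1 \in s, w p1 != 0 & f p1 < f p0]).
  - have i1 := fi _ p1s wp1; exists (f p1); split=> // p ps wp; have ip := fi _ ps wp.
    have := int_gap i1 i0 lt; have := fd _ _ ps p1s wp wp1; have := fd _ _ ps p0s wp wp0.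
    have := fd _ _ p1s p0s wp1 wp0; rewrite !ler_norml => h1 h2 h3 h4.
    have [h|h] := leP (f p) (f p1); first by left; lra.
    by right; have := int_gap i1 ip h; lra.
  - exists (f p0); split=> // p ps wp; have ip := fi _ ps wp.
    have h1 : f p0 <= f p by rewrite leNgt; apply/negP => h; apply: hn; exists p.
    have := fd _ _ ps p0s wp wp0; rewrite ler_norml => h2.
    have [h|h] := leP (f p) (f p0); first by left; lra.
    by right; have := int_gap i0 ip h; lra.
have Econst c : E s w (fun _ => c) = c.
  by rewrite -[RHS]mulr1 -w1 -EZ; apply: eq_E => p _; rewrite mulr1.
have aff a b : E s w (fun p => a + b * f p) = a + b * E s w f.
  by rewrite (ED s w (fun _ => a)) EZ Econst.
have eqw (g h : T -> R) : {in s, forall p, w p != 0 -> g p = h p} -> E s w g = E s w h.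
  move=> gh; apply: eq_big_seq => p ps; have [->|wp] := eqVneq (w p) 0; first by rewrite !mul0r.
  by rewrite gh.
have lo : v <= E s w f.
  by rewrite -[leLHS]Econst; apply: E_le => // p ps wp; case: (hv p ps wp) => ->; lra.
have hi : E s w f <= v + 1.
  by rewrite -[leRHS]Econst; apply: E_le => // p ps wp; case: (hv p ps wp) => ->; lra.
rewrite /hat; have [er|nr] := eqVneq r v.
  rewrite (eqw _ (fun p => (1 + v) + (-1) * f p)) ?aff => [|p ps wp].
    by rewrite er ger0_norm ?subr_ge0 // max_r; lra.
  by rewrite er; case: (hv p ps wp) => ->; [rewrite eqxx /=; ring | rewrite -subr_eq0 addrAC subrr add0r oner_eq0 /=; ring].
have [er|nr'] := eqVneq r (v + 1).
  rewrite (eqw _ (fun p => (- v) + 1 * f p)) ?aff => [|p ps wp].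
    by rewrite er ler0_norm ?max_r; lra.
  by rewrite er; case: (hv p ps wp) => ->; [rewrite -subr_eq0 opprD addrA subrr add0r oppr_eq0 oner_eq0 /=; ring | rewrite eqxx /=; ring].
rewrite (eqw _ (fun p => 0)) ?Econst => [|p ps wp]; last first.
  by case: (hv p ps wp) => ->; rewrite eq_sym ?(negbTE nr) ?(negbTE nr').
have [h|h] := leP r v.
  have := int_gap ri vi; rewrite lt_neqAle nr h => /(_ isT) h'.
  by rewrite ger0_norm ?max_l; lra.
have vi1 : v + 1 \is a Num.int by rewrite rpredD ?rpred1.
have h1 := int_gap vi ri h.
have := int_gap vi1 ri; rewrite lt_neqAle eq_sym nr' h1 => /(_ isT) h'.
by rewrite ler0_norm ?max_l; lra.
Qed.

End Hat.

Section Grid.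
Variable R : realType.
Notation P2 := (R * R)%type.
Variables (q : nat) (p : int) (K : seq P2 -> Prop).
Hypothesis q0 : (0 < q)%N.
Hypothesis cop : exists u v : int, u * p + v * q%:Z = 1.
Hypothesis sqK : square q p K.

Definition sh (m n : int) (P : P2) : P2 := (P.1 + m%:~R, P.2 + n%:~R).

Lemma shK m n : cancel (sh m n) (sh (- m) (- n)).
Proof. by move=> P; rewrite /sh /= !rmorphN /= !addrK -surjective_pairing. Qed.

Lemma shK' m n : cancel (sh (- m) (- n)) (sh m n).
Proof. by move=> P; rewrite /sh /= !rmorphN /= !subrK -surjective_pairing. Qed.

Definition shift m n l := map (sh m n) l.

(* The translates of the triangulated square tile the plane. *)
Definition grid l := exists m n l0, K l0 /\ l = shift m n l0.

Lemma mem_shift m n l P : (P \in shift m n l) = (sh (- m) (- n) P \in l).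
Proof.
apply/mapP/idP => [[Q Ql ->]|h]; first by rewrite shK.
by exists (sh (- m) (- n) P); rewrite ?shK'.
Qed.

Lemma rep2_unshift m n l w B : rep2 (shift m n l) w B -> rep2 l (w \o sh m n) (sh (- m) (- n) B).
Proof.
move=> [w0 ws w1 [e1 e2]].
have eE (f : P2 -> R) : E (shift m n l) w f = E l (w \o sh m n) (f \o sh m n) by rewrite /E big_map.
have mass : E l (w \o sh m n) (fun _ => 1) = 1 by rewrite -[RHS]w1 eE.
have ec (c : R) : E l (w \o sh m n) (fun _ => c) = c.
  by rewrite -[RHS]mulr1 -mass -EZ; apply: eq_E => X _; rewrite mulr1.
split=> // [P|P Pl|].
- exact: w0.
- by apply: ws; rewrite mem_shift shK.
- rewrite /= -e1 -e2 !eE /= !rmorphN /=; congr [:: _; _].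
  + by rewrite (ED l _ fst (fun _ => m%:~R)) ec addrK.
  + by rewrite (ED l _ snd (fun _ => n%:~R)) ec addrK.
Qed.

Lemma rep2_shift m n l w B : rep2 l w B ->
  rep2 (shift m n l) (w \o sh (- m) (- n)) (sh m n B).
Proof.
move=> [w0 ws w1 [e1 e2]].
have eE (f : P2 -> R) : E (shift m n l) (w \o sh (- m) (- n)) f = E l w (f \o sh m n).
  by rewrite /E big_map; apply: eq_bigr => X _ /=; rewrite shK.
have ec (c : R) : E l w (fun _ => c) = c.
  by rewrite -[RHS]mulr1 -w1 -EZ; apply: eq_E => X _; rewrite mulr1.
split=> [P|P Pl||] /=.
- exact: w0.
- by apply: ws; rewrite -mem_shift.
- by rewrite eE.
- rewrite !eE; congr [:: _; _].
  + by rewrite (ED l w fst (fun _ => m%:~R)) ec e1.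
  + by rewrite (ED l w snd (fun _ => n%:~R)) ec e2.
Qed.

Lemma grid_uniq l : grid l -> uniq l.
Proof.
move=> [m [n [l0 [Kl ->]]]]; rewrite map_inj_uniq ?(sq_uniq sqK Kl) //; exact: can_inj (shK m n).
Qed.

Lemma lat_sh m n P : lat q p (sh m n P) = lat q p P.
Proof.
have sub (m' n' : int) P' : lat q p P' -> lat q p (sh m' n' P').
  move=> l; have l' : lat q p ((m'%:~R, n'%:~R) : P2) by apply: lat_int; rewrite intr_int.
  exact: lat_add l l'.
by apply/idP/idP => [/(sub (- m) (- n))|/sub//]; rewrite shK.
Qed.

Lemma grid_lat l P : grid l -> P \in l -> lat q p P.
Proof. by move=> [m [n [l0 [Kl ->]]]]; rewrite mem_shift => /(sq_lat sqK Kl); rewrite lat_sh. Qed.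

Lemma grid_sq_cover m n B : insq (sh (- m) (- n) B) ->
  exists l0 w, [/\ K l0, rep2 (shift m n l0) w B & {in shift m n l0, forall P, 0 < w P}].
Proof.
move=> /(sq_cover sqK)[l0 [w [Kl r pos]]].
exists l0, (w \o sh (- m) (- n)); split=> //; first by rewrite -[B](shK' m n); exact: rep2_shift.
by move=> P; rewrite mem_shift => /pos.
Qed.

Lemma floor_sq (B : P2) : insq (sh (- Num.floor B.1) (- Num.floor B.2) B).
Proof.
have := floor_itv B.1; have := floor_itv B.2.
by rewrite !intrD !rmorph1 /insq /sh /= !rmorphN /=; lra.
Qed.

Lemma grid_cover B : exists l w, [/\ grid l, rep2 l w B & {in l, forall P, 0 < w P}].
Proof.
have [l0 [w [h1 h2 h3]]] := grid_sq_cover (floor_sq B).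
by exists (shift (Num.floor B.1) (Num.floor B.2) l0), w; split=> //; do 3!eexists; split; first exact: h1.
Qed.

Definition corner ax (m n : int) : int := if ax then m else n.

Lemma co_sh ax m n P : co ax (sh m n P) = co ax P + (corner ax m n)%:~R.
Proof. by case: ax. Qed.

Lemma sq_bounds ax m n l0 P : K l0 -> P \in shift m n l0 ->
  (corner ax m n)%:~R <= co ax P <= (corner ax m n)%:~R + 1.
Proof.
move=> Kl; rewrite mem_shift => /(sq_in sqK Kl) /andP[h1 h2].
by rewrite /co /corner; move: h1 h2; rewrite /sh /= !rmorphN /=; case: ax; lra.
Qed.

Lemma co_le ax l w (B : P2) (c : R) : rep2 l w B -> (forall P, w P != 0 -> c <= co ax P) -> c <= co ax B.
Proof.
move=> r h; rewrite -subr_ge0; have [al [be [ga hl]]] : exists al be ga, forall P : P2, co ax P - c = al + be * P.1 + ga * P.2.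
  by rewrite /co; case: (ax); [exists (- c), 1, 0 | exists (- c), 0, 1] => P; ring.
by apply: (rep2_le (l := fun P => co ax P - c) r hl) => P /h; rewrite subr_ge0.
Qed.

Lemma co_ge ax l w (B : P2) (c : R) : rep2 l w B -> (forall P, w P != 0 -> co ax P <= c) -> co ax B <= c.
Proof.
move=> r h; rewrite -subr_ge0; have [al [be [ga hl]]] : exists al be ga, forall P : P2, c - co ax P = al + be * P.1 + ga * P.2.
  by rewrite /co; case: (ax); [exists c, (-1), 0 | exists c, 0, (-1)] => P; ring.
by apply: (rep2_le (l := fun P => c - co ax P) r hl) => P /h; rewrite subr_ge0.
Qed.

Lemma co_face_lo ax l w (B : P2) (c : R) : rep2 l w B -> (forall P, w P != 0 -> c <= co ax P) ->
  co ax B <= c -> forall P, w P != 0 -> co ax P = c.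
Proof.
move=> r h le P wP; have [al [be [ga hl]]] : exists al be ga, forall P : P2, co ax P - c = al + be * P.1 + ga * P.2.
  by rewrite /co; case: (ax); [exists (- c), 1, 0 | exists (- c), 0, 1] => X; ring.
have : co ax P - c = 0.
  by apply: (rep2_face r hl) wP => [X /h|]; [rewrite subr_ge0 | rewrite subr_le0].
lra.
Qed.

Lemma co_face_hi ax l w (B : P2) (c : R) : rep2 l w B -> (forall P, w P != 0 -> co ax P <= c) ->
  c <= co ax B -> forall P, w P != 0 -> co ax P = c.
Proof.
move=> r h le P wP; have [al [be [ga hl]]] : exists al be ga, forall P : P2, c - co ax P = al + be * P.1 + ga * P.2.
  by rewrite /co; case: (ax); [exists c, (-1), 0 | exists c, 0, (-1)] => X; ring.
have : c - co ax P = 0.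
  by apply: (rep2_face r hl) wP => [X /h|]; [rewrite subr_ge0 | rewrite subr_le0].
lra.
Qed.

Lemma sq_line ax m n l0 w B (c : int) : K l0 -> rep2 (shift m n l0) w B ->
  (co ax B <= c%:~R -> forall P, w P != 0 -> co ax P <= c%:~R) /\
  (c%:~R <= co ax B -> forall P, w P != 0 -> c%:~R <= co ax P).
Proof.
move=> Kl r; have inl P : w P != 0 -> P \in shift m n l0 by case: r => _ h _ _; apply: contraNT => /h ->.
have bd P : w P != 0 -> _ := fun wP => sq_bounds ax Kl (inl P wP).
set M := corner ax m n in bd.
have [hM|hM] := ltP c (M + 1).
- have hR : (c%:~R : R) <= M%:~R by rewrite ler_int; move: hM; clear; lia.
  split=> h P wP; last by have := bd P wP; lra.
  have e : co ax P = M%:~R.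
    by apply: (co_face_lo r _ _ wP) => [X /bd|]; lra.
  suff : (M%:~R : R) <= c%:~R by rewrite e.
  have : M%:~R <= co ax B by apply: (co_le r) => X /bd; lra.
  lra.
- have hR : (M%:~R : R) + 1 <= c%:~R by rewrite -(intrD _ M 1) ler_int.
  split=> h P wP; first by have := bd P wP; lra.
  have e : co ax P = M%:~R + 1.
    by apply: (co_face_hi r _ _ wP) => [X /bd|]; lra.
  have : co ax B <= M%:~R + 1 by apply: (co_ge r) => X /bd; lra.
  lra.
Qed.

Lemma grid_line ax l w B (c : int) : grid l -> rep2 l w B ->
  (co ax B <= c%:~R -> forall P, w P != 0 -> co ax P <= c%:~R) /\
  (c%:~R <= co ax B -> forall P, w P != 0 -> c%:~R <= co ax P).
Proof. by move=> [m [n [l0 [Kl ->]]]]; exact: sq_line. Qed.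

(* On the integral lines every triangulation of the square induces the unit subdivision. *)
Lemma grid_hat ax l w B : grid l -> rep2 l w B -> co ax B \is a Num.int ->
  forall P, w P = if (co ax P == co ax B) && (co (~~ ax) P \is a Num.int)
                  then hat (co (~~ ax) B - co (~~ ax) P) else 0.
Proof.
move=> gl r /intrP[c ec] P; have [m [n [l0 [Kl el]]]] := gl.
have ul := grid_uniq gl.
have inl X : w X != 0 -> X \in l by case: r => _ h _ _; apply: contraNT => /h ->.
have [h1 h2] := grid_line ax c gl r.
have on X : w X != 0 -> co ax X = c%:~R.
  by move=> wX; apply/le_anti; rewrite (h1 _ _ wX) ?(h2 _ _ wX) // ec lexx.
have oint X : w X != 0 -> co (~~ ax) X \is a Num.int.
  move=> wX; have h := lat_x cop (grid_lat gl (inl X wX)); have := on X wX.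
  by rewrite /co; case: (ax) => /= o; [rewrite -h o intr_int | rewrite h o intr_int].
have [w0 ws w1 [e1 e2]] := r.
have [/andP[/eqP eP iP]|nP] := boolP ((co ax P == co ax B) && (co (~~ ax) P \is a Num.int)); last first.
  by apply/eqP; apply: contraNT nP => wP; rewrite on // ec eqxx /=; exact: oint.
have eco : co (~~ ax) B = E l w (co (~~ ax)) by rewrite /co; case: (ax).
rewrite eco -(@hat_mass R _ l w (co (~~ ax)) w0 w1 _ _ (co (~~ ax) P) iP).
- have [Pl|Pl] := boolP (P \in l).
    rewrite -(E_pick ul w Pl) /E; apply: eq_big_seq => X _.
    have [->|wX] := eqVneq (w X) 0; first by rewrite !mul0r.
    suff -> : (co (~~ ax) X == co (~~ ax) P) = (X == P) by []; apply/eqP/eqP => [e|->] //; have e' := on X wX; rewrite -ec -eP in e'.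
    by rewrite (surjective_pairing X) (surjective_pairing P); move: e e'; rewrite /co; case: (ax) => /= -> ->.
  rewrite ws // /E big_seq big1 // => X Xl; have [->|wX] := eqVneq (w X) 0; first by rewrite mul0r.
  suff -> : co (~~ ax) X == co (~~ ax) P = false by rewrite mulr0.
  apply: contraNF Pl => /eqP e; have e' := on X wX; rewrite -ec -eP in e'.
  suff <- : X = P by [].
  by rewrite (surjective_pairing X) (surjective_pairing P); move: e e'; rewrite /co; case: (ax) => /= -> ->.
- by move=> X Xl; exact: oint.
- move=> X Y Xl Yl _ _; rewrite el in Xl Yl.
  have := sq_bounds (~~ ax) Kl Xl; have := sq_bounds (~~ ax) Kl Yl; rewrite ler_norml; lra.
Qed.

(** On an integral line [grid_hat] gives the weights explicitly. Off these lines the point is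
    interior to a unit square, which both cells must belong to, and uniqueness in that square
    applies. *)
Lemma grid_same l1 l2 w1 w2 B : grid l1 -> grid l2 -> rep2 l1 w1 B -> rep2 l2 w2 B -> w1 =1 w2.
Proof.
move=> g1 g2 r1 r2 P.
have [i1|i1] := boolP (co true B \is a Num.int); first by rewrite (grid_hat g1 r1 i1) (grid_hat g2 r2 i1).
have [i2|i2] := boolP (co false B \is a Num.int); first by rewrite (grid_hat g1 r1 i2) (grid_hat g2 r2 i2).
have [m1 [n1 [l1' [K1 e1]]]] := g1; have [m2 [n2 [l2' [K2 e2]]]] := g2.
rewrite e1 in r1; rewrite e2 in r2.
have loc m n l w ax : co ax B \isn't a Num.int -> K l -> rep2 (shift m n l) w B ->
    corner ax m n = Num.floor (co ax B).
  move=> ni Kl r.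
  have inl X : w X != 0 -> X \in shift m n l by case: r => _ h _ _; apply: contraNT => /h ->.
  have h1 : (corner ax m n)%:~R <= co ax B.
    by apply: (co_le r) => X /inl /(sq_bounds ax Kl) /andP[].
  have h2 : co ax B <= (corner ax m n)%:~R + 1.
    by apply: (co_ge r) => X /inl /(sq_bounds ax Kl) /andP[].
  apply/esym/floor_def; rewrite h1 intrD /= lt_neqAle h2 andbT.
  by apply: contraNneq ni => ->; rewrite rpredD ?intr_int ?rpred1.
have := loc _ _ _ _ true i1 K1 r1; have := loc _ _ _ _ true i1 K2 r2.
have := loc _ _ _ _ false i2 K1 r1; have := loc _ _ _ _ false i2 K2 r2.
rewrite /corner => en2 en1 em2 em1; subst m1 m2 n1 n2.
have := sq_same sqK K1 K2 (rep2_unshift r1) (rep2_unshift r2) (sh (- Num.floor (co true B)) (- Num.floor (co false B)) P).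
by rewrite /= shK'.
Qed.

Lemma grid_in l w B m n : grid l -> rep2 l w B -> {in l, forall P, 0 < w P} ->
  insq (sh (- m) (- n) B) -> exists2 l0, K l0 & perm_eq l (shift m n l0).
Proof.
move=> gl r pos /grid_sq_cover[l0 [w' [K0 r' pos']]].
have g0 : grid (shift m n l0) by do 3!eexists; split; first exact: K0.
exists l0 => //; apply: uniq_perm; [exact: grid_uniq | exact: grid_uniq|] => P.
have e := grid_same gl g0 r r' P.
have [_ ws _ _] := r; have [_ ws' _ _] := r'.
apply/idP/idP => Pl; apply: contraT => nP.
- by have := pos P Pl; rewrite e ws' // ltxx.
- by have := pos' P Pl; rewrite -e ws // ltxx.
Qed.

Section Curves.
Variables (ax : bool) (good : P2 -> P2 -> Prop) (lo up : R -> R).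
Hypothesis pK : paths K (co ax) (co (~~ ax)) good lo up.

Definition per (f : R -> R) (x : R) := f (x - (Num.floor x)%:~R).

(** For [i > 0] the curve [i] lies in the row below height [i], and the curve 0 in the row above
    height 0. For [j > 0] the curves 0, ..., j thus stay inside a rectangle of height [j]. Each
    passes through the integral points of its own height. *)
Definition curve (i : nat) (x : R) := if i is i'.+1 then i'%:R + per up x else per lo x.

Let axes : @co R ax = fst /\ @co R (~~ ax) = snd \/ @co R ax = snd /\ @co R (~~ ax) = fst.
Proof. by rewrite /co; case: (ax); [left | right]. Qed.

Lemma fracP (x : R) : 0 <= x - (Num.floor x)%:~R <= 1.
Proof. by have := floor_itv x; rewrite intrD rmorph1; lra. Qed.

Lemma per_bnd x : [/\ 0 <= per lo x, per lo x <= per up x & per up x <= 1].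
Proof. by have [h1 [h2 h3]] := pth_bnd pK (fracP x). Qed.

Lemma per_eq (f : R -> R) (m : int) x : f 0 = f 1 -> 0 <= x - m%:~R <= 1 -> per f x = f (x - m%:~R).
Proof.
move=> e hx; have [e1|ne] := eqVneq (x - m%:~R) 1.
  rewrite e1 -e /per; have -> : Num.floor x = m + 1.
    by apply: floor_def; rewrite !intrD /=; lra.
  by rewrite intrD opprD addrA e1 subrr.
by rewrite /per (_ : Num.floor x = m) //; apply: floor_def; rewrite intrD /=; move: ne; rewrite lt_neqAle => ne; lra.
Qed.

Lemma curve_int i (c : int) : curve i c%:~R = (i : nat)%:R.
Proof.
have [l0 l1 u0 u1] := pth_ends pK.
have e0 : (c%:~R - c%:~R : R) = 0 by rewrite subrr.
case: i => [|i]; rewrite /curve (@per_eq _ c) ?e0 ?l0 ?u0 ?l1 ?u1 ?lexx ?ler01 //.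
by rewrite -natr1.
Qed.

Lemma curve_bnd i x : (i.-1)%:R <= curve i x <= i%:R \/ i = 0%N /\ 0 <= curve i x <= 1.
Proof.
have [h1 h2 h3] := per_bnd x; case: i => [|i]; [right | left]; rewrite /curve /=; first by split=> //; lra.
by rewrite -natr1; lra.
Qed.

Lemma curve_mono i x : curve i x <= curve i.+1 x.
Proof.
have [h1 h2 h3] := per_bnd x; case: i => [|i] /=; first by lra.
by rewrite -natr1; lra.
Qed.

Definition strip_row (i : nat) : int := i.-1%:Z.

Lemma curve_row i x : (strip_row i)%:~R <= curve i x <= (strip_row i)%:~R + 1.
Proof.
rewrite /strip_row; case: (curve_bnd i x) => [|[-> h]]; last by rewrite /= add0r.
case: i => [|i] /=; last by rewrite -natr1.
by have [h1 h2 h3] := per_bnd x; move=> _; rewrite add0r; lra.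
Qed.

Let pth i : exists f, [/\ pathI K (co ax) (co (~~ ax)) good 0 1 f, f 0 = f 1 &
  forall x, curve i x = (strip_row i)%:~R + per f x].
Proof.
have [l0 l1 u0 u1] := pth_ends pK.
case: i => [|i]; [exists lo | exists up]; split=> //; rewrite ?l0 ?u0 //.
- exact: (pth_lo pK).
- by move=> x; rewrite /curve /strip_row /= add0r.
- exact: (pth_up pK).
Qed.

Let square_of i B : (strip_row i)%:~R <= co (~~ ax) B <= (strip_row i)%:~R + 1 ->
  exists m n, [/\ insq (sh (- m) (- n) B), corner ax m n = Num.floor (co ax B) & corner (~~ ax) m n = strip_row i].
Proof.
move=> h; exists (if ax then Num.floor (co ax B) else strip_row i), (if ax then strip_row i else Num.floor (co ax B)).
have := fracP (co ax B); rewrite /insq /sh /corner; move: h; rewrite /co; case: (ax) => /= h f;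
  rewrite !rmorphN /=; split=> //; lra.
Qed.

(** Beyond the row of the curve an integral line already separates. Within the row the cell is a
    translate of a cell of the square, where [path_side] applies. *)
Lemma grid_curve i l w B w' B' : grid l -> rep2 l w B -> {in l, forall P, 0 < w P} -> rep2 l w' B' ->
  (co (~~ ax) B <= curve i (co ax B) -> co (~~ ax) B' <= curve i (co ax B')) /\
  (curve i (co ax B) <= co (~~ ax) B -> curve i (co ax B') <= co (~~ ax) B').
Proof.
move=> gl r pos r'.
have cB := curve_row i (co ax B); have cB' := curve_row i (co ax B').
have inl X : w' X != 0 -> w X != 0.
  by move=> wX; rewrite gt_eqF // pos //; case: r' => _ h _ _; apply: contraNT wX => /h ->.
have [lt|ge] := ltP (co (~~ ax) B) (strip_row i)%:~R.
  split=> h; last lra.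
  have [h1 _] := grid_line (~~ ax) (strip_row i) gl r.
  have : co (~~ ax) B' <= (strip_row i)%:~R by apply: (co_ge r') => X /inl; apply: h1; lra.
  lra.
have [gt|le] := ltP ((strip_row i)%:~R + 1) (co (~~ ax) B).
  split=> h; first lra.
  have [_ h1] := grid_line (~~ ax) (strip_row i + 1) gl r; rewrite intrD /= in h1.
  have : (strip_row i)%:~R + 1 <= co (~~ ax) B' by apply: (co_le r') => X /inl; apply: h1; lra.
  lra.
have [|m [n [iB em en]]] := @square_of i B; first by rewrite ge le.
have [l0 K0 pe] := grid_in gl r pos iB.
have [f [pf f01 fE]] := pth i.
have u := rep2_unshift (rep_perm pe r); have u' := rep2_unshift (rep_perm pe r').
have pos0 : {in l0, forall P, 0 < (w \o sh m n) P}.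
  by move=> P Pl /=; apply: pos; rewrite (perm_mem pe) mem_shift shK.
have bd P : P \in l0 -> 0 <= co ax P <= 1.
  by move=> Pl; have /andP[] := sq_in sqK K0 Pl; rewrite /co; case: (ax).
have [g1 g2] := path_side axes pf K0 bd u pos0 u'.
have cs ax' X : co ax' (sh (- m) (- n) X) = co ax' X - (corner ax' m n)%:~R.
  by rewrite co_sh /corner; case: (ax'); rewrite rmorphN.
rewrite !cs em en in g1 g2.
have inB' : 0 <= co ax B' - (corner ax m n)%:~R <= 1.
  have := co_le (ax := ax) (c := (corner ax m n)%:~R) r'.
  have := co_ge (ax := ax) (c := (corner ax m n)%:~R + 1) r'.
  have ins X : w' X != 0 -> X \in shift m n l0.
    by move=> wX; rewrite -(perm_mem pe); case: r' => _ h _ _; apply: contraNT wX => /h ->.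
  move=> a1 a2.
  have {}a1 : co ax B' <= (corner ax m n)%:~R + 1 by apply: a1 => X /ins /(sq_bounds ax K0) /andP[].
  have {}a2 : (corner ax m n)%:~R <= co ax B' by apply: a2 => X /ins /(sq_bounds ax K0) /andP[].
  lra.
rewrite em in inB'.
rewrite !fE (per_eq f01 (fracP (co ax B))) (per_eq f01 inB').
by split=> h; [have := g1 | have := g2]; lra.
Qed.

Lemma grid_good i l P P' : grid l -> perm_eq l [:: P; P'] ->
  (forall w B, rep2 l w B -> co (~~ ax) B = curve i (co ax B)) ->
  exists P0 P0' m n, [/\ P = sh m n P0, P' = sh m n P0' & good P0 P0' \/ good P0' P0].
Proof.
move=> gl pl on.
have ul := grid_uniq gl.
have PP' : P != P' by move: ul; rewrite (perm_uniq pl) /= inE andbT.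
have Pl : P \in l by rewrite (perm_mem pl) !inE eqxx.
have Pl' : P' \in l by rewrite (perm_mem pl) !inE eqxx orbT.
pose B : P2 := ((P.1 + P'.1) / 2, (P.2 + P'.2) / 2).
have mid l1 (X Y : P2) : uniq l1 -> X \in l1 -> Y \in l1 ->
    rep2 l1 (fun Z => 2^-1 * (Z == X)%:R + 2^-1 * (Z == Y)%:R) ((X.1 + Y.1) / 2, (X.2 + Y.2) / 2).
  move=> u1 X1 Y1; split=> [x|x xl||].
  - by rewrite addr_ge0 // mulr_ge0 ?ler0n // invr_ge0 ler0n.
  - have -> : x == X = false by apply: contraNF xl => /eqP ->.
    have -> : x == Y = false by apply: contraNF xl => /eqP ->.
    by rewrite !mulr0 addr0.
  - by rewrite E_two //; field.
  - by rewrite /= !E_two //; congr [:: _; _]; field.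
have r := mid l P P' ul Pl Pl'.
have pos : {in l, forall X, 0 < 2^-1 * (X == P)%:R + 2^-1 * (X == P')%:R :> R}.
  have hp : 0 < (2^-1 : R) by rewrite invr_gt0 ltr0n.
  move=> X; rewrite (perm_mem pl) !inE => /orP[] /eqP ->; rewrite eqxx mulr1.
    by apply: ltr_wpDr => //; rewrite mulr_ge0 ?ler0n // ltW.
  by apply: ltr_wpDl => //; rewrite mulr_ge0 ?ler0n // ltW.
have oB := on _ _ r.
have [|m [n [iB em en]]] := @square_of i B; first by rewrite oB; exact: curve_row.
have [l0 K0 pe] := grid_in gl r pos iB.
have [f [pf f01 fE]] := pth i.
exists (sh (- m) (- n) P), (sh (- m) (- n) P'), m, n; rewrite !shK'; split=> //.
have in0 X : X \in l -> sh (- m) (- n) X \in l0 by rewrite (perm_mem pe) mem_shift.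
have cs ax' X : co ax' (sh (- m) (- n) X) = co ax' X - (corner ax' m n)%:~R.
  by rewrite co_sh /corner; case: (ax'); rewrite rmorphN.
apply: (path_good axes pf K0 (sq_uniq sqK K0) (in0 P Pl) (in0 P' Pl')).
  by apply: contra PP' => /eqP /(can_inj (shK' m n)) ->.
move=> C C1 C2.
have -> : C = sh (- m) (- n) B.
  by rewrite (surjective_pairing C) C1 C2 /sh /B /=; congr (_, _); field.
rewrite !cs em en; split; first exact: fracP.
by rewrite oB fE addrAC subrr add0r.
Qed.

End Curves.
End Grid.

(** * Staircases *)

Section Stairs.
Variable R : realType.

(* (a, b) lies on the monotone staircase with corners (al i, be i) and (al i, be (i + 1)). *)
Definition stair (n : nat) (al be : nat -> R) (a b : R) := forall i, (i <= n)%N ->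
  (a < al i -> b <= be i) /\ (al i < a -> be i.+1 <= b).

Lemma stair_mono n al be a b a' b' : stair n al be a b -> stair n al be a' b' ->
  be 0%N <= b' -> b <= be n.+1 -> a < a' -> b <= b'.
Proof.
move=> s s' b0 bn lt.
have H m : (m <= n.+1)%N -> (forall i, (i < m)%N -> al i <= a) -> b <= b' \/ b <= be n.+1 /\ be m <= b'.
  elim: m => [_ _|m IH hm h]; first by right.
  have hm' : (m <= n.+1)%N by lia.
  have h' i : (i < m)%N -> al i <= a by move=> hi; apply: h; lia.
  have [g|[_ _]] := IH hm' h'; first by left.
  have [_ h2] := s' m hm; right; split=> //; apply: h2; apply: le_lt_trans lt; exact: h.
have [[m [hm hl hg]]|hn] := pselect (exists m, [/\ (m <= n)%N, a < al m & forall i, (i < m)%N -> al i <= a]).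
  have hm' : (m <= n.+1)%N by lia.
  have [//|[_ h]] := H m hm' hg.
  by have [h1 _] := s m hm; apply: le_trans (h1 hl) h.
have al_le m : (m <= n.+1)%N -> forall i, (i < m)%N -> al i <= a.
  elim: m => // m IH hm i; rewrite ltnS leq_eqVlt => /orP[/eqP ->|hi]; last by apply: IH => //; lia.
  rewrite leNgt; apply/negP => hl; apply: hn; exists m; split=> //; apply: IH; lia.
have [//|[g1 g2]] := H n.+1 (leqnn _) (al_le n.+1 (leqnn _)).
exact: le_trans g1 g2.
Qed.

(** A monotone staircase meets a line of negative slope at most once. *)
Lemma stair_uniq n al be a b a' b' t : 0 < t < 1 -> stair n al be a b -> stair n al be a' b' ->
  be 0%N <= b <= be n.+1 -> be 0%N <= b' <= be n.+1 ->
  (1 - t) * b + t * a = (1 - t) * b' + t * a' -> a = a' /\ b = b'.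
Proof.
move=> /andP[t0 t1] s s' /andP[b0 b1] /andP[b0' b1'] e.
case: (ltrgtP a a') => [lt|gt|ea].
- by have := stair_mono s s' b0' b1 lt; nra.
- by have := stair_mono s' s b0 b1' gt; nra.
- split=> //; have /(mulfI _) : (1 - t) * b = (1 - t) * b' by rewrite ea in e; lra.
  by apply; rewrite gt_eqF // subr_gt0.
Qed.

(** The line of negative slope given by the last equation separates the two ends of the staircase.
    The induction drops the last corner until the line meets the piece next to it. *)
Lemma stair_exists n al be am ax t c : 0 < t < 1 ->
  am <= al 0%N -> (forall i, (i < n)%N -> al i <= al i.+1) -> al n <= ax ->
  (forall i, (i <= n)%N -> be i <= be i.+1) ->
  (1 - t) * be 0%N + t * am <= c <= (1 - t) * be n.+1 + t * ax ->
  exists a b, [/\ am <= a <= ax, be 0%N <= b <= be n.+1, stair n al be a b & (1 - t) * b + t * a = c].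
Proof.
move=> /andP[t0 t1] h0 hal hn hbe hc.
have t1' : 0 < 1 - t by lra.
have be_le i j : (i <= j)%N -> (j <= n.+1)%N -> be i <= be j.
  elim: j => [|j IH]; first by rewrite leqn0 => /eqP ->.
  rewrite leq_eqVlt => /orP[/eqP -> //|hi] hj; apply: le_trans (IH _ _) (hbe j _); move: hi hj; clear; lia.
have al_le i j : (i <= j)%N -> (j <= n)%N -> al i <= al j.
  elim: j => [|j IH]; first by rewrite leqn0 => /eqP ->.
  rewrite leq_eqVlt => /orP[/eqP -> //|hi] hj; apply: le_trans (IH _ _) (hal j _); move: hi hj; clear; lia.
have div (x y : R) : 0 < y -> y * (x / y) = x by move=> y0; rewrite mulrC divfK // gt_eqF.
have H m : (m <= n.+1)%N -> forall d, c <= (1 - t) * be m + t * d -> (m = n.+1 -> d <= ax) -> ((0 < m)%N -> al m.-1 <= d) ->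
   am <= d -> exists a b, [/\ am <= a <= d, be 0%N <= b <= be m, (1 - t) * b + t * a = c &
    forall i, (i < m)%N -> (a < al i -> b <= be i) /\ (al i < a -> be i.+1 <= b)].
  elim: m => [|m IH] hm d cd hd dm amd.
    exists ((c - (1 - t) * be 0%N) / t), (be 0%N); split=> //; last by rewrite div //; ring.
      by rewrite ler_pdivlMr // ler_pdivrMr //; lra.
    by rewrite lexx.
  have dm' : al m <= d by exact: dm.
  have am_al : am <= al m by apply: le_trans h0 (al_le 0%N m (leq0n m) hm).
  have [c1|c1] := leP c ((1 - t) * be m + t * al m).
    have p1 : m = n.+1 -> al m <= ax by move=> e; move: hm; rewrite e ltnn.
    have p2 : (0 < m)%N -> al m.-1 <= al m by move=> _; apply: al_le => //; exact: leq_pred.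
    have [a [b [ha hb hab hs]]] := IH (ltnW hm) (al m) c1 p1 p2 am_al.
    have hbm := hbe m hm.
    exists a, b; split=> //; [lra | lra |].
    move=> i; rewrite ltnS leq_eqVlt => /orP[/eqP ->|/hs//].
    split=> h; last by lra.
    by case/andP: hb.
  have [c2|c2] := leP c ((1 - t) * be m.+1 + t * al m).
    exists (al m), ((c - t * al m) / (1 - t)).
    have hb : be m <= (c - t * al m) / (1 - t) <= be m.+1.
      by rewrite ler_pdivlMr // ler_pdivrMr //; lra.
    split.
    - by rewrite am_al.
    - have : be 0%N <= be m := be_le 0%N m (leq0n m) (ltnW hm).
      lra.
    - by rewrite div //; ring.
    - move=> i hi; split=> h.
      + have : al i <= al m := al_le i m hi hm.
        lra.
      + have lt : (i < m)%N by move: hi h; rewrite ltnS leq_eqVlt => /orP[/eqP ->|//]; rewrite ltxx.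
        have : be i.+1 <= be m := be_le i.+1 m lt (ltnW hm).
        lra.
  exists ((c - (1 - t) * be m.+1) / t), (be m.+1).
  have ha : al m <= (c - (1 - t) * be m.+1) / t <= d.
    by rewrite ler_pdivlMr // ler_pdivrMr //; lra.
  split.
  - lra.
  - by rewrite (be_le 0%N m.+1 (leq0n _) hm) lexx.
  - by rewrite div //; ring.
  - move=> i hi; split=> h; last exact: (be_le i.+1 m.+1 hi hm).
    have : al i <= al m := al_le i m hi hm.
    lra.
have am_ax : am <= ax.
  exact: le_trans h0 (le_trans (al_le 0%N n (leq0n n) (leqnn n)) hn).
have [_ hc2] := andP hc.
have [a [b [ha hb hab hs]]] := H n.+1 (leqnn _) ax hc2 (fun _ => lexx ax) (fun _ => hn) am_ax.
by exists a, b; split=> // i hi; apply: hs.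
Qed.

(** Membership depends only on the sides of the corner values on which [a] and [b] lie. *)
Lemma stair_pres n al be al' be' a b a' b' : stair n al be a b ->
  (forall i, (a <= al i -> a' <= al' i) /\ (al i <= a -> al' i <= a')) ->
  (forall i, (b <= be i -> b' <= be' i) /\ (be i <= b -> be' i <= b')) -> stair n al' be' a' b'.
Proof.
move=> s ha hb i hi; have [s1 s2] := s i hi; have [a1 a2] := ha i.
split=> h.
- by apply: (hb i).1; apply: s1; rewrite ltNge; apply/negP => /a2; rewrite leNgt h.
- by apply: (hb i.+1).2; apply: s2; rewrite ltNge; apply/negP => /a1; rewrite leNgt h.
Qed.

End Stairs.

(** * Complexes in space and the shapes of good cells *)

Section Space.
Variable R : realType.
Notation P2 := (R * R)%type.
Notation P3 := (R * R * R)%type.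

Definition cr (i : nat) (P : P3) : R := match i with 0%N => P.1.1 | 1%N => P.1.2 | _ => P.2 end.
Definition cs3 : seq (P3 -> R) := [:: cr 0; cr 1; cr 2].
Definition rep3 (l : seq P3) (w : P3 -> R) (P : P3) := rep cs3 l w [:: cr 0 P; cr 1 P; cr 2 P].

Lemma cr_ext (P Q : P3) : (forall i, cr i P = cr i Q) -> P = Q.
Proof.
move=> h; move: (h 0%N) (h 1%N) (h 2%N); rewrite /cr.
by case: P {h} => [[x y] z]; case: Q => [[x' y'] z'] /= -> -> ->.
Qed.

Lemma rep3P l w P : [/\ forall p, 0 <= w p, forall p, p \notin l -> w p = 0, E l w (fun _ => 1) = 1 &
  forall i, E l w (cr i) = cr i P] <-> rep3 l w P.
Proof.
split=> [[h1 h2 h3 h4]|[h1 h2 h3 [e0 e1 e2]]].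
  by split=> //; rewrite /= !h4.
by split=> // -[|[|i]].
Qed.

Definition aff3 (f : P3 -> R) := exists al be ga de, forall P,
  f P = al + be * cr 0 P + ga * cr 1 P + de * cr 2 P.

Lemma E_aff3 l w P f : rep3 l w P -> aff3 f -> E l w f = f P.
Proof.
move=> /rep3P[w0 ws w1 ec] [al [be [ga [de h]]]].
rewrite (eq_E w (g := fun Q => al * 1 + be * cr 0 Q + ga * cr 1 Q + de * cr 2 Q)); last first.
  by move=> Q _; rewrite h mulr1.
rewrite (ED l w (fun Q => al * 1 + be * cr 0 Q + ga * cr 1 Q)) (ED l w (fun Q => al * 1 + be * cr 0 Q)).
by rewrite (ED l w (fun Q => al * 1)) !EZ w1 !ec h mulr1.
Qed.

Lemma rep3_in l w P Q : rep3 l w P -> w Q != 0 -> Q \in l.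
Proof. by move=> [_ h _ _]; apply: contraNT => /h ->. Qed.

Lemma rep3_face l w P f : rep3 l w P -> aff3 f -> (forall Q, w Q != 0 -> 0 <= f Q) -> f P <= 0 ->
  forall Q, w Q != 0 -> f Q = 0.
Proof.
move=> r af f0 fP Q wQ; have [w0 _ _ _] := r.
apply: (@E_ge0_eq0 _ _ l w f w0 _ _ Q (rep3_in r wQ) wQ) => [X _|]; first exact: f0.
by rewrite (E_aff3 r af).
Qed.

Lemma rep3_ge0 l w P f : rep3 l w P -> aff3 f -> (forall Q, w Q != 0 -> 0 <= f Q) -> 0 <= f P.
Proof.
move=> r af f0; have [w0 _ _ _] := r; rewrite -(E_aff3 r af).
by apply: E_ge0 => // Q _; exact: f0.
Qed.

(* The barycentric coordinates of k Delta', scaled by k. *)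
Definition bc (k : R) (i : nat) (P : P3) : R :=
  match i with 0%N => k - cr 0 P - cr 2 P | 1%N => cr 0 P | 2%N => cr 2 P - cr 1 P | _ => cr 1 P end.

Definition inD (k : R) (P : P3) := forall i, 0 <= bc k i P.

Lemma bc_aff k i : aff3 (bc k i).
Proof.
case: i => [|[|[|i]]].
- by exists k, (-1), 0, (-1) => P /=; ring.
- by exists 0, 1, 0, 0 => P /=; ring.
- by exists 0, 0, (-1), 1 => P /=; ring.
- by exists 0, 0, 1, 0 => P /=; ring.
Qed.

Lemma cr_aff i : aff3 (cr i).
Proof.
case: i => [|[|i]].
- by exists 0, 1, 0, 0 => P /=; ring.
- by exists 0, 0, 1, 0 => P /=; ring.
- by exists 0, 0, 0, 1 => P /=; ring.
Qed.

Definition lat3 (q : nat) (p : int) (P : P3) := lat q p P.1 && (P.2 \is a Num.int).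

(** Cells of all dimensions may occur. Positive weights in [cx_cover] provide the carrier of each
    point, not just a cell containing it. *)
Record cplx q p (S : P3 -> Prop) (K : seq P3 -> Prop) : Prop := Cplx {
  cx_uniq : forall l, K l -> uniq l;
  cx_lat : forall l P, K l -> P \in l -> lat3 q p P;
  cx_in : forall l P, K l -> P \in l -> S P;
  cx_cover : forall P, S P -> exists l w, [/\ K l, rep3 l w P & {in l, forall Q, 0 < w Q}];
  cx_same : forall l1 l2 w1 w2 P, K l1 -> K l2 -> rep3 l1 w1 P -> rep3 l2 w2 P -> w1 =1 w2 }.

(* [l] is an affine lattice image of Delta'(1, m); it is unimodular exactly for m = 1. *)
Definition good4 q p (Pm : int -> Prop) (l : seq P3) := exists a b c d w (m : int),
  [/\ perm_eq l [:: a; b; c; d], 1 <= m /\ Pm m, lat3 q p w,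
   forall i, cr i b - cr i a + (cr i d - cr i c) = m%:~R * cr i w &
   forall X, lat3 q p X -> exists n1 n2 n3 : int, forall i,
     cr i X = cr i a + n1%:~R * (cr i b - cr i a) + n2%:~R * (cr i c - cr i a) + n3%:~R * cr i w].

(** [goodp] with a condition on [m]: taking [eq^~ 1] for [Pm] asks for unimodular cells. *)
Definition goodm q p ax (Pm : int -> Prop) (C D : P2) := exists (m : int) (W : P2) (e : int),
  [/\ 1 <= m /\ Pm m, lat q p W, co ax W = q%:R^-1, e = 1 \/ e = -1 &
      co ax D - co ax C = m%:~R * co ax W /\
      co (~~ ax) D - co (~~ ax) C = m%:~R * co (~~ ax) W + e%:~R].

Variables (q : nat) (p : int).
Hypothesis q0 : (0 < q)%N.
Hypothesis cop : exists u v : int, u * p + v * q%:Z = 1.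

(** A pyramid over a unimodular triangle with apex in a neighbouring layer. The apex is listed
    third, so that the two edges in [good4] lead from [P] to [Q] and from the apex to [S]; their sum
    is a lattice vector and serves as [w] with [m = 1]. *)
Lemma good4_apex (Pm : int -> Prop) (l : seq P3) (P Q S A : P2) (z d : int) : Pm 1 ->
  (forall L, lat q p L -> exists a b : int,
    L.1 = P.1 + a%:~R * (Q.1 - P.1) + b%:~R * (S.1 - P.1) /\
    L.2 = P.2 + a%:~R * (Q.2 - P.2) + b%:~R * (S.2 - P.2)) ->
  lat q p P -> lat q p Q -> lat q p S -> lat q p A -> d = 1 \/ d = -1 ->
  perm_eq l [:: (P, z%:~R); (Q, z%:~R); (A, (z + d)%:~R); (S, z%:~R)] -> good4 q p Pm l.
Proof.
move=> pm sp lP lQ lS lA hd pl.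
pose a : P3 := (P, z%:~R); pose b : P3 := (Q, z%:~R).
pose c : P3 := (A, (z + d)%:~R); pose e : P3 := (S, z%:~R).
pose w : P3 := (Q.1 - P.1 + (S.1 - A.1), Q.2 - P.2 + (S.2 - A.2), - d%:~R).
exists a, b, c, e, w, 1; split=> //.
- rewrite /lat3 rpredN intr_int andbT; exact: (lat_add (lat_sub lQ lP) (lat_sub lS lA)).
- by case=> [|[|i]]; rewrite mul1r /= ?intrD //; ring.
- move=> X /andP[lX /intrP[k ek]].
  pose g := (k - z) * d.
  have dd : d * d = 1 by case: hd => ->.
  have gd : g * d = k - z by rewrite /g -mulrA dd mulr1.
  have := sp (X.1.1 - g%:~R * (A.1 - P.1), X.1.2 - g%:~R * (A.2 - P.2)).
  case=> [|al [be [e1 e2]]].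
    exact: lat_sub lX (lat_mulz g (lat_sub lA lP)).
  exists (al - be), (g + be), be => -[|[|i]]; rewrite /= !(rmorphB, rmorphD) /=.
  + have {}e1 : X.1.1 = P.1 + al%:~R * (Q.1 - P.1) + be%:~R * (S.1 - P.1) + g%:~R * (A.1 - P.1).
      by rewrite -e1 /=; ring.
    by rewrite e1; ring.
  + have {}e2 : X.1.2 = P.2 + al%:~R * (Q.2 - P.2) + be%:~R * (S.2 - P.2) + g%:~R * (A.2 - P.2).
      by rewrite -e2 /=; ring.
    by rewrite e2; ring.
  + rewrite ek; have := congr1 (intmul (1 : R)) gd; rewrite rmorphM rmorphB /= => h.
    have -> : k%:~R = z%:~R + g%:~R * d%:~R :> R by rewrite h; ring.
    ring.
Qed.

Lemma good4_edge ax (Pm : int -> Prop) (l : seq P3) (Z0 Z1 C D : P2) (z d : int) :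
  co ax Z1 = co ax Z0 -> (co (~~ ax) Z1 = co (~~ ax) Z0 + 1 \/ co (~~ ax) Z1 = co (~~ ax) Z0 - 1) ->
  goodm q p ax Pm C D -> lat q p Z0 -> lat q p Z1 -> lat q p C -> lat q p D ->
  d = 1 \/ d = -1 ->
  perm_eq l [:: (Z0, z%:~R); (Z1, z%:~R); (C, (z + d)%:~R); (D, (z + d)%:~R)] -> good4 q p Pm l.
Proof.
move=> ez1 ez2 [m [W [e [hm lW cW he [h1 h2]]]]] l0 l1 lC lD hd pl.
(* The unit edge is oriented so that it cancels the unit vector [e] in the step from [C] to [D]; the
   sum of the two edges is then [m * W]. *)
have [Y0 [Y1 [eY1 eY2 lY0 lY1 pY]]] : exists Y0 Y1 : P2, [/\ co ax Y1 = co ax Y0,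
   co (~~ ax) Y1 = co (~~ ax) Y0 - e%:~R, lat q p Y0, lat q p Y1 &
   perm_eq [:: (Z0, z%:~R : R); (Z1, z%:~R)] [:: (Y0, z%:~R); (Y1, z%:~R)]].
  case: ez2 he => e2 [] ->; [exists Z1, Z0 | exists Z0, Z1 | exists Z0, Z1 | exists Z1, Z0];
    rewrite ?rmorphN /= ?e2 ?ez1; split=> //; try ring; try exact: perm_refl;
    apply/permPl; exact: (perm_catC [:: _] [:: _]).
pose a : P3 := (Y0, z%:~R); pose b : P3 := (Y1, z%:~R).
pose c : P3 := (C, (z + d)%:~R); pose f : P3 := (D, (z + d)%:~R).
pose w : P3 := (W, 0).
exists a, b, c, f, w, m; split=> //.
- apply: (perm_trans pl); by rewrite (perm_cat2r [:: c; f] [:: (Z0, z%:~R); (Z1, z%:~R)] [:: a; b]).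
- by rewrite /lat3 lW rpred0.
- case: ax ez1 ez2 cW h1 h2 eY1 eY2; rewrite /co /= => ez1 ez2 cW h1 h2 eY1 eY2 -[|[|i]] /=; lra.
- move=> X /andP[lX /intrP[k ek]].
  pose g := (k - z) * d.
  have dd : d * d = 1 by case: hd => ->.
  have gd : g * d = k - z by rewrite /g -mulrA dd mulr1.
  have lV := lat_sub (lat_sub lX lY0) (lat_mulz g (lat_sub lC lY0)).
  set V := (_, _) in lV.
  have qn : (q%:R : R) != 0 by rewrite pnatr_eq0 -lt0n.
  have /intrP[r hr] : q%:R * co ax V \is a Num.int.
    by rewrite /co; case: (ax); [exact: (lat_qx lV) | by case/andP: lV].
  have eV : co ax V = r%:~R * co ax W.
    by rewrite cW -hr mulrAC mulfV // mul1r.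
  have lV' := lat_sub lV (lat_mulz r lW); set V' := (_, _) in lV'.
  have cV' : co ax V' = 0 by move: eV; rewrite /V' /co; case: (ax) => /= ->; rewrite subrr.
  have /intrP[s hs] : co (~~ ax) V' \is a Num.int.
    have := lat_x cop lV'; move: cV'; rewrite /co; case: (ax) => /= ->; rewrite rpred0.
      by move=> <-.
    by move=> ->.
  have hV' : co (~~ ax) V = s%:~R + r%:~R * co (~~ ax) W.
    by rewrite -hs /V' /co; case: (ax) => /=; ring.
  have ee : e * e = 1 by case: he => ->.
  have eeR : e%:~R * e%:~R = 1 :> R by rewrite -rmorphM ee.
  have gdR : g%:~R * d%:~R = k%:~R - z%:~R :> R by rewrite -rmorphM gd rmorphB.
  exists (- s * e), g, r.
  have zc : X.2 = z%:~R + g%:~R * ((z + d)%:~R - z%:~R).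
    by rewrite ek; have -> : (z + d)%:~R - z%:~R = d%:~R :> R by [rewrite rmorphD /=; ring]; rewrite gdR; ring.
  have e1 : co ax X.1 = co ax Y0 + g%:~R * (co ax C - co ax Y0) + r%:~R * co ax W.
    by rewrite -eV /V /co; case: (ax) => /=; ring.
  have e2 : co (~~ ax) X.1 = co (~~ ax) Y0 + (- s * e)%:~R * (co (~~ ax) Y1 - co (~~ ax) Y0) +
      g%:~R * (co (~~ ax) C - co (~~ ax) Y0) + r%:~R * co (~~ ax) W.
    have -> : co (~~ ax) Y1 - co (~~ ax) Y0 = - e%:~R by rewrite eY2; ring.
    have -> : (- s * e)%:~R * - e%:~R = s%:~R :> R.
      by rewrite mulNr rmorphN rmorphM /= mulrNN -mulrA eeR mulr1.
    have -> : co (~~ ax) X.1 = co (~~ ax) V + co (~~ ax) Y0 + g%:~R * (co (~~ ax) C - co (~~ ax) Y0).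
      by rewrite /V /co; case: (ax) => /=; ring.
    by rewrite hV'; ring.
  move: eY1 e1 e2; rewrite /co; case: (ax) => /= eY1 e1 e2 -[|[|i]] /=.
  + by rewrite e1 eY1; ring.
  + by rewrite e2.
  + by rewrite subrr mulr0 addr0 mulr0 addr0.
  + by rewrite e2.
  + by rewrite e1 eY1; ring.
  + by rewrite subrr mulr0 addr0 mulr0 addr0.
Qed.

End Space.

(** * Slabs between consecutive layers *)

Section Lift.
Variable R : realType.
Notation P2 := (R * R)%type.
Notation P3 := (R * R * R)%type.

Definition layer (z : R) (l : seq P2) : seq P3 := [seq (B, z) | B <- l].

Lemma E_layer z l w (f : P3 -> R) : E (layer z l) w f = E l (fun B => w (B, z)) (fun B => f (B, z)).
Proof. by rewrite /E big_map. Qed.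

Lemma mem_layer z l Q : (Q \in layer z l) = (Q.2 == z) && (Q.1 \in l).
Proof.
apply/mapP/andP => [[B Bl ->]|[/eqP <- h]]; first by rewrite eqxx.
by exists Q.1; rewrite // -surjective_pairing.
Qed.

Lemma layer_uniq z l : uniq (layer z l) = uniq l.
Proof. by apply: map_inj_uniq => A B []. Qed.

Lemma rep2_norm (l : seq P2) (v : P2 -> R) (m : R) : (forall B, 0 <= v B) -> (forall B, B \notin l -> v B = 0) ->
  E l v (fun _ => 1) = m -> 0 < m -> rep2 l (fun B => v B / m) (E l v fst / m, E l v snd / m).
Proof.
move=> v0 vs vm m0; have mn : m != 0 by rewrite gt_eqF.
have e f : E l (fun B => v B / m) f = E l v f / m.
  by rewrite [RHS]mulrC -EwZ; apply: eq_Ew => B _; rewrite mulrC.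
split=> [B|B Bl||]; first by rewrite divr_ge0 // ltW.
- by rewrite vs // mul0r.
- by rewrite e vm mulfV.
- by rewrite /= !e.
Qed.

Lemma E1_eq0 (l : seq P2) (v : P2 -> R) : (forall B, 0 <= v B) -> (forall B, B \notin l -> v B = 0) ->
  E l v (fun _ => 1) = 0 -> forall B, v B = 0.
Proof.
move=> v0 vs e B; have [Bl|/vs//] := boolP (B \in l).
apply/eqP; apply: contraT => vB.
have := @E_ge0_eq0 _ _ l v (fun _ => 1) v0 _ _ B Bl vB; rewrite e => h.
by have /eqP := h (fun _ _ _ => ler01) (lexx 0); rewrite oner_eq0.
Qed.

Lemma rep3_layer z (l : seq P2) w B : rep2 l w B ->
  rep3 (layer z l) (fun Q => if Q.2 == z then w Q.1 else 0) (B, z).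
Proof.
move=> [w0 ws w1 [e1 e2]].
have e f : E (layer z l) (fun Q => if Q.2 == z then w Q.1 else 0) f = E l w (fun B => f (B, z)).
  by rewrite E_layer; apply: eq_Ew => X _ /=; rewrite eqxx.
apply/rep3P; split=> [Q|Q||i].
- by case: ifP.
- by rewrite mem_layer; case: eqP => //= _ /ws.
- by rewrite e.
- rewrite e; case: i => [|[|i]] //=.
  by rewrite -[RHS]mulr1 -w1 -EZ; apply: eq_E => X _; rewrite mulr1.
Qed.

Lemma rep3_cat z0 z1 t (l0 l1 : seq P2) w0 w1 A B : z0 != z1 -> 0 <= t <= 1 -> rep2 l0 w0 B -> rep2 l1 w1 A ->
  rep3 (layer z0 l0 ++ layer z1 l1)
    (fun Q => if Q.2 == z0 then (1 - t) * w0 Q.1 else if Q.2 == z1 then t * w1 Q.1 else 0)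
    (((1 - t) * B.1 + t * A.1, (1 - t) * B.2 + t * A.2), (1 - t) * z0 + t * z1).
Proof.
move=> zz ht [a0 as_ a1 [ae1 ae2]] [b0 bs b1 [be1 be2]].
set w := fun Q => _.
have e f : E (layer z0 l0 ++ layer z1 l1) w f =
    (1 - t) * E l0 w0 (fun B => f (B, z0)) + t * E l1 w1 (fun B => f (B, z1)).
  rewrite E_cat !E_layer /w /= -!EwZ; congr (_ + _); apply: eq_Ew => X _ /=; rewrite eqxx //.
  by rewrite eq_sym (negbTE zz).
apply/rep3P; split=> [Q|Q||i].
- by rewrite /w; case: ifP => _; [apply: mulr_ge0 => //; lra | case: ifP => // _; apply: mulr_ge0 => //; lra].
- rewrite mem_cat !mem_layer negb_or /w => /andP[].
  case: eqP => /= [_ /as_ ->|_ _]; first by rewrite mulr0.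
  by case: eqP => //= _ /bs ->; rewrite mulr0.
- by rewrite e a1 b1; ring.
- rewrite e; case: i => [|[|i]] /=; first by rewrite ae1 be1.
    by rewrite ae2 be2.
  have c (l : seq P2) v (z : R) : E l v (fun _ => 1) = 1 -> E l v (fun _ => z) = z.
    by move=> h; rewrite -[RHS]mulr1 -h -EZ; apply: eq_E => X _; rewrite mulr1.
  by rewrite (c _ _ _ a1) (c _ _ _ b1).
Qed.

End Lift.

Section Stack.
Variable R : realType.
Notation P2 := (R * R)%type.
Notation P3 := (R * R * R)%type.
Variables (q : nat) (p : int) (K : seq P2 -> Prop).
Hypothesis q0 : (0 < q)%N.
Hypothesis cop : exists u v : int, u * p + v * q%:Z = 1.
Hypothesis sqK : square q p K.
Variables (ge gg : P2 -> P2 -> Prop) (lo up L U : R -> R) (row : bool) (k : nat) (Pm : int -> Prop).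
Hypothesis pe : paths K (co true) (co false) ge lo up.
Hypothesis pg : row -> paths K (co false) (co true) gg L U.
Hypothesis k0 : (0 < k)%N.
Hypothesis k2 : row -> (1 < k)%N.
Hypothesis Pm1 : Pm 1.
Hypothesis He : forall C D, lat q p C -> lat q p D -> ge C D -> goodm q p true Pm C D.
Hypothesis Hg : forall C D, lat q p C -> lat q p D -> gg C D -> goodm q p false Pm C D.

Let gsame := grid_same cop sqK.

(* Which pairs (A, B), with B in the layer z = j and A in the layer z = j + 1, may be joined. In the
   slab j = 0, where B lies on a segment, [row] says whether the points A are separated along edge
   paths of the layer z = 1 rather than along integral lines. *)
Definition alx (j : nat) (A : P2) (i : nat) : R := if row && (j == 0%N) then curve L U i A.2 else i%:R.
(** The heights for [B]: the lower side 0 of the rectangle, the curves 0, ..., j, and the upper side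
    [j]. For the curves 0, ..., j + 1 at [A] this is one value more than there are corners, as
    [stair] requires. *)
Definition bey (j : nat) (x : R) (i : nat) : R :=
  if i is i'.+1 then (if i' == j.+1 then j%:R else curve lo up i' x) else 0.
Definition relx j (A B : P2) := stair (k - j).-1 (alx j A) (fun i => i%:R) A.1 B.1.
Definition rely j (A B : P2) := j = 0%N \/
  stair j.+1 (fun i => curve lo up i A.1) (bey j B.1) A.2 B.2.
Definition slab_rel j A B := relx j A B /\ rely j A B.
Definition rect (j : nat) (B : P2) := 0 <= B.1 <= (k - j)%:R /\ 0 <= B.2 <= j%:R.

Let kj j : (j < k)%N -> (k - j)%N = (k - j).-1.+1.
Proof. by move=> h; rewrite prednK // subn_gt0. Qed.

(** For [j > 0] the first coordinates come first, since their staircase is integral and the second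
    one depends on them. For [j = 0] the second coordinate of [A] is forced to be [y / t], and the
    staircase for the first coordinates depends on it. *)
Lemma rel_ex j t x y : (j < k)%N -> 0 < t < 1 -> 0 <= x <= (k - j)%:R - t -> 0 <= y <= j%:R + t ->
  exists A B, [/\ rect j B, rect j.+1 A, slab_rel j A B, (1 - t) * B.1 + t * A.1 = x &
                  (1 - t) * B.2 + t * A.2 = y].
Proof.
move=> jk ht hx hy; set n := (k - j).-1.
have en : (k - j)%:R = n%:R + 1 :> R by rewrite (kj jk) -/n -natr1.
have en' : (k - j.+1)%:R = n%:R :> R by rewrite subnS.
have t0 : 0 < t by case/andP: ht.
have natS i : (i%:R : R) <= i.+1%:R by rewrite ler_nat.
case: (posnP j) => [j0|j0].
- subst j; rewrite add0r in hy.
  pose yA := y / t.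
  have hyA : 0 <= yA <= 1 by rewrite divr_ge0 ?ler_pdivrMr ?mul1r //; lra.
  pose al i := if row && true then curve L U i yA else i%:R.
  have [al0 alS aln] : [/\ 0 <= al 0%N, forall i, al i <= al i.+1 & al n <= n%:R].
    rewrite /al andbT; case: ifP => [hr|_]; last by [].
    have pp := pg hr; split=> [|i|].
    + by have [h _ _] := per_bnd pp yA.
    + exact: (curve_mono pp).
    + have n0 : (0 < n)%N by rewrite /n subn0; move: (k2 hr); clear; case: k => [|[]].
      by case: (curve_bnd pp n yA) => [/andP[]//|[e _]]; rewrite e in n0.
  have [|||a [b [ha hb hs hab]]] := @stair_exists R n al (fun i => i%:R) 0 n%:R t x ht al0 _ aln _.
  + by move=> i _.
  + by move=> i _.
  + by rewrite mulr0 mulr0 add0r -natr1; lra.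
  exists (a, yA), (b, 0); split=> //=; rewrite /rect ?en ?en' /=.
  + by rewrite -natr1 in hb; rewrite lexx; split.
  + by [].
  + split; last by left.
    exact: hs.
  + by rewrite mulr0 add0r /yA mulrC divfK // gt_eqF.
have [|||a [b [ha hb hs hab]]] := @stair_exists R n (fun i => i%:R) (fun i => i%:R) 0 n%:R t x ht (lexx _) _ (lexx _) _.
- by move=> i _.
- by move=> i _.
- by rewrite mulr0 mulr0 add0r -natr1; lra.
have h0 : [/\ 0 <= per lo a, per lo a <= per up a & per up a <= 1] := per_bnd pe a.
have h1 : [/\ 0 <= per lo b, per lo b <= per up b & per up b <= 1] := per_bnd pe b.
have [|||||a' [b' [ha' hb' hs' hab']]] := @stair_exists R j.+1 (fun i => curve lo up i a) (bey j b) 0 j.+1%:R t y ht.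
- by case: h0.
- by move=> i _; exact: (curve_mono pe).
- by rewrite /= -natr1; case: h0; lra.
- case=> [_|i hi] /=; first by case: h1.
  have -> : i == j.+1 = false by apply: ltn_eqF.
  case: eqP => [[ei]|_]; last exact: (curve_mono pe).
  rewrite ei; case: (curve_bnd pe j b) => [/andP[]//|[e _]]; by rewrite e in j0.
- by rewrite /= eqxx mulr0 mulr0 add0r -natr1; lra.
exists (a, a'), (b, b'); split=> //=; rewrite /rect ?en ?en' /=.
- by rewrite /bey /= eqxx in hb'; rewrite -natr1 in hb; split.
- by split.
- split; last by right.
  have e : alx j (a, a') = fun i => i%:R.
    by apply: funext => i; rewrite /alx; have -> : j == 0%N = false by [apply/eqP; case: (j) j0]; rewrite andbF.
  by rewrite /relx e.
Qed.

Lemma rel_uq j t A B A' B' : (j < k)%N -> 0 < t < 1 -> rect j B -> rect j B' ->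
  slab_rel j A B -> slab_rel j A' B' ->
  (1 - t) * B.1 + t * A.1 = (1 - t) * B'.1 + t * A'.1 ->
  (1 - t) * B.2 + t * A.2 = (1 - t) * B'.2 + t * A'.2 -> A = A' /\ B = B'.
Proof.
move=> jk ht [rB1 rB2] [rB1' rB2'] [rx ry] [rx' ry'] e1 e2.
have t0 : 0 < t by case/andP: ht.
have tn : t != 0 by rewrite gt_eqF.
have fin : A.1 = A'.1 -> B.1 = B'.1 -> A.2 = A'.2 -> B.2 = B'.2 -> A = A' /\ B = B'.
  by move=> a1 b1 a2 b2; rewrite (surjective_pairing A) (surjective_pairing B) a1 b1 a2 b2 -!surjective_pairing.
have kjR : (k - j)%:R = (k - j).-1.+1%:R :> R by rewrite -kj.
rewrite kjR in rB1 rB1'.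
have ux : alx j A = alx j A' -> A.1 = A'.1 /\ B.1 = B'.1.
  by move=> ea; rewrite /relx -ea in rx'; apply: (stair_uniq ht rx rx').
case: (posnP j) => [j0|j0].
- subst j; have b2 : B.2 = 0 by [move: rB2; lra]. have b2' : B'.2 = 0 by [move: rB2'; lra].
  have a2 : A.2 = A'.2 by apply: (mulfI tn); move: e2; rewrite b2 b2'; lra.
  have [|a1 b1] := ux; first by rewrite /alx a2.
  by apply: fin => //; rewrite b2.
have [|a1 b1] := ux; first by apply: funext => i; rewrite /alx; have -> : j == 0%N = false by [apply/eqP; case: (j) j0]; rewrite andbF.
case: ry ry' => [e|sy] [e'|sy']; try by rewrite ?e ?e' in j0.
rewrite -a1 -b1 in sy'.
have b_end : bey j B.1 j.+2 = j%:R by rewrite /bey eqxx.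
have [||a2 b2] := stair_uniq ht sy sy' _ _ e2; rewrite ?b_end //.
exact: fin.
Qed.

Lemma grid_side ax l w (B B' : P2) w' (c : int) : grid K l -> rep2 l w B -> {in l, forall P, 0 < w P} -> rep2 l w' B' ->
  (co ax B <= c%:~R -> co ax B' <= c%:~R) /\ (c%:~R <= co ax B -> c%:~R <= co ax B').
Proof.
move=> gl r pos r'; have [h1 h2] := grid_line sqK ax c gl r.
have inl X : w' X != 0 -> w X != 0.
  by move=> wX; rewrite gt_eqF // pos //; case: r' => _ h _ _; apply: contraNT wX => /h ->.
split=> h; [apply: (co_ge r') | apply: (co_le r')] => X /inl; [exact: h1 | exact: h2].
Qed.

(** The relation depends only on sides of integral lines and curves, which no cell of a layer
    crosses. Related points of full support thus make the whole join of their cells related. *)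
Lemma rel_pres j A B l0 l1 w0 w1 w0' w1' A' B' : grid K l0 -> grid K l1 ->
  rep2 l0 w0 B -> {in l0, forall P, 0 < w0 P} -> rep2 l1 w1 A -> {in l1, forall P, 0 < w1 P} ->
  rep2 l0 w0' B' -> rep2 l1 w1' A' -> slab_rel j A B -> slab_rel j A' B'.
Proof.
move=> g0 g1 r0 p0 r1 p1 r0' r1' [rx ry]; split.
- apply: (stair_pres rx) => i; last exact: (grid_side true i%:Z g0 r0 p0 r0').
  rewrite /alx; case: ifP => [/andP[hr _]|_]; last exact: (grid_side true i%:Z g1 r1 p1 r1').
  exact: (grid_curve cop sqK (pg hr) i g1 r1 p1 r1').
- case: ry => [->|ry]; [by left | right].
  apply: (stair_pres ry) => i.
    exact: (grid_curve cop sqK pe i g1 r1 p1 r1').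
  case: i => [|i] /=; first exact: (grid_side false 0 g0 r0 p0 r0').
  case: ifP => _; first exact: (grid_side false j%:Z g0 r0 p0 r0').
  exact: (grid_curve cop sqK pe i g0 r0 p0 r0').
Qed.

(* The empty face makes a cell of the slab lie in a single layer. *)
Definition gface (l : seq P2) := l = [::] \/ grid K l.

Lemma gface_rep l w B : gface l -> rep2 l w B -> grid K l.
Proof. by case=> // -> [_ _ h _]; move: h; rewrite /E big_nil => /eqP; rewrite eq_sym oner_eq0. Qed.

Definition sdata (l : seq P3) j l0 l1 :=
  [/\ (j < k)%N, gface l0 /\ gface l1,
      {in l0, forall B, rect j B} /\ {in l1, forall A, rect j.+1 A},
      forall w0 w1 A B, rep2 l0 w0 B -> rep2 l1 w1 A -> slab_rel j A B &
      l = layer j%:R l0 ++ layer j.+1%:R l1].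

Definition scell l := exists j l0 l1, sdata l j l0 l1.

Let zz (j : nat) : (j%:R : R) != j.+1%:R.
Proof. by rewrite eqr_nat neq_ltn ltnSn. Qed.

Lemma gface_uniq l : gface l -> uniq l.
Proof. by case=> [->//|]; exact: (grid_uniq sqK). Qed.

Lemma scell_uniq l : scell l -> uniq l.
Proof.
move=> [j [l0 [l1 [jk [g0 g1] _ _ ->]]]]; rewrite cat_uniq !layer_uniq !gface_uniq //= andbT.
apply/hasPn => Q; rewrite !mem_layer => /andP[/eqP -> _]; by rewrite eq_sym (negbTE (zz j)).
Qed.

Lemma scell_lat l P : scell l -> P \in l -> lat3 q p P.
Proof.
move=> [j [l0 [l1 [jk [g0 g1] _ _ ->]]]]; rewrite mem_cat !mem_layer.
have gl l' X : gface l' -> X \in l' -> lat q p X by case=> [->//|]; exact: (grid_lat sqK).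
by case/orP => /andP[/eqP e h]; rewrite /lat3 e natr_int andbT; [exact: gl g0 h | exact: gl g1 h].
Qed.

Lemma rect_inD j B : (j <= k)%N -> rect j B -> inD (k%:R : R) (B, j%:R).
Proof.
move=> jk [h1 h2] i; rewrite natrB // in h1.
by case: i => [|[|[|i]]] /=; lra.
Qed.

Lemma scell_in l P : scell l -> P \in l -> inD (k%:R : R) P.
Proof.
move=> [j [l0 [l1 [jk _ [r0 r1] _ ->]]]]; rewrite mem_cat !mem_layer.
by case/orP => /andP[/eqP e h]; rewrite (surjective_pairing P) e; apply: rect_inD; rewrite ?(ltnW jk) //; [exact: r0 | exact: r1].
Qed.

(** The height of [P] determines the total mass in each of the two layers. *)
Lemma scell_split l j l0 l1 w P : sdata l j l0 l1 -> rep3 l w P ->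
  let v z := fun B : P2 => w (B, z) in
  [/\ forall z B, 0 <= v z B, 
      (forall B, B \notin l0 -> v j%:R B = 0) /\ (forall B, B \notin l1 -> v j.+1%:R B = 0),
      E l0 (v j%:R) (fun _ => 1) = 1 - (P.2 - j%:R) /\ E l1 (v j.+1%:R) (fun _ => 1) = P.2 - j%:R,
      P.1.1 = E l0 (v j%:R) fst + E l1 (v j.+1%:R) fst /\
      P.1.2 = E l0 (v j%:R) snd + E l1 (v j.+1%:R) snd &
      forall Q, Q.2 != j%:R -> Q.2 != j.+1%:R -> w Q = 0].
Proof.
move=> [jk _ _ _ el] /rep3P[w0 ws w1 ec] v.
have sp f : E l w f = E l0 (v j%:R) (fun B => f (B, j%:R)) + E l1 (v j.+1%:R) (fun B => f (B, j.+1%:R)).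
  by rewrite el E_cat !E_layer.
have m1 := sp (fun _ => 1); rewrite w1 in m1.
have c (l' : seq P2) u (z : R) : E l' u (fun _ => z) = z * E l' u (fun _ => 1).
  by rewrite -EZ; apply: eq_E => X _; rewrite mulr1.
have m2 := sp (cr 2); rewrite ec /cr /= (c _ _ j%:R) (c _ _ j.+1%:R) in m2.
have jS : (j.+1%:R : R) = j%:R + 1 by rewrite natr1.
split.
- by move=> z B; exact: w0.
- split=> B Bl; apply: ws; rewrite el mem_cat !mem_layer /= ?eqxx /= negb_or Bl ?(negbTE (zz j)) //=.
  by rewrite eq_sym (negbTE (zz j)).
- rewrite jS in m1 m2 *; split; nra.
- by have := sp (cr 0); have := sp (cr 1); rewrite !ec /cr.
- by move=> Q n0 n1; apply: ws; rewrite el mem_cat !mem_layer (negbTE n0) (negbTE n1).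
Qed.

(** At integral height all mass lies in one layer. Otherwise the height fixes the masses of both
    layers, [rel_uq] fixes their centres, and uniqueness in the plane fixes the weights around each
    centre. *)
Lemma scell_same l l' w w' P : scell l -> scell l' -> rep3 l w P -> rep3 l' w' P -> w =1 w'.
Proof.
move=> sl sl' r r' Q.
have small j : 0 <= P.2 - j%:R <= 1 -> P.2 \is a Num.int -> P.2 - j%:R = 0 \/ P.2 - j%:R = 1.
  move=> h Pi; have [h1|h1] := ltP (P.2 - j%:R) 1; last by right; lra.
  by left; apply: int_small; [rewrite rpredB ?natr_int | lra].
have bnd l1 w1 j l10 l11 : sdata l1 j l10 l11 -> rep3 l1 w1 P -> 0 <= P.2 - j%:R <= 1.
  move=> d r1; have [v0 _ [m0 m1] _ _] := scell_split d r1.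
  have g (l2 : seq P2) z : 0 <= E l2 (fun B => w1 (B, z)) (fun _ => 1).
    by apply: E_ge0 => [B|B _ _]; [exact: v0 | exact: ler01].
  by have := g l10 j%:R; have := g l11 j.+1%:R; rewrite m0 m1; lra.
have [Pi|Pn] := boolP (P.2 \is a Num.int).
- have lay l1 w1 : scell l1 -> rep3 l1 w1 P ->
      exists lz, [/\ grid K lz, rep2 lz (fun B => w1 (B, P.2)) P.1 & forall X, X.2 != P.2 -> w1 X = 0].
    move=> [j [l10 [l11 d]]] r1; have b := bnd _ _ _ _ _ d r1.
    have [v0 [s0 s1] [m0 m1] [e1 e2] oth] := scell_split d r1.
    have [jk [g0 g1] _ _ _] := d.
    have zer (l2 : seq P2) v (f : P2 -> R) : (forall B, v B = 0) -> E l2 v f = 0.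
      by move=> h; rewrite /E big1 // => B _; rewrite h mul0r.
    case: (small j b Pi) => t.
    - have z1 : forall B, w1 (B, j.+1%:R) = 0 by apply: (E1_eq0 (v0 _) s1); rewrite m1.
      have ez : P.2 = j%:R by lra.
      have rz : rep2 l10 (fun B => w1 (B, P.2)) P.1.
        rewrite ez; split=> [B|B Bl||]; [exact: v0 | exact: s0 | by rewrite m0 t subr0 |].
        by rewrite /= e1 e2 !(zer l11) // !addr0.
      exists l10; split=> //; first exact: gface_rep g0 rz.
      move=> X; rewrite ez => nX; have [e|ne] := eqVneq X.2 j.+1%:R; last exact: oth.
      by rewrite (surjective_pairing X) e z1.
    - have z1 : forall B, w1 (B, j%:R) = 0 by apply: (E1_eq0 (v0 _) s0); rewrite m0 t subrr.
      have ez : P.2 = j.+1%:R by rewrite -natr1; lra.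
      have rz : rep2 l11 (fun B => w1 (B, P.2)) P.1.
        rewrite ez; split=> [B|B Bl||]; [exact: v0 | exact: s1 | by rewrite m1 t |].
        by rewrite /= e1 e2 !(zer l10) // !add0r.
      exists l11; split=> //; first exact: gface_rep g1 rz.
      move=> X; rewrite ez => nX; have [e|ne] := eqVneq X.2 j%:R; last exact: oth.
      by rewrite (surjective_pairing X) e z1.
  have [lz [g1 r1 o1]] := lay _ _ sl r; have [lz' [g2 r2 o2]] := lay _ _ sl' r'.
  have [e|ne] := eqVneq Q.2 P.2; last by rewrite o1 // o2.
  by have := gsame g1 g2 r1 r2 Q.1; rewrite -e -surjective_pairing.
have [j [l0 [l1 d]]] := sl; have [j' [l0' [l1' d']]] := sl'.
have b := bnd _ _ _ _ _ d r; have b' := bnd _ _ _ _ _ d' r'.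
have st i : 0 <= P.2 - i%:R <= 1 -> 0 < P.2 - i%:R < 1.
  move=> h; rewrite !lt_neqAle; have -> : 0 != P.2 - i%:R.
    by apply: contraNneq Pn => e; have -> : P.2 = i%:R by [lra]; exact: natr_int.
  have -> : P.2 - i%:R != 1.
    by apply: contraNneq Pn => e; have -> : P.2 = i.+1%:R by [rewrite -natr1; lra]; exact: natr_int.
  by [].
have ej : j = j'.
  have fl i : 0 < P.2 - i%:R < 1 -> Num.floor P.2 = i%:Z.
    by move=> h; apply: floor_def; rewrite intrD /=; lra.
  by have := fl j (st j b); rewrite (fl j' (st j' b')) => -[].
subst j'; have {}b := st j b; clear b' st.
set t := P.2 - j%:R in b.
have [v0 [s0 s1] [m0 m1] [e1 e2] oth] := scell_split d r.
have [v0' [s0' s1'] [m0' m1'] [e1' e2'] oth'] := scell_split d' r'.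
have [jk [g0 g1] [rc0 rc1] hrel el] := d; have [_ [g0' g1'] [rc0' rc1'] hrel' el'] := d'.
have t1 : 0 < 1 - t by lra. have t0 : 0 < t by lra.
have n0 := rep2_norm (v0 _) s0 m0 t1; have n1 := rep2_norm (v0 _) s1 m1 t0.
have n0' := rep2_norm (v0' _) s0' m0' t1; have n1' := rep2_norm (v0' _) s1' m1' t0.
have rr := hrel _ _ _ _ n0 n1; have rr' := hrel' _ _ _ _ n0' n1'.
have rct l2 w2 C : {in l2, forall B, rect j B} -> rep2 l2 w2 C -> rect j C.
  move=> h r2; have inl X : w2 X != 0 -> X \in l2 by case: r2 => _ hh _ _; apply: contraNT => /hh ->.
  split; apply/andP; split.
  - by apply: (co_le (ax := true) r2) => X /inl /h [/andP[]].
  - by apply: (co_ge (ax := true) r2) => X /inl /h [/andP[]].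
  - by apply: (co_le (ax := false) r2) => X /inl /h [_ /andP[]].
  - by apply: (co_ge (ax := false) r2) => X /inl /h [_ /andP[]].
have dv (x s : R) : 0 < s -> s * (x / s) = x by move=> s0''; rewrite mulrC divfK // gt_eqF.
have [||eA eB] := rel_uq jk b (rct _ _ _ rc0 n0) (rct _ _ _ rc0' n0') rr rr'.
- by rewrite /= !dv // -e1 -e1'.
- by rewrite /= !dv // -e2 -e2'.
have gr0 := gface_rep g0 n0; have gr1 := gface_rep g1 n1.
have gr0' := gface_rep g0' n0'; have gr1' := gface_rep g1' n1'.
rewrite eB in n0; rewrite eA in n1.
have q0' := gsame gr0 gr0' n0 n0' Q.1; have q1' := gsame gr1 gr1' n1 n1' Q.1.
have can (x y s : R) : 0 < s -> x / s = y / s -> x = y.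
  by move=> s0'' h; rewrite -(dv x s s0'') -(dv y s s0'') h.
have [ez|nz0] := eqVneq Q.2 j%:R.
  by rewrite (surjective_pairing Q) ez; exact: can t1 q0'.
have [ez|nz1] := eqVneq Q.2 j.+1%:R.
  by rewrite (surjective_pairing Q) ez; exact: can t0 q1'.
by rewrite oth // oth'.
Qed.

Lemma carrier_rect j l w B : (j <= k)%N -> rect j B -> grid K l -> rep2 l w B -> {in l, forall P, 0 < w P} ->
  {in l, forall P, rect j P}.
Proof.
move=> jk [/andP[h1 h2] /andP[h3 h4]] gl r pos P Pl.
have wP : w P != 0 by rewrite gt_eqF // pos.
have [a1 a2] := grid_line sqK true 0 gl r; have [b1 b2] := grid_line sqK true (k - j)%N%:Z gl r.
have [c1 c2] := grid_line sqK false 0 gl r; have [d1 d2] := grid_line sqK false j%:Z gl r.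
by split; apply/andP; split; [exact: a2 wP | exact: b1 wP | exact: c2 wP | exact: d1 wP].
Qed.

Lemma scell_cover P : inD (k%:R : R) P -> exists l w, [/\ scell l, rep3 l w P & {in l, forall Q, 0 < w Q}].
Proof.
move=> h; have h0 := h 0%N; have h1 := h 1%N; have h2 := h 2%N; have h3 := h 3%N; rewrite /bc /cr in h0 h1 h2 h3.
have [j [jk jz]] : exists j, (j < k)%N /\ 0 <= P.2 - j%:R <= 1.
  have [zk|zk] := ltP P.2 k%:R; last first.
    exists k.-1; split; first by rewrite prednK.
    have : (k%:R : R) = k.-1%:R + 1 by rewrite natr1 prednK.
    lra.
  have f0 : 0 <= Num.floor P.2 by rewrite floor_ge0; lra.
  exists (absz (Num.floor P.2)).
  have e : ((absz (Num.floor P.2))%:R : R) = (Num.floor P.2)%:~R by rewrite natr_absz ger0_norm.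
  have := floor_itv P.2; rewrite -e intrD /= -e => fl; split; last lra.
  by rewrite -(ltr_nat R); lra.
set t := P.2 - j%:R in jz.
have kR : (k - j)%:R = k%:R - j%:R :> R by rewrite natrB // ltnW.
have kR' : (k - j.+1)%:R = k%:R - j%:R - 1 :> R by rewrite natrB // -natr1; ring.
have nilrep w (B : P2) : rep2 [::] w B -> False.
  by move=> [_ _ e _]; move: e; rewrite /E big_nil => /eqP; rewrite eq_sym oner_eq0.
have [t0|tn0] := eqVneq t 0.
  have ez : P.2 = j%:R by rewrite /t in t0; lra.
  have rP : rect j P.1 by split; rewrite ?kR; lra.
  have [l0 [w [g r pos]]] := grid_cover sqK P.1.
  exists (layer j%:R l0 ++ layer j.+1%:R [::]), (fun Q => if Q.2 == j%:R then w Q.1 else 0); split.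
  - exists j, l0, [::]; split=> //; first by split; [right | left].
      by split=> //; apply: (carrier_rect (ltnW jk) rP g r pos).
    by move=> w0 w1 A B _ /nilrep.
  - by rewrite cats0 (surjective_pairing P) ez; exact: rep3_layer.
  - by move=> Q; rewrite cats0 mem_layer => /andP[-> /pos].
have [t1|tn1] := eqVneq t 1.
  have ez : P.2 = j.+1%:R by rewrite /t in t1; rewrite -natr1; lra.
  have rP : rect j.+1 P.1 by split; rewrite ?kR' -?natr1; rewrite -natr1 in ez; lra.
  have [l0 [w [g r pos]]] := grid_cover sqK P.1.
  exists (layer j%:R [::] ++ layer j.+1%:R l0), (fun Q => if Q.2 == j.+1%:R then w Q.1 else 0); split.
  - exists j, [::], l0; split=> //; first by split; [left | right].
      by split=> //; apply: (carrier_rect jk rP g r pos).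
    by move=> w0 w1 A B /nilrep.
  - by rewrite /= (surjective_pairing P) ez; exact: rep3_layer.
  - by move=> Q; rewrite /= mem_layer => /andP[-> /pos].
have ht : 0 < t < 1 by rewrite !lt_neqAle tn1 eq_sym tn0.
have [||A [B [rB rA rel_ e1 e2]]] := @rel_ex j t P.1.1 P.1.2 jk ht.
- by rewrite kR /t; lra.
- by rewrite /t; lra.
have [l0 [w0 [g0 r0 p0]]] := grid_cover sqK B; have [l1 [w1 [g1 r1 p1]]] := grid_cover sqK A.
have rc := rep3_cat (zz j) jz r0 r1.
exists (layer j%:R l0 ++ layer j.+1%:R l1),
  (fun Q => if Q.2 == j%:R then (1 - t) * w0 Q.1 else if Q.2 == j.+1%:R then t * w1 Q.1 else 0); split.
- exists j, l0, l1; split=> //; first by split; right.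
    by split; [exact: (carrier_rect (ltnW jk) rB g0 r0 p0) | exact: (carrier_rect jk rA g1 r1 p1)].
  move=> w0' w1' A' B' r0' r1'; exact: (rel_pres g0 g1 r0 p0 r1 p1 r0' r1' rel_).
- have -> : P = ((1 - t) * B.1 + t * A.1, (1 - t) * B.2 + t * A.2, (1 - t) * j%:R + t * j.+1%:R).
    rewrite e1 e2 -surjective_pairing; have -> : (1 - t) * j%:R + t * j.+1%:R = P.2.
      by rewrite -natr1 /t; ring.
    by rewrite -surjective_pairing.
  exact: rc.
- move=> Q; rewrite mem_cat !mem_layer => /orP[] /andP[/eqP ez Ql].
  + by rewrite /= ez eqxx mulr_gt0 ?p0 //; lra.
  + by rewrite /= ez eq_sym (negbTE (zz j)) eqxx mulr_gt0 ?p1 //; lra.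
Qed.

Lemma scell_cplx : cplx q p (inD (k%:R : R)) scell.
Proof.
split; [exact: scell_uniq | exact: scell_lat | exact: scell_in | exact: scell_cover | exact: scell_same].
Qed.

End Stack.

Lemma perm4 (T : eqType) (a b c d : T) :
  [/\ perm_eq [:: a; b; c; d] [:: a; b; d; c], perm_eq [:: a; b; c; d] [:: c; d; a; b],
      perm_eq [:: a; b; c; d] [:: c; d; b; a] & perm_eq [:: a; b; c; d] [:: b; c; a; d]].
Proof. by split; apply/permP => f /=; lia. Qed.

Lemma perm22 (T : eqType) (a b c d : T) :
  perm_eq [:: b; a; c; d] [:: a; b; c; d] /\ perm_eq [:: b; a; d; c] [:: a; b; c; d].
Proof. by split; apply/permP => f /=; lia. Qed.

(** * The cells of a slab and their shapes *)

Section StackCells.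
Variable R : realType.
Notation P2 := (R * R)%type.
Notation P3 := (R * R * R)%type.
Variables (q : nat) (p : int) (K : seq P2 -> Prop).
Hypothesis q0 : (0 < q)%N.
Hypothesis cop : exists u v : int, u * p + v * q%:Z = 1.
Hypothesis sqK : square q p K.

Lemma int_nat (x : R) : x \is a Num.int -> 0 <= x -> exists n : nat, x = n%:R.
Proof.
move=> /intrP[z ->]; rewrite ler0z => h; exists (absz z); by rewrite natr_absz ger0_norm.
Qed.

Lemma rep2_mid (l : seq P2) (X Y : P2) : uniq l -> X \in l -> Y \in l ->
  exists w, rep2 l w ((X.1 + Y.1) / 2, (X.2 + Y.2) / 2).
Proof.
move=> ul Xl Yl; exists (fun Z => 2^-1 * (Z == X)%:R + 2^-1 * (Z == Y)%:R); split=> [x|x xl||].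
- by rewrite addr_ge0 // mulr_ge0 ?ler0n // invr_ge0 ler0n.
- have -> : x == X = false by apply: contraNF xl => /eqP ->.
  have -> : x == Y = false by apply: contraNF xl => /eqP ->.
  by rewrite !mulr0 addr0.
- by rewrite E_two //; field.
- by rewrite /= !E_two //; congr [:: _; _]; field.
Qed.

Lemma rep2_pt (l : seq P2) (X : P2) : uniq l -> X \in l -> exists w, rep2 l w X.
Proof.
move=> ul Xl; have [w r] := rep2_mid ul Xl Xl; exists w.
suff -> : X = ((X.1 + X.1) / 2, (X.2 + X.2) / 2) by [].
by rewrite [LHS]surjective_pairing; congr (_, _); field.
Qed.

Lemma grid_box ax l : grid K l -> exists m : int, forall P, P \in l -> m%:~R <= co ax P <= m%:~R + 1.
Proof.
move=> [m [n [l0 [Kl ->]]]]; exists (corner ax m n) => P Pl; exact: (sq_bounds sqK ax Kl Pl).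
Qed.

Lemma grid_sep ax l (c : int) P Q : grid K l -> P \in l -> Q \in l ->
  co ax P < c%:~R -> c%:~R < co ax Q -> False.
Proof.
move=> /(grid_box ax)[m hm] /hm hP /hm hQ h1 h2.
have : (m%:~R : R) < c%:~R by lra.
have : (c%:~R : R) < m%:~R + 1 by lra.
rewrite -(intrD _ m 1) !ltr_int; clear; lia.
Qed.

Lemma grid_diam ax l P Q : grid K l -> P \in l -> Q \in l -> `|co ax P - co ax Q| <= 1.
Proof. by move=> /(grid_box ax)[m hm] /hm hP /hm hQ; rewrite ler_norml; lra. Qed.

Lemma grid_size l : grid K l -> (size l <= 3)%N.
Proof.
move=> gl; apply: (@cell_size R _ cs2 l); first exact: (grid_uniq sqK).
move=> w1 w2 b [a0 a1 a2 a3] r2.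
have e : b = [:: E l w1 fst; E l w1 snd] by rewrite -a3.
subst b; apply: (grid_same cop sqK (B := (E l w1 fst, E l w1 snd)) gl gl) => //.
Qed.

Lemma grid_tri l : grid K l -> size l = 3 -> exists P Q S : P2, perm_eq l [:: P; Q; S] /\
  forall X, lat q p X -> exists a b : int,
    X.1 = P.1 + a%:~R * (Q.1 - P.1) + b%:~R * (S.1 - P.1) /\
    X.2 = P.2 + a%:~R * (Q.2 - P.2) + b%:~R * (S.2 - P.2).
Proof.
move=> [m [n [l0 [Kl ->]]]]; rewrite size_map => /(sq_uni sqK Kl)[P [Q [S [pl sp]]]].
exists (sh m n P), (sh m n Q), (sh m n S); split; first exact: (perm_map (sh m n) pl).
move=> X lX; have [|a [b [e1 e2]]] := sp (sh (- m) (- n) X); first by rewrite lat_sh.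
exists a, b; move: e1 e2; rewrite /sh /= !rmorphN /= => e1 e2.
have -> : X.1 = (X.1 - m%:~R) + m%:~R by ring.
have -> : X.2 = (X.2 - n%:~R) + n%:~R by ring.
rewrite e1 e2; split; ring.
Qed.

Lemma unit_edge ax Z0 Z1 : grid K [:: Z0; Z1] -> co ax Z0 = co ax Z1 -> co ax Z0 \is a Num.int ->
  [/\ co (~~ ax) Z0 \is a Num.int, co (~~ ax) Z1 \is a Num.int &
   co (~~ ax) Z1 = co (~~ ax) Z0 + 1 \/ co (~~ ax) Z1 = co (~~ ax) Z0 - 1].
Proof.
move=> g e i0; have i1 : co ax Z1 \is a Num.int by rewrite -e.
have m0 : Z0 \in [:: Z0; Z1] by rewrite !inE eqxx.
have m1 : Z1 \in [:: Z0; Z1] by rewrite !inE eqxx orbT.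
have lx Z : Z \in [:: Z0; Z1] -> co ax Z \is a Num.int -> co (~~ ax) Z \is a Num.int.
  by move=> Zl; have := lat_x cop (grid_lat sqK g Zl); rewrite /co; case: (ax) => /= ->.
have j0 := lx _ m0 i0; have j1 := lx _ m1 i1.
split=> //.
have ne : co (~~ ax) Z0 != co (~~ ax) Z1.
  apply/eqP => e'; have := grid_uniq sqK g; rewrite /= inE andbT => /eqP; apply.
  by rewrite (surjective_pairing Z0) (surjective_pairing Z1); move: e e'; rewrite /co; case: (ax) => /= -> ->.
have := grid_diam (~~ ax) g m0 m1; rewrite ler_norml => d.
case: (ltrgtP (co (~~ ax) Z0) (co (~~ ax) Z1)) => h.
- by left; have := int_gap j0 j1 h; lra.
- by right; have := int_gap j1 j0 h; lra.
- by rewrite h eqxx in ne.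
Qed.

(** The edge lies within one unit interval of this coordinate and is not constant, so its midpoint
    is strictly inside. *)
Lemma mid_floor ax Z0 Z1 : grid K [:: Z0; Z1] -> co ax Z0 != co ax Z1 -> 0 <= co ax Z0 -> 0 <= co ax Z1 ->
  exists m : nat, m%:R < (co ax Z0 + co ax Z1) / 2 < m.+1%:R /\
    m%:R <= co ax Z0 <= m.+1%:R /\ m%:R <= co ax Z1 <= m.+1%:R.
Proof.
move=> g ne h0 h1; have [m hm] := grid_box ax g.
have b0 : m%:~R <= co ax Z0 <= m%:~R + 1 by apply: hm; rewrite !inE eqxx.
have b1 : m%:~R <= co ax Z1 <= m%:~R + 1 by apply: hm; rewrite !inE eqxx orbT.
have m0 : 0 <= m.
  rewrite leNgt; apply/negP => mn; have : (m%:~R : R) + 1 <= 0 by rewrite -(intrD _ m 1) lerz0; move: mn; clear; lia.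
  by move=> h; have : co ax Z0 = co ax Z1 by [lra]; move/eqP; rewrite (negbTE ne).
have em : (m%:~R : R) = (absz m)%:R by rewrite natr_absz ger0_norm.
have mS : ((absz m).+1%:R : R) = m%:~R + 1 by rewrite -natr1 em.
exists (absz m); rewrite mS -em; split; last by lra.
case: (ltrgtP (co ax Z0) (co ax Z1)) => h; [lra | lra |].
by rewrite h eqxx in ne.
Qed.

Lemma edge_goodm ax good lo up (Pm : int -> Prop) i P P' : paths K (co ax) (co (~~ ax)) good lo up ->
  (forall C D, lat q p C -> lat q p D -> good C D -> goodm q p ax Pm C D) ->
  grid K [:: P; P'] -> (forall w B, rep2 [:: P; P'] w B -> co (~~ ax) B = curve lo up i (co ax B)) ->
  goodm q p ax Pm P P' \/ goodm q p ax Pm P' P.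
Proof.
move=> pK H g on.
have lP : lat q p P by apply: (grid_lat sqK g); rewrite !inE eqxx.
have lP' : lat q p P' by apply: (grid_lat sqK g); rewrite !inE eqxx orbT.
have [P0 [P0' [m [n [e e' gd]]]]] := grid_good cop sqK pK g (perm_refl _) on.
have l0 : lat q p P0 by rewrite -(lat_sh q p m n) -e.
have l0' : lat q p P0' by rewrite -(lat_sh q p m n) -e'.
have tr X Y : goodm q p ax Pm X Y -> goodm q p ax Pm (sh m n X) (sh m n Y).
  move=> [m' [W [s [h1 h2 h3 h4 [h5 h6]]]]]; exists m', W, s; split=> //.
  by rewrite !co_sh -h5 -h6; split; ring.
by rewrite e e'; case: gd => gd; [left | right]; apply: tr; apply: H.
Qed.

Variables (ge gg : P2 -> P2 -> Prop) (lo up L U : R -> R) (row : bool) (k : nat) (Pm : int -> Prop).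
Hypothesis pe : paths K (co true) (co false) ge lo up.
Hypothesis pg : row -> paths K (co false) (co true) gg L U.
Hypothesis k0 : (0 < k)%N.
Hypothesis k2 : row -> (1 < k)%N.
Hypothesis Pm1 : Pm 1.
Hypothesis He : forall C D, lat q p C -> lat q p D -> ge C D -> goodm q p true Pm C D.
Hypothesis Hg : forall C D, lat q p C -> lat q p D -> gg C D -> goodm q p false Pm C D.

Notation sdata := (sdata K lo up L U row k).
Notation scell := (scell K lo up L U row k).
Notation relx_ := (relx L U row k).
Notation alx_ := (alx L U row).
Notation bey_ := (bey lo up).
Notation rect := (rect k).

Lemma alx_int j A i : A.2 \is a Num.int -> alx_ j A i = i%:R.
Proof. by move=> /intrP[c e]; rewrite /alx; case: ifP => // /andP[/pg pp _]; rewrite e (curve_int pp). Qed.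

Let kj j : (j < k)%N -> (k - j)%:R = (k - j).-1%:R + 1 :> R.
Proof. by move=> h; rewrite natr1 prednK // subn_gt0. Qed.

Let kj1 j : (k - j.+1)%:R = (k - j).-1%:R :> R.
Proof. by rewrite subnS. Qed.

Lemma relx_int j (A B : P2) : (j < k)%N -> rect j B -> rect j.+1 A -> relx_ j A B ->
  A.1 \is a Num.int -> A.2 \is a Num.int -> A.1 <= B.1 <= A.1 + 1.
Proof.
move=> jk [hB _] [hA _] rx iA iA2; rewrite kj // in hB; rewrite kj1 in hA.
have [a ea] := int_nat iA (proj1 (andP hA)).
have an : (a <= (k - j).-1)%N by rewrite -(ler_nat R) -ea; case/andP: hA.
apply/andP; split.
- case: a ea an => [|a] ea an; first by rewrite ea; case/andP: hB.
  have [_ h] := rx a (ltnW an); rewrite alx_int // ea in h *; apply: h.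
  by rewrite ltr_nat.
- move: an; rewrite leq_eqVlt => /orP[/eqP e|lt]; first by rewrite ea e; case/andP: hB.
  have [h _] := rx a.+1 lt; rewrite alx_int // in h; rewrite ea natr1; apply: h.
  by rewrite ea ltr_nat.
Qed.

Lemma rely_int j (A B : P2) : rect j B -> rect j.+1 A -> rely lo up j A B ->
  A.1 \is a Num.int -> A.2 \is a Num.int -> B.1 \is a Num.int -> B.2 <= A.2 <= B.2 + 1.
Proof.
move=> [_ hB] [_ hA] ry /intrP[c ec] iA2 /intrP[d ed].
have jS : (j.+1%:R : R) = j%:R + 1 by rewrite natr1.
case: ry => [j0|ry]; first by subst j; rewrite jS in hA; lra.
have [a ea] := int_nat iA2 (proj1 (andP hA)).
have aj : (a <= j.+1)%N by rewrite -(ler_nat R) -ea; case/andP: hA.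
apply/andP; split.
- move: (aj); rewrite leq_eqVlt => /orP[/eqP e|lt]; first by rewrite ea e jS; lra.
  have [h _] := ry a.+1 lt; rewrite ec (curve_int pe) /bey (ltn_eqF lt) ed (curve_int pe) in h.
  by rewrite ea; apply: h; rewrite ea ltr_nat.
- case: a ea aj => [|a] ea aj; first by rewrite ea; lra.
  have aj' : (a <= j.+1)%N by apply: ltnW.
  have [_ h] := ry a aj'; rewrite ec (curve_int pe) /bey (ltn_eqF aj) ed (curve_int pe) in h.
  by have := h _; rewrite ea ltr_nat ltnSn => /(_ isT); rewrite -natr1; lra.
Qed.

Lemma gface_in l (X : P2) : gface K l -> X \in l -> grid K l.
Proof. by case=> [->|]. Qed.

(** Every curve passes through integral points at its own height, so between integral points both
    staircases are the integral ones. Lattice points of the facets are integral, whence the standard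
    boundary. *)
Lemma scell_std l P Q : scell l -> P \in l -> Q \in l -> cr 0 P \is a Num.int -> cr 0 Q \is a Num.int ->
  forall i, `|bc k%:R i P - bc k%:R i Q| <= 1.
Proof.
move=> sl; have [j [l0 [l1 [jk [g0 g1] [r0 r1] hr el]]]] := sl.
have jS : (j.+1%:R : R) = j%:R + 1 by rewrite natr1.
have same (z : R) l' X Y : gface K l' -> X \in layer z l' -> Y \in layer z l' ->
    forall i, `|bc k%:R i X - bc k%:R i Y| <= 1.
  move=> gl; rewrite !mem_layer => /andP[/eqP ex Xl] /andP[/eqP ey Yl] i.
  have g := gface_in gl Xl.
  have := grid_diam true g Xl Yl; have := grid_diam false g Xl Yl; rewrite /co !ler_norml => d1 d2.
  by case: i => [|[|[|i]]] /=; rewrite ?ex ?ey; lra.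
have cross X Y : X \in layer j%:R l0 -> Y \in layer j.+1%:R l1 -> cr 0 X \is a Num.int -> cr 0 Y \is a Num.int ->
    forall i, `|bc k%:R i X - bc k%:R i Y| <= 1.
  rewrite !mem_layer => /andP[/eqP ex Xl] /andP[/eqP ey Yl] iX iY i.
  have gX := gface_in g0 Xl; have gY := gface_in g1 Yl.
  have [w rX] := rep2_pt (grid_uniq sqK gX) Xl; have [w' rY] := rep2_pt (grid_uniq sqK gY) Yl.
  have [hx hy] := hr _ _ _ _ rX rY.
  have iY2 : Y.1.2 \is a Num.int by rewrite -(lat_x cop (grid_lat sqK gY Yl)).
  have a := relx_int jk (r0 _ Xl) (r1 _ Yl) hx iY iY2.
  have b := rely_int (r0 _ Xl) (r1 _ Yl) hy iY iY2 iX.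
  by rewrite ler_norml; case: i => [|[|[|i]]] /=; rewrite ?ex ?ey ?jS; lra.
rewrite el !mem_cat => /orP[] hP /orP[] hQ iP iQ i.
- exact: same hP hQ i.
- exact: cross hP hQ iP iQ i.
- by rewrite distrC; apply: cross hQ hP iQ iP i.
- exact: same hP hQ i.
Qed.

(** The plane x + f z = c meets the layer j + 1 in x = i and the layer j in x = i + f, where i = c -
    f (j + 1). With [row = false] the staircase for the first coordinates has a corner at i, so
    related points do not lie strictly on opposite sides. *)
Lemma scell_side (f : bool) (c : nat) l : row = false -> (c <= k)%N -> scell l ->
  (forall P, P \in l -> cr 0 P + f%:R * cr 2 P <= c%:R) \/ (forall P, P \in l -> c%:R <= cr 0 P + f%:R * cr 2 P).
Proof.
move=> nr ck sl; have [j [l0 [l1 [jk [g0 g1] [r0 r1] hr el]]]] := sl.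
have jS : (j.+1%:R : R) = j%:R + 1 by rewrite natr1.
apply: contrapT => hn.
have [P Pl hP] : exists2 P, P \in l & c%:R < cr 0 P + f%:R * cr 2 P.
  apply: contrapT => h; apply: hn; left => P Pl; rewrite leNgt; apply/negP => h'; apply: h; by exists P.
have [Q Ql hQ] : exists2 P, P \in l & cr 0 P + f%:R * cr 2 P < c%:R.
  apply: contrapT => h; apply: hn; right => Q Ql; rewrite leNgt; apply/negP => h'; apply: h; by exists Q.
have same (z : nat) l' X Y : gface K l' -> X \in layer z%:R l' -> Y \in layer z%:R l' ->
    c%:R < cr 0 X + f%:R * cr 2 X -> cr 0 Y + f%:R * cr 2 Y < c%:R -> False.
  move=> gl; rewrite !mem_layer => /andP[/eqP ex Xl] /andP[/eqP ey Yl].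
  rewrite /cr ex ey => hX hY; have g := gface_in gl Xl.
  have e : ((c%:Z - f%:Z * z%:Z)%:~R : R) = c%:R - f%:R * z%:R by rewrite rmorphB rmorphM.
  by apply: (grid_sep (ax := true) (c := c%:Z - f%:Z * z%:Z) g Yl Xl); rewrite e /co; lra.
have relc X Y : X \in layer j%:R l0 -> Y \in layer j.+1%:R l1 ->
    [/\ X.2 = j%:R, Y.2 = j.+1%:R, rect j X.1, rect j.+1 Y.1 & stair (k - j).-1 (fun i => i%:R) (fun i => i%:R) Y.1.1 X.1.1].
  rewrite !mem_layer => /andP[/eqP ex Xl] /andP[/eqP ey Yl].
  have gX := gface_in g0 Xl; have gY := gface_in g1 Yl.
  have [w rX] := rep2_pt (grid_uniq sqK gX) Xl; have [w' rY] := rep2_pt (grid_uniq sqK gY) Yl.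
  have [hx _] := hr _ _ _ _ rX rY; split=> //; [exact: r0 | exact: r1 |].
  by move: hx; rewrite /relx /alx nr.
set n := (k - j).-1 in relc.
have kn : (k = j + n.+1)%N by rewrite /n prednK ?subn_gt0 // subnKC // ltnW.
move: hP hQ Pl Ql; rewrite el !mem_cat => hP hQ /orP[] Pl /orP[] Ql; try exact: (same _ _ _ _ _ Pl Ql).
- have [eP eQ [rP _] [rQ _] st] := relc _ _ Pl Ql; rewrite kj // in rP; rewrite kj1 in rQ.
  rewrite /cr eP eQ jS in hP hQ.
  have fj : (f * j.+1 <= c)%N.
    rewrite leqNgt; apply/negP => h; have : (c%:R : R) + 1 <= f%:R * (j%:R + 1).
      by rewrite -jS -natrM natr1 ler_nat.
    lra.
  pose i := (c - f * j.+1)%N.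
  have ei : (i%:R : R) = c%:R - f%:R * (j%:R + 1) by rewrite /i natrB // natrM jS.
  have [iN|iN] := leqP i n.
  + have [h _] := st i iN; have : P.1.1 <= i%:R by apply: h; lra.
    have : 0 <= (f%:R : R) by rewrite ler0n.
    lra.
  + have : (n.+1%:R : R) <= i%:R by rewrite ler_nat.
    rewrite -natr1 ei; have : 0 <= (f%:R : R) by rewrite ler0n.
    lra.
- have [eQ eP [rQ _] [rP _] st] := relc _ _ Ql Pl; rewrite kj // in rQ; rewrite kj1 in rP.
  rewrite /cr eP eQ jS in hP hQ.
  have [fj|fj] := leqP (f * j.+1) c; last first.
    have : (c%:R : R) <= f%:R * j%:R.
      rewrite -natrM ler_nat; move: fj; case: (f) => /=; clear; lia.
    lra.
  pose i := (c - f * j.+1)%N.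
  have ei : (i%:R : R) = c%:R - f%:R * (j%:R + 1) by rewrite /i natrB // natrM jS.
  have iN : (i <= n)%N.
    rewrite -(ler_nat R); lra.
  have [_ h] := st i iN; have : i.+1%:R <= Q.1.1 by apply: h; lra.
  rewrite -natr1 ei; have : (f%:R : R) <= 1 by case: (f).
  lra.
Qed.

(** Translates of the undilated tetrahedron, unimodular only for [q = 1]. They join a unit segment
    of the edge z = 0 to a vertical unit edge of the layer z = 1. *)
Definition raw4 (l : seq P3) := exists n : nat, (n < k)%N /\
  perm_eq l [:: ((n%:R, 0), 0); ((n.+1%:R, 0), 0); ((n%:R, 0), 1); ((n%:R, 1), 1)].

Let zS (j : nat) : ((j%:Z + 1)%:~R : R) = j.+1%:R.
Proof. by rewrite intrD /= natr1. Qed.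

Let zB (j : nat) : ((j.+1%:Z - 1)%:~R : R) = j%:R.
Proof. by have -> : (j.+1%:Z - 1) = j%:Z by lia. Qed.

Lemma cell31 j l0 l1 : sdata (layer j%:R l0 ++ layer j.+1%:R l1) j l0 l1 ->
  (size l0 = 3 /\ size l1 = 1) \/ (size l0 = 1 /\ size l1 = 3) ->
  good4 q p Pm (layer j%:R l0 ++ layer j.+1%:R l1).
Proof.
have lt (l' : seq P2) X : grid K l' -> X \in l' -> lat q p X by exact: (grid_lat sqK).
move=> [jk [g0 g1] _ _ _] [[s0 s1]|[s0 s1]].
- case: l1 s1 g1 => [|A [|]] // _ g1.
  have {}g0 : grid K l0 by case: g0 => // e; rewrite e in s0.
  have {}g1 : grid K [:: A] by case: g1.
  have [P [Q [S [pl sp]]]] := grid_tri g0 s0.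
  have mem X : X \in [:: P; Q; S] -> lat q p X by rewrite -(perm_mem pl); exact: lt.
  have lP : lat q p P by apply: mem; rewrite !inE eqxx.
  have lQ : lat q p Q by apply: mem; rewrite !inE eqxx orbT.
  have lS : lat q p S by apply: mem; rewrite !inE eqxx !orbT.
  have lA : lat q p A by apply: lt g1 _; rewrite inE.
  apply: (good4_apex (z := j%:Z) (d := 1) Pm1 sp lP lQ lS lA); first by left.
  + rewrite zS; apply: (perm_trans (y := [:: (P, j%:R); (Q, j%:R); (S, j%:R)] ++ [:: (A, j.+1%:R)])).
      by rewrite perm_cat2r; exact: (perm_map (fun B => (B, j%:R)) pl).
    by case: (perm4 (P, j%:R) (Q, j%:R) (S, j%:R) (A, j.+1%:R : R)).
- case: l0 s0 g0 => [|A [|]] // _ g0.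
  have {}g1 : grid K l1 by case: g1 => // e; rewrite e in s1.
  have {}g0 : grid K [:: A] by case: g0.
  have [P [Q [S [pl sp]]]] := grid_tri g1 s1.
  have mem X : X \in [:: P; Q; S] -> lat q p X by rewrite -(perm_mem pl); exact: lt.
  have lP : lat q p P by apply: mem; rewrite !inE eqxx.
  have lQ : lat q p Q by apply: mem; rewrite !inE eqxx orbT.
  have lS : lat q p S by apply: mem; rewrite !inE eqxx !orbT.
  have lA : lat q p A by apply: lt g0 _; rewrite inE.
  apply: (good4_apex (z := j.+1%:Z) (d := - 1) Pm1 sp lP lQ lS lA); first by right.
  + rewrite zB; apply: (perm_trans (y := [:: (A, j%:R)] ++ [:: (P, j.+1%:R); (Q, j.+1%:R); (S, j.+1%:R)])).
      by rewrite perm_cat2l; exact: (perm_map (fun B => (B, j.+1%:R)) pl).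
    by case: (perm4 (A, j%:R : R) (P, j.+1%:R) (Q, j.+1%:R) (S, j.+1%:R)).
Qed.

Section Quad.
Variables (j : nat) (B0 B1 A0 A1 : P2).
Let l0 := [:: B0; B1].
Let l1 := [:: A0; A1].
Let l := layer j%:R l0 ++ layer j.+1%:R l1.
Hypothesis d : sdata l j l0 l1.
Hypothesis g0 : grid K l0.
Hypothesis g1 : grid K l1.

Let jk : (j < k)%N. Proof. by case: d. Qed.
Let hr w0 w1 A B : rep2 l0 w0 B -> rep2 l1 w1 A -> slab_rel lo up L U row k j A B.
Proof. by case: d => _ _ _ h _; exact: h. Qed.
Let b0 : B0 \in l0. Proof. by rewrite !inE eqxx. Qed.
Let b1 : B1 \in l0. Proof. by rewrite !inE eqxx orbT. Qed.
Let a0 : A0 \in l1. Proof. by rewrite !inE eqxx. Qed.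
Let a1 : A1 \in l1. Proof. by rewrite !inE eqxx orbT. Qed.
Let rB B : B \in l0 -> rect j B. Proof. by case: d => _ _ [h _] _ _; exact: h. Qed.
Let rA A : A \in l1 -> rect j.+1 A. Proof. by case: d => _ _ [_ h] _ _; exact: h. Qed.
Let u0 : uniq l0. Proof. exact: (grid_uniq sqK g0). Qed.
Let u1 : uniq l1. Proof. exact: (grid_uniq sqK g1). Qed.
Let lB B : B \in l0 -> lat q p B. Proof. exact: (grid_lat sqK g0). Qed.
Let lA A : A \in l1 -> lat q p A. Proof. exact: (grid_lat sqK g1). Qed.
Let jS : (j.+1%:R : R) = j%:R + 1. Proof. by rewrite natr1. Qed.
Let n := (k - j).-1.
Let kn : (k - j)%:R = n%:R + 1 :> R. Proof. exact: kj. Qed.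

(* Two vertical segments would lie in a plane. *)
Lemma quad_indep : A0.1 = A1.1 -> B0.1 != B1.1.
Proof.
move=> eA; apply/eqP => eB.
have sc : scell l by exists j, l0, l1.
have ul : uniq l := scell_uniq sqK sc.
have same (w1 w2 : P3 -> R) (b : seq R) : rep (cs3 R) l w1 b -> rep (cs3 R) l w2 b -> w1 =1 w2.
  move=> r1 r2; have e : b = [:: E l w1 (cr 0); E l w1 (cr 1); E l w1 (cr 2)] by case: r1 => _ _ _ <-.
  apply: (scell_same cop sqK sc sc (P := ((E l w1 (cr 0), E l w1 (cr 1)), E l w1 (cr 2)))); by rewrite /rep3 /= -e.
pose al := A1.2 - A0.2; pose be := B1.2 - B0.2.
have al0 : al != 0.
  rewrite subr_eq0; apply/eqP => e; move: u1; rewrite /= inE andbT => /eqP; apply.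
  by rewrite (surjective_pairing A0) (surjective_pairing A1) eA e.
pose D (Q : P3) : R := (al * (Q == (B1, j%:R))%:R + (- al) * (Q == (B0, j%:R))%:R) +
  (be * (Q == (A0, j.+1%:R))%:R + (- be) * (Q == (A1, j.+1%:R))%:R).
have mB B : B \in l0 -> (B, j%:R : R) \in l by move=> h; rewrite mem_cat !mem_layer eqxx h.
have mA A : A \in l1 -> (A, j.+1%:R : R) \in l by move=> h; rewrite mem_cat !mem_layer eqxx h orbT.
have ED' f : E l D f = (al * f (B1, j%:R) + (- al) * f (B0, j%:R)) + (be * f (A0, j.+1%:R) + (- be) * f (A1, j.+1%:R)).
  by rewrite /D (EwD l (fun Q => al * (Q == (B1, j%:R))%:R + (- al) * (Q == (B0, j%:R))%:R)) !E_two ?mB ?mA.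
have D0 : D (B1, j%:R) = 0.
  apply: (cell_indep ul same (d := D)); [by rewrite ED'; ring | | exact: mB].
  move=> c; rewrite ED' /=; case=> [<-|[<-|[<-|//]]] /=.
  - by rewrite eA eB; ring.
  - by rewrite /al /be; ring.
  - ring.
have nj : (j%:R : R) == j.+1%:R = false by rewrite eqr_nat ltn_eqF.
move: D0; rewrite /D !xpair_eqE nj !andbF !eqxx !andbT !mulr0 !addr0 mulr1.
have -> : (B1 == B0) = false by apply/negbTE; move: u0; rewrite /= inE andbT eq_sym.
by rewrite mulr0 addr0; apply/eqP.
Qed.

Let good_top ax Z0 Z1 C D : perm_eq l [:: (Z0, j.+1%:R); (Z1, j.+1%:R); (C, j%:R); (D, j%:R)] ->
  co ax Z1 = co ax Z0 -> (co (~~ ax) Z1 = co (~~ ax) Z0 + 1 \/ co (~~ ax) Z1 = co (~~ ax) Z0 - 1) ->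
  goodm q p ax Pm C D -> lat q p Z0 -> lat q p Z1 -> lat q p C -> lat q p D -> good4 q p Pm l.
Proof.
move=> pl e1 e2 g z0 z1 c0 d0.
apply: (good4_edge q0 cop (d := - 1) (z := j.+1%:Z) e1 e2 g z0 z1 c0 d0); first by right.
by rewrite zB.
Qed.

Let good_bot ax Z0 Z1 C D : perm_eq l [:: (Z0, j%:R); (Z1, j%:R); (C, j.+1%:R); (D, j.+1%:R)] ->
  co ax Z1 = co ax Z0 -> (co (~~ ax) Z1 = co (~~ ax) Z0 + 1 \/ co (~~ ax) Z1 = co (~~ ax) Z0 - 1) ->
  goodm q p ax Pm C D -> lat q p Z0 -> lat q p Z1 -> lat q p C -> lat q p D -> good4 q p Pm l.
Proof.
move=> pl e1 e2 g z0 z1 c0 d0.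
apply: (good4_edge q0 cop (d := 1) (z := j%:Z) e1 e2 g z0 z1 c0 d0); first by left.
by rewrite zS.
Qed.

Let pm := perm4 (B0, j%:R : R) (B1, j%:R) (A0, j.+1%:R) (A1, j.+1%:R).

Let bot_cell ax : co ax B0 = co ax B1 -> co ax B0 \is a Num.int ->
  goodm q p ax Pm A0 A1 \/ goodm q p ax Pm A1 A0 -> good4 q p Pm l.
Proof.
move=> e i g; have [_ _ h] := unit_edge g0 e i.
case: g => g.
- exact: (good_bot (perm_refl _) (esym e) h g (lB b0) (lB b1) (lA a0) (lA a1)).
- by apply: (good_bot _ (esym e) h g (lB b0) (lB b1) (lA a1) (lA a0)); case: pm.
Qed.

Let top_cell ax : co ax A0 = co ax A1 -> co ax A0 \is a Num.int ->
  goodm q p ax Pm B0 B1 \/ goodm q p ax Pm B1 B0 -> good4 q p Pm l.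
Proof.
move=> e i g; have [_ _ h] := unit_edge g1 e i.
case: g => g.
- by apply: (good_top _ (esym e) h g (lA a0) (lA a1) (lB b0) (lB b1)); case: pm.
- apply: (good_top _ (esym e) h g (lA a0) (lA a1) (lB b1) (lB b0)).
  case: pm => _ h1 _ _; apply: (perm_trans h1).
  by case: (perm4 (A0, j.+1%:R : R) (A1, j.+1%:R) (B0, j%:R) (B1, j%:R)).
Qed.

Let mB : exists w, rep2 l0 w ((B0.1 + B1.1) / 2, (B0.2 + B1.2) / 2) := rep2_mid u0 b0 b1.
Let mA : exists w, rep2 l1 w ((A0.1 + A1.1) / 2, (A0.2 + A1.2) / 2) := rep2_mid u1 a0 a1.

Let conv_rect w B : rep2 l0 w B -> 0 <= B.1 <= n%:R + 1.
Proof.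
move=> r; have inl X : w X != 0 -> X \in l0 by case: r => _ hh _ _; apply: contraNT => /hh ->.
rewrite -kn; apply/andP; split.
- by apply: (co_le (ax := true) r) => X /inl /rB [/andP[]].
- by apply: (co_ge (ax := true) r) => X /inl /rB [/andP[]].
Qed.

(* The bottom edge covers an open unit interval, so the staircase pins the top points. *)
Let pin_top (m : nat) w : m%:R < (B0.1 + B1.1) / 2 < m.+1%:R -> forall A, rep2 l1 w A ->
  (m <= n)%N /\ A.1 = alx_ j A m.
Proof.
move=> /andP[m1 m2] A rA'; have [v rM] := mB; have [rx _] := hr rM rA'.
have mn : (m <= n)%N.
  have /andP[_ h] := conv_rect rM; rewrite leqNgt; apply/negP => lt.
  have : (n.+1%:R : R) <= m%:R by rewrite ler_nat.
  by have -> : (n.+1%:R : R) = n%:R + 1 by [rewrite natr1]; move: h; rewrite /=; lra.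
split=> //; have [s1 s2] := rx m mn; rewrite /= in s1 s2.
case: (ltrgtP A.1 (alx_ j A m)) => // h.
- by have := s1 h; lra.
- by have := s2 h; lra.
Qed.

(** If the upper edge is not vertical, it pins the lower edge to a vertical integral line, and this
    in turn pins the upper edge to a curve. If it is vertical, the lower edge pins it to an integral
    line and is itself pinned to a curve when [j > 0]; for [j = 0] this leaves a copy of Delta'.
    With [row] and [j = 0] the lower edge is a unit segment and pins the upper one to a curve of the
    other family. *)
Lemma cell22 : good4 q p Pm l \/ row = false /\ raw4 l.
Proof.
have hB0 := rB b0; have hB1 := rB b1; have hA0 := rA a0; have hA1 := rA a1.
have [wA0 rA0] := rep2_pt u1 a0; have [wA1 rA1] := rep2_pt u1 a1.
have [wB0 rB0] := rep2_pt u0 b0; have [wB1 rB1] := rep2_pt u0 b1.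
have bneq : B0 != B1 by move: u0; rewrite /= inE andbT.
have flat : j = 0%N -> B0.2 = 0 /\ B1.2 = 0.
  by move=> e; subst j; move: hB0 hB1 => [_ h] [_ h']; split; lra.
have flatx : j = 0%N -> B0.1 != B1.1.
  move=> /flat[e0 e1]; apply: contra bneq => /eqP e.
  by rewrite (surjective_pairing B0) (surjective_pairing B1) e e0 e1.
have [/andP[hrow /eqP j0]|nrow] := boolP (row && (j == 0%N)).
  left; have [e0 e1] := flat j0.
  have [m [hm _]] := @mid_floor true B0 B1 g0 (flatx j0) (proj1 (andP (proj1 hB0))) (proj1 (andP (proj1 hB1))).
  apply: (@bot_cell false); rewrite /co ?e0 ?e1 ?rpred0 //.
  apply: (edge_goodm (pg hrow) Hg g1 (i := m)) => w A rA'.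
  by have [_] := pin_top hm rA'; rewrite /alx hrow j0.
have alE A i : alx_ j A i = i%:R by rewrite /alx (negbTE nrow).
have [eA|nA] := eqVneq A0.1 A1.1; last first.
  have [m [hm [hm0 hm1]]] := @mid_floor true A0 A1 g1 nA (proj1 (andP (proj1 hA0))) (proj1 (andP (proj1 hA1))).
  rewrite /co in hm hm0 hm1.
  have mn : (m.+1 <= n)%N.
    rewrite -(ltr_nat R); have := hA0.1; have := hA1.1; rewrite kj1 -/n.
    move: nA; case/andP: hm; case: (ltrgtP A0.1 A1.1) => //; lra.
  have eqB w B : rep2 l0 w B -> B.1 = m.+1%:R.
    move=> r; have [v rM] := mA; have [rx _] := hr r rM.
    have [_ s2] := rx m (ltnW mn); have [s1 _] := rx m.+1 mn.
    rewrite !alE /= in s1 s2; case/andP: hm => h1 h2.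
    by have := s1 h2; have := s2 h1; lra.
  have x0 := eqB _ _ rB0; have x1 := eqB _ _ rB1.
  have j0 : (0 < j)%N by case: (posnP j) => // /flatx; rewrite x0 x1 eqxx.
  left; apply: (@bot_cell true); rewrite /co ?x0 ?x1 ?natr_int //.
  have nB : B0.2 != B1.2.
    apply: contra bneq => /eqP e; by rewrite (surjective_pairing B0) (surjective_pairing B1) x0 x1 e.
  have [i [hi [hi0 hi1]]] := @mid_floor false B0 B1 g0 nB (proj1 (andP (proj2 hB0))) (proj1 (andP (proj2 hB1))).
  rewrite /co in hi hi0 hi1.
  have ij : (i.+1 <= j)%N.
    rewrite -(ltr_nat R); have := hB0.2; have := hB1.2.
    move: nB; case/andP: hi; case: (ltrgtP B0.2 B1.2) => //; lra.
  apply: (edge_goodm pe He g1 (i := i.+1)) => w A rA'.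
  have [v rM] := mB; have [_ ry] := hr rM rA'; have eM := eqB _ _ rM.
  case: ry => [e|ry]; first by rewrite e in j0.
  have ij1 : (i.+1 <= j.+1)%N by apply: ltnW.
  have [s1 s2] := ry i.+1 ij1.
  have ne1 : (i == j.+1) = false by apply: ltn_eqF; apply: ltnW.
  have ne2 : (i.+1 == j.+1) = false by apply: ltn_eqF.
  have em : (m.+1%:R : R) = m.+1%:Z%:~R by [].
  rewrite eM /bey ?ne1 ?ne2 em !(curve_int pe) /= in s1 s2.
  case/andP: hi => h1 h2; apply: le_anti; apply/andP; split; rewrite leNgt; apply/negP => h.
  - by have := s2 h; lra.
  - by have := s1 h; lra.
have nB := quad_indep eA.
have [m [hm [hm0 hm1]]] := @mid_floor true B0 B1 g0 nB (proj1 (andP (proj1 hB0))) (proj1 (andP (proj1 hB1))).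
rewrite /co in hm hm0 hm1.
have xA w A : rep2 l1 w A -> A.1 = m%:R by move=> r; have [_] := pin_top hm r; rewrite alE.
have [mn _] := pin_top hm rA0.
have x0 := xA _ _ rA0; have x1 := xA _ _ rA1.
have nA : A0.2 != A1.2.
  apply/eqP => e; move: u1; rewrite /= inE andbT => /eqP; apply.
  by rewrite (surjective_pairing A0) (surjective_pairing A1) x0 x1 e.
have [iA0 iA1 hA] : [/\ A0.2 \is a Num.int, A1.2 \is a Num.int & A1.2 = A0.2 + 1 \/ A1.2 = A0.2 - 1].
  by apply: (@unit_edge true A0 A1 g1); rewrite /co ?x0 ?x1 ?natr_int.
case: (posnP j) => [j0|j0].
  right; split; first by move: nrow; rewrite j0 andbT => /negbTE.
  have [e0 e1] := flat j0; exists m; split.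
    by move: mn; rewrite /n j0 subn0; move: k0; clear; lia.
  have i0 : B0.1 \is a Num.int by rewrite (lat_x cop (lB b0)) e0 rpred0.
  have i1 : B1.1 \is a Num.int by rewrite (lat_x cop (lB b1)) e1 rpred0.
  have im (z : R) : z \is a Num.int -> m%:R <= z <= m.+1%:R -> z = m%:R \/ z = m.+1%:R.
    move=> zi hz; have [h|h] := ltP z m.+1%:R; last by right; lra.
    left; suff : z - m%:R = 0 by lra.
    apply: int_small; first by rewrite rpredB ?natr_int.
    by rewrite -natr1 in h; lra.
  have {}hA : A0.2 = 0 /\ A1.2 = 1 \/ A0.2 = 1 /\ A1.2 = 0.
    have := hA0.2; have := hA1.2; rewrite jS j0.
    by case: hA => e; rewrite e => h h'; [left | right]; split; lra.
  have {}hBB : B0.1 = m%:R /\ B1.1 = m.+1%:R \/ B0.1 = m.+1%:R /\ B1.1 = m%:R.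
    case: (im _ i0 hm0) => e; case: (im _ i1 hm1) => e'; rewrite ?e ?e' ?eqxx // in nB *; auto.
  rewrite /l /l0 /l1 /= j0 (surjective_pairing A0) (surjective_pairing A1) (surjective_pairing B0) (surjective_pairing B1).
  rewrite x0 x1 e0 e1.
  pose c0 : P3 := ((m%:R, 0), 0); pose c1 : P3 := ((m.+1%:R, 0), 0).
  pose c2 : P3 := ((m%:R, 0), 1); pose c3 : P3 := ((m%:R, 1), 1).
  have [t1 t2] := perm22 c0 c1 c2 c3; have [t3 _ _ _] := perm4 c0 c1 c3 c2.
  by case: hA => -[-> ->]; case: hBB => -[-> ->].
left; apply: (@top_cell true); rewrite /co ?x0 ?x1 ?natr_int //.
have [i [hi [hi0 hi1]]] := @mid_floor false A0 A1 g1 nA (proj1 (andP (proj2 hA0))) (proj1 (andP (proj2 hA1))).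
rewrite /co in hi hi0 hi1.
have ij : (i.+1 <= j.+1)%N.
  rewrite -(ltr_nat R); have := hA0.2; have := hA1.2.
  move: nA; case/andP: hi; case: (ltrgtP A0.2 A1.2) => //; lra.
apply: (edge_goodm pe He g0 (i := i)) => w B rB'.
have [v rM] := mA; have [_ ry] := hr rB' rM; have eM := xA _ _ rM.
case: ry => [e|ry]; first by rewrite e in j0.
have [_ s2] := ry i (ltnW ij); have [s1 _] := ry i.+1 ij.
have ne : (i == j.+1) = false by apply: ltn_eqF.
rewrite eM /bey ne in s1 s2.
have em : (m%:R : R) = m%:Z%:~R by [].
rewrite em !(curve_int pe) /= in s1 s2.
case/andP: hi => h1 h2; apply: le_anti.
by rewrite (s1 h2) (s2 h1).
Qed.

End Quad.

Lemma scell_cells l : scell l -> size l = 4 -> good4 q p Pm l \/ row = false /\ raw4 l.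
Proof.
move=> [j [l0 [l1 d]]]; have [jk [g0 g1] _ _ el] := d.
rewrite el size_cat !size_map => s4; rewrite el in d.
have sz l' : gface K l' -> (size l' <= 3)%N by case=> [->//|]; exact: grid_size.
have h0 := sz _ g0; have h1 := sz _ g1.
have [e0|n0] := eqVneq (size l0) 2.
  have e1 : size l1 = 2 by move: s4; rewrite e0; clear; lia.
  case: l0 l1 e0 e1 d g0 g1 {el s4 h0 h1} => [|B0 [|B1 [|]]] // [|A0 [|A1 [|]]] // _ _ d g0 g1.
  have {}g0 : grid K [:: B0; B1] by case: g0.
  have {}g1 : grid K [:: A0; A1] by case: g1.
  exact: cell22 d g0 g1.
left; apply: (cell31 d); move: s4 h0 h1 n0; move: (size l0) (size l1); clear => a b.
by case: a => [|[|[|[|a]]]] //; case: b => [|[|[|[|b]]]] //; auto.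
Qed.

End StackCells.

(** * Triangulations with standard boundary *)

Section StdUniq.
Variables (R : realType) (T : eqType).

Lemma three_lines (a0 a1 a2 x1 x2 y0 y2 z0 z1 : int) :
  a0 + x1 + x2 = a0 + a1 + a2 -> y0 + a1 + y2 = a0 + a1 + a2 -> z0 + z1 + a2 = a0 + a1 + a2 ->
  x1 != a1 -> y0 != a0 -> z0 != a0 ->
  -1 <= a0 - y0 <= 1 -> -1 <= x1 - a1 <= 1 -> -1 <= x2 - y2 <= 1 ->
  -1 <= a0 - z0 <= 1 -> -1 <= x1 - z1 <= 1 -> -1 <= x2 - a2 <= 1 ->
  -1 <= y0 - z0 <= 1 -> -1 <= a1 - z1 <= 1 -> -1 <= y2 - a2 <= 1 -> False.
Proof. by lia. Qed.

(* Lattice points of a dilated triangle with coordinates differing by at most 1 lie in a standard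
   unimodular triangle; three points of such a triangle on the three standard lines through
   another lattice point cannot exist. *)
Lemma std_uniq (s1 s2 : seq T) (w1 w2 : T -> R) (f1 f2 : nat -> T -> R) (c : R) :
  uniq s1 -> uniq s2 ->
  (forall p, 0 <= w1 p) -> (forall p, 0 <= w2 p) ->
  (forall p, p \notin s1 -> w1 p = 0) -> (forall p, p \notin s2 -> w2 p = 0) ->
  E s1 w1 (fun _ => 1) = 1 -> E s2 w2 (fun _ => 1) = 1 ->
  (forall i, (i < 3)%N -> E s1 w1 (f1 i) = E s2 w2 (f2 i)) ->
  (forall p, w1 p != 0 -> [/\ f1 0%N p \is a Num.int, f1 1%N p \is a Num.int, f1 2%N p \is a Num.int &
     f1 0%N p + f1 1%N p + f1 2%N p = c]) ->
  (forall p, w2 p != 0 -> [/\ f2 0%N p \is a Num.int, f2 1%N p \is a Num.int, f2 2%N p \is a Num.int &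
     f2 0%N p + f2 1%N p + f2 2%N p = c]) ->
  (forall i p p', (i < 3)%N -> w1 p != 0 -> w1 p' != 0 -> `|f1 i p - f1 i p'| <= 1) ->
  (forall i p p', (i < 3)%N -> w2 p != 0 -> w2 p' != 0 -> `|f2 i p - f2 i p'| <= 1) ->
  (forall p p', w1 p != 0 -> w2 p' != 0 -> (forall i, (i < 3)%N -> f1 i p = f2 i p') -> p = p') ->
  w1 =1 w2.
Proof.
move=> us1 us2 p1 p2 z1 z2 m1 m2 mean i1 i2 d1 d2 sep.
have in1 p : w1 p != 0 -> p \in s1 by apply: contraNT => /z1 ->.
have in2 p : w2 p != 0 -> p \in s2 by apply: contraNT => /z2 ->.
have le12 p : w1 p <= w2 p.
  rewrite leNgt; apply/negP => lt.
  have wp : w1 p != 0 by rewrite gt_eqF //; have := p2 p; lra.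
  (* Suppose [w1 p > w2 p]. By [hat_mass] both weights put the same mass on each line through [p]
     parallel to a side, so the second cell has a vertex other than [p] on each of the three
     lines. *)
  have ex i : (i < 3)%N -> exists p', [/\ w2 p' != 0, p' != p & f2 i p' = f1 i p].
    move=> hi; apply: contrapT => hn.
    have int1 x : w1 x != 0 -> f1 i x \is a Num.int.
      by move=> /i1[]; case: i hi {hn} => [|[|[|]]].
    have int2 x : w2 x != 0 -> f2 i x \is a Num.int.
      by move=> /i2[]; case: i hi {hn int1} => [|[|[|]]].
    have h1 := @hat_mass R T s1 w1 (f1 i) p1 m1 (fun x _ => int1 x) (fun x y _ _ => d1 i x y hi) _ (int1 _ wp).
    have h2 := @hat_mass R T s2 w2 (f2 i) p2 m2 (fun x _ => int2 x) (fun x y _ _ => d2 i x y hi) _ (int1 _ wp).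
    rewrite -mean // -h1 in h2.
    have ge1 : w1 p <= E s1 w1 (fun x => (f1 i x == f1 i p)%:R).
      rewrite -(E_pick us1 w1 (in1 _ wp)); apply: E_le => // x _ _.
      by case: eqP => [->|_]; rewrite ?eqxx // ler0n.
    have le2 : E s2 w2 (fun x => (f2 i x == f1 i p)%:R) <= w2 p.
      have [p2s|p2n] := boolP (p \in s2).
        rewrite -(E_pick us2 w2 p2s); apply: E_le => // x _ wx.
        case: (eqVneq x p) => [_|ne]; first by case: eqP.
        by case: eqP => // e; case: hn; exists x.
      rewrite (z2 _ p2n) -[leRHS](_ : E s2 w2 (fun _ => 0) = 0); last by rewrite /E big1 // => x _; rewrite mulr0.
      apply: E_le => // x xs wx; case: eqP => // e; case: hn; exists x; split=> //.
      by apply: contraNneq p2n => <-.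
    by move: lt ge1 le2; rewrite h2; lra.
  have [x0 [w0x n0 e0]] := ex 0%N isT; have [x1 [w1x n1 e1]] := ex 1%N isT; have [x2 [w2x n2 e2]] := ex 2%N isT.
  have [a0 a1 a2 ac] := i1 p wp.
  have [b0 b1 b2 bc_] := i2 x0 w0x; have [c0 c1 c2 cc] := i2 x1 w1x; have [g0 g1 g2 gc] := i2 x2 w2x.
  have neq x : w2 x != 0 -> x != p -> f2 0%N x = f1 0%N p -> f2 1%N x = f1 1%N p -> f2 2%N x = f1 2%N p -> False.
    move=> wx /eqP nx e e' e''; apply: nx; apply/esym; apply: sep => // i.
    by case: i => [|[|[|]]].
  have dz (u v : int) : `|u%:~R - v%:~R| <= 1 :> R -> -1 <= u - v <= 1.
    by rewrite -rmorphB -intr_norm lerz1 ler_norml.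
  have d01 i hi := d2 i x0 x1 hi w0x w1x; have d02 i hi := d2 i x0 x2 hi w0x w2x.
  have d12 i hi := d2 i x1 x2 hi w1x w2x.
  have [A0 h0] := intrP a0; have [A1 h1] := intrP a1; have [A2 h2] := intrP a2.
  have [X1 k1] := intrP b1; have [X2 k2] := intrP b2.
  have [Y0 l0] := intrP c0; have [Y2 l2] := intrP c2.
  have [Z0 o0] := intrP g0; have [Z1 o1] := intrP g1.
  rewrite h0 in e0; rewrite h1 in e1; rewrite h2 in e2.
  have eq3 (a b d a' b' d' : int) : a%:~R + b%:~R + d%:~R = c -> a'%:~R + b'%:~R + d'%:~R = c :> R ->
      a + b + d = a' + b' + d'.
    by move=> q1 q2; apply: (@intr_inj R); rewrite !rmorphD /= q1 q2.
  have ne3 x (u v : int) : w2 x != 0 -> x != p -> (u = v -> [/\ f2 0%N x = f1 0%N p, f2 1%N x = f1 1%N p & f2 2%N x = f1 2%N p]) -> u != v.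
    by move=> wx nx h; apply/eqP => /h[q0 q1 q2]; exact: (neq x wx nx q0 q1 q2).
  have s0 : A0 + X1 + X2 = A0 + A1 + A2 by apply: eq3; [rewrite -e0 -k1 -k2 | rewrite -h0 -h1 -h2].
  have s1' : Y0 + A1 + Y2 = A0 + A1 + A2 by apply: eq3; [rewrite -e1 -l0 -l2 | rewrite -h0 -h1 -h2].
  have s2' : Z0 + Z1 + A2 = A0 + A1 + A2 by apply: eq3; [rewrite -e2 -o0 -o1 | rewrite -h0 -h1 -h2].
  apply: (three_lines s0 s1' s2'); try (by apply: dz; rewrite -?e0 -?e1 -?e2 -?k1 -?k2 -?l0 -?l2 -?o0 -?o1; auto).
  - apply: (ne3 x0) => // e; rewrite e0 k1 k2 h0 h1 h2 e; split=> //; congr _%:~R; move: s0 e; clear; lia.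
  - apply: (ne3 x1) => // e; rewrite e1 l0 l2 h0 h1 h2 e; split=> //; congr _%:~R; move: s1' e; clear; lia.
  - apply: (ne3 x2) => // e; rewrite e2 o0 o1 h0 h1 h2 e; split=> //; congr _%:~R; move: s2' e; clear; lia.
(* Two weights of total mass 1, one below the other, agree. *)
have s12 : {subset [seq x <- s1 | w1 x != 0] <= s2}.
  move=> x; rewrite mem_filter => /andP[wx _]; apply: in2; rewrite gt_eqF //.
  by apply: lt_le_trans (le12 x); rewrite lt_neqAle eq_sym wx p1.
have zf x : x \notin [seq x <- s1 | w1 x != 0] -> w1 x = 0.
  by rewrite mem_filter negb_and negbK => /orP[/eqP//|/z1].
have m12 : E s2 w1 (fun _ => 1) = 1.
  rewrite (E_widen _ (filter_uniq _ us1) us2 s12 zf) -[RHS]m1; apply/esym; apply: E_widen => //.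
  - exact: filter_uniq.
  - by move=> x; rewrite mem_filter => /andP[].
move=> x; have [xs|xn] := boolP (x \in s2); last first.
  by rewrite (z2 _ xn); apply/eqP; rewrite eq_le p1 andbT -(z2 _ xn) le12.
apply/eqP; rewrite eq_sym -subr_eq0; apply: contraT => nz.
have le0 : E s2 (fun y => w2 y - w1 y) (fun _ => 1) <= 0.
  have -> : E s2 (fun y => w2 y - w1 y) (fun _ => 1) = E s2 w2 (fun _ => 1) - E s2 w1 (fun _ => 1).
    by rewrite /E -sumrB; apply: eq_bigr => y _; rewrite mulrBl.
  by rewrite m2 m12 subrr.
have := @E_ge0_eq0 _ _ s2 (fun y => w2 y - w1 y) (fun _ => 1) _ _ le0 x xs nz.
move=> h; have /eqP : (1 : R) = 0 by apply: h => [y|y _ _]; rewrite ?subr_ge0 ?le12 ?ler01.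
by rewrite oner_eq0.
Qed.

End StdUniq.

Section Tri.
Variable R : realType.
Notation P2 := (R * R)%type.
Notation P3 := (R * R * R)%type.

(* [tri_std] says that the boundary is standard: on the facet [bc i = 0] all [bc j] are integers. *)
Record tri q p (k : nat) (Pm : int -> Prop) (K : seq P3 -> Prop) : Prop := Tri {
  tri_cplx : cplx q p (inD (k%:R : R)) K;
  tri_std : forall l P Q i, K l -> P \in l -> Q \in l -> bc k%:R i P = 0 -> bc k%:R i Q = 0 ->
    forall j, `|bc k%:R j P - bc k%:R j Q| <= 1;
  tri_good : forall l, K l -> size l = 4 -> good4 q p Pm l }.

Lemma facet_int (q : nat) (p : int) (k : nat) i (P : P3) : (exists u v : int, u * p + v * q%:Z = 1) -> lat3 q p P ->
  bc k%:R i P = 0 -> cr 0 P \is a Num.int.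
Proof.
move=> cop /andP[lP zi]; have e := lat_x cop lP.
case: i => [|[|[|i]]] /= h; rewrite /cr in h *.
- have -> : P.1.1 = k%:R - P.2 by lra.
  by rewrite rpredB ?natr_int.
- by rewrite h rpred0.
- by rewrite e; have -> : P.1.2 = P.2 by lra.
- by rewrite e h rpred0.
Qed.

Lemma step_goodm q p ax (C D : P2) : lat q p C -> lat q p D -> step q ax C D -> goodm q p ax (eq^~ 1) C D.
Proof.
move=> lC lD st; have lDC := lat_sub lD lC.
pose W : P2 := if ax then (D.1 - C.1, D.2 - C.2 - 1) else (D.1 - C.1 - 1, D.2 - C.2).
exists 1, W, 1; split=> //.
- have l10 : lat q p (if ax then (0, 1) else (1, 0) : P2).
    by case: (ax); apply: lat_int; rewrite ?rpred0 ?rpred1.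
  have := lat_sub lDC l10; rewrite /W; case: (ax) => /=; congr (lat _ _ (_, _)); ring.
- by rewrite -st /W /co; case: (ax).
- by left.
- by rewrite !mul1r /W; move: st; rewrite /step /co; case: (ax) => /=; split; lra.
Qed.

Lemma zigzag_tri q k : (0 < q)%N -> (1 < k)%N -> exists K, tri q 1 k (eq^~ 1) K.
Proof.
move=> q0 k1.
have cop : exists u v : int, u * 1 + v * q%:Z = 1 by exists 1, 0; rewrite mul0r addr0 mulr1.
have [K [lo [up [sq pe pg]]]] := @zigzag_square R q 1 q0 cop.
have {pg}[L [U pg]] := pg erefl.
have k0 : (0 < k)%N by apply: ltnW.
have g1 ax C D := @step_goodm q 1 ax C D.
exists (scell K lo up L U true k); split.
- exact: (scell_cplx cop sq pe (fun _ => pg) k0 (fun _ => k1)).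
- move=> l P Q i sl Pl Ql eP eQ; apply: (scell_std cop sq pe (fun _ => pg) sl Pl Ql).
  + exact: (facet_int cop (scell_lat sq sl Pl) eP).
  + exact: (facet_int cop (scell_lat sq sl Ql) eQ).
- move=> l sl s4.
  by have [] := scell_cells q0 cop sq pe (fun _ => pg) k0 (fun _ => k1) (erefl : (eq^~ 1) 1) (@g1 true) (@g1 false) sl s4 => // -[].
Qed.

Lemma goodp_goodm q p ax (C D : P2) : goodp q p ax C D -> goodm q p ax (fun _ => True) C D.
Proof. by move=> [m [W [e [h1 h2 h3 h4 h5]]]]; exists m, W, e; split. Qed.

Lemma pin_tri q (p p2 c dl : int) k : (0 < q)%N -> 1 <= c ->
  p * p2 = dl + c * q%:Z -> p < q%:Z -> p2 < q%:Z ->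
  [/\ dl = 1, 2 * c + 1 <= p & 2 * c + 1 <= p2] \/ [/\ dl = -1, 2 * c <= p & 2 * c <= p2] ->
  (1 < k)%N -> exists K, tri q p k (fun _ => True) K.
Proof.
move=> q0 c0 inv pq p2q cas k1.
have cop : exists u v : int, u * p + v * q%:Z = 1.
  exists (dl * p2), (- dl * c).
  have -> : dl * p2 * p + - dl * c * q%:Z = dl * (p * p2 - c * q%:Z) by ring.
  by rewrite inv; case: cas => -[-> _ _]; ring.
have [K [lo [up [L [U [sq pe pg]]]]]] := @pinwheel_square R q p p2 c dl q0 c0 inv pq p2q cas.
have k0 : (0 < k)%N by apply: ltnW.
exists (scell K lo up L U true k); split.
- exact: (scell_cplx cop sq pe (fun _ => pg) k0 (fun _ => k1)).
- move=> l P Q i sl Pl Ql eP eQ; apply: (scell_std cop sq pe (fun _ => pg) sl Pl Ql).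
  + exact: (facet_int cop (scell_lat sq sl Pl) eP).
  + exact: (facet_int cop (scell_lat sq sl Ql) eQ).
- move=> l sl s4.
  have h ax C D (_ : lat q p C) (_ : lat q p D) := @goodp_goodm q p ax C D.
  by have [] := @scell_cells R q p K q0 cop sq _ _ lo up L U true k (fun _ => True) pe (fun _ => pg) k0 (fun _ => k1) I (h true) (h false) l sl s4 => // -[].
Qed.

(** The variant with [row = false] is available for every [p] and is compatible with the planes that
    cut a sum of factors. Its only defect is the copies of Delta'. *)
Lemma zigzag_raw q (p : int) k : (0 < q)%N -> (exists u v : int, u * p + v * q%:Z = 1) -> (0 < k)%N ->
  exists K : seq P3 -> Prop, [/\ cplx q p (inD (k%:R : R)) K,
    forall l P Q, K l -> P \in l -> Q \in l -> cr 0 P \is a Num.int -> cr 0 Q \is a Num.int ->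
      forall i, `|bc k%:R i P - bc k%:R i Q| <= 1,
    forall (f : bool) (c : nat) l, (c <= k)%N -> K l ->
      (forall P, P \in l -> cr 0 P + f%:R * cr 2 P <= c%:R) \/ (forall P, P \in l -> c%:R <= cr 0 P + f%:R * cr 2 P) &
    forall l, K l -> size l = 4 -> good4 q p (eq^~ 1) l \/ raw4 k l].
Proof.
move=> q0 cop k0.
have [K [lo [up [sq pe _]]]] := @zigzag_square R q p q0 cop.
have pg : false -> paths K (co false) (co true) (step q false) lo up by [].
have g1 ax C D := @step_goodm q p ax C D.
exists (scell K lo up lo up false k); split.
- exact: (scell_cplx cop sq pe pg k0 (fun h : is_true false => False_ind _ (notF h))).
- move=> l P Q sl Pl Ql; exact: (scell_std cop sq pe pg sl Pl Ql).
- move=> f c l ck sl; exact: (scell_side sq f erefl ck sl).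
- move=> l sl s4.
  by have [h|[_ h]] := scell_cells q0 cop sq pe pg k0 (fun h : is_true false => False_ind _ (notF h)) (erefl : (eq^~ 1) 1) (@g1 true) (@g1 false) sl s4; [left | right].
Qed.

End Tri.

(** * Affine images of cells and complexes *)

Lemma good4_map (R : realType) (f : R * R * R -> R * R * R) q p q' p' (Pm : int -> Prop) l :
  (forall i, aff3 (fun P => cr i (f P))) ->
  (forall P, lat3 q p P -> lat3 q' p' (f P)) ->
  (forall X, lat3 q' p' X -> exists2 Y, lat3 q p Y & X = f Y) ->
  good4 q p Pm l -> good4 q' p' Pm (map f l).
Proof.
move=> fa hl hl' [a [b [c [d [w [m [pl hm lw eq sp]]]]]]].
pose o : (R * R * R)%type := ((0, 0), 0).
(* [w] is a vector, so it is mapped by the linear part of [f], found by subtracting the image of the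
   origin. *)
pose v : (R * R * R)%type := ((cr 0 (f w) - cr 0 (f o), cr 1 (f w) - cr 1 (f o)), cr 2 (f w) - cr 2 (f o)).
have cv i : cr i v = cr i (f w) - cr i (f o) by case: i => [|[|i]].
have o0 i : cr i o = 0 by case: i => [|[|i]].
exists (f a), (f b), (f c), (f d), v, m; split=> //.
- exact: (perm_map f pl).
- have lo : lat3 q p o by rewrite /lat3 /lat /= !mulr0 !subr0 !rpred0.
  case/andP: (hl _ lw) (hl _ lo) => l1 z1 /andP[l2 z2].
  by rewrite /lat3 (lat_sub l1 l2) /= rpredB.
- move=> i; rewrite cv; have [al [be [ga [de h]]]] := fa i; rewrite !h !o0.
  have -> : al + be * cr 0 b + ga * cr 1 b + de * cr 2 b - (al + be * cr 0 a + ga * cr 1 a + de * cr 2 a) +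
    (al + be * cr 0 d + ga * cr 1 d + de * cr 2 d - (al + be * cr 0 c + ga * cr 1 c + de * cr 2 c)) =
    be * (cr 0 b - cr 0 a + (cr 0 d - cr 0 c)) + ga * (cr 1 b - cr 1 a + (cr 1 d - cr 1 c)) +
    de * (cr 2 b - cr 2 a + (cr 2 d - cr 2 c)) by ring.
  by rewrite !eq; ring.
- move=> X /hl'[Y lg ->].
  have [n1 [n2 [n3 e]]] := sp _ lg; exists n1, n2, n3 => i.
  rewrite cv; have [al [be [ga [de h]]]] := fa i; rewrite !h !o0 !e; ring.
Qed.

Section Maps.
Variable R : realType.
Notation P2 := (R * R)%type.
Notation P3 := (R * R * R)%type.
Variables (f g : P3 -> P3).
Hypothesis fK : cancel f g.
Hypothesis gK : cancel g f.
Hypothesis fa : forall i, aff3 (fun P => cr i (f P)).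

Lemma mem_fmap (l : seq P3) Q : (Q \in map f l) = (g Q \in l).
Proof.
apply/mapP/idP => [[P Pl ->]|h]; first by rewrite fK.
by exists (g Q).
Qed.

Lemma rep3_map l w P : rep3 l w P -> rep3 (map f l) (w \o g) (f P).
Proof.
move=> r; have /rep3P[w0 ws w1 _] := r.
have e h : E (map f l) (w \o g) h = E l w (h \o f).
  by rewrite /E big_map; apply: eq_bigr => X _ /=; rewrite fK.
apply/rep3P; split=> [Q|Q||i].
- exact: w0.
- by rewrite mem_fmap => /ws.
- by rewrite e.
- by rewrite e (E_aff3 r (fa i)).
Qed.

End Maps.

Section Transport.
Variable R : realType.
Notation P2 := (R * R)%type.
Notation P3 := (R * R * R)%type.

Lemma cplx_map q p q' p' (S S' : P3 -> Prop) (f g : P3 -> P3) K : cancel f g -> cancel g f ->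
  (forall i, aff3 (fun P => cr i (f P))) -> (forall i, aff3 (fun P => cr i (g P))) ->
  (forall P, lat3 q p P = lat3 q' p' (f P)) -> (forall P, S P <-> S' (f P)) ->
  cplx q p S K -> cplx q' p' S' (fun l => exists2 l0, K l0 & l = map f l0).
Proof.
move=> fK gK fa ga hl hS [c1 c2 c3 c4 c5]; split.
- by move=> l [l0 K0 ->]; rewrite map_inj_uniq ?c1 //; exact: can_inj fK.
- by move=> l P [l0 K0 ->] /mapP[X Xl ->]; rewrite -hl; exact: c2 Xl.
- by move=> l P [l0 K0 ->] /mapP[X Xl ->]; apply/hS; exact: c3 Xl.
- move=> P SP; have SP' : S (g P) by apply/hS; rewrite gK.
  have [l [w [Kl r pos]]] := c4 _ SP'; exists (map f l), (w \o g); split.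
  + by exists l.
  + by rewrite -[P]gK; exact: rep3_map.
  + by move=> Q; rewrite (mem_fmap fK gK) => /pos.
- move=> l1 l2 w1 w2 P [m1 K1 ->] [m2 K2 ->] r1 r2 Q.
  have back l w : rep3 (map f l) w P -> rep3 l (w \o f) (g P).
    by move=> r; have := rep3_map gK fK ga r; rewrite -map_comp map_id_in // => X _ /=.
  by have := c5 _ _ _ _ _ K1 K2 (back _ _ r1) (back _ _ r2) (g Q); rewrite /= gK.
Qed.

(** The affine symmetry of the dilated tetrahedron that exchanges the facets x = 0 and x + z = k; it
    turns the lattice of [p] into that of [-p]. *)
Definition refl (k : nat) (P : P3) : P3 := ((k%:R - P.1.1 - P.2, P.1.2), P.2).

Lemma reflK k : involutive (refl k).
Proof. by case=> [[x y] z]; rewrite /refl /=; congr (_, _, _); ring. Qed.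

Lemma refl_aff k i : aff3 (fun P => cr i (refl k P)).
Proof.
case: i => [|[|i]].
- by exists k%:R, (-1), 0, (-1) => P /=; ring.
- by exists 0, 0, 1, 0 => P /=; ring.
- by exists 0, 0, 0, 1 => P /=; ring.
Qed.

Lemma refl_lat q p k (P : P3) : lat3 q p P = lat3 q (- p) (refl k P).
Proof.
have h p' X : lat3 q p' X -> lat3 q (- p') (refl k X).
  move=> /andP[/andP[h1 h2] h3]; rewrite /lat3 /lat /= h1 h3 andbT /= rmorphN /=.
  have -> : k%:R - X.1.1 - X.2 - - p'%:~R * X.1.2 = k%:R - X.2 - (X.1.1 - p'%:~R * X.1.2) by ring.
  by rewrite rpredB // rpredB ?natr_int.
by apply/idP/idP => [/h//|/h]; rewrite opprK reflK.
Qed.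

Definition swap01 (i : nat) : nat := match i with 0 => 1 | 1 => 0 | i => i end%N.

Lemma refl_bc k i (P : P3) : bc k%:R i (refl k P) = bc k%:R (swap01 i) P.
Proof. by case: i => [|[|[|i]]] /=; ring. Qed.

Lemma tri_refl q p k Pm K : tri q p k Pm K ->
  tri q (- p) k Pm (fun l => exists2 l0, K l0 & l = map (refl k) l0).
Proof.
move=> [c s gd]; split.
- apply: (cplx_map (reflK k) (reflK k) (refl_aff k) (refl_aff k) (@refl_lat q p k) _ c).
  move=> P; split=> h i; first by rewrite refl_bc; exact: h.
  by have := h (swap01 i); rewrite refl_bc; case: i => [|[|i]].
- move=> l P Q i [l0 K0 ->] /mapP[X Xl ->] /mapP[Y Yl ->]; rewrite !refl_bc => e1 e2 j; rewrite !refl_bc.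
  exact: s K0 Xl Yl e1 e2 _.
- move=> l [l0 K0 ->]; rewrite size_map => s4.
  apply: (good4_map (refl_aff k) _ _ (gd _ K0 s4)) => P; first by rewrite (refl_lat _ _ k).
  by exists (refl k P); rewrite ?reflK // (refl_lat _ _ k) reflK.
Qed.

Lemma tri_eqp q p p' k Pm (K : seq P3 -> Prop) : (forall P : P2, lat q p P = lat q p' P) -> tri q p k Pm K -> tri q p' k Pm K.
Proof.
move=> h [[c1 c2 c3 c4 c5] s gd].
have h3 (P : P3) : lat3 q p P = lat3 q p' P by rewrite /lat3 h.
split=> //; first by split=> // l P Kl Pl; rewrite -h3; exact: c2 Pl.
move=> l Kl s4; have [a [b [c [d [w [m [g1 g2 g3 g4 g5]]]]]]] := gd l Kl s4.
exists a, b, c, d, w, m; split=> //; first by rewrite -h3.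
by move=> X; rewrite -h3; exact: g5.
Qed.

Lemma lat_mod q (p n : int) (P : P2) : lat q p P = lat q (p + n * q%:Z) P.
Proof.
have h p' n' : lat q p' P -> lat q (p' + n' * q%:Z) P.
  move=> /andP[h1 h2]; rewrite /lat h1 /= rmorphD rmorphM /=.
  have -> : P.1 - (p'%:~R + n'%:~R * q%:R) * P.2 = P.1 - p'%:~R * P.2 - n'%:~R * (q%:R * P.2) by ring.
  by rewrite rpredB // rpredM ?intr_int.
apply/idP/idP => [/h//|/(h _ (- n))]; by rewrite mulNr addrK.
Qed.

End Transport.

(** * Products of dilation factors *)

Section Cell.
Variable R : realType.
Notation P3 := (R * R * R)%type.
Variables (q : nat) (p : int) (k1 k2 : nat).
Hypothesis cop : exists u v : int, u * p + v * q%:Z = 1.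
Hypothesis k10 : (0 < k1)%N.
Hypothesis k20 : (0 < k2)%N.

Definition isdat (l : seq P3) (v : nat -> P3) (w : P3) (m : int) :=
  [/\ perm_eq l [:: v 0%N; v 1%N; v 2%N; v 3%N], 1 <= m, lat3 q p w,
   forall i, cr i (v 1%N) - cr i (v 0%N) + (cr i (v 3%N) - cr i (v 2%N)) = m%:~R * cr i w &
   forall X, lat3 q p X -> exists n1 n2 n3 : int, forall i,
     cr i X = cr i (v 0%N) + n1%:~R * (cr i (v 1%N) - cr i (v 0%N)) +
       n2%:~R * (cr i (v 2%N) - cr i (v 0%N)) + n3%:~R * cr i w].

Lemma good4_dat Pm l : good4 q p Pm l ->
  exists v w m, isdat l v w m /\ forall i, (3 <= i)%N -> v i = v 3%N.
Proof.
move=> [a [b [c [d [w [m [h1 [h2 _] h3 h4 h5]]]]]]].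
exists (fun i => match i with 0 => a | 1 => b | 2 => c | _ => d end%N), w, m; split=> //.
by case=> [|[|[|i]]].
Qed.

(* The affine map taking the vertices k2 * Delta'(1, m) to the points k2 * v i. *)
Definition phi_c (v : nat -> P3) (X : P3) (i : nat) : R :=
  k2%:R * cr i (v 0%N) + cr 0 X * (cr i (v 1%N) - cr i (v 0%N)) +
  cr 1 X * (cr i (v 3%N) - cr i (v 2%N)) + cr 2 X * (cr i (v 2%N) - cr i (v 0%N)).
Definition phi v X : P3 := ((phi_c v X 0, phi_c v X 1), phi_c v X 2).

Lemma phiE v X i : cr i (phi v X) = phi_c v X i.
Proof. by case: i => [|[|i]]. Qed.

Lemma phi_aff v i : aff3 (fun X => cr i (phi v X)).
Proof.
exists (k2%:R * cr i (v 0%N)), (cr i (v 1%N) - cr i (v 0%N)), (cr i (v 3%N) - cr i (v 2%N)), (cr i (v 2%N) - cr i (v 0%N)).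
by move=> X; rewrite phiE /phi_c; ring.
Qed.

Definition bsum (X : P3) (f : nat -> R) :=
  bc k2%:R 0 X * f 0%N + bc k2%:R 1 X * f 1%N + bc k2%:R 2 X * f 2%N + bc k2%:R 3 X * f 3%N.

Lemma phi_bsum v X i : cr i (phi v X) = bsum X (fun t => cr i (v t)).
Proof. by rewrite phiE /phi_c /bsum /bc; ring. Qed.

Lemma bc_phi v X j : bc (k1 * k2)%:R j (phi v X) = bsum X (fun t => bc k1%:R j (v t)).
Proof.
rewrite natrM; case: j => [|[|[|j]]] /=; rewrite /phi_c /bsum /bc; ring.
Qed.

Lemma bsum_ge0 X f : inD k2%:R X -> (forall t, 0 <= f t) -> 0 <= bsum X f.
Proof. by move=> h f0; rewrite /bsum !addr_ge0 // mulr_ge0. Qed.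

Lemma phi_in v X : (forall t, inD (k1%:R : R) (v t)) -> inD (k2%:R : R) X -> inD ((k1 * k2)%:R : R) (phi v X).
Proof. by move=> hv hX j; rewrite bc_phi; apply: bsum_ge0 => // t; exact: hv. Qed.

(** The scaled barycentric coordinates of [X] as weights on the vertices [v i] themselves, which
    makes them comparable between cells with common vertices. *)
Definition cw (v : nat -> P3) (X t : P3) : R := bsum X (fun i => (v i == t)%:R).

Variables (l : seq P3) (v : nat -> P3) (w : P3) (m : int).
Hypothesis ul : uniq l.
Hypothesis lat_l : forall P, P \in l -> lat3 q p P.
Hypothesis in_l : forall P, P \in l -> inD (k1%:R : R) P.
Hypothesis same_l : forall w1 w2 P, rep3 l w1 P -> rep3 l w2 P -> w1 =1 w2.
Hypothesis std_l : forall P Q i, P \in l -> Q \in l -> bc k1%:R i P = 0 -> bc k1%:R i Q = 0 ->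
    forall j, `|bc k1%:R j P - bc k1%:R j Q| <= 1.
Hypothesis hd : isdat l v w m.
(* only indices below 4 matter *)
Hypothesis v3 : forall i, (3 <= i)%N -> v i = v 3%N.

Lemma v_in i : v i \in l.
Proof.
have [h _ _ _ _] := hd; rewrite (perm_mem h) !inE.
by case: i => [|[|[|i]]]; rewrite ?eqxx ?orbT // v3 // eqxx !orbT.
Qed.

Lemma l_v P : P \in l -> exists2 i, (i < 4)%N & P = v i.
Proof.
have [h _ _ _ _] := hd; rewrite (perm_mem h) !inE => /or4P[] /eqP ->;
  [by exists 0%N | by exists 1%N | by exists 2%N | by exists 3%N].
Qed.

Lemma v_neq i j : (i < 4)%N -> (j < 4)%N -> (v i == v j) = (i == j).
Proof.
have [h _ _ _ _] := hd; move: (ul); rewrite (perm_uniq h) /= !inE !negb_or => /and4P[/and3P[n1 n2 n3] /andP[n4 n5] n6 _].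
have := negbTE n1; have := negbTE n2; have := negbTE n3; have := negbTE n4; have := negbTE n5; have := negbTE n6.
move=> e6 e5 e4 e3 e2 e1.
by case: i => [|[|[|[|i]]]] //; case: j => [|[|[|[|j]]]] // _ _; rewrite ?eqxx // eq_sym.
Qed.

Lemma cw_v X i : (i < 4)%N -> cw v X (v i) = bc k2%:R i X.
Proof.
move=> hi; rewrite /cw /bsum !v_neq //.
by case: i hi => [|[|[|[|i]]]] //= _; ring.
Qed.

Lemma cw_out X t : t \notin l -> cw v X t = 0.
Proof.
move=> h; have e i : (v i == t) = false by apply: contraNF h => /eqP <-; exact: v_in.
by rewrite /cw /bsum !e /=; ring.
Qed.

Lemma E_cw X f : E l (cw v X) f = bsum X (fun i => f (v i)).
Proof.
rewrite /cw /bsum.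
rewrite (EwD l (fun t => bc k2%:R 0 X * (v 0 == t)%:R + bc k2%:R 1 X * (v 1 == t)%:R + bc k2%:R 2 X * (v 2 == t)%:R)).
rewrite (EwD l (fun t => bc k2%:R 0 X * (v 0 == t)%:R + bc k2%:R 1 X * (v 1 == t)%:R)).
rewrite (EwD l (fun t => bc k2%:R 0 X * (v 0 == t)%:R)) !EwZ.
have e i : E l (fun t => (v i == t)%:R) f = f (v i).
  by rewrite -(E_ind f ul (v_in i)); apply: eq_Ew => t _; rewrite eq_sym.
by rewrite !e.
Qed.

Definition sc (P : P3) : P3 := ((P.1.1 / k2%:R, P.1.2 / k2%:R), P.2 / k2%:R).

Lemma cr_sc P i : cr i (sc P) = cr i P / k2%:R.
Proof. by case: i => [|[|i]]. Qed.

Let k2R : 0 < (k2%:R : R). Proof. by rewrite ltr0n. Qed.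
Let k2n : (k2%:R : R) != 0. Proof. by rewrite gt_eqF. Qed.

Lemma cw_rep X : inD (k2%:R : R) X -> rep3 l (fun t => cw v X t / k2%:R) (sc (phi v X)).
Proof.
move=> hX.
have e f : E l (fun t => cw v X t / k2%:R) f = bsum X (fun i => f (v i)) / k2%:R.
  by rewrite -E_cw [RHS]mulrC -EwZ; apply: eq_Ew => t _; rewrite mulrC.
apply/rep3P; split=> [t|t tl||i].
- by apply: divr_ge0; [apply: bsum_ge0 => // i; exact: ler0n | exact: ltW].
- by rewrite cw_out // mul0r.
- rewrite e; have -> : bsum X (fun _ => 1) = k2%:R by rewrite /bsum /bc; ring.
  by rewrite mulfV.
- by rewrite e cr_sc phi_bsum.
Qed.

Lemma bc_ext (X Y : P3) : (forall t, (t < 4)%N -> bc k2%:R t X = bc k2%:R t Y) -> X = Y.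
Proof.
move=> h; have h1 := h 1%N isT; have h2 := h 2%N isT; have h3 := h 3%N isT; rewrite /bc in h1 h2 h3.
by apply: cr_ext => -[|[|i]] //; move: h2 h3; rewrite /cr; lra.
Qed.

Lemma phi_inj X Y : phi v X = phi v Y -> X = Y.
Proof.
move=> e; apply: bc_ext => t ht.
pose d s := cw v X s - cw v Y s.
have Ed f : E l d f = bsum X (fun i => f (v i)) - bsum Y (fun i => f (v i)).
  by rewrite -!E_cw /E -sumrB; apply: eq_bigr => s _; rewrite mulrBl.
have same w1 w2 b : rep (cs3 R) l w1 b -> rep (cs3 R) l w2 b -> w1 =1 w2.
  move=> r1 r2; have eb : b = [:: E l w1 (cr 0); E l w1 (cr 1); E l w1 (cr 2)] by case: r1 => _ _ _ <-.
  by apply: (same_l (P := ((E l w1 (cr 0), E l w1 (cr 1)), E l w1 (cr 2)))); rewrite /rep3 /= -eb.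
have : d (v t) = 0.
  apply: (cell_indep ul same (d := d)); last exact: v_in.
  - by rewrite Ed /bsum /bc; ring.
  - move=> c hc; rewrite Ed; have [i ->] : exists i, c = cr i.
      by move: hc => /= [<-|[<-|[<-|//]]]; [exists 0%N | exists 1%N | exists 2%N].
    by rewrite -!phi_bsum e subrr.
by rewrite /d !cw_v // => /eqP; rewrite subr_eq0 => /eqP.
Qed.

Let mR : (m%:~R : R) != 0.
Proof. by have [_ h _ _ _] := hd; rewrite intr_eq0 gt_eqF //; move: h; clear; lia. Qed.

Lemma lat3_comb (P A B C D : P3) (n0 n1 n2 n3 : int) : lat3 q p A -> lat3 q p B -> lat3 q p C -> lat3 q p D ->
  (forall i, cr i P = n0%:~R * cr i A + n1%:~R * cr i B + n2%:~R * cr i C + n3%:~R * cr i D) -> lat3 q p P.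
Proof.
move=> /andP[/andP[a1 a2] a3] /andP[/andP[b1 b2] b3] /andP[/andP[c1 c2] c3] /andP[/andP[d1 d2] d3] e.
have e0 := e 0%N; have e1 := e 1%N; have e2 := e 2%N; rewrite /cr in e0 e1 e2.
rewrite /lat3 /lat e0 e1 e2; apply/andP; split; first (apply/andP; split).
- have -> : q%:R * (n0%:~R * A.1.2 + n1%:~R * B.1.2 + n2%:~R * C.1.2 + n3%:~R * D.1.2) =
    n0%:~R * (q%:R * A.1.2) + n1%:~R * (q%:R * B.1.2) + n2%:~R * (q%:R * C.1.2) + n3%:~R * (q%:R * D.1.2) by ring.
  by rewrite !rpredD // rpredM ?intr_int.
- have -> : n0%:~R * A.1.1 + n1%:~R * B.1.1 + n2%:~R * C.1.1 + n3%:~R * D.1.1 -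
    p%:~R * (n0%:~R * A.1.2 + n1%:~R * B.1.2 + n2%:~R * C.1.2 + n3%:~R * D.1.2) =
    n0%:~R * (A.1.1 - p%:~R * A.1.2) + n1%:~R * (B.1.1 - p%:~R * B.1.2) +
    n2%:~R * (C.1.1 - p%:~R * C.1.2) + n3%:~R * (D.1.1 - p%:~R * D.1.2) by ring.
  by rewrite !rpredD // rpredM ?intr_int.
- by rewrite !rpredD // rpredM ?intr_int.
Qed.

(** The relation in [isdat] trades the edge from [v 2] to [v 3] for [w]. The coefficients
    [cr 0 X - cr 1 X], [m * cr 1 X] and [cr 2 X] are integers exactly for [X] in the lattice of
    Delta'(1, m). *)
Lemma phi_w X i : cr i (phi v X) = k2%:R * cr i (v 0%N) + (cr 0 X - cr 1 X) * (cr i (v 1%N) - cr i (v 0%N)) +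
  (m%:~R * cr 1 X) * cr i w + cr 2 X * (cr i (v 2%N) - cr i (v 0%N)).
Proof.
have [_ _ _ e _] := hd; rewrite phiE /phi_c.
have -> : m%:~R * cr 1 X * cr i w = cr 1 X * (m%:~R * cr i w) by ring.
by rewrite -e; ring.
Qed.

Let mE : ((absz m)%:R : R) = m%:~R.
Proof. by have [_ h _ _ _] := hd; rewrite natr_absz ger0_norm //; move: h; clear; lia. Qed.

Lemma phi_lat X : lat3 (absz m) 1 X -> lat3 q p (phi v X).
Proof.
have [_ _ lw _ _] := hd.
move=> /andP[/andP[h1 h2] h3]; rewrite mE in h1; rewrite mul1r in h2.
case/intrP: h1 => n3 e3; case/intrP: h2 => n1 e1; case/intrP: h3 => n2 e2.
have ln i := lat_l (v_in i).
apply: (@lat3_comb _ (v 0%N) (v 1%N) (v 2%N) w (k2%:Z - n1 - n2) n1 n2 n3) => // i.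
by rewrite phi_w /cr e1 e2 e3 !rmorphB /= -/(cr i _); ring.
Qed.

Lemma phi_lat_inv Q : lat3 q p Q -> exists2 X, lat3 (absz m) 1 X & Q = phi v X.
Proof.
move=> lQ; have [_ _ lw _ sp] := hd.
pose o : P3 := ((0, 0), 0).
(* [isdat] expands points from [v 0], whereas [phi] starts at [k2 * v 0]; [Q'] is the translate of
   [Q] that compensates for this. *)
pose Q' : P3 := ((cr 0 Q - k2%:R * cr 0 (v 0) + cr 0 (v 0), cr 1 Q - k2%:R * cr 1 (v 0) + cr 1 (v 0)), cr 2 Q - k2%:R * cr 2 (v 0) + cr 2 (v 0)).
have cQ i : cr i Q' = cr i Q - k2%:R * cr i (v 0%N) + cr i (v 0%N) by case: i => [|[|i]].
have lQ' : lat3 q p Q'.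
  apply: (@lat3_comb _ Q (v 0%N) w w 1 (1 - k2%:Z) 0 0) => //; try exact: lat_l (v_in 0).
  by move=> i; rewrite cQ rmorphB /=; ring.
have [n1 [n2 [n3 e]]] := sp _ lQ'.
pose X : P3 := ((n1%:~R + n3%:~R / m%:~R, n3%:~R / m%:~R), n2%:~R).
exists X.
  rewrite /lat3 /lat /= mE intr_int andbT mulrC divfK // intr_int mul1r.
  by rewrite addrK intr_int.
have [x0 x1 x2] : [/\ cr 0 X = n1%:~R + n3%:~R / m%:~R, cr 1 X = n3%:~R / m%:~R & cr 2 X = n2%:~R] by [].
apply: cr_ext => i; rewrite phi_w x0 x1 x2.
have -> : cr i Q = cr i Q' + k2%:R * cr i (v 0%N) - cr i (v 0%N) by rewrite cQ; ring.
have -> : m%:~R * (n3%:~R / m%:~R) = n3%:~R :> R by rewrite mulrC divfK.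
by rewrite e; ring.
Qed.

Lemma phi_good l2 : good4 (absz m) 1 (eq^~ 1) l2 -> good4 q p (eq^~ 1) (map (phi v) l2).
Proof. by apply: good4_map; [exact: phi_aff | exact: phi_lat | exact: phi_lat_inv]. Qed.

Lemma phi_rep l2 w2 X : uniq l2 -> rep3 l2 w2 X -> exists w', [/\ rep3 (map (phi v) l2) w' (phi v X) &
  {in l2, forall Y, w' (phi v Y) = w2 Y}].
Proof.
move=> u2 r; have /rep3P[w0 ws w1 _] := r.
pose w' Q := E l2 w2 (fun Y => (phi v Y == Q)%:R).
have wE Y : Y \in l2 -> w' (phi v Y) = w2 Y.
  move=> Yl; rewrite -(E_pick u2 w2 Yl); apply: eq_E => Z _; congr (_ _).
  by congr nat_of_bool; apply/eqP/eqP => [/phi_inj|->].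
have e f : E (map (phi v) l2) w' f = E l2 w2 (f \o phi v).
  by rewrite /E big_map; apply: eq_big_seq => Y Yl; rewrite wE.
exists w'; split=> //; apply/rep3P; split=> [Q|Q Ql||i].
- by apply: E_ge0 => // Y _ _; exact: ler0n.
- rewrite /w' /E big_seq big1 // => Y Yl; case: eqP => [eQ|_]; last by rewrite mulr0.
  by move: Ql; rewrite -eQ map_f.
- by rewrite e.
- by rewrite e (E_aff3 r (phi_aff v i)).
Qed.

Lemma phi_unrep l2 w' Q : rep3 (map (phi v) l2) w' Q -> exists X, [/\ Q = phi v X,
  rep3 l2 (fun Y => if Y \in l2 then w' (phi v Y) else 0) X & forall Q', w' Q' != 0 -> exists2 Y, Y \in l2 & Q' = phi v Y].
Proof.
move=> /rep3P[w0 ws w1 ec].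
pose w2 (Y : P3) : R := if Y \in l2 then w' (phi v Y) else 0.
have e f : E (map (phi v) l2) w' f = E l2 w2 (f \o phi v).
  by rewrite /E big_map; apply: eq_big_seq => Y Yl; rewrite /w2 Yl.
pose X : P3 := ((E l2 w2 (cr 0), E l2 w2 (cr 1)), E l2 w2 (cr 2)).
have r : rep3 l2 w2 X.
  apply/rep3P; split=> [Y|Y Yl||i].
  - by rewrite /w2; case: ifP.
  - by rewrite /w2 (negbTE Yl).
  - by rewrite -[RHS]w1 e.
  - by case: i => [|[|i]].
exists X; split=> //.
- by apply: cr_ext => i; rewrite -ec e (E_aff3 r (phi_aff v i)).
- move=> Q' wQ; have : Q' \in map (phi v) l2 by apply: contraNT wQ => /ws ->.
  by case/mapP => Y Yl ->; exists Y.
Qed.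

(** A cell inside a facet plane would, by its spanning property, force the whole lattice into that
    plane, but each plane misses some integral point. *)
Lemma nonflat i : exists2 t, (t < 4)%N & bc k1%:R i (v t) != 0.
Proof.
apply: contrapT => hn; have h t : (t < 4)%N -> bc k1%:R i (v t) = 0.
  by move=> ht; apply/eqP; apply: contraT => ne; case: hn; exists t.
have [_ _ _ e sp] := hd.
have H (X : P3) : lat3 q p X -> bc k1%:R i X = 0.
  move=> lX; have [n1 [n2 [n3 eX]]] := sp _ lX.
  have [al [be [ga [de hb]]]] := @bc_aff R k1%:R i.
  have t0 := h 0%N isT; have t1 := h 1%N isT; have t2 := h 2%N isT; have t3 := h 3%N isT.
  rewrite !hb in t0 t1 t2 t3 *.
  pose Lw := be * cr 0 w + ga * cr 1 w + de * cr 2 w.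
  have Lw0 : Lw = 0.
    apply: (mulfI mR); rewrite mulr0.
    have -> : m%:~R * Lw = be * (m%:~R * cr 0 w) + ga * (m%:~R * cr 1 w) + de * (m%:~R * cr 2 w) by rewrite /Lw; ring.
    rewrite -!e; move: t0 t1 t2 t3; lra.
  rewrite !eX.
  have -> : al + be * (cr 0 (v 0%N) + n1%:~R * (cr 0 (v 1%N) - cr 0 (v 0%N)) + n2%:~R * (cr 0 (v 2%N) - cr 0 (v 0%N)) + n3%:~R * cr 0 w) +
     ga * (cr 1 (v 0%N) + n1%:~R * (cr 1 (v 1%N) - cr 1 (v 0%N)) + n2%:~R * (cr 1 (v 2%N) - cr 1 (v 0%N)) + n3%:~R * cr 1 w) +
     de * (cr 2 (v 0%N) + n1%:~R * (cr 2 (v 1%N) - cr 2 (v 0%N)) + n2%:~R * (cr 2 (v 2%N) - cr 2 (v 0%N)) + n3%:~R * cr 2 w) =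
     (1 - n1%:~R - n2%:~R) * (al + be * cr 0 (v 0%N) + ga * cr 1 (v 0%N) + de * cr 2 (v 0%N)) +
     n1%:~R * (al + be * cr 0 (v 1%N) + ga * cr 1 (v 1%N) + de * cr 2 (v 1%N)) +
     n2%:~R * (al + be * cr 0 (v 2%N) + ga * cr 1 (v 2%N) + de * cr 2 (v 2%N)) + n3%:~R * Lw by rewrite /Lw; ring.
  by rewrite t0 t1 t2 Lw0; ring.
have k1R : (k1%:R : R) != 0 by rewrite pnatr_eq0 -lt0n.
have lint (x y z : R) : x \is a Num.int -> y \is a Num.int -> z \is a Num.int -> lat3 q p ((x, y), z).
  by move=> a b c; rewrite /lat3 lat_int.
case: i H {h hn} => [|[|[|i]]] H.
- have := H ((0, 0), 0); rewrite /bc /cr /= !subr0 => h; have /eqP := h (lint _ _ _ (rpred0 _) (rpred0 _) (rpred0 _)).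
  by rewrite (negbTE k1R).
- have := H ((1, 0), 0) (lint _ _ _ (rpred1 _) (rpred0 _) (rpred0 _)) => /= /eqP; by rewrite oner_eq0.
- have := H ((0, 0), 1) (lint _ _ _ (rpred0 _) (rpred0 _) (rpred1 _)) => /= /eqP; by rewrite subr0 oner_eq0.
- have := H ((0, 1), 0) (lint _ _ _ (rpred0 _) (rpred1 _) (rpred0 _)) => /= /eqP; by rewrite oner_eq0.
Qed.

End Cell.

Section Compose.
Variable R : realType.
Notation P3 := (R * R * R)%type.

Lemma rep3_inD k l w (X : P3) : rep3 l w X -> (forall Y, Y \in l -> inD (k : R) Y) -> inD k X.
Proof.
move=> r h i; apply: (rep3_ge0 r (bc_aff k i)) => Y wY; apply: h; exact: (rep3_in r wY).
Qed.

Lemma bc_int (q : nat) (p : int) k i (X : P3) : (exists u v : int, u * p + v * q%:Z = 1) -> lat3 q p X ->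
  bc k%:R i X = 0 -> forall j, bc (k : nat)%:R j X \is a Num.int.
Proof.
move=> cop lX h j; have i0 := facet_int cop lX h; case/andP: lX => lX z.
have i1 : cr 1 X \is a Num.int by rewrite /cr -(lat_x cop lX).
by case: j => [|[|[|j]]] //=; rewrite !rpredB ?natr_int.
Qed.

Lemma tau_sum k2 (v : nat -> P3) (Y t0 t1 t2 : P3) (g : P3 -> R) : uniq [:: t0; t1; t2] ->
  (forall j, (j < 4)%N -> bc k2%:R j Y != 0 -> v j \in [:: t0; t1; t2]) ->
  bsum k2 Y (fun j => g (v j)) = cw k2 v Y t0 * g t0 + cw k2 v Y t1 * g t1 + cw k2 v Y t2 * g t2.
Proof.
rewrite /= !inE negb_or !andbT => /andP[/andP[n01 n02] n12] h.
have e j : (j < 4)%N -> bc k2%:R j Y * g (v j) =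
    bc k2%:R j Y * ((v j == t0)%:R * g t0 + (v j == t1)%:R * g t1 + (v j == t2)%:R * g t2).
  move=> hj; have [->|nz] := eqVneq (bc k2%:R j Y) 0; first by rewrite !mul0r.
  congr (_ * _); move: (h j hj nz); rewrite !inE => /or3P[] /eqP ->.
  - by rewrite eqxx (negbTE n01) (negbTE n02) /=; ring.
  - by rewrite eqxx eq_sym (negbTE n01) (negbTE n12) /=; ring.
  - by rewrite eqxx ![t2 == _]eq_sym (negbTE n02) (negbTE n12) /=; ring.
rewrite /cw /bsum !e //; ring.
Qed.

(** The integers [d] sum to 0 and are at most 1 in absolute value: either all vanish, or one is 1
    and one is -1, and the combination is a difference of two of the [b]. *)
Lemma small_comb (d1 d2 d3 b1 b2 b3 : R) :
  d1 \is a Num.int -> d2 \is a Num.int -> d3 \is a Num.int -> `|d1| <= 1 -> `|d2| <= 1 -> `|d3| <= 1 ->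
  d1 + d2 + d3 = 0 -> (d1 != 0 -> d2 != 0 -> `|b1 - b2| <= 1) -> (d1 != 0 -> d3 != 0 -> `|b1 - b3| <= 1) ->
  (d2 != 0 -> d3 != 0 -> `|b2 - b3| <= 1) -> `|d1 * b1 + d2 * b2 + d3 * b3| <= 1.
Proof.
have tri (d : R) : d \is a Num.int -> `|d| <= 1 -> [\/ d = 0, d = 1 | d = -1].
  move=> /intrP[n ->]; rewrite -intr_norm lerz1 => h.
  have [->|[->|->]] : n = 0 \/ n = 1 \/ n = -1 by move: h; clear; lia.
  - by apply: Or31.
  - by apply: Or32.
  - by apply: Or33; rewrite rmorphN1.
move=> i1 i2 i3 a1 a2 a3 s h12 h13 h23.
have n1 : (1 : R) != 0 by exact: oner_neq0.
have n1' : (-1 : R) != 0 by rewrite oppr_eq0.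
case: (tri _ i1 a1) s h12 h13 => ->; case: (tri _ i2 a2) h23 => ->; case: (tri _ i3 a3) => ->;
  rewrite ?n1 ?n1' ?ler_norml => h23 s h12 h13; try (exfalso; lra).
- by lra.
- by have := h23 isT isT; lra.
- by have := h23 isT isT; lra.
- by have := h13 isT isT; lra.
- by have := h12 isT isT; lra.
- by have := h13 isT isT; lra.
- by have := h12 isT isT; lra.
Qed.

Variables (q : nat) (p : int) (k1 k2 : nat) (Pm : int -> Prop).
Hypothesis cop : exists u v : int, u * p + v * q%:Z = 1.
Hypothesis k10 : (0 < k1)%N.
Hypothesis k20 : (0 < k2)%N.
Variables (K1 : seq P3 -> Prop) (KM : int -> seq P3 -> Prop).
Hypothesis C1 : tri q p k1 Pm K1.
Hypothesis pure : forall P : P3, inD k1%:R P -> exists l w, [/\ K1 l, size l = 4 & rep3 l w P].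
Hypothesis HM : forall m, 1 <= m -> tri (absz m) 1 k2 (eq^~ 1) (KM m).

Let cop1 (n : nat) : exists u v : int, u * 1 + v * n%:Z = 1.
Proof. by exists 1, 0; rewrite mul0r addr0 mulr1. Qed.

Definition dat_ok (l : seq P3) (D : (nat -> P3) * P3 * int) :=
  isdat q p l D.1.1 D.1.2 D.2 /\ forall i, (3 <= i)%N -> D.1.1 i = D.1.1 3%N.

(* The vertex order of a cell is chosen depending on its vertex set only. *)
Lemma dat_exists : exists D : seq P3 -> (nat -> P3) * P3 * int,
  (forall l, K1 l -> size l = 4 -> dat_ok l (D l)) /\ (forall l l', perm_eq l l' -> D l = D l').
Proof.
have /choice[D0 h0] : forall l : seq P3, exists D, good4 q p Pm l -> dat_ok l D.
  move=> l; have [g|ng] := pselect (good4 q p Pm l); last by exists (fun _ => ((0, 0), 0), ((0, 0), 0), 0).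
  by have [v [w [m [h1 h2]]]] := good4_dat g; exists (v, w, m).
pose c (l : seq P3) := choose (perm_eq l) l.
have pc l : perm_eq l (c l) by apply: chooseP; exact: perm_refl.
exists (fun l => D0 (c l)); split=> [l Kl s4|l l' e].
- have g : good4 q p Pm (c l).
    have [a [b [x [d [w [m [g1 g2 g3 g4 g5]]]]]]] := tri_good C1 Kl s4.
    exists a, b, x, d, w, m; split=> //; apply: perm_trans g1; rewrite perm_sym; exact: pc.
  have [[g1 g2 g3 g4 g5] g6] := h0 _ g; split=> //; split=> //; exact: perm_trans (pc l) g1.
- suff -> : c l = c l' by [].
  rewrite /c (eq_choose (P := perm_eq l) (Q := perm_eq l')) => [|x]; last exact: (permPl e x).
  by apply: choose_id => //; rewrite perm_sym.
Qed.

Section Composite.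
Variable D : seq P3 -> (nat -> P3) * P3 * int.
Hypothesis D1 : forall l, K1 l -> size l = 4 -> dat_ok l (D l).
Hypothesis D2 : forall l l', perm_eq l l' -> D l = D l'.

Let ph l := phi k2 (D l).1.1.

Definition fine (l l2 : seq P3) := [/\ K1 l, size l = 4 & KM (D l).2 l2].
Definition ccell (l' : seq P3) := exists l l2, fine l l2 /\ l' = map (ph l) l2.

Let m1 l : K1 l -> size l = 4 -> 1 <= (D l).2.
Proof. by move=> Kl s4; have [[_ h _ _ _] _] := D1 Kl s4. Qed.

Let finj l : K1 l -> size l = 4 -> injective (ph l).
Proof.
move=> Kl s4 X Y; have [hd v3] := D1 Kl s4.
apply: (phi_inj (cx_uniq (tri_cplx C1) Kl) _ hd v3) => w1 w2 P.
exact: (cx_same (tri_cplx C1) Kl Kl).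
Qed.

Let inX l l2 w X : fine l l2 -> rep3 l2 w X -> inD (k2%:R : R) X.
Proof.
move=> [Kl s4 Km] r; apply: (rep3_inD r) => Y Yl; exact: (cx_in (tri_cplx (HM (m1 Kl s4))) Km Yl).
Qed.

Lemma ccell_cover P : inD ((k1 * k2)%:R : R) P -> exists l w, [/\ ccell l, rep3 l w P & {in l, forall Q, 0 < w Q}].
Proof.
move=> hP; have k2R : 0 < (k2%:R : R) by rewrite ltr0n.
have k2n : (k2%:R : R) != 0 by rewrite gt_eqF.
have hs : inD (k1%:R : R) (sc k2 P).
  move=> i; have -> : bc k1%:R i (sc k2 P) = bc (k1 * k2)%:R i P / k2%:R.
    by rewrite natrM; case: i => [|[|[|i]]] /=; field.
  by rewrite divr_ge0 // ltW.
have [l [u [Kl s4 r]]] := pure hs; have [hd v3] := D1 Kl s4.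
have ul := cx_uniq (tri_cplx C1) Kl.
have /rep3P[u0 us um uc] := r.
set v := (D l).1.1 in hd v3.
(* The point of [k2] Delta'(1, m) whose scaled barycentric coordinates are [k2] times the weights of
   [P / k2] in the coarse cell. *)
pose X : P3 := ((k2%:R * u (v 1%N), k2%:R * u (v 3%N)), k2%:R * (u (v 2%N) + u (v 3%N))).
have sumE f : E l u f = u (v 0%N) * f (v 0%N) + u (v 1%N) * f (v 1%N) + u (v 2%N) * f (v 2%N) + u (v 3%N) * f (v 3%N).
  have [pl _ _ _ _] := hd; rewrite (E_perm _ _ pl) /E !big_cons big_nil; ring.
have bX i : (i < 4)%N -> bc k2%:R i X = k2%:R * u (v i).
  have := um; rewrite sumE => e; have {}e : u (v 0%N) = 1 - u (v 1%N) - u (v 2%N) - u (v 3%N) by lra.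
  by case: i => [|[|[|[|i]]]] //= _; rewrite /cr /=; rewrite ?e; ring.
have hX : inD (k2%:R : R) X.
  move=> i; have [hi|hi] := ltnP i 4; first by rewrite bX // mulr_ge0 // ltW.
  have -> : bc k2%:R i X = bc k2%:R 3 X by case: i hi => [|[|[|i]]].
  by rewrite bX // mulr_ge0 // ltW.
have eP : P = phi k2 v X.
  apply: cr_ext => i; rewrite phi_bsum /bsum !bX //.
  have h := uc i; rewrite sumE cr_sc in h.
  have -> : cr i P = k2%:R * (cr i P / k2%:R) by rewrite mulrC divfK.
  by rewrite -h; ring.
have [l2 [w2 [Km r2 pos]]] := cx_cover (tri_cplx (HM (m1 Kl s4))) hX.
have same w1' w2' Q := cx_same (tri_cplx C1) Kl Kl (w1 := w1') (w2 := w2') (P := Q).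
have [w' [r' e']] := phi_rep k2 ul same hd v3 (cx_uniq (tri_cplx (HM (m1 Kl s4))) Km) r2.
exists (map (ph l) l2), w'; split.
- by exists l, l2.
- by rewrite eP.
- by move=> Q /mapP[Y Yl ->]; rewrite e' // pos.
Qed.

Let facet l l2 w X i : fine l l2 -> rep3 l2 w X -> bc k2%:R i X = 0 ->
  (forall Y, w Y != 0 -> [/\ Y \in l2, bc k2%:R i Y = 0 & forall j, bc k2%:R j Y \is a Num.int]) /\
  (forall Y Y', w Y != 0 -> w Y' != 0 -> forall j, `|bc k2%:R j Y - bc k2%:R j Y'| <= 1).
Proof.
move=> f r e; have [Kl s4 Km] := f; have T := HM (m1 Kl s4).
have f0 Y : w Y != 0 -> bc k2%:R i Y = 0.
  apply: (rep3_face r (bc_aff _ i)); last by rewrite e.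
  by move=> Z wZ; apply: (cx_in (tri_cplx T) Km (rep3_in r wZ)).
have h Y : w Y != 0 -> [/\ Y \in l2, bc k2%:R i Y = 0 & forall j, bc k2%:R j Y \is a Num.int].
  move=> wY; have Yl := rep3_in r wY; split=> //; first exact: f0.
  exact: (bc_int (cop1 _) (cx_lat (tri_cplx T) Km Yl) (f0 _ wY)).
split=> // Y Y' /h[Yl eY _] /h[Yl' eY' _]; exact: (tri_std T Km Yl Yl' eY eY').
Qed.

(** Over one coarse cell this is uniqueness in its refinement. Over two different ones the coarse
    weights agree, so each cell has a vertex of weight 0 and the point lies on a facet of each. Both
    refinements are standard there, and [std_uniq] applies with the weights at three coarse vertices
    as coordinates. *)
Lemma ccell_same l1' l2' w1 w2 Q : ccell l1' -> ccell l2' -> rep3 l1' w1 Q -> rep3 l2' w2 Q -> w1 =1 w2.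
Proof.
move=> [l [l2 [f ->]]] [l' [l2'' [f' ->]]] r1 r2.
have [Kl s4 Km] := f; have [Kl' s4' Km'] := f'.
have [X [eX rX supX]] := phi_unrep r1; have [X' [eX' rX' supX']] := phi_unrep r2.
have [hd v3] := D1 Kl s4; have [hd' v3'] := D1 Kl' s4'.
have ul := cx_uniq (tri_cplx C1) Kl; have ul' := cx_uniq (tri_cplx C1) Kl'.
have T := HM (m1 Kl s4); have T' := HM (m1 Kl' s4').
have hX := inX f rX; have hX' := inX f' rX'.
set v := (D l).1.1 in hd v3 eX rX supX; set v' := (D l').1.1 in hd' v3' eX' rX' supX'.
have k2n : (k2%:R : R) != 0 by rewrite pnatr_eq0 -lt0n.
have eqcw t : cw k2 v X t = cw k2 v' X' t.
  have c1 := cw_rep k20 ul hd v3 hX; have c2 := cw_rep k20 ul' hd' v3' hX'.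
  rewrite -eX in c1; rewrite -eX' in c2.
  have := cx_same (tri_cplx C1) Kl Kl' c1 c2 t; exact: (mulIf (invr_neq0 k2n)).
have inj := finj Kl s4; have inj' := finj Kl' s4'.
have val L (M : seq P3) w : injective (ph L) -> (forall Q', w Q' != 0 -> exists2 Y, Y \in M & Q' = ph L Y) ->
    forall Y : P3, (if Y \in M then w (ph L Y) else 0) = w (ph L Y) :> R.
  move=> ij sup Y; case: ifPn => // Yn; have [->//|/sup[Z Zl /ij e]] := eqVneq (w (ph L Y)) 0.
  by move: Yn; rewrite e Zl.
have [pe|npe] := boolP (perm_eq l l').
- have eD := D2 pe.
  have ev : v' = v by rewrite /v' /v -eD.
  have eX2 : X' = X by apply: inj; rewrite /ph -/v -eX -ev -eX'.
  rewrite -eD in Km'; rewrite eX2 in rX'.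
  have := cx_same (tri_cplx T) Km Km' rX rX' => e Q'.
  have eL : ph l' = ph l by rewrite /ph -eD.
  have val1 := val l l2 w1 inj supX.
  have val2 : forall Y : P3, (if Y \in l2'' then w2 (ph l Y) else 0) = w2 (ph l Y).
    by apply: val => // Z /supX'; rewrite -eL.
  have eY Y : w1 (ph l Y) = w2 (ph l Y).
    by rewrite -val1 -val2; have := e Y; rewrite ev.
  have [z1|/supX[Y _ ->]] := eqVneq (w1 Q') 0; last exact: eY.
  have [->//|/supX'[Y _ eQ]] := eqVneq (w2 Q') 0.
  have eQ' : Q' = ph l Y by rewrite eQ -eL.
  by rewrite eQ' eY.
have notin (L M : seq P3) : uniq L -> uniq M -> size L = 4 -> size M = 4 -> ~~ perm_eq L M ->
    exists2 t, t \in L & t \notin M.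
  move=> uL uM sL sM np; apply: contrapT => hn.
  have sub : {subset L <= M} by move=> t tL; apply: contrapT => tM; apply: hn; exists t => //; apply/negP.
  have [|_ e] := uniq_min_size uL sub; first by rewrite sL sM.
  by move: np; rewrite uniq_perm.
have [t tl tn] := notin _ _ ul ul' s4 s4' npe.
have [|t' tl' tn'] := notin _ _ ul' ul s4' s4; first by rewrite perm_sym.
have [i i4 et] := l_v hd tl; have [i' i4' et'] := l_v hd' tl'.
have e0 : bc k2%:R i X = 0 by rewrite -(cw_v k2 ul hd X i4) -et eqcw (cw_out k2 hd' v3').
have e0' : bc k2%:R i' X' = 0 by rewrite -(cw_v k2 ul' hd' X' i4') -et' -eqcw (cw_out k2 hd v3).
have [fac dif] := facet f rX e0; have [fac' dif'] := facet f' rX' e0'.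
(* The three vertices of the first cell other than [v i]; the vertices of the second cell that carry
   weight are among them. *)
pose tau n := v (bump i n).
have tau_ne n : (n < 3)%N -> (bump i n < 4)%N by rewrite /bump; case: (i <= n)%N; clear; lia.
have utau : uniq [:: tau 0%N; tau 1%N; tau 2%N].
  rewrite /= !inE /tau !(v_neq ul hd) ?tau_ne //= !(inj_eq (can_inj (bumpK i))).
  by [].
have in_tau j : (j < 4)%N -> j != i -> v j \in [:: tau 0%N; tau 1%N; tau 2%N].
  move=> hj ne; rewrite !inE /tau !(v_neq ul hd) ?tau_ne //.
  move: i i4 j hj ne {et e0 fac dif tau tau_ne utau} => [|[|[|[|i]]]] // _ [|[|[|[|j]]]] //.
have supY Y : inD (k2%:R : R) Y -> bc k2%:R i Y = 0 ->
    forall j, (j < 4)%N -> bc k2%:R j Y != 0 -> v j \in [:: tau 0%N; tau 1%N; tau 2%N].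
  by move=> _ eY j hj; apply: contraNT => nt; apply/eqP; have [->//|ne] := eqVneq j i; move: nt; rewrite in_tau.
have supY' Y : (if Y \in l2'' then w2 (phi k2 v' Y) else 0) != 0 ->
    forall j, (j < 4)%N -> bc k2%:R j Y != 0 -> v' j \in [:: tau 0%N; tau 1%N; tau 2%N].
  move=> wY j hj nz.
  have nz' : bc k2%:R j X' != 0.
    apply: contraNneq nz => z; apply/eqP; apply: (rep3_face rX' (bc_aff _ j) _ _ wY); last by rewrite z.
    by move=> Z wZ; apply: (cx_in (tri_cplx T') Km' (rep3_in rX' wZ)).
  have cwn : cw k2 v X (v' j) != 0 by rewrite eqcw (cw_v k2 ul' hd').
  have vl : v' j \in l by apply: contraNT cwn => h; rewrite (cw_out k2 hd v3).
  have [j0 j04 ej] := l_v hd vl; rewrite ej; apply: in_tau => //.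
  by apply: contraNneq cwn => ji; rewrite ej ji (cw_v k2 ul hd) // e0.
have inY Y : Y \in l2 -> inD (k2%:R : R) Y by move=> Yl; exact: (cx_in (tri_cplx T) Km Yl).
(* A left inverse of the injective map [ph L], which lets coordinates of the model serve as
   functions on all points. *)
pose iv L (Z : P3) : P3 := if pselect (exists Y, ph L Y = Z) is left h then projT1 (cid h) else Z.
have ivK L : injective (ph L) -> cancel (ph L) (iv L).
  move=> ij Y; rewrite /iv; case: pselect => [h|hn]; last by case: hn; exists Y.
  by case: cid => Z /= /ij.
have ivl := ivK l inj; have ivl' := ivK l' inj'.
have val1 := val l l2 w1 inj supX; have val2 := val l' l2'' w2 inj' supX'.
have sup1 Z : w1 Z != 0 -> exists Y, [/\ Z = ph l Y, Y \in l2 & (if Y \in l2 then w1 (phi k2 v Y) else 0) != 0].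
  by move=> wZ; have [Y Yl eZ] := supX _ wZ; exists Y; split=> //; move: wZ; rewrite eZ Yl.
have sup2 Z : w2 Z != 0 -> exists Y, [/\ Z = ph l' Y, Y \in l2'' & (if Y \in l2'' then w2 (phi k2 v' Y) else 0) != 0].
  by move=> wZ; have [Y Yl eZ] := supX' _ wZ; exists Y; split=> //; move: wZ; rewrite eZ Yl.
have /rep3P[p1 z1 mm1 _] := r1; have /rep3P[p2 z2 mm2 _] := r2.
have cwint V Y s : (forall j, bc k2%:R j Y \is a Num.int) -> cw k2 V Y s \is a Num.int.
  by move=> h; rewrite /cw /bsum !rpredD // rpredM // ?natr_int.
have cwaff (V : nat -> P3) s : aff3 (fun Y => cw k2 V Y s).
  have [a0 [a1 [a2 [a3 h0]]]] := @bc_aff R k2%:R 0; have [b0 [b1 [b2 [b3 h1]]]] := @bc_aff R k2%:R 1.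
  have [c0 [c1 [c2 [c3 h2]]]] := @bc_aff R k2%:R 2; have [d0 [d1 [d2 [d3 h3]]]] := @bc_aff R k2%:R 3.
  rewrite /cw /bsum; move: ((V 0%N == s)%:R : R) ((V 1%N == s)%:R : R) ((V 2%N == s)%:R : R) ((V 3%N == s)%:R : R) => A B C F.
  exists (a0 * A + b0 * B + c0 * C + d0 * F), (a1 * A + b1 * B + c1 * C + d1 * F),
    (a2 * A + b2 * B + c2 * C + d2 * F), (a3 * A + b3 * B + c3 * C + d3 * F) => Y.
  by rewrite h0 h1 h2 h3; ring.
have cwd V (VI : forall a b, (a < 4)%N -> (b < 4)%N -> (V a == V b) = (a == b)) Y Y' s :
    (forall j, `|bc k2%:R j Y - bc k2%:R j Y'| <= 1) -> `|cw k2 V Y s - cw k2 V Y' s| <= 1.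
  move=> h; have e a : (a < 4)%N -> s = V a -> `|cw k2 V Y s - cw k2 V Y' s| <= 1.
    move=> ha ->; have ev X0 : cw k2 V X0 (V a) = bc k2%:R a X0.
      by rewrite /cw /bsum !VI //; case: a ha => [|[|[|[|a]]]] //= _; ring.
    by rewrite !ev.
  have [[a ha es]|ns] := pselect (exists2 a, (a < 4)%N & s = V a); first exact: e ha es.
  have e0'' a : (a < 4)%N -> (V a == s) = false by move=> ha; apply/eqP => es; apply: ns; exists a.
  by rewrite /cw /bsum !e0'' //= !mulr0 !addr0 subrr normr0 ler01.
have bsum1 Y : bsum k2 Y (fun _ => 1 : R) = k2%:R by rewrite /bsum /bc; ring.
apply: (@std_uniq R P3 _ _ w1 w2 (fun n Z => cw k2 v (iv l Z) (tau n)) (fun n Z => cw k2 v' (iv l' Z) (tau n)) k2%:R _ _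
  p1 p2 z1 z2 mm1 mm2).
- by rewrite (map_inj_uniq inj) (cx_uniq (tri_cplx T) Km).
- by rewrite (map_inj_uniq inj') (cx_uniq (tri_cplx T') Km').
- move=> n hn.
  have Em L (M : seq P3) w g0 (c : P3 -> R) : cancel (ph L) g0 ->
      E (map (ph L) M) w (fun Z => c (g0 Z)) = E M (fun Y => if Y \in M then w (ph L Y) else 0) c.
    by move=> hK; rewrite /E big_map; apply: eq_big_seq => Y Yl; rewrite Yl hK.
  apply: (eq_trans (Em l l2 w1 (iv l) (fun Y => cw k2 v Y (tau n)) ivl)); apply/esym.
  apply: (eq_trans (Em l' l2'' w2 (iv l') (fun Y => cw k2 v' Y (tau n)) ivl')).
  by rewrite (E_aff3 rX (cwaff v (tau n))) (E_aff3 rX' (cwaff v' (tau n))) eqcw.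
- move=> Z /sup1[Y [-> Yl wY]]; rewrite !ivl; have [_ eY iY] := fac _ wY.
  split; try exact: cwint.
  by have h := tau_sum (v := v) (fun _ => 1) utau (supY _ (inY _ Yl) eY); rewrite !mulr1 bsum1 in h; rewrite h.
- move=> Z /sup2[Y [-> Yl wY]]; rewrite !ivl'; have [_ eY iY] := fac' _ wY.
  split; try exact: cwint.
  by have h := tau_sum (v := v') (fun _ => 1) utau (supY' _ wY); rewrite !mulr1 bsum1 in h; rewrite h.
- move=> n Z Z' hn /sup1[Y [-> Yl wY]] /sup1[Y' [-> Yl' wY']]; rewrite !ivl.
  by apply: cwd; [exact: (v_neq ul hd) | exact: dif].
- move=> n Z Z' hn /sup2[Y [-> Yl wY]] /sup2[Y' [-> Yl' wY']]; rewrite !ivl'.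
  by apply: cwd; [exact: (v_neq ul' hd') | exact: dif'].
- move=> Z Z' /sup1[Y [-> Yl wY]] /sup2[Y' [-> Yl' wY']] h.
  have h0 := h 0%N isT; have h1 := h 1%N isT; have h2 := h 2%N isT; rewrite !ivl !ivl' in h0 h1 h2.
  have [_ eY iY] := fac _ wY.
  apply: cr_ext => j; rewrite !phi_bsum.
  rewrite (tau_sum (v := v) (cr j) utau (supY _ (inY _ Yl) eY)).
  by rewrite (tau_sum (v := v') (cr j) utau (supY' _ wY')) h0 h1 h2.
Qed.

(** On a facet of the large tetrahedron only coarse vertices of that facet carry weight. Their
    coordinates differ by at most 1, as do the fine coordinates, and [small_comb] combines the two
    bounds. *)
Lemma ccell_std l0 P Q i : ccell l0 -> P \in l0 -> Q \in l0 ->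
  bc (k1 * k2)%:R i P = 0 -> bc (k1 * k2)%:R i Q = 0 -> forall j, `|bc (k1 * k2)%:R j P - bc (k1 * k2)%:R j Q| <= 1.
Proof.
move=> [l [l2 [f ->]]] /mapP[Y Yl ->] /mapP[Y' Yl' ->]; have [Kl s4 Km] := f.
have [hd v3] := D1 Kl s4; have T := HM (m1 Kl s4); rewrite /ph; set v := (D l).1.1 in hd v3 *.
rewrite !bc_phi => e e' j; rewrite !bc_phi.
have hY := cx_in (tri_cplx T) Km Yl; have hY' := cx_in (tri_cplx T) Km Yl'.
have vin t := v_in hd v3 t.
have vD t : inD (k1%:R : R) (v t) by exact: (cx_in (tri_cplx C1) Kl (vin t)).
have z Z : inD (k2%:R : R) Z -> bsum k2 Z (fun t => bc k1%:R i (v t)) = 0 ->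
    forall t, (t < 4)%N -> bc k1%:R i (v t) != 0 -> bc k2%:R t Z = 0.
  move=> hZ; rewrite /bsum => s.
  have p0 := mulr_ge0 (hZ 0%N) (vD 0%N i); have p1 := mulr_ge0 (hZ 1%N) (vD 1%N i).
  have p2 := mulr_ge0 (hZ 2%N) (vD 2%N i); have p3 := mulr_ge0 (hZ 3%N) (vD 3%N i).
  move=> t ht nz; apply/eqP; have : bc k2%:R t Z * bc k1%:R i (v t) == 0.
    by apply/eqP; case: t ht nz => [|[|[|[|t]]]] // _ _; lra.
  by rewrite mulf_eq0 (negbTE nz) orbF.
have zY := z _ hY e; have zY' := z _ hY' e'.
have [t0 t04 nt0] := nonflat k10 hd i.
have fY := zY _ t04 nt0; have fY' := zY' _ t04 nt0.
have iY := bc_int (cop1 _) (cx_lat (tri_cplx T) Km Yl) fY.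
have iY' := bc_int (cop1 _) (cx_lat (tri_cplx T) Km Yl') fY'.
have dY := tri_std T Km Yl Yl' fY fY'.
pose d t := bc k2%:R t Y - bc k2%:R t Y'.
have di t : d t \is a Num.int by rewrite rpredB.
have onf t : (t < 4)%N -> d t != 0 -> bc k1%:R i (v t) = 0.
  move=> ht; apply: contraNeq => nz; apply/eqP; by rewrite /d zY // zY' // subrr.
have sd a b : (a < 4)%N -> (b < 4)%N -> d a != 0 -> d b != 0 -> `|bc k1%:R j (v a) - bc k1%:R j (v b)| <= 1.
  by move=> ha hb na nb; apply: (tri_std C1 Kl (vin a) (vin b) (onf _ ha na) (onf _ hb nb)).
have sum0 : d 0%N + d 1%N + d 2%N + d 3%N = 0 by rewrite /d /bc; ring.
have -> : bsum k2 Y (fun t => bc k1%:R j (v t)) - bsum k2 Y' (fun t => bc k1%:R j (v t)) =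
    d 0%N * bc k1%:R j (v 0%N) + d 1%N * bc k1%:R j (v 1%N) + d 2%N * bc k1%:R j (v 2%N) + d 3%N * bc k1%:R j (v 3%N).
  by rewrite /bsum /d; ring.
have d0 : d t0 = 0 by rewrite /d fY fY' subrr.
have dd t : `|d t| <= 1 by exact: dY.
move: d di sum0 d0 sd dd {onf} => d' di sum0 d0 sd dd.
case: t0 t04 d0 {nt0 fY fY'} => [|[|[|[|t0]]]] // _ d0; rewrite d0 in sum0; rewrite d0 mul0r ?add0r ?addr0.
- by apply: (small_comb (di 1%N) (di 2%N) (di 3%N) (dd 1%N) (dd 2%N) (dd 3%N));
    [move: sum0; lra | exact: sd | exact: sd | exact: sd].
- by apply: (small_comb (di 0%N) (di 2%N) (di 3%N) (dd 0%N) (dd 2%N) (dd 3%N));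
    [move: sum0; lra | exact: sd | exact: sd | exact: sd].
- by apply: (small_comb (di 0%N) (di 1%N) (di 3%N) (dd 0%N) (dd 1%N) (dd 3%N));
    [move: sum0; lra | exact: sd | exact: sd | exact: sd].
- by apply: (small_comb (di 0%N) (di 1%N) (di 2%N) (dd 0%N) (dd 1%N) (dd 2%N));
    [move: sum0; lra | exact: sd | exact: sd | exact: sd].
Qed.

Lemma ccell_tri : tri q p (k1 * k2) (eq^~ 1) ccell.
Proof.
split; first split.
- move=> l0 [l [l2 [[Kl s4 Km] ->]]]; rewrite (map_inj_uniq (finj Kl s4)).
  exact: (cx_uniq (tri_cplx (HM (m1 Kl s4))) Km).
- move=> l0 P [l [l2 [[Kl s4 Km] ->]]] /mapP[Y Yl ->]; have [hd v3] := D1 Kl s4.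
  apply: (phi_lat k2 _ hd v3); first by move=> Z; exact: (cx_lat (tri_cplx C1) Kl).
  exact: (cx_lat (tri_cplx (HM (m1 Kl s4))) Km Yl).
- move=> l0 P [l [l2 [[Kl s4 Km] ->]]] /mapP[Y Yl ->]; have [hd v3] := D1 Kl s4.
  apply: phi_in; first by move=> t; exact: (cx_in (tri_cplx C1) Kl (v_in hd v3 t)).
  exact: (cx_in (tri_cplx (HM (m1 Kl s4))) Km Yl).
- exact: ccell_cover.
- exact: ccell_same.
- exact: ccell_std.
- move=> l0 [l [l2 [[Kl s4 Km] ->]]]; rewrite size_map => s; have [hd v3] := D1 Kl s4.
  apply: (phi_good k2 _ hd v3); first by move=> Z; exact: (cx_lat (tri_cplx C1) Kl).
  exact: (tri_good (HM (m1 Kl s4)) Km s).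
Qed.

End Composite.

Lemma compose : exists K, tri q p (k1 * k2) (eq^~ 1) (K : seq P3 -> Prop).
Proof. by have [D [D1 D2]] := dat_exists; exists (ccell D); exact: ccell_tri. Qed.

End Compose.

(** * Sums of dilation factors *)

Section Additive.
Variable R : realType.
Notation P3 := (R * R * R)%type.
Variables (q : nat) (p : int) (k1 k2 : nat).
Hypothesis q0 : (0 < q)%N.
Hypothesis cop : exists u v : int, u * p + v * q%:Z = 1.
Hypothesis k10 : (0 < k1)%N.
Hypothesis k20 : (0 < k2)%N.
Variables (K1 K2 Kr : seq P3 -> Prop).
Hypothesis T1 : tri q p k1 (eq^~ 1) K1.
Hypothesis T2 : tri q p k2 (eq^~ 1) K2.
Hypothesis Cr : cplx q p (inD ((k1 + k2)%:R : R)) Kr.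
Hypothesis Sr : forall l P Q, Kr l -> P \in l -> Q \in l -> cr 0 P \is a Num.int -> cr 0 Q \is a Num.int ->
  forall i, `|bc (k1 + k2)%:R i P - bc (k1 + k2)%:R i Q| <= 1.
Hypothesis side : forall (f : bool) (c : nat) l, (c <= k1 + k2)%N -> Kr l ->
  (forall P, P \in l -> cr 0 P + f%:R * cr 2 P <= c%:R) \/ (forall P, P \in l -> c%:R <= cr 0 P + f%:R * cr 2 P).
Hypothesis cells : forall l, Kr l -> size l = 4 -> good4 q p (eq^~ 1) l \/ raw4 (k1 + k2) l.

Definition tr (P : P3) : P3 := ((P.1.1 + k1%:R, P.1.2), P.2).
Definition rt (P : P3) : P3 := ((P.1.1 - k1%:R, P.1.2), P.2).

Lemma trK : cancel tr rt.
Proof. by case=> [[x y] z]; rewrite /tr /rt /= addrK. Qed.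
Lemma rtK : cancel rt tr.
Proof. by case=> [[x y] z]; rewrite /tr /rt /= subrK. Qed.

Lemma tr_aff i : aff3 (fun P => cr i (tr P)).
Proof.
case: i => [|[|i]].
- by exists k1%:R, 1, 0, 0 => P /=; ring.
- by exists 0, 0, 1, 0 => P /=; ring.
- by exists 0, 0, 0, 1 => P /=; ring.
Qed.

Lemma rt_aff i : aff3 (fun P => cr i (rt P)).
Proof.
case: i => [|[|i]].
- by exists (- k1%:R), 1, 0, 0 => P /=; ring.
- by exists 0, 0, 1, 0 => P /=; ring.
- by exists 0, 0, 0, 1 => P /=; ring.
Qed.

Lemma tr_lat P : lat3 q p P = lat3 q p (tr P).
Proof.
rewrite /lat3 /lat /=; congr (_ && _ && _).
have -> : P.1.1 + k1%:R - p%:~R * P.1.2 = (P.1.1 - p%:~R * P.1.2) + k1%:R by ring.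
by apply/idP/idP => [h|h]; [rewrite rpredD ?natr_int | move: (rpredB h (natr_int R k1)); rewrite addrK].
Qed.

Definition K2t l := exists2 l0, K2 l0 & l = map tr l0.

Lemma C2 : cplx q p (fun P => inD (k2%:R : R) (rt P)) K2t.
Proof.
apply: (cplx_map trK rtK tr_aff rt_aff tr_lat _ (tri_cplx T2)) => P; by rewrite trK.
Qed.

Definition mid l := [/\ Kr l, forall P, P \in l -> k1%:R <= cr 0 P + cr 2 P & forall P, P \in l -> cr 0 P <= k1%:R].
Definition acell l := [\/ K1 l, K2t l | mid l].

(* The plane x + z = k1 (b = false) or x = k1 (b = true) and its three standard coordinates. *)
Definition onpl (b : bool) (P : P3) := if b then cr 0 P = k1%:R else cr 0 P + cr 2 P = k1%:R.
Definition pc (b : bool) (i : nat) (P : P3) : R :=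
  match i with 0%N => if b then (k1 + k2)%:R - cr 0 P - cr 2 P else cr 0 P | 1%N => cr 2 P - cr 1 P | _ => cr 1 P end.
Definition std_on b (w : P3 -> R) :=
  (forall Q, w Q != 0 -> onpl b Q /\ forall i, pc b i Q \is a Num.int) /\
  (forall Q Q', w Q != 0 -> w Q' != 0 -> forall i, `|pc b i Q - pc b i Q'| <= 1).

Lemma pc_aff b i : aff3 (pc b i).
Proof.
case: i => [|[|i]]; rewrite /pc.
- by case: b; [exists (k1 + k2)%:R, (-1), 0, (-1) => P /=; ring | exists 0, 1, 0, 0 => P /=; ring].
- by exists 0, 0, (-1), 1 => P /=; ring.
- by exists 0, 0, 1, 0 => P /=; ring.
Qed.

(** The three coordinates [pc] have constant sum on the plane and separate its points, as [std_uniq]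
    requires. *)
Lemma glue b l l' w w' P : uniq l -> uniq l' -> rep3 l w P -> rep3 l' w' P -> std_on b w -> std_on b w' -> w =1 w'.
Proof.
move=> ul ul' r r' [s1 s2] [s1' s2'].
have /rep3P[p1 z1 m1 _] := r; have /rep3P[p2 z2 m2 _] := r'.
pose c : R := if b then k2%:R else k1%:R.
have sum Q : onpl b Q -> pc b 0 Q + pc b 1 Q + pc b 2 Q = c.
  by rewrite /onpl /pc /c natrD; case: (b) => h; lra.
apply: (@std_uniq R P3 l l' w w' (pc b) (pc b) c ul ul' p1 p2 z1 z2 m1 m2).
- by move=> i _; rewrite (E_aff3 r (pc_aff b i)) (E_aff3 r' (pc_aff b i)).
- by move=> Q /s1[h hi]; split; rewrite ?sum.
- by move=> Q /s1'[h hi]; split; rewrite ?sum.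
- by move=> i Q Q' _ h h'; exact: s2.
- by move=> i Q Q' _ h h'; exact: s2'.
- move=> Q Q' /s1[h _] /s1'[h' _] e.
  have e0 := e 0%N isT; have e1 := e 1%N isT; have e2 := e 2%N isT.
  apply: cr_ext => i; move: e0 e1 e2 h h'; rewrite /pc /onpl; case: (b) => e0 e1 e2 h h';
    case: i => [|[|i]]; rewrite /cr in e0 e1 e2 h h' *; lra.
Qed.

Lemma std1 l w P : K1 l -> rep3 l w P -> onpl false P -> std_on false w.
Proof.
move=> Kl r oP.
have f0 Q : w Q != 0 -> bc k1%:R 0 Q = 0.
  apply: (rep3_face r (bc_aff _ 0)); last by move: oP; rewrite /onpl /bc; lra.
  by move=> Z wZ; apply: (cx_in (tri_cplx T1) Kl (rep3_in r wZ)).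
split=> [Q wQ|Q Q' wQ wQ' i].
- have f := f0 _ wQ; have bi := bc_int cop (cx_lat (tri_cplx T1) Kl (rep3_in r wQ)) f.
  split; first by move: f; rewrite /onpl /bc; lra.
  by case=> [|[|i]]; [exact: (bi 1%N) | exact: (bi 2%N) | exact: (bi 3%N)].
- have d := tri_std T1 Kl (rep3_in r wQ) (rep3_in r wQ') (f0 _ wQ) (f0 _ wQ').
  by case: i => [|[|i]]; [exact: (d 1%N) | exact: (d 2%N) | exact: (d 3%N)].
Qed.

Lemma bc_rt i P : bc k2%:R i (rt P) = match i with 0%N => (k1 + k2)%:R - cr 0 P - cr 2 P | 1%N => cr 0 P - k1%:R
   | 2%N => cr 2 P - cr 1 P | _ => cr 1 P end.
Proof. by rewrite natrD; case: i => [|[|[|i]]] //=; rewrite /cr; ring. Qed.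

Lemma std2 l w P : K2t l -> rep3 l w P -> onpl true P -> std_on true w.
Proof.
move=> Kl r oP; have [l0 K0 el] := Kl.
have in0 Q : w Q != 0 -> rt Q \in l0.
  by move=> /(rep3_in r); rewrite el (mem_fmap trK rtK).
have aff i : aff3 (fun P => bc k2%:R i (rt P)).
  have [al [be [ga [de h]]]] := @bc_aff R k2%:R i.
  have [a0 [a1 [a2 [a3 h0]]]] := rt_aff 0; have [b0 [b1 [b2 [b3 h1]]]] := rt_aff 1; have [c0 [c1 [c2 [c3 h2]]]] := rt_aff 2.
  exists (al + be * a0 + ga * b0 + de * c0), (be * a1 + ga * b1 + de * c1), (be * a2 + ga * b2 + de * c2), (be * a3 + ga * b3 + de * c3).
  by move=> Q; rewrite h h0 h1 h2; ring.
have f0 Q : w Q != 0 -> bc k2%:R 1 (rt Q) = 0.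
  apply: (rep3_face r (aff 1%N)); last by move: oP; rewrite bc_rt /onpl; lra.
  by move=> Z wZ; apply: (cx_in (tri_cplx T2) K0 (in0 _ wZ)).
split=> [Q wQ|Q Q' wQ wQ' i].
- have f := f0 _ wQ; have bi := bc_int cop (cx_lat (tri_cplx T2) K0 (in0 _ wQ)) f.
  split; first by move: f; rewrite bc_rt /onpl; lra.
  by case=> [|[|i]]; [have := bi 0%N | have := bi 2%N | have := bi 3%N]; rewrite bc_rt.
- have d := tri_std T2 K0 (in0 _ wQ) (in0 _ wQ') (f0 _ wQ) (f0 _ wQ').
  by case: i => [|[|i]]; [have := d 0%N | have := d 2%N | have := d 3%N]; rewrite !bc_rt.
Qed.

(** The two outer pieces meet only in the point (k1, 0, 0), which lies on both planes. *)
Lemma std2' l w P : K2t l -> rep3 l w P -> onpl true P -> onpl false P -> std_on false w.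
Proof.
move=> Kl r o1 o0; have [s1 s2] := std2 Kl r o1.
have z0 Q : w Q != 0 -> cr 2 Q = 0.
  apply: (rep3_face r (cr_aff R 2)); last by move: o1 o0; rewrite /onpl; lra.
  move=> Z wZ; have := cx_in C2 Kl (rep3_in r wZ) => h; have := h 2%N; have := h 3%N; rewrite !bc_rt; lra.
split=> [Q wQ|Q Q' wQ wQ' i].
- have [oQ iQ] := s1 _ wQ; have zQ := z0 _ wQ; split; first by rewrite /onpl zQ addr0.
  case=> [|[|i]]; [|exact: (iQ 1%N) | exact: (iQ 2%N)].
  by move: oQ; rewrite /onpl /pc => ->; rewrite natr_int.
- have [oQ _] := s1 _ wQ; have [oQ' _] := s1 _ wQ'; have d := s2 _ _ wQ wQ'.
  case: i => [|[|i]]; [|exact: (d 1%N) | exact: (d 2%N)].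
  by move: oQ oQ'; rewrite /onpl /pc => -> ->; rewrite subrr normr0 ler01.
Qed.

Lemma std3 b l w P : mid l -> rep3 l w P -> onpl b P -> std_on b w.
Proof.
move=> [Kl h0 h1] r oP.
have on Q : w Q != 0 -> onpl b Q.
  move=> wQ; move: oP; rewrite /onpl; case: b => oP.
  - have : k1%:R - cr 0 Q = 0; last lra.
    apply: (rep3_face r (f := fun Q => k1%:R - cr 0 Q) _ _ _ wQ); last lra.
    + by exists k1%:R, (-1), 0, 0 => Z; ring.
    + by move=> Z wZ; rewrite subr_ge0; exact: (h1 _ (rep3_in r wZ)).
  - have : cr 0 Q + cr 2 Q - k1%:R = 0; last lra.
    apply: (rep3_face r (f := fun Q => cr 0 Q + cr 2 Q - k1%:R) _ _ _ wQ); last lra.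
    + by exists (- k1%:R), 1, 0, 1 => Z; ring.
    + by move=> Z wZ; rewrite subr_ge0; exact: (h0 _ (rep3_in r wZ)).
have ix Q : w Q != 0 -> [/\ cr 0 Q \is a Num.int, cr 1 Q \is a Num.int & cr 2 Q \is a Num.int].
  move=> wQ; have /andP[lQ iz] := cx_lat Cr Kl (rep3_in r wQ).
  have i0 : cr 0 Q \is a Num.int.
    move: (on _ wQ); rewrite /onpl; case: (b) => e; first by rewrite e natr_int.
    have -> : cr 0 Q = k1%:R - cr 2 Q by lra.
    by rewrite rpredB ?natr_int.
  by split=> //; rewrite /cr -(lat_x cop lQ).
split=> [Q wQ|Q Q' wQ wQ' i].
- split; first exact: on.
  have [i0 i1 i2] := ix _ wQ; case=> [|[|i]] //=; last by rewrite rpredB.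
  by case: (b) => //; rewrite !rpredB ?natr_int.
- have [i0 _ _] := ix _ wQ; have [i0' _ _] := ix _ wQ'.
  have d := Sr Kl (rep3_in r wQ) (rep3_in r wQ') i0 i0'.
  case: i => [|[|i]]; [|exact: (d 2%N) | exact: (d 3%N)].
  by rewrite /pc; case: (b); [exact: (d 0%N) | exact: (d 1%N)].
Qed.

Lemma acell_uniq l : acell l -> uniq l.
Proof. by case=> [h|h|[h _ _]]; [exact: (cx_uniq (tri_cplx T1) h) | exact: (cx_uniq C2 h) | exact: (cx_uniq Cr h)]. Qed.

Lemma mid_pl l w P : mid l -> rep3 l w P -> k1%:R <= cr 0 P + cr 2 P /\ cr 0 P <= k1%:R.
Proof.
move=> [Kl h0 h1] r; split; rewrite -subr_ge0.
- apply: (rep3_ge0 r (f := fun Q => cr 0 Q + cr 2 Q - k1%:R)); first by exists (- k1%:R), 1, 0, 1 => Z; ring.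
  by move=> Z wZ; rewrite subr_ge0; exact: (h0 _ (rep3_in r wZ)).
- apply: (rep3_ge0 r (f := fun Q => k1%:R - cr 0 Q)); first by exists k1%:R, (-1), 0, 0 => Z; ring.
  by move=> Z wZ; rewrite subr_ge0; exact: (h1 _ (rep3_in r wZ)).
Qed.

Lemma one_pl l w P : K1 l -> rep3 l w P -> cr 0 P + cr 2 P <= k1%:R /\ 0 <= cr 2 P.
Proof.
move=> Kl r; have h : inD (k1%:R : R) P by apply: (rep3_inD r) => Y; exact: (cx_in (tri_cplx T1) Kl).
by have := h 0%N; have := h 2%N; have := h 3%N; rewrite /bc; lra.
Qed.

Lemma two_pl l w P : K2t l -> rep3 l w P -> k1%:R <= cr 0 P.
Proof.
move=> Kl r; rewrite -subr_ge0.
apply: (rep3_ge0 r (f := fun Q => cr 0 Q - k1%:R)); first by exists (- k1%:R), 1, 0, 0 => Z; ring.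
by move=> Z wZ; have := cx_in C2 Kl (rep3_in r wZ) 1%N; rewrite bc_rt.
Qed.

Lemma acell_same l l' w w' P : acell l -> acell l' -> rep3 l w P -> rep3 l' w' P -> w =1 w'.
Proof.
have s12 m m' v v' : K1 m -> K2t m' -> rep3 m v P -> rep3 m' v' P -> v =1 v'.
  move=> h h' r r'; have [a1 a2] := one_pl h r; have b1 := two_pl h' r'.
  have o1 : onpl true P by rewrite /onpl; lra.
  have o0 : onpl false P by rewrite /onpl; lra.
  apply: (glue _ _ r r' (std1 h r o0) (std2' h' r' o1 o0)).
  - exact: (cx_uniq (tri_cplx T1) h).
  - exact: (cx_uniq C2 h').
have s13 m m' v v' : K1 m -> mid m' -> rep3 m v P -> rep3 m' v' P -> v =1 v'.
  move=> h h' r r'; have [a1 a2] := one_pl h r; have [b1 b2] := mid_pl h' r'.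
  have o0 : onpl false P by rewrite /onpl; lra.
  apply: (glue _ _ r r' (std1 h r o0) (std3 h' r' o0)).
  - exact: (cx_uniq (tri_cplx T1) h).
  - by case: h' => h' _ _; exact: (cx_uniq Cr h').
have s23 m m' v v' : K2t m -> mid m' -> rep3 m v P -> rep3 m' v' P -> v =1 v'.
  move=> h h' r r'; have a1 := two_pl h r; have [b1 b2] := mid_pl h' r'.
  have o1 : onpl true P by rewrite /onpl; lra.
  apply: (glue _ _ r r' (std2 h r o1) (std3 h' r' o1)).
  - exact: (cx_uniq C2 h).
  - by case: h' => h' _ _; exact: (cx_uniq Cr h').
case=> h; case=> h' r r'.
- exact: (cx_same (tri_cplx T1) h h' r r').
- exact: s12 h h' r r'.
- exact: s13 h h' r r'.
- by move=> Q; apply/esym; exact: (s12 _ _ _ _ h' h r' r).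
- exact: (cx_same C2 h h' r r').
- exact: s23 h h' r r'.
- by move=> Q; apply/esym; exact: (s13 _ _ _ _ h' h r' r).
- by move=> Q; apply/esym; exact: (s23 _ _ _ _ h' h r' r).
- by case: h => h _ _; case: h' => h' _ _; exact: (cx_same Cr h h' r r').
Qed.

Lemma acell_cover P : inD ((k1 + k2)%:R : R) P -> exists l w, [/\ acell l, rep3 l w P & {in l, forall Q, 0 < w Q}].
Proof.
move=> hP; have h0 := hP 0%N; have h1 := hP 1%N; have h2 := hP 2%N; have h3 := hP 3%N.
rewrite /bc natrD in h0 h1 h2 h3.
have [c1|c1] := leP (cr 0 P + cr 2 P) k1%:R.
  have h : inD (k1%:R : R) P by case=> [|[|[|i]]] //=; rewrite /cr in c1 h0 h1 h2 h3 *; lra.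
  have [l [w [Kl r pos]]] := cx_cover (tri_cplx T1) h; exists l, w; split=> //; exact: Or31.
have [c2|c2] := leP k1%:R (cr 0 P).
  have h : inD (k2%:R : R) (rt P) by move=> i; rewrite bc_rt; case: i => [|[|[|i]]]; rewrite ?natrD; lra.
  have [l [w [Kl r pos]]] := cx_cover C2 h; exists l, w; split=> //; exact: Or32.
have [l [w [Kl r pos]]] := cx_cover Cr hP; exists l, w; split=> //; apply: Or33; split=> //.
- have ck : (k1 <= k1 + k2)%N by rewrite leq_addr.
  have [h|h] := side true ck Kl; last by move=> Q /h; rewrite mul1r.
  have : 0 <= k1%:R - (cr 0 P + cr 2 P); last lra.
  apply: (rep3_ge0 r (f := fun Q => k1%:R - (cr 0 Q + cr 2 Q))); first by exists k1%:R, (-1), 0, (-1) => Z; ring.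
  by move=> Z wZ; have := h _ (rep3_in r wZ); rewrite mul1r subr_ge0.
- have ck : (k1 <= k1 + k2)%N by rewrite leq_addr.
  have [h|h] := side false ck Kl; first by move=> Q /h; rewrite mul0r addr0.
  have : 0 <= cr 0 P - k1%:R; last lra.
  apply: (rep3_ge0 r (f := fun Q => cr 0 Q - k1%:R)); first by exists (- k1%:R), 1, 0, 0 => Z; ring.
  by move=> Z wZ; have := h _ (rep3_in r wZ); rewrite mul0r addr0 subr_ge0.
Qed.

Lemma inD1 (P : P3) : inD (k1%:R : R) P -> inD ((k1 + k2)%:R : R) P.
Proof.
move=> h; have h0 := h 0%N; have h1 := h 1%N; have h2 := h 2%N; have h3 := h 3%N; rewrite /bc in h0 h1 h2 h3.
have n2 := ler0n R k2; by case=> [|[|[|i]]]; rewrite /bc ?natrD; lra.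
Qed.

Lemma inD2 (P : P3) : inD (k2%:R : R) (rt P) -> inD ((k1 + k2)%:R : R) P.
Proof.
move=> h; have h0 := h 0%N; have h1 := h 1%N; have h2 := h 2%N; have h3 := h 3%N; rewrite !bc_rt in h0 h1 h2 h3.
have n1 := ler0n R k1; by case=> [|[|[|i]]]; rewrite /bc; lra.
Qed.

Lemma acell_tri : tri q p (k1 + k2) (eq^~ 1) acell.
Proof.
have k1R : 1 <= (k1%:R : R) by rewrite ler1n. have k2R : 1 <= (k2%:R : R) by rewrite ler1n.
split; first split.
- exact: acell_uniq.
- move=> l P [h|h|[h _ _]]; [exact: (cx_lat (tri_cplx T1) h) | exact: (cx_lat C2 h) | exact: (cx_lat Cr h)].
- move=> l P [h|h|[h _ _]] Pl.
  + by apply: inD1; exact: (cx_in (tri_cplx T1) h Pl).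
  + by apply: inD2; exact: (cx_in C2 h Pl).
  + exact: (cx_in Cr h Pl).
- exact: acell_cover.
- exact: acell_same.
- move=> l P Q i [h|h|[h _ _]] Pl Ql eP eQ j.
  + have DP := cx_in (tri_cplx T1) h Pl.
    have e k (Z : P3) : bc (k1 + k2)%:R k Z = bc k1%:R k Z + (if k == 0%N then k2%:R else 0).
      by rewrite natrD; case: k => [|[|[|k]]] //=; ring.
    (* The first piece does not reach the facet x + z = k1 + k2. The other three facets have the
       same equations for the piece and the whole. *)
    have i0 : i != 0%N.
      by apply/eqP => i0; subst i; move: (DP 0%N) eP; rewrite e /=; lra.
    rewrite !e in eP eQ *; rewrite (negbTE i0) addr0 in eP; rewrite (negbTE i0) addr0 in eQ.
    have := tri_std T1 h Pl Ql eP eQ j; congr (`|_| <= _); ring.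
  + have [l0 K0 el] := h; rewrite el !(mem_fmap trK rtK) in Pl Ql.
    have DP := cx_in (tri_cplx T2) K0 Pl.
    have e k (Z : P3) : bc (k1 + k2)%:R k Z = bc k2%:R k (rt Z) + (if k == 1%N then k1%:R else 0).
      by rewrite bc_rt; case: k => [|[|[|k]]] //=; ring.
    have i0 : i != 1%N.
      by apply/eqP => i0; subst i; move: (DP 1%N) eP; rewrite e /=; lra.
    rewrite !e in eP eQ *; rewrite (negbTE i0) addr0 in eP; rewrite (negbTE i0) addr0 in eQ.
    have := tri_std T2 K0 Pl Ql eP eQ j; congr (`|_| <= _); ring.
  + apply: (Sr h Pl Ql).
    * exact: (facet_int cop (cx_lat Cr h Pl) eP).
    * exact: (facet_int cop (cx_lat Cr h Ql) eQ).
- move=> l [h|[l0 K0 ->]|[h m1 m2]] s4.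
  + exact: (tri_good T1 h s4).
  + rewrite size_map in s4; apply: (good4_map tr_aff _ _ (tri_good T2 K0 s4)) => P; first by rewrite -tr_lat.
    by move=> lP; exists (rt P); rewrite ?rtK // tr_lat rtK.
  (* A copy of Delta' contains a unit segment of the edge z = 0, which the middle part meets in a
     single point. *)
  + have [//|[n [hn pl]]] := cells h s4; exfalso.
    have b0 := m1 ((n%:R, 0), 0); have b1 := m2 ((n.+1%:R, 0), 0).
    rewrite !(perm_mem pl) !inE !eqxx ?orbT /cr /= addr0 in b0 b1.
    have := b0 isT; have := b1 isT; rewrite !ler_nat; clear; lia.
Qed.

End Additive.

Lemma tri_add (R : realType) q (p : int) k1 k2 : (0 < q)%N -> (exists u v : int, u * p + v * q%:Z = 1) ->
  (0 < k1)%N -> (0 < k2)%N ->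
  (exists K, @tri R q p k1 (eq^~ 1) K) -> (exists K, @tri R q p k2 (eq^~ 1) K) ->
  exists K, @tri R q p (k1 + k2) (eq^~ 1) K.
Proof.
move=> q0 cop k10 k20 [K1 T1] [K2 T2].
have k0 : (0 < k1 + k2)%N by rewrite addn_gt0 k10.
have [Kr [Cr Sr side cells]] := @zigzag_raw R q p (k1 + k2) q0 cop k0.
exists (acell k1 K1 K2 Kr); exact: acell_tri.
Qed.

(** * Purity *)

Lemma pigeonhole (T : finType) (f : nat -> T) : exists t, forall N, exists2 n, (N <= n)%N & f n = t.
Proof.
apply: contrapT => hn.
have /choice[N hN] : forall t, exists N, forall n, (N <= n)%N -> f n <> t.
  move=> t; apply: contrapT => h; apply: hn; exists t => N; apply: contrapT => h'.
  by apply: h; exists N => n hn e; apply: h'; exists n.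
pose M := (\max_t N t)%N.
exact: (hN (f M) M (leq_bigmax _)).
Qed.

Section Purity.
Variable R : realType.
Notation P3 := (R * R * R)%type.
Variables (q : nat) (p : int) (k : nat) (Pm : int -> Prop) (K : seq P3 -> Prop).
Hypothesis q0 : (0 < q)%N.
Hypothesis k0 : (0 < k)%N.
Hypothesis T : tri q p k Pm K.

Lemma lattice_points : exists V : seq P3, forall P, lat3 q p P -> inD (k%:R : R) P -> P \in V.
Proof.
have [V2 [_ mV]] := @square_points R q p q0.
pose N := iota 0 k.+1.
pose L2 := [seq sh mn.1%:Z mn.2%:Z B | mn <- [seq (m, n) | m <- N, n <- N], B <- V2].
exists [seq (Q, z%:R) | Q <- L2, z <- N].
move=> P /andP[lP zi] h.
have h0 := h 0%N; have h1 := h 1%N; have h2 := h 2%N; have h3 := h 3%N; rewrite /bc /cr in h0 h1 h2 h3.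
have fl (x : R) : 0 <= x -> x <= k%:R -> exists2 n, n \in N & Num.floor x = n%:Z.
  move=> x0 xk; have f0 : 0 <= Num.floor x by rewrite floor_ge0.
  exists (absz (Num.floor x)); last by rewrite gez0_abs.
  have := floor_itv x; rewrite intrD /= => /andP[fx _].
  have : (Num.floor x)%:~R <= (k%:Z)%:~R :> R by apply: le_trans fx _.
  by rewrite mem_iota add0n /= ler_int ltnS -lez_nat gez0_abs.
have [m mN em] := fl P.1.1 ltac:(lra) ltac:(lra); have [n nN en] := fl P.1.2 ltac:(lra) ltac:(lra).
have [z zN ez] := fl P.2 ltac:(lra) ltac:(lra).
have eP : P = (P.1, z%:R).
  rewrite [LHS]surjective_pairing; congr (_, _); case/intrP: zi => c ec.
  by rewrite ec intrKfloor in ez *; rewrite ez.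
rewrite eP; apply: allpairs_f => //.
rewrite -(shK' m n P.1); apply: (allpairs_f (fun mn B => sh mn.1%:Z mn.2%:Z B) (x := (m, n))).
  exact: allpairs_f.
by rewrite mV lat_sh lP -em -en floor_sq.
Qed.

Definition hc (i : 'I_4) (X : P3) : R :=
  match nat_of_ord i with 0%N => 1 | 1%N => cr 0 X | 2%N => cr 1 X | _ => cr 2 X end.

Definition fun_of (v : 'rV[R]_4) (X : P3) : R := \sum_i v 0 i * hc i X.

Lemma fun_ofE v X : fun_of v X = v 0 (inord 0) + v 0 (inord 1) * cr 0 X + v 0 (inord 2) * cr 1 X + v 0 (inord 3) * cr 2 X.
Proof.
rewrite /fun_of !big_ord_recl big_ord0 /hc /= mulr1 addr0 !addrA.
by congr (v 0 _ + v 0 _ * _ + v 0 _ * _ + v 0 _ * _); apply: val_inj; rewrite /= inordK.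
Qed.

Lemma fun_aff v : aff3 (fun_of v).
Proof. by exists (v 0 (inord 0)), (v 0 (inord 1)), (v 0 (inord 2)), (v 0 (inord 3)) => X; exact: fun_ofE. Qed.

Variable P : P3.
Hypothesis hP : inD (k%:R : R) P.

(* The curve gam leaves P inside k Delta' and lies in no plane near P, so that a cell containing
   infinitely many of the points gam (s n), which accumulate at P, is a tetrahedron containing P. *)
Let s (n : nat) : R := n.+2%:R^-1.
Definition gam (t : R) : P3 :=
  let c := 1 - t - t ^+ 2 - t ^+ 3 - t ^+ 4 in
  ((c * cr 0 P + t ^+ 2 * k%:R, c * cr 1 P + t ^+ 4 * k%:R), c * cr 2 P + t ^+ 3 * k%:R + t ^+ 4 * k%:R).

Let V0 : P3 := ((0, 0), 0).
Let V1 : P3 := ((k%:R, 0), 0).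
Let V2 : P3 := ((0, 0), k%:R).
Let V3 : P3 := ((0, k%:R), k%:R).

Lemma aff_gam f t : aff3 f -> f (gam t) = (1 - t - t ^+ 2 - t ^+ 3 - t ^+ 4) * f P +
  t * f V0 + t ^+ 2 * f V1 + t ^+ 3 * f V2 + t ^+ 4 * f V3.
Proof. by move=> [al [be [ga [de h]]]]; rewrite !h /gam /cr /=; ring. Qed.

Let s_bnd n : 0 < s n <= 2^-1.
Proof. by rewrite /s invr_gt0 ltr0n /= lef_pV2 ?posrE ?ltr0n // ler_nat. Qed.

Lemma gam_in t : 0 < t <= 2^-1 -> inD (k%:R : R) (gam t).
Proof.
(* [t <= 1/2] keeps the coefficient of [P] at least 1/16. *)
move=> ht i; rewrite (aff_gam _ (bc_aff _ i)).
have t1 : t <= 2^-1 by case/andP: ht.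
have t0 : 0 <= t by lra.
have p2 : 0 <= t ^+ 2 <= 4^-1 by rewrite expr2; nra.
have p3 : 0 <= t ^+ 3 <= 8^-1 by rewrite exprS; nra.
have p4 : 0 <= t ^+ 4 <= 16^-1 by rewrite exprS; nra.
have kR := ler0n R k.
have v (X : P3) : X \in [:: V0; V1; V2; V3] -> 0 <= bc k%:R i X.
  by rewrite !inE => /or4P[] /eqP ->; case: i => [|[|[|i]]]; rewrite /bc /cr /=; lra.
have t' (x y : R) : 0 <= x -> 0 <= y -> 0 <= x * y by exact: mulr_ge0.
do 4!(apply: addr_ge0; last by apply: t'; [rewrite ?exprn_ge0 | apply: v; rewrite !inE eqxx ?orbT]).
by apply: t'; [lra | exact: hP].
Qed.

Lemma poly_zero (a b c d e : R) : (forall N, exists2 n, (N <= n)%N &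
  a + b * s n + c * s n ^+ 2 + d * s n ^+ 3 + e * s n ^+ 4 = 0) -> [/\ a = 0, b = 0, c = 0, d = 0 & e = 0].
Proof.
move=> h.
have [n0 _ r0] := h 0%N; have [n1 l1 r1] := h n0.+1; have [n2 l2 r2] := h n1.+1.
have [n3 l3 r3] := h n2.+1; have [n4 l4 r4] := h n3.+1.
pose f := Poly [:: a; b; c; d; e].
have ev n : a + b * s n + c * s n ^+ 2 + d * s n ^+ 3 + e * s n ^+ 4 = 0 -> root f (s n).
  move=> r; apply/rootP; rewrite /f horner_Poly /=; rewrite -[RHS]r; ring.
have sinj : injective s.
  by move=> a' b' /invr_inj /eqP; rewrite eqr_nat => /eqP[].
have f0 : f = 0.
  apply/eqP; apply: contraT => nf.
  have ar : all (root f) (map s [:: n0; n1; n2; n3; n4]) by rewrite /= !ev.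
  have us : uniq (map s [:: n0; n1; n2; n3; n4]).
    rewrite (map_inj_uniq sinj) /= !inE !negb_or.
    by move: l1 l2 l3 l4; clear => l1 l2 l3 l4; repeat (apply/andP; split); rewrite ?andbT //; apply/eqP; lia.
  have := max_poly_roots nf ar us; rewrite /= ltnNge => /negP; case.
  exact: size_Poly.
have cf i : f`_i = [:: a; b; c; d; e]`_i by rewrite coef_Poly.
rewrite f0 in cf.
by split; [have := cf 0%N | have := cf 1%N | have := cf 2%N | have := cf 3%N | have := cf 4%N]; rewrite coef0 /= => <-.
Qed.

Lemma pure : exists l w, [/\ K l, size l = 4 & rep3 l w P].
Proof.
have [V inV] := lattice_points.
have /choice[L hL] : forall n, exists lw : seq P3 * (P3 -> R),
    [/\ K lw.1, rep3 lw.1 lw.2 (gam (s n)) & {in lw.1, forall Q, 0 < lw.2 Q}].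
  by move=> n; have [l [w h]] := cx_cover (tri_cplx T) (gam_in (s_bnd n)); exists (l, w).
(* Cells have their vertices in the finite set [V], so one vertex set recurs for infinitely many
   [n]. *)
pose code (l : seq P3) := [ffun i : 'I_(size V) => nth V0 V i \in l].
have [t ht] := pigeonhole (fun n => code (L n).1).
have [n0 _ e0] := ht 0%N; set l := (L n0).1 in e0; have [Kl _ _] := hL n0; rewrite -/l in Kl.
have KV l' : K l' -> {subset l' <= V}.
  by move=> Kl' X Xl; apply: inV; [exact: (cx_lat (tri_cplx T) Kl' Xl) | exact: (cx_in (tri_cplx T) Kl' Xl)].
have ul := cx_uniq (tri_cplx T) Kl.
have inf N : exists2 n, (N <= n)%N & exists2 w, rep3 l w (gam (s n)) & True.
  have [n Nn en] := ht N; exists n => //; have [K' r _] := hL n; exists (L n).2 => //.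
  have pe : perm_eq (L n).1 l.
    apply: uniq_perm => //; first exact: (cx_uniq (tri_cplx T) K').
    have cde : code (L n).1 = code l by rewrite en e0.
    have H (l1 l2 : seq P3) X : code l1 = code l2 -> {subset l1 <= V} -> X \in l1 -> X \in l2.
      move=> ce sub Xl; have Xi : (index X V < size V)%N by rewrite index_mem sub.
      have := congr1 (fun f : {ffun 'I_(size V) -> bool} => f (Ordinal Xi)) ce.
      by rewrite !ffunE /= nth_index ?sub // Xl => /esym.
    by move=> X; apply/idP/idP => h; apply: H h; rewrite ?cde //; exact: KV.
  exact: rep_perm pe r.
(* An affine function vanishing on [l] vanishes at infinitely many points of the curve. The
   resulting quartic in the parameter is 0, and its coefficients give the values at [P] and at the
   four vertices. *)
have flat v : (forall X, X \in l -> fun_of v X = 0) -> v = 0.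
  move=> h.
  have h' n w : rep3 l w (gam (s n)) -> fun_of v (gam (s n)) = 0.
    move=> r; rewrite -(E_aff3 r (fun_aff v)) /E big_seq big1 // => X Xl; by rewrite h // mulr0.
  have [e1 e2 e3 e4 e5] : [/\ fun_of v P = 0, fun_of v V0 - fun_of v P = 0, fun_of v V1 - fun_of v P = 0,
      fun_of v V2 - fun_of v P = 0 & fun_of v V3 - fun_of v P = 0].
    apply: poly_zero => N; have [n Nn [w r _]] := inf N; exists n => //.
    by rewrite -(h' n w r) (aff_gam _ (fun_aff v)); ring.
  have kR : (k%:R : R) != 0 by rewrite pnatr_eq0 -lt0n.
  rewrite e1 subr0 in e2 e3 e4 e5; rewrite !fun_ofE /cr /= !mulr0 !addr0 in e2 e3 e4 e5.
  rewrite e2 !add0r !(subr0 (_ * _)) ?(subr0 (_ + _)) in e3 e4 e5.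
  have z1 : v 0 (inord 1) = 0 by apply/eqP; move/eqP: e3; rewrite mulf_eq0 (negbTE kR) orbF.
  have z3 : v 0 (inord 3) = 0 by apply/eqP; move/eqP: e4; rewrite mulf_eq0 (negbTE kR) orbF.
  have z2 : v 0 (inord 2) = 0.
    by apply/eqP; move/eqP: e5; rewrite z3 mul0r addr0 mulf_eq0 (negbTE kR) orbF.
  apply/rowP => i; rewrite mxE -(inord_val i).
  by case: i => [[|[|[|[|i]]]] hi] //=.
pose A := \matrix_(i < 4, j < size l) hc i (nth V0 l j).
have freeA : row_free A.
  apply: inj_row_free => v vA; apply: flat => X Xl.
  have Xi : (index X l < size l)%N by rewrite index_mem.
  have := congr1 (fun M : 'rV[R]_(size l) => M 0 (Ordinal Xi)) vA; rewrite !mxE => <-.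
  by apply: eq_bigr => i _; rewrite !mxE /= nth_index.
have same w1 w2 b : rep (cs3 R) l w1 b -> rep (cs3 R) l w2 b -> w1 =1 w2.
  move=> r1 r2; have eb : b = [:: E l w1 (cr 0); E l w1 (cr 1); E l w1 (cr 2)] by case: r1 => _ _ _ <-.
  by apply: (cx_same (tri_cplx T) Kl Kl (P := ((E l w1 (cr 0), E l w1 (cr 1)), E l w1 (cr 2)))); rewrite /rep3 /= -eb.
have sl : size l = 4.
  apply/eqP; rewrite eqn_leq; apply/andP; split; first exact: (cell_size ul same).
  by move: freeA; rewrite /row_free => /eqP e; rewrite -[X in (X <= _)%N]e; exact: rank_leq_col.
(* A one-sided inverse of the coordinate matrix yields the barycentric coordinates [W j] as affine
   functions on all of space. *)
have /row_freeP[B AB] := freeA.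
pose W (j : 'I_(size l)) (X : P3) := \sum_i B j i * hc i X.
have hc_aff i : aff3 (hc i).
  by rewrite /hc; case: (nat_of_ord i) => [|[|[|n]]]; [exists 1, 0, 0, 0 | exists 0, 1, 0, 0 | exists 0, 0, 1, 0 | exists 0, 0, 0, 1] => X; ring.
have Waff j : aff3 (W j).
  have e X : W j X = fun_of (row j B) X by apply: eq_bigr => i _; rewrite mxE.
  by have [a [b [c [d h]]]] := fun_aff (row j B); exists a, b, c, d => X; rewrite e h.
have AW i X : \sum_j W j X * hc i (nth V0 l j) = hc i X.
  have -> : \sum_j W j X * hc i (nth V0 l j) = \sum_i' (A *m B) i i' * hc i' X.
    under eq_bigr do rewrite /W big_distrl /=; rewrite exchange_big /=; apply: eq_bigr => i' _.
    by rewrite mxE big_distrl; apply: eq_bigr => j _; rewrite !mxE /=; ring.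
  by rewrite AB (bigD1 i) //= !mxE eqxx mul1r big1 ?addr0 // => i' ne; rewrite !mxE eq_sym (negbTE ne) mul0r.
pose wt X (Q : P3) : R := \sum_j W j X * (nth V0 l j == Q)%:R.
have wtj X (j : 'I_(size l)) : wt X (nth V0 l j) = W j X.
  rewrite /wt (bigD1 j) //= eqxx mulr1 big1 ?addr0 // => j' ne.
  by rewrite nth_uniq // val_eqE (negbTE ne) mulr0.
have Ewt X f : E l (wt X) f = \sum_j W j X * f (nth V0 l j).
  by rewrite /E (big_nth V0) big_mkord; apply: eq_bigr => j _; rewrite wtj.
have mom X i : E l (wt X) (hc i) = hc i X by rewrite Ewt AW.
have Wpos n w j : rep3 l w (gam (s n)) -> 0 <= W j (gam (s n)).
  move=> r; have /rep3P[w0 ws w1 wc] := r.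
  have Ed f : E l (fun Q => w Q - wt (gam (s n)) Q) f = E l w f - E l (wt (gam (s n))) f.
    by rewrite /E -sumrB; apply: eq_bigr => Q _; rewrite mulrBl.
  have hcE (g : P3 -> R) : aff3 g -> E l (wt (gam (s n))) g = g (gam (s n)).
    move=> [al [be [ga [de hg]]]].
    have m0 := mom (gam (s n)) (inord 0); have m1 := mom (gam (s n)) (inord 1).
    have m2 := mom (gam (s n)) (inord 2); have m3 := mom (gam (s n)) (inord 3).
    rewrite /hc !inordK // in m0 m1 m2 m3.
    rewrite (eq_E _ (g := fun Q => al * 1 + be * cr 0 Q + ga * cr 1 Q + de * cr 2 Q)); last by move=> Q _; rewrite hg mulr1.
    rewrite (ED l _ (fun Q => al * 1 + be * cr 0 Q + ga * cr 1 Q)) (ED l _ (fun Q => al * 1 + be * cr 0 Q)).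
    by rewrite (ED l _ (fun Q => al * 1)) !EZ m0 m1 m2 m3 hg mulr1.
  have := cell_indep ul same (d := fun Q => w Q - wt (gam (s n)) Q).
  move=> ind; have z : w (nth V0 l j) - wt (gam (s n)) (nth V0 l j) = 0.
    apply: ind; last exact: mem_nth.
    - rewrite Ed w1 (hcE (fun _ => 1)) ?subrr //; by exists 1, 0, 0, 0 => X; ring.
    - move=> c hc'; rewrite Ed; have [i ->] : exists i, c = cr i.
        by move: hc' => /= [<-|[<-|[<-|//]]]; [exists 0%N | exists 1%N | exists 2%N].
      by rewrite wc hcE ?subrr //; exact: cr_aff.
  by rewrite wtj in z; have := w0 (nth V0 l j); lra.
(* The [W j] are nonnegative at points of the curve that tend to [P]; [C] makes the continuity
   explicit. *)
have WP j : 0 <= W j P.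
  rewrite leNgt; apply/negP => neg.
  pose C : R := `|W j V0 - W j P| + `|W j V1 - W j P| + `|W j V2 - W j P| + `|W j V3 - W j P|.
  have C0 : 0 <= C by rewrite /C !addr_ge0.
  pose N := Num.bound (C / - W j P).
  have [n Nn [w r _]] := inf N; have := Wpos n w j r; rewrite (aff_gam _ (Waff j)).
  have sb := s_bnd n; set x := s n in sb *.
  have x1 : 0 < x <= 1 by have : (2^-1 : R) <= 1 by [rewrite invf_le1 ?ler1n]; lra.
  have le (y : R) m : x ^+ m.+1 * y <= x * `|y|.
    apply: (@le_trans _ _ (x ^+ m.+1 * `|y|)); first by rewrite ler_wpM2l ?exprn_ge0 ?ler_norm //; lra.
    rewrite ler_wpM2r // exprS ler_piMr ?exprn_ile1 //; lra.
  have l1 := le (W j V0 - W j P) 0%N; have l2 := le (W j V1 - W j P) 1%N.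
  have l3 := le (W j V2 - W j P) 2%N; have l4 := le (W j V3 - W j P) 3%N; rewrite expr1 in l1.
  have big : x * C < - W j P.
    have bN : C / - W j P < n.+2%:R.
      apply: (lt_le_trans (archi_boundP _)); first by rewrite divr_ge0 //; lra.
      by rewrite ler_nat; apply: leq_trans Nn _; clear; lia.
    rewrite ltr_pdivrMr in bN; last lra.
    have nn : 0 < (n.+2%:R : R) by rewrite ltr0n.
    rewrite /x /s -(ltr_pM2l nn) mulrA mulfV ?gt_eqF // mul1r; lra.
  move=> h; have : W j P + x * C >= 0; last lra.
  rewrite /C; move: h l1 l2 l3 l4.
  set a0 := `|_|; set a1 := `|_|; set a2 := `|_|; set a3 := `|_| => h l1 l2 l3 l4.
  lra.
exists l, (wt P); split=> //; apply/rep3P; split=> [Q|Q Ql||i].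
- by rewrite /wt sumr_ge0 // => j _; rewrite mulr_ge0.
- rewrite /wt big1 // => j _; case: eqP => [e|_]; last by rewrite mulr0.
  by move: Ql; rewrite -e mem_nth.
- by have := mom P (inord 0); rewrite /hc inordK.
- case: i => [|[|i]].
  + by have := mom P (inord 1); rewrite /hc inordK.
  + by have := mom P (inord 2); rewrite /hc inordK.
  + by have := mom P (inord 3); rewrite /hc inordK.
Qed.

End Purity.

(** * Existence *)

Lemma half_residue (q : nat) (p : int) : (0 < q)%N ->
  exists e h n : int, [/\ e = 1 \/ e = -1, 0 <= h, 2 * h <= q%:Z & p = e * h + n * q%:Z].
Proof.
move=> q0; have qz : 0 < q%:Z by [].
have := divz_eq p q; have := modz_ge0 p (lt0r_neq0 qz); have := ltz_pmod p qz.
move: (p %/ q)%Z (p %% q)%Z => n r rq r0 ->.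
case: (leP (2 * r) q) => h; first by exists 1, r, n; split=> //; [left | ring].
by exists (-1), (q%:Z - r), (n + 1); split; [right | lia | lia | ring].
Qed.

Lemma mult_gap (c x q : int) : c * q = x -> - q < x -> x < q -> c = 0.
Proof.
move=> <- h1 h2; case: (ltgtP c 0) => // hc.
  by have : 0 <= (-1 - c) * q by [rewrite mulr_ge0; lia]; lia.
by have : 0 <= (c - 1) * q by [rewrite mulr_ge0; lia]; lia.
Qed.

Section Existence.
Variable R : realType.
Notation tri := (@tri R).

Lemma tri_zigzag_pm (q : nat) (p n e : int) k : (0 < q)%N -> (1 < k)%N -> e = 1 \/ e = -1 -> p = e + n * q%:Z ->
  exists K, tri q p k (eq^~ 1) K.
Proof.
move=> q0 k1 he ->; have [K h] := @zigzag_tri R q k q0 k1.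
by case: he => ->; [have h' := h | have h' := tri_refl h];
  eexists; apply: (tri_eqp _ h') => P; exact: lat_mod.
Qed.

Lemma composite_tri (q : nat) (p : int) k1 k2 : (0 < q)%N -> (exists u v : int, u * p + v * q%:Z = 1) ->
  (1 < k1)%N -> (1 < k2)%N -> exists K, tri q p (k1 * k2) (eq^~ 1) K.
Proof.
move=> q0 [u [v uv]] k1' k2'.
have k10 : (0 < k1)%N by apply: ltn_trans k1'.
have k20 : (0 < k2)%N by apply: ltn_trans k2'.
have k12 : (1 < k1 * k2)%N by apply: (leq_mul k10 k2').
have [e [h [n [he h0 hq ep]]]] := half_residue p q0.
have [q1|qn1] := eqVneq q 1%N.
  by apply: (@tri_zigzag_pm q p (p - 1) 1) => //; [left | rewrite q1 mulr1; ring].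
have [h1|hn1] := eqVneq h 1.
  by apply: (tri_zigzag_pm q0 k12 he (n := n)); rewrite ep h1 mulr1.
have uv' : u * e * h + (u * n + v) * q%:Z = 1 by rewrite -uv ep; ring.
have h2 : 2 <= h.
  have : h != 0.
    apply/eqP => z; move: uv' q0 qn1; rewrite z mulr0 add0r; move: (u * n + v) => x; clear => e q0 q1.
    by case: (lerP x 0) => x0; [have : x * q%:Z <= 0 by rewrite mulr_le0_ge0 | have : 1 * 2 <= x * q%:Z by apply: ler_pM; lia]; lia.
  by move: h0 hn1; clear; lia.
have q4 : 4 <= q%:Z by move: h2 hq; clear; lia.
(* [g] is the inverse of [h] modulo [q] up to the sign [d], reduced to at most half of [q]. *)
have [d [g [m [hd g0 gq eu]]]] := half_residue (u * e) q0.
have [c ec] : exists c : int, h * g = d + c * q%:Z.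
  exists (- d * (m * h + u * n + v)).
  have dd : d * d = 1 by case: hd => ->.
  apply: (@eq_trans _ _ (d * (d * g * h))); first by rewrite !mulrA dd; ring.
  have -> : d * g * h = 1 - (m * h + u * n + v) * q%:Z by rewrite -uv' eu; ring.
  by ring.
have g2 : 2 <= g.
  have : g != 0.
    apply/eqP => z; rewrite z mulr0 in ec; have cq : c * q%:Z = - d by rewrite -[LHS](addKr d) -ec addr0.
    have c0 : c = 0 by apply: (mult_gap cq); move: hd q4; clear; lia.
    by move: cq hd; rewrite c0 mul0r; clear; lia.
  have : g != 1.
    apply/eqP => z; rewrite z mulr1 in ec; have cq : c * q%:Z = h - d by rewrite ec; ring.
    have c0 : c = 0 by apply: (mult_gap cq); move: hd q4 h2 hq; clear; lia.
    by move: cq hd h2 hn1; rewrite c0 mul0r; clear; lia.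
  by move: g0; clear; lia.
have c1 : 1 <= c by move: hd ec q4 h2 g2; clear; nia.
(* From [2 * g <= q] one gets [2 * c * q <= h * q - 2 * d], which bounds [2 * c] by [h]; the bound
   by [g] is symmetric. *)
have bnd : [/\ d = 1, 2 * c + 1 <= h & 2 * c + 1 <= g] \/ [/\ d = -1, 2 * c <= h & 2 * c <= g].
  move: ec h2 g2 hq gq q4; clear -hd; case: hd => -> ec h2 g2 hq gq q4; [left | right]; split=> //; nia.
have hq' : h < q%:Z by move: q4 hq; clear; lia.
have gq' : g < q%:Z by move: q4 gq; clear; lia.
have [K0 T0] := @pin_tri R _ _ _ _ _ _ q0 c1 ec hq' gq' bnd k1'.
have [K1 T1] : exists K1, tri q p k1 (fun _ => True) K1.
  by rewrite ep; case: he => ->; [rewrite mul1r; have T' := T0 | rewrite mulN1r; have T' := tri_refl T0];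
    eexists; apply: (tri_eqp _ T') => P; exact: lat_mod.
have /choice[KM hKM] : forall m : int, exists KM, 1 <= m -> tri (absz m) 1 k2 (eq^~ 1) KM.
  move=> m'; case: (boolP (1 <= m')) => m1; last by exists (fun _ => True).
  by have [KM hKM] := @zigzag_tri R (absz m') k2 ltac:(move: m1; clear; lia) k2'; exists KM.
apply: (compose k10 k20 T1 _ hKM) => P hP; exact: (pure q0 k10 T1 hP).
Qed.

Lemma tri_exists (q : nat) (p : int) k : (0 < q)%N -> (exists u v : int, u * p + v * q%:Z = 1) ->
  (0 < k)%N -> k \notin [:: 1; 2; 3; 5; 7; 11]%N -> exists K, tri q p k (eq^~ 1) K.
Proof.
move=> q0 cop k0; rewrite !inE !negb_or => /and5P[n1 n2 n3 n5 /andP[n7 n11]].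
have ev j : (1 < j)%N -> exists K, tri q p (2 * j) (eq^~ 1) K by move=> j1; exact: composite_tri.
have [ek|ok] := boolP (odd k); last first.
  have -> : k = (2 * k./2)%N by move: ok; clear; lia.
  by apply: ev; move: k0 n2 ok; clear; lia.
have t9 : exists K, tri q p 9 (eq^~ 1) K by apply: (@composite_tri q p 3 3).
have [->|n9] := eqVneq k 9%N; first exact: t9.
have -> : k = (9 + 2 * ((k - 9)./2))%N by move: ek n1 n3 n5 n7 n9; clear; lia.
have k' : (1 < (k - 9)./2)%N by move: ek n1 n3 n5 n7 n9 n11; clear; lia.
by apply: tri_add t9 (ev _ k') => //; rewrite muln_gt0 /= (ltn_trans _ k').
Qed.
End Existence.

(** * Convex hulls of integer vectors *)

Section Weights.
Variable R : realType.

(** Replaces weights indexed by positions in a list by functions on the index type, which are easier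
    to restrict and compare. *)
Lemma conv_weights (I : finType) (F : I -> 'rV[R]_3) (s : seq I) x : uniq s ->
  conv R (map F s) x <-> exists c : I -> R,
    [/\ forall i, 0 <= c i, forall i, i \notin s -> c i = 0, \sum_i c i = 1 & x = \sum_i c i *: F i].
Proof.
move=> us; split.
  move=> [l [l0 [l1 ex]]].
  have ss : size [seq F i | i <- s] = size s by rewrite size_map.
  pose g (j : nat) : R := if insub j is Some o then l o else 0.
  have gE (o : 'I_(size [seq F i | i <- s])) : g o = l o by rewrite /g valK.
  pose c i : R := if i \in s then g (index i s) else 0.
  have sumc (V : lmodType R) (G : I -> V) (H : nat -> V) : (forall i, i \in s -> G i = H (index i s)) ->
      (forall i, i \notin s -> G i = 0) -> \sum_i G i = \sum_(o < size [seq F i | i <- s]) H o.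
    move=> h1 h2; rewrite (bigID (mem s)) /= [X in _ + X]big1 // addr0 -big_uniq //.
    case: s us ss h1 {l l0 l1 ex g gE c h2} => [|i0 s'] us ss h1.
      by rewrite big_nil big1 // => o; case: o.
    rewrite (big_nth i0) big_mkord ss; apply: eq_bigr => o _.
    by rewrite h1 ?mem_nth // index_uniq.
  exists c; split=> [i|i /negbTE h||].
  - by rewrite /c /g; case: ifP => // _; case: insubP.
  - by rewrite /c h.
  - rewrite -l1 (sumc R^o c g); first exact: eq_bigr.
      by move=> i h; rewrite /c h.
    by move=> i /negbTE h; rewrite /c h.
  - rewrite ex (sumc _ (fun i => c i *: F i) (fun j => g j *: [seq F i | i <- s]`_j)).
    + by apply: eq_bigr => o _; rewrite gE.
    + move=> i h; rewrite /c h; congr (_ *: _).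
      by rewrite (nth_map i) ?index_mem // nth_index.
    + by move=> i /negbTE h; rewrite /c h scale0r.
move=> [c [c0 cs c1 ex]].
have ss : size [seq F i | i <- s] = size s by rewrite size_map.
pose l (o : 'I_(size [seq F i | i <- s])) := c (tnth (in_tuple s) (cast_ord ss o)).
have sumc (V : lmodType R) (G : I -> V) : (forall i, i \notin s -> G i = 0) ->
    \sum_i G i = \sum_(o < size [seq F i | i <- s]) G (tnth (in_tuple s) (cast_ord ss o)).
  move=> h2; rewrite (bigID (mem s)) /= [X in _ + X]big1 // addr0 -big_uniq //.
  rewrite big_tnth (reindex (cast_ord ss)) //=.
  by exists (cast_ord (esym ss)) => o _; rewrite ?cast_ordK ?cast_ordKV.
exists l; split; first by move=> o; exact: c0.
split; first by rewrite -c1 (sumc R^o c).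
rewrite ex (sumc _ (fun i => c i *: F i)) => [|i h]; last by rewrite cs ?scale0r.
apply: eq_bigr => o _; congr (_ *: _).
have os : (o < size s)%N by rewrite -[X in (_ < X)%N]ss ltn_ord.
case: s us ss {l sumc ex cs} o os => [|i0 s'] us ss o os //.
by rewrite (nth_map i0) // (tnth_nth i0).
Qed.

Lemma face_weights (v : 'I_4 -> ipt) (S : {set 'I_4}) x :
  face R v S x <-> exists c : 'I_4 -> R,
    [/\ forall i, 0 <= c i, forall i, i \notin S -> c i = 0, \sum_i c i = 1 & x = \sum_i c i *: toR R (v i)].
Proof.
split=> [/(conv_weights _ _ (enum_uniq _))[c [h1 h2 h3 h4]]|[c [h1 h2 h3 h4]]].
  by exists c; split=> // i iS; apply: h2; rewrite mem_enum.
by apply/(conv_weights _ _ (enum_uniq _)); exists c; split=> // i iS; apply: h2; rewrite mem_enum in iS.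
Qed.
End Weights.

(** * Tetrahedra with vertices in the given lattice that realise the cells *)

Section Realisation.
Variable R : realType.
Notation P3 := (R * R * R)%type.
Variables (q : nat) (p : int) (k : nat).
Notation pp := (pprime p q%:Z).
Hypothesis q0 : (0 < q)%N.
Hypothesis k0 : (0 < k)%N.
Hypothesis cop : exists u v : int, u * pp + v * q%:Z = 1.

Let qR : (q%:R : R) != 0. Proof. by rewrite pnatr_eq0 -lt0n. Qed.

Let qZ : (q%:Z)%:~R = q%:R :> R. Proof. by []. Qed.

(* Division by q takes Lambda_{p,q} to [lat3] and k Delta' to [inD k]. *)
Definition nrm (x : 'rV[R]_3) : P3 :=
  ((x 0 (inord 0) / q%:R, x 0 (inord 1) / q%:R), x 0 (inord 2)).

Lemma cr_nrm i x : cr i (nrm x) = x 0 (inord (minn i 2)) / (if (i < 2)%N then q%:R else 1).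
Proof. by case: i => [|[|i]] //=; rewrite divr1. Qed.

Lemma row3_ext (S : Type) (x y : 'rV[S]_3) : (forall i, (i < 3)%N -> x 0 (inord i) = y 0 (inord i)) -> x = y.
Proof. by move=> h; apply/rowP => i; rewrite -(inord_val i) h. Qed.

Lemma nrm_inj : injective nrm.
Proof.
move=> x y [e0 e1 e2]; apply: row3_ext => -[|[|[|i]]] // _.
  exact: (mulIf (invr_neq0 qR) e0).
exact: (mulIf (invr_neq0 qR) e1).
Qed.

Lemma nrm_comb (I : finType) (c : I -> R) (F : I -> 'rV[R]_3) i :
  cr i (nrm (\sum_j c j *: F j)) = \sum_j c j * cr i (nrm (F j)).
Proof.
rewrite cr_nrm summxE mulr_suml; apply: eq_bigr => j _.
by rewrite cr_nrm mxE mulrA.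
Qed.

Definition nrmZ (v : ipt) : P3 := nrm (toR R v).

Lemma nrmZ_inj : injective nrmZ.
Proof.
move=> v w /nrm_inj /rowP e; apply/rowP => i; have := e i.
by rewrite !mxE => /eqP; rewrite eqr_int => /eqP.
Qed.

Lemma toR_comb (I : finType) (c : I -> int) (F : I -> ipt) :
  toR R (\sum_j c j *: F j) = \sum_j (c j)%:~R *: toR R (F j).
Proof.
apply/rowP => s; rewrite mxE !summxE rmorph_sum /=.
by apply: eq_bigr => j _; rewrite !mxE intrM.
Qed.

Lemma nrmZ_mk (a b c : int) : nrmZ (mkpt a b c) = ((a%:~R / q%:R, b%:~R / q%:R), c%:~R).
Proof. by rewrite /nrmZ /nrm !mxE !inordK. Qed.

Lemma mkptE (v : ipt) : v = mkpt (v 0 (inord 0)) (v 0 (inord 1)) (v 0 (inord 2)).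
Proof. by apply: row3_ext => -[|[|[|i]]] // _; rewrite !mxE inordK. Qed.

Lemma in_LambdaE (v : ipt) : in_Lambda p q v <-> lat3 q pp (nrmZ v).
Proof.
split.
  move=> [x [y [z [t ->]]]]; rewrite nrmZ_mk /lat3 /lat /= intr_int andbT.
  have -> : q%:R * ((q%:Z * y + t)%:~R / q%:R) = (q%:Z * y + t)%:~R :> R by field.
  rewrite intr_int /=.
  have -> : (q%:Z * x + t * pp)%:~R / q%:R - pp%:~R * ((q%:Z * y + t)%:~R / q%:R) = (x - pp * y)%:~R :> R.
    by rewrite !(intrD, intrM, intrN) qZ; field.
  exact: intr_int.
rewrite {1}(mkptE v) nrmZ_mk; set a := v 0 _; set b := v 0 _; set c := v 0 _.
rewrite /lat3 /lat /= => /andP[/andP[_ /intrP[m em]] _].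
exists m, 0, c, b; rewrite {1}(mkptE v); congr (mkpt _ _ _); last by rewrite mulr0 add0r.
apply: (mulrIz (oner_neq0 R)).
by move: em; rewrite -/a !(intrD, intrM) qZ => <-; field.
Qed.

Lemma nrmZ_surj P : lat3 q pp P -> exists v, nrmZ v = P.
Proof.
case: P => [[x y] z] /andP[/andP[/= /intrP[b eb] /intrP[m em]] /intrP[c ec]].
exists (mkpt (q%:Z * m + pp * b) b c); rewrite nrmZ_mk -ec.
have ey : y = b%:~R / q%:R by rewrite -eb; field.
have ex : x = m%:~R + pp%:~R * y by rewrite -em; ring.
congr (_, _, _); last exact: esym.
by rewrite ex ey !(intrD, intrM) qZ; field.
Qed.

Lemma nrmZ_Delta i : nrmZ (Delta' p q%:Z i) =
  [:: ((0, 0), 0); ((1, 0), 0); ((0, 0), 1); ((0, 1), 1)]`_i.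
Proof.
by case: i => [[|[|[|[|i]]]] hi] //; rewrite /Delta' [nth _ _ _]/= nrmZ_mk /= ?mul0r ?divff.
Qed.

Lemma nrmZ_kDelta i j : cr i (nrmZ (kDelta' p q%:Z k j)) = k%:R * cr i (nrmZ (Delta' p q%:Z j)).
Proof. by rewrite /nrmZ !cr_nrm !mxE intrM mulrA. Qed.

Lemma sum4 (V : zmodType) (f : 'I_4 -> V) :
  \sum_i f i = f (inord 0) + f (inord 1) + f (inord 2) + f (inord 3).
Proof.
rewrite !big_ord_recl big_ord0 addr0 !addrA.
by congr (f _ + f _ + f _ + f _); apply: val_inj; rewrite /= inordK.
Qed.

Lemma nrm_kDelta (c : 'I_4 -> R) i : cr i (nrm (\sum_j c j *: toR R (kDelta' p q%:Z k j))) =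
  k%:R * [:: c (inord 1); c (inord 3); c (inord 2) + c (inord 3)]`_(minn i 2).
Proof.
rewrite nrm_comb sum4 -![nrm (toR R (kDelta' _ _ _ _))]/(nrmZ (kDelta' _ _ _ _)) !nrmZ_kDelta !nrmZ_Delta !inordK //=.
by case: i => [|[|i]]; rewrite /cr /=; ring.
Qed.

Lemma kDelta_inD x : polytope R (kDelta' p q%:Z k) x <-> inD (k%:R : R) (nrm x).
Proof.
have kR : (k%:R : R) != 0 by rewrite pnatr_eq0 -lt0n.
have kp := ler0n R k.
split.
  move/face_weights => [c [c0 _ c1 ->]] i.
  rewrite sum4 in c1; have c0' : c (inord 0) = 1 - c (inord 1) - c (inord 2) - c (inord 3) by rewrite -c1; ring.
  case: i => [|[|[|i]]]; rewrite /bc !nrm_kDelta /=; last by rewrite mulr_ge0.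
  - have -> : k%:R - k%:R * c (inord 1) - k%:R * (c (inord 2) + c (inord 3)) = k%:R * c (inord 0) by rewrite c0'; ring.
    by rewrite mulr_ge0.
  - by rewrite mulr_ge0.
  - by rewrite mulrDr addrK mulr_ge0.
move=> h; apply/face_weights; exists (fun i => bc k%:R i (nrm x) / k%:R); split.
- by move=> i; rewrite divr_ge0.
- by move=> i; rewrite inE.
- rewrite sum4 !inordK // -!mulrDl -[RHS](divff kR); congr (_ / _); rewrite /bc; ring.
- apply: (nrm_inj); apply: cr_ext => i; rewrite nrm_kDelta !inordK //=.
  by case: i => [|[|i]]; rewrite [nth _ _ _]/= ?mulrDr ![k%:R * (_ / _)]mulrCA divff // !mulr1 /bc ?subrK.
Qed.

Variable K : seq P3 -> Prop.
Hypothesis T : tri q pp k (eq^~ 1) K.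

Let O3 : P3 := ((0, 0), 0).

Definition realises (S : tetra) (l : seq P3) :=
  [/\ K l, size l = 4%N & forall i, nrmZ (S i) = nth O3 l i].

(** Cells are lists over the finitely many lattice points of the dilated tetrahedron, so their
    realisations are found by filtering all quadruples. *)
Lemma realised : exists ts : seq tetra, forall S, S \in ts <-> exists l, realises S l.
Proof.
have [V inV] := @lattice_points R q pp k q0.
have /choice[ip hip] : forall P : P3, exists v, lat3 q pp P -> nrmZ v = P.
  move=> P; case: (boolP (lat3 q pp P)) => h; last by exists 0.
  by have [v e] := nrmZ_surj h; exists v.
pose tet (f : {ffun 'I_4 -> 'I_(size V)}) : tetra := [ffun i => ip (nth O3 V (f i))].
exists [seq S <- [seq tet f | f : {ffun 'I_4 -> 'I_(size V)}] | `[< exists l, realises S l >]] => S.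
rewrite mem_filter; split; first by case/andP => /asboolP.
move=> h; apply/andP; split; first exact/asboolP.
case: h => l [Kl sl e].
have lV (i : 'I_4) : (index (nth O3 l i) V < size V)%N.
  have il : nth O3 l i \in l by rewrite mem_nth // sl.
  by rewrite index_mem inV //; [exact: (cx_lat (tri_cplx T) Kl il) | exact: (cx_in (tri_cplx T) Kl il)].
apply/mapP; exists [ffun i => Ordinal (lV i)]; first by rewrite mem_enum.
apply/ffunP => i; rewrite !ffunE /= nth_index -?index_mem //; apply: nrmZ_inj.
rewrite hip ?e //; apply: (cx_lat (tri_cplx T) Kl); by rewrite mem_nth // sl.
Qed.

Section Cell.
Variables (S : tetra) (l : seq P3).
Hypothesis Sl : realises S l.

Lemma S_uniq : uniq l. Proof. by case: Sl => Kl _ _; exact: (cx_uniq (tri_cplx T) Kl). Qed.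

Lemma sum_cell (f : P3 -> R) : \sum_i f (nrmZ (S i)) = \sum_(P <- l) f P.
Proof.
have [_ sl e] := Sl; rewrite (big_nth O3) big_mkord sl.
by apply: eq_bigr => i _; rewrite e.
Qed.

Lemma S_inj i j : (nrmZ (S i) == nrmZ (S j)) = (i == j).
Proof. by have [_ sl e] := Sl; rewrite !e nth_uniq ?sl // S_uniq. Qed.

Lemma S_mem i : nrmZ (S i) \in l.
Proof. by have [_ sl ->] := Sl; rewrite mem_nth // sl. Qed.

Lemma mem_S P : P \in l -> exists i, P = nrmZ (S i).
Proof.
have [_ sl e] := Sl => Pl; have il : (index P l < 4)%N by rewrite -sl index_mem.
by exists (Ordinal il); rewrite e nth_index.
Qed.

Lemma S_lat i : in_Lambda p q (S i).
Proof. by apply/in_LambdaE; case: Sl => Kl _ _; exact: (cx_lat (tri_cplx T) Kl (S_mem i)). Qed.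

Lemma S_pick (c : 'I_4 -> R) i : \sum_j c j * (nrmZ (S j) == nrmZ (S i))%:R = c i.
Proof. by rewrite (bigD1 i) //= eqxx mulr1 big1 ?addr0 // => j /negbTE h; rewrite S_inj h mulr0. Qed.

Lemma S_face (A : {set 'I_4}) x : face R S A x <->
  exists2 w, rep3 l w (nrm x) & forall i, i \notin A -> w (nrmZ (S i)) = 0.
Proof.
split=> [/face_weights[c [c0 cA c1 ->]]|[w /rep3P[w0 wl w1 wc] wA]].
  pose w P := \sum_j c j * (nrmZ (S j) == P)%:R.
  have wS i : w (nrmZ (S i)) = c i by exact: S_pick.
  have Ew f : E l w f = \sum_i c i * f (nrmZ (S i)).
    by rewrite /E -sum_cell; apply: eq_bigr => i _; rewrite wS.
  exists w => [|i iA]; last by rewrite wS cA.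
  apply/rep3P; split=> [P|P Pl||i].
  - by rewrite sumr_ge0 // => i _; rewrite mulr_ge0.
  - rewrite /w big1 // => j _; case: eqP => [e|_]; last by rewrite mulr0.
    by move: Pl; rewrite -e S_mem.
  - by rewrite Ew -[RHS]c1; apply: eq_bigr => i _; rewrite mulr1.
  - by rewrite Ew nrm_comb.
apply/face_weights; exists (fun i => w (nrmZ (S i))); split=> //.
- by rewrite -[RHS]w1 /E -sum_cell; apply: eq_bigr => i _; rewrite mulr1.
- apply: (nrm_inj); apply: cr_ext => i; rewrite nrm_comb -wc /E -sum_cell.
  by apply: eq_bigr.
Qed.

Lemma S_poly x : polytope R S x <-> exists w, rep3 l w (nrm x).
Proof.
split=> [/S_face[w h _]|[w h]]; first by exists w.
by apply/S_face; exists w => // i; rewrite inE.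
Qed.

Lemma S_indep : aff_indep S.
Proof.
move=> c c1 c0 i.
pose d P : R := \sum_j (c j)%:~R * (nrmZ (S j) == P)%:R.
have dS j : d (nrmZ (S j)) = (c j)%:~R by exact: S_pick.
have Ed f : E l d f = \sum_i (c i)%:~R * f (nrmZ (S i)).
  by rewrite /E -sum_cell; apply: eq_bigr => j _; rewrite dS.
have [Kl _ _] := Sl.
have same w1 w2 b : rep (cs3 R) l w1 b -> rep (cs3 R) l w2 b -> w1 =1 w2.
  move=> r1 r2; have eb : b = [:: E l w1 (cr 0); E l w1 (cr 1); E l w1 (cr 2)] by case: r1 => _ _ _ <-.
  by apply: (cx_same (tri_cplx T) Kl Kl (P := ((E l w1 (cr 0), E l w1 (cr 1)), E l w1 (cr 2)))); rewrite /rep3 /= -eb.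
have z : \sum_j (c j)%:~R *: toR R (S j) = 0 by rewrite -toR_comb c0; apply/rowP => s; rewrite !mxE.
have cz t : E l d (cr t) = 0.
  rewrite Ed -[LHS](nrm_comb (fun j => (c j)%:~R) (fun j => toR R (S j))) z cr_nrm mxE mul0r //.
apply/eqP; rewrite -(intr_eq0 R) -dS; apply/eqP.
apply: (cell_indep S_uniq same _ _ (S_mem i)).
- by rewrite Ed; under eq_bigr do rewrite mulr1; rewrite -rmorph_sum /= c1.
- by move=> g /= [<-|[<-|[<-|//]]].
Qed.

Lemma S_unimodular : unimodular (in_Lambda p q) S.
Proof.
split; first exact: S_lat.
split; first exact: S_indep.
move=> v /in_LambdaE vL; have [Kl sl _] := Sl.
have [a [b [c [d [w [m [pe [_ m1] wL hw hX]]]]]]] := tri_good T Kl sl.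
have [n1 [n2 [n3 hv]]] := hX _ vL; rewrite m1 in hw.
have ul := S_uniq; have [al bl cl dl] : [/\ a \in l, b \in l, c \in l & d \in l].
  by rewrite !(perm_mem pe) !inE !eqxx ?orbT.
(* Obtained by substituting [w = b - a + d - c], the edge relation for [m = 1], into the expansion
   of the lattice point. *)
pose cf (P : P3) : int := (1 - n1 - n2 - n3) * (P == a)%:R + (n1 + n3) * (P == b)%:R +
  (n2 - n3) * (P == c)%:R + n3 * (P == d)%:R.
have Ecf f : \sum_i (cf (nrmZ (S i)))%:~R * f (nrmZ (S i)) =
    (1 - n1 - n2 - n3)%:~R * f a + (n1 + n3)%:~R * f b + (n2 - n3)%:~R * f c + n3%:~R * f d :> R.
  rewrite (sum_cell (fun P => (cf P)%:~R * f P)).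
  rewrite -[LHS](eq_Ew (w := fun P : P3 => (1 - n1 - n2 - n3)%:~R * (P == a)%:R + (n1 + n3)%:~R * (P == b)%:R +
    (n2 - n3)%:~R * (P == c)%:R + n3%:~R * (P == d)%:R)); last first.
    by move=> P _; rewrite /cf !(intrD, intrM) !mulrz_nat.
  by rewrite !(EwD, EwZ) !E_ind.
exists (fun i => cf (nrmZ (S i))); split.
  apply: (@intr_inj R); rewrite rmorph_sum /=.
  transitivity (\sum_i (cf (nrmZ (S i)))%:~R * 1 : R); first by apply: eq_bigr => i _; rewrite mulr1.
  by rewrite (Ecf (fun _ => 1)) !(intrD, intrN); ring.
apply: nrmZ_inj; apply: cr_ext => i.
rewrite /nrmZ toR_comb nrm_comb (Ecf (cr i)) hv !(intrD, intrN).
have := hw i; rewrite mul1r => <-; ring.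
Qed.

End Cell.

(** A common point has equal weights in both cells, so they vanish off the common vertices. *)
Lemma meet_face S1 S2 l1 l2 x : realises S1 l1 -> realises S2 l2 ->
  (polytope R S1 x /\ polytope R S2 x) <-> face R S1 [set i | nrmZ (S1 i) \in l2] x.
Proof.
move=> h1 h2; have [K1 _ _] := h1; have [K2 _ _] := h2.
split=> [[/(S_poly h1)[w1 r1] /(S_poly h2)[w2 r2]]|/(S_face h1)[w r ws]].
  apply/(S_face h1); exists w1 => // i; rewrite inE => il.
  by rewrite (cx_same (tri_cplx T) K1 K2 r1 r2); case: r2 => _ ->.
split; first by apply/(S_poly h1); exists w.
apply/(S_poly h2); exists w.
pose s := [seq P <- l1 | P \in l2]; have us : uniq s by rewrite filter_uniq ?(S_uniq h1).
apply: (rep_widen us (S_uniq h2)) => [P|]; first by rewrite mem_filter => /andP[].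
apply: (rep_shrink us (S_uniq h1) _ _ r) => [P|P]; rewrite mem_filter; first by case/andP.
rewrite negb_and => /orP[P2|P1]; last by case: r => _ ->.
have [/(mem_S h1)[i ei]|P1] := boolP (P \in l1); last by case: r => _ ->.
by rewrite ei ws // inE -ei.
Qed.

Lemma boundary_facet x : boundary3 R (polytope R (kDelta' p q%:Z k)) x ->
  exists2 t, (t < 4)%N & bc k%:R t (nrm x) = 0.
Proof.
move=> [/kDelta_inD hx nint]; apply: contrapT => nt; apply: nint.
have pos t : (t < 4)%N -> 0 < bc k%:R t (nrm x).
  by move=> t4; rewrite lt0r hx andbT; apply/eqP => e; apply: nt; exists t.
have := pos 0%N isT; have := pos 1%N isT; have := pos 2%N isT; have := pos 3%N isT => b3 b2 b1 b0.
(* The least barycentric coordinate. Each of the four involves at most two coordinates of the point,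
   so moving these by less than [m / 2] keeps it nonnegative. *)
pose m := Num.min (Num.min (bc k%:R 0 (nrm x)) (bc k%:R 1 (nrm x))) (Num.min (bc k%:R 2 (nrm x)) (bc k%:R 3 (nrm x))).
have m0 : 0 < m by rewrite !lt_min b0 b1 b2 b3.
have ml t : (t < 4)%N -> m <= bc k%:R t (nrm x) by case: t => [|[|[|[|t]]]] // _; rewrite !ge_min lexx ?orbT.
exists (m / 2); first by lra.
move=> y hy; apply/kDelta_inD.
have hc i : `|cr i (nrm y) - cr i (nrm x)| < m / 2.
  rewrite !cr_nrm -mulrBl normrM; apply: le_lt_trans (hy (inord (minn i 2))).
  rewrite ler_piMr // normfV ger0_norm; last by case: ifP.
  by case: ifP => _; rewrite ?invr1 // invf_le1 ?ltr0n // ler1n.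
have := hc 0%N; have := hc 1%N; have := hc 2%N; rewrite !ltr_norml => /andP[c2 c2'] /andP[c1 c1'] /andP[c0 c0'].
have := ml 0%N isT; have := ml 1%N isT; have := ml 2%N isT; have := ml 3%N isT; rewrite /bc => l3 l2 l1 l0.
by case=> [|[|[|t]]]; rewrite /bc; lra.
Qed.

Lemma small_int (x : R) : x \is a Num.int -> `|x| <= 1 -> [\/ x = -1, x = 0 | x = 1].
Proof.
move=> /intrP[z ->]; rewrite -intr_norm lerz1 => h.
have : z = -1 \/ z = 0 \/ z = 1 by move: h; clear; lia.
by case=> [|[]] ->; [constructor 1; rewrite intrN | constructor 2 | constructor 3].
Qed.

(** The three remaining differences lie in {-1, 0, 1} and sum to 0, so one of them vanishes and the
    other two are opposite: the edge is parallel to one of the tetrahedron. *)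
Lemma unit_step4 (d : nat -> R) t : (t < 4)%N -> d t = 0 -> d 0%N + d 1%N + d 2%N + d 3%N = 0 ->
  (forall s, [\/ d s = -1, d s = 0 | d s = 1]) ->
  exists a b : 'I_4, [/\ a != b, d b = - d a & forall s : 'I_4, s != a -> s != b -> d s = 0].
Proof.
move=> t4 dt ds h.
have h3 (x y z : R) : [\/ x = -1, x = 0 | x = 1] -> [\/ y = -1, y = 0 | y = 1] -> [\/ z = -1, z = 0 | z = 1] ->
    x + y + z = 0 -> [\/ x = 0, y = 0 | z = 0].
  move=> [] hx [] hy [] hz e; first [by constructor 1 | by constructor 2 | by constructor 3 | lra].
have pk (a b : nat) : (a < 4)%N -> (b < 4)%N -> a != b -> (forall s, (s < 4)%N -> s != a -> s != b -> d s = 0) ->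
    d b = - d a -> exists a b : 'I_4, [/\ a != b, d b = - d a & forall s : 'I_4, s != a -> s != b -> d s = 0].
  by move=> a4 b4 ab z e; exists (Ordinal a4), (Ordinal b4); split=> // s; exact: (z s (ltn_ord s)).
case: t t4 dt => [|[|[|[|t]]]] // _ dt.
- case: (h3 (d 1%N) (d 2%N) (d 3%N)) => // [|z|z|z]; first by lra.
  + by apply: (pk 2 3)%N => //; [case=> [|[|[|[|]]]] | lra].
  + by apply: (pk 1 3)%N => //; [case=> [|[|[|[|]]]] | lra].
  + by apply: (pk 1 2)%N => //; [case=> [|[|[|[|]]]] | lra].
- case: (h3 (d 0%N) (d 2%N) (d 3%N)) => // [|z|z|z]; first by lra.
  + by apply: (pk 2 3)%N => //; [case=> [|[|[|[|]]]] | lra].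
  + by apply: (pk 0 3)%N => //; [case=> [|[|[|[|]]]] | lra].
  + by apply: (pk 0 2)%N => //; [case=> [|[|[|[|]]]] | lra].
- case: (h3 (d 0%N) (d 1%N) (d 3%N)) => // [|z|z|z]; first by lra.
  + by apply: (pk 1 3)%N => //; [case=> [|[|[|[|]]]] | lra].
  + by apply: (pk 0 3)%N => //; [case=> [|[|[|[|]]]] | lra].
  + by apply: (pk 0 1)%N => //; [case=> [|[|[|[|]]]] | lra].
- case: (h3 (d 0%N) (d 1%N) (d 2%N)) => // [|z|z|z]; first by lra.
  + by apply: (pk 1 2)%N => //; [case=> [|[|[|[|]]]] | lra].
  + by apply: (pk 0 2)%N => //; [case=> [|[|[|[|]]]] | lra].
  + by apply: (pk 0 1)%N => //; [case=> [|[|[|[|]]]] | lra].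
Qed.

Lemma S_edge S l i j : realises S l ->
  (forall x, conv R [:: toR R (S i); toR R (S j)] x -> boundary3 R (polytope R (kDelta' p q%:Z k)) x) ->
  exists a b : 'I_4, a != b /\ exists lam : R,
    toR R (S j) - toR R (S i) = lam *: (toR R (Delta' p q%:Z b) - toR R (Delta' p q%:Z a)).
Proof.
(* Barycentric coordinates are nonnegative, so a facet through the midpoint contains both ends. *)
move=> Sl h; pose M := 2^-1 *: toR R (S i) + 2^-1 *: toR R (S j).
have cM : conv R [:: toR R (S i); toR R (S j)] M.
  exists (fun _ => 2^-1); split=> [_|]; first by rewrite invr_ge0.
  by rewrite !big_ord_recl !big_ord0 /= !addr0; split=> //; field.
have [t t4 bM] := boundary_facet (h _ cM).
set A := nrmZ (S i); set B := nrmZ (S j).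
have eM s : cr s (nrm M) = (cr s A + cr s B) / 2 by rewrite /A /B /nrmZ !cr_nrm /M !mxE; ring.
have {bM}bM : bc k%:R t A + bc k%:R t B = 0.
  move: bM; rewrite /bc; case: t {t4} => [|[|[|t]]]; rewrite !eM => e; lra.
have [Kl sl _] := Sl; have Al := S_mem Sl i; have Bl := S_mem Sl j.
have iA := cx_in (tri_cplx T) Kl Al; have iB := cx_in (tri_cplx T) Kl Bl.
have zA : bc k%:R t A = 0 by have := iA t; have := iB t; lra.
have zB : bc k%:R t B = 0 by have := iA t; have := iB t; lra.
pose d s := bc k%:R s B - bc k%:R s A.
have [a [b [ab dab d0]]] : exists a b : 'I_4, [/\ a != b, d b = - d a & forall s : 'I_4, s != a -> s != b -> d s = 0].
  apply: (unit_step4 t4); first by rewrite /d zA zB subrr.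
    by rewrite /d /bc; ring.
  move=> s; apply: small_int; last exact: (tri_std T Kl Bl Al zB zA).
  by rewrite rpredB //; [apply: (bc_int cop _ zB) | apply: (bc_int cop _ zA)]; exact: (cx_lat (tri_cplx T) Kl).
exists a, b; split=> //; exists (d b); apply: nrm_inj; apply: cr_ext => s.
have lin (u v : 'rV[R]_3) (c : R) : cr s (nrm (c *: (u - v))) = c * (cr s (nrm u) - cr s (nrm v)).
  by rewrite !cr_nrm !mxE; ring.
rewrite lin -[toR R (S j) - _]scale1r lin mul1r -/A -/B -![nrm (toR R (Delta' _ _ _))]/(nrmZ (Delta' _ _ _)).
have -> : cr s B - cr s A = \sum_(e < 4) d e * cr s (nrmZ (Delta' p q%:Z e)).
  rewrite sum4 !nrmZ_Delta !inordK // /d /bc.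
  by case: s {lin} => [|[|s]]; rewrite /cr /=; ring.
rewrite (bigD1 b) //= (bigD1 a) //= big1 => [|e /andP[eb ea]]; last by rewrite d0 ?mul0r.
by rewrite dab; ring.
Qed.

End Realisation.

Theorem theorem5p1 (R : realType) (p q : int) (k : nat) :
  1 <= q -> coprimez p q -> (0 < k)%N -> k \notin [:: 1; 2; 3; 5; 7; 11]%N ->
  exists ts : seq tetra,
    triangulation R (in_Lambda p q) (kDelta' p q k) ts /\
    (forall T, T \in ts -> unimodular (in_Lambda p q) T) /\
    standard_boundary R (Delta' p q) (kDelta' p q k) ts.
Proof.
case: q => [q|//] q1 cpq k0 hk; have q0 : (0 < q)%N by [].
have cop : exists u v : int, u * pprime p q + v * q%:Z = 1.
  have [u [v e]] := Bezoutz (pprime p q) q; exists u, v; rewrite e; apply/eqP.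
  by move: cpq; rewrite /pprime /coprimez gcdz_modl gcdNz.
have [K T] := @tri_exists R q (pprime p q) k q0 cop k0 hk.
have [ts hts] := realised q0 T; exists ts; split; [split; [|split]|split].
- by move=> S /hts[l Sl]; split; [exact: (S_lat q0 T Sl) | exact: (S_indep T Sl)].
- move=> x; split=> [/(kDelta_inD _ q0 k0) h|[S /hts[l Sl] /(S_poly q0 T Sl)[w r]]].
    (* Cells of [K] may have lower dimension; purity provides a tetrahedron through the point. *)
    have [l [w [Kl sl r]]] := pure q0 k0 T h.
    have /choice[v hv] : forall i : 'I_4, exists v, nrmZ R q v = nth ((0, 0), 0) l i.
      by move=> i; apply: nrmZ_surj => //; apply: (cx_lat (tri_cplx T) Kl); rewrite mem_nth // sl.
    have Sl : realises q K [ffun i => v i] l by split=> // i; rewrite ffunE.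
    by exists [ffun i => v i]; [apply/hts; exists l | apply/(S_poly q0 T Sl); exists w].
  apply/(kDelta_inD _ q0 k0); apply: (rep3_inD r) => Y Yl.
  by case: Sl => Kl _ _; exact: (cx_in (tri_cplx T) Kl Yl).
- move=> S1 S2 /hts[l1 h1] /hts[l2 h2].
  exists [set i | nrmZ R q (S1 i) \in l2], [set i | nrmZ R q (S2 i) \in l1].
  split=> x; first exact: (meet_face q0 T _ h1 h2).
  by rewrite -(meet_face q0 T _ h2 h1); split=> [[]|[]].
- by move=> S /hts[l Sl]; exact: (S_unimodular q0 T Sl).
- by move=> S /hts[l Sl] i j _; exact: (S_edge q0 k0 cop T Sl).
Qed.
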